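(* Let $\alpha\in(0,1)$ with $\alpha\ne1/n$ for all $n\in\mathbb N$, and $0<\beta<\alpha$. Let $E$ be the total space $\bigsqcup_{\mathbf X\in\mathscr C^\alpha}\mathscr D^{\alpha,\beta}_{\mathbf X}$ or $\bigsqcup_{\mathbf X\in\mathscr C^\alpha_g}\mathscr D^{\alpha,\beta}_{\mathbf X}$ of the Banach bundle of controlled rough paths, with projection $p$ to the controlling rough path and its Banach bundle (tube) topology, and let $a\in A$. Then the integration map $$\mathfrak I:E\to E,\qquad \mathbf Y\mapsto\int\mathbf Y\,d\mathbf X:=\mathfrak I^a_{\mathbf X}(\mathbf Y),\quad\mathbf X=p(\mathbf Y),$$ is a morphism of Banach bundles over the identity, i.e. $\mathfrak I$ is continuous, fibrewise linear, and projects via the bundle projection to the identity ($p\circ\mathfrak I=p$).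
   Context: Forests. $A$ is a fixed finite nonempty set. $\mathcal F$ is the set of forests (commutative monomials of non-planar rooted trees with nodes labelled by $A$), including the empty forest $\mathbf 1$; $\mathcal H$ is the real vector space with basis $\mathcal F$, i.e. the polynomial algebra on trees. $|h|$ is the number of nodes of $h\in\mathcal F$; $\mathcal H_n$ is the span of the forests with $n$ nodes; $\mathcal F_{(n)}=\{h\in\mathcal F:|h|\le n\}$, $\mathcal F^+_{(n)}=\mathcal F_{(n)}\setminus\{\mathbf 1\}$. For $a\in A$, $[h]_a$ is the tree obtained by grafting the trees of $h$ on a new root labelled $a$. The coproduct $\Delta:\mathcal H\to\mathcal H\otimes\mathcal H$ is the algebra morphism with $\Delta[h]_a=(\mathrm{id}\otimes[\cdot]_a)\Delta h+[h]_a\otimes\mathbf 1$. On $\mathcal H^*$, $\langle\phi\star\psi,h\rangle=\langle\phi\otimes\psi,\Delta h\rangle$. A forest $h$ is identified with the functional $h'\mapsto\delta_{h,h'}$, so $\bar h\star h$ is a finite linear combination of forests. Rough paths. $T>0$ is fixed; $N=\lfloor1/\alpha\rfloor$. An $\alpha$-branched rough path is a family $\mathbf X=(\mathbf X_{s,t})_{s,t\in[0,T]}$ of characters (unital multiplicative linear functionals) of $\mathcal H$ with $\mathbf X_{s,u}\star\mathbf X_{u,t}=\mathbf X_{s,t}$ and $\sup_{s\ne t}|\langle\mathbf X_{s,t},h\rangle|/|t-s|^{\alpha|h|}<\infty$ for all $h\in\mathcal F$. Write $\mathbf X^h_{s,t}=\langle\mathbf X_{s,t},h\rangle$ (extended linearly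 in $h$) and $\|F\|_\gamma=\sup_{s\neq t}|F_{s,t}|/|t-s|^\gamma$. $\mathscr C^\alpha$ is the set of all of them, with the metric $\rho_\alpha(\mathbf X,\tilde{\mathbf X})=\max_{h\in\mathcal F^+_{(N)}}\|\mathbf X^h-\tilde{\mathbf X}^h\|_{|h|\alpha}$. The canonical lift of a smooth path $x:[0,T]\to\mathbb R^A$ is the family of characters given recursively by $\mathbf X^{[h]_a}_{s,t}=\int_s^t\mathbf X^h_{s,r}\,dx^a_r$ and multiplicativity; $\mathscr C^\alpha_g$ (geometric rough paths) is the $\rho_\alpha$-closure of these lifts. Controlled paths. For a path $\mathbf Z:[0,T]\to\mathrm{span}\,\mathcal F_{(N-1)}$ and $h\in\mathcal F_{(N-1)}$ put $Z^h_t=\langle h,\mathbf Z_t\rangle$, $R^h_{s,t}=\langle h,\mathbf Z_t\rangle-\langle\mathbf X_{s,t}\star h,\mathbf Z_s\rangle$, and for $0<\gamma\le\alpha$ put $|||\mathbf Z|||_\gamma=\sum_{h\in\mathcal F_{(N-1)}}(|\langle h,\mathbf Z_0\rangle|+\|R^h\|_{(N-|h|)\gamma})$. $\mathscr D^\alpha_{\mathbf X}$ is the space of $\mathbf Z$ with $|||\mathbf Z|||_\alpha<\infty$, and $\mathscr D^{\alpha,\beta}_{\mathbf X}$ is the closure of $\mathscr D^\alpha_{\mathbf X}$ under $|||\cdot|||_\beta$, a Banach space with this norm. Rough integral. $\int_0^tZ_s\,d\mathbf X^a_s=\lim_{|\pi|\to0}\sum_{[u,v]\in\pi}\sum_{h\in\mathcal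 F_{(N-1)}}Z^h_u\mathbf X^{[h]_a}_{u,v}$ over partitions $\pi$ of $[0,t]$. $\mathfrak I^a_{\mathbf X}(\mathbf Z)$ is the path with components $\langle\mathbf 1,\mathfrak I^a_{\mathbf X}(\mathbf Z)_t\rangle=\int_0^tZ_s\,d\mathbf X^a_s$, $\langle[h]_a,\mathfrak I^a_{\mathbf X}(\mathbf Z)_t\rangle=Z^h_t$ for $|h|\le N-2$, and zero for all other forests of $\mathcal F_{(N-1)}$. Sections. For forests, $h\top h'$ is $\frac1{|h'|}$ times the sum over nodes $v$ of $h'$ of the forest obtained by grafting all trees of $h$ at $v$ (bilinear extension). $\mathcal P$ is a basis of homogeneous elements of $\{h\in\bigoplus_{n\ge1}\mathcal H_n:\Delta h=h\otimes\mathbf 1+\mathbf 1\otimes h\}$. Then $\mathcal P^\top$, the set of $(\cdots(p_1\top p_2)\cdots)\top p_k$ with $p_i\in\mathcal P$, $k\ge1$, together with $\mathbf 1$, is a basis of $\mathcal H$; $\rho^*$ denotes the dual basis element of $\rho$ in the graded dual, i.e. in the span of forests. Fix $\varepsilon\in(0,1-N\alpha)$; $C^{0,1-\varepsilon}$ is the closure of $C^\infty([0,T])$ in the $(1-\varepsilon)$-Hölder norm, and $\mathcal S_N=\bigoplus_{h\in\mathcal F_{(N-1)}}C^{0,1-\varepsilon}$. For $f\in\mathcal S_N$, $\Gamma_{\mathbf X}(f)\in\mathscr D^\alpha_{\mathbf X}$ is defined by decreasing recursion on $|h|$: $\Gamma_{\mathbf X}(f)^h_t=f^h_t$ if $|h|=N-1$;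 if $0\le|h|<N-1$, $\Gamma_{\mathbf X}(f)^h_t=\sum_{p\in\mathcal P,|p|<N-|h|}\int_0^t\Gamma_{\mathbf X}(f)^{p^*\star h}_r\,d\mathbf X^p_r+f^h_t$, where the integral is $\lim_{|\pi|\to0}\sum_{[u,v]\in\pi}\sum_{\rho\in\mathcal P^\top\cup\{\mathbf 1\},|\rho|<N-|h|-|p|}\Gamma_{\mathbf X}(f)^{\rho^*\star p^*\star h}_u\mathbf X^{\rho\top p}_{u,v}$ over partitions $\pi$ of $[0,t]$ ($\Gamma_{\mathbf X}(f)^g$ is extended linearly in $g$; $\mathbf 1\top p=p$, $\mathbf 1^*=\mathbf 1$). Let $\Gamma=\{\mathbf X\mapsto\Gamma_{\mathbf X}(f):f\in\mathcal S_N\}$ (restricted to $\mathscr C^\alpha_g$ in the geometric case). Banach bundle topology. With $B=\mathscr C^\alpha$ or $\mathscr C^\alpha_g$ the base space, the topology of $E$ is the tube topology, with base $W(\gamma,U,\delta)=\{b\in E:p(b)\in U,\ \|b-\gamma(p(b))\|<\delta\}$, $\gamma\in\Gamma$, $U\subseteq B$ open, $\delta>0$, where $\|\cdot\|$ is the norm $|||\cdot|||_\beta$ of the fibre.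
   Formalization: The integration map E→E is shown to exist only when ⌊1/α⌋β+α>1; for smaller β the defining limits fail for some Y in E, so the map does not exist. For all 0<β<α, any map given by the integral is shown continuous, fibrewise linear and over the identity. *)

(* Defs.v *)
From HB Require Import structures.
From mathcomp Require Import all_boot all_order all_algebra finmap.
From mathcomp Require Import all_classical all_reals all_analysis.
From mathcomp Require monalg.
Import -(notations) monalg.
Import Order.TTheory GRing.Theory Num.Theory numFieldNormedType.Exports.

Set Implicit Arguments.
Unset Strict Implicit.
Unset Printing Implicit Defensive.

Inductive ptree (A : Type) : Type := PNode of A & seq (ptree A).

Lemma ptree_ind_in (A : Type) (Q : ptree A -> Prop) :
  (forall a s, foldr (fun t B => Q t /\ B) True s -> Q (PNode a s)) ->
  forall t, Q t.
Proof.
move=> IH; fix rec 1 => -[a s]; apply: IH.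
by elim: s => [|t s IHs] //=; split.
Qed.

Fixpoint ptree_encode (A : Type) (t : ptree A) : GenTree.tree A :=
  let: PNode a s := t in
  GenTree.Node 0 (GenTree.Leaf a :: map (@ptree_encode A) s).

Fixpoint ptree_decode (A : Type) (g : GenTree.tree A) : option (ptree A) :=
  if g is GenTree.Node _ (GenTree.Leaf a :: s)
  then Some (PNode a (pmap id (map (@ptree_decode A) s))) else None.

Lemma ptree_encodeK (A : Type) : pcancel (@ptree_encode A) (@ptree_decode A).
Proof.
rewrite /pcancel; fix rec 1 => -[a s] /=; congr (Some (PNode a _)).
by elim: s => [|t s IHs] //=; rewrite rec /= IHs.
Qed.

HB.instance Definition _ (A : countType) :=
  Countable.copy (ptree A) (pcan_type (@ptree_encodeK A)).

Section Forests.
Variable A : finType.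
Implicit Types (t u : ptree A) (s : seq (ptree A)).

(* An arbitrary total order, used only to choose a representative among the
   planar embeddings of a non-planar tree or forest. *)
Definition ptle : rel (ptree A) :=
  fun t u => choice.pickle t <= choice.pickle u.

Lemma ptle_total : total ptle. Proof. by move=> t u; exact: leq_total. Qed.
Lemma ptle_trans : transitive ptle.
Proof. by move=> u t v; exact: leq_trans. Qed.
Lemma ptle_anti : antisymmetric ptle.
Proof.
by move=> t u; rewrite -eqn_leq => /eqP; exact: (pcan_inj choice.pickleK).
Qed.

Fixpoint tree_nf t : ptree A :=
  let: PNode a s := t in PNode a (sort ptle (map tree_nf s)).

Definition forest_nf s : seq (ptree A) := sort ptle (map tree_nf s).

Lemma perm_forest_nf s : perm_eq (forest_nf s) (map tree_nf s).
Proof. by rewrite perm_sort. Qed.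

Lemma eq_forest_nf s1 s2 :
  perm_eq (map tree_nf s1) (map tree_nf s2) -> forest_nf s1 = forest_nf s2.
Proof. by move/(perm_sortP ptle_total ptle_trans ptle_anti). Qed.

Lemma tree_nfK t : tree_nf (tree_nf t) = tree_nf t.
Proof.
elim/ptree_ind_in: t => a s IHs /=; congr PNode.
apply: eq_forest_nf; rewrite (permPl (perm_map _ (perm_forest_nf s))).
by elim: s IHs => //= t s IH [-> /IH]; rewrite perm_cons.
Qed.

Lemma map_tree_nfK s : map tree_nf (map tree_nf s) = map tree_nf s.
Proof. by rewrite -map_comp; apply: eq_map => t /=; exact: tree_nfK. Qed.

Lemma forest_nfK s : forest_nf (forest_nf s) = forest_nf s.
Proof.
by apply: eq_forest_nf;
  rewrite (permPl (perm_map _ (perm_forest_nf s))) map_tree_nfK.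
Qed.

(* A non-planar forest is the normal form of its planar embeddings. *)
Record forest := Forest { pforest :> seq (ptree A);
                          _ : forest_nf pforest == pforest }.

HB.instance Definition _ := [isSub for pforest].
HB.instance Definition _ := [Countable of forest by <:].

Definition mkforest s : forest := Forest (introT eqP (forest_nfK s)).

Lemma mkforestK (h : forest) : mkforest h = h.
Proof. by apply: val_inj; apply/eqP; case: h. Qed.

Lemma mkforest_eq s1 s2 :
  mkforest s1 = mkforest s2 <-> perm_eq (map tree_nf s1) (map tree_nf s2).
Proof.
split=> [[e]|e]; last by apply: val_inj; exact: eq_forest_nf.
by rewrite -(permPl (perm_forest_nf s1)) e perm_forest_nf.
Qed.

Fixpoint ptree_size t : nat :=
  let: PNode _ s := t in (sumn (map ptree_size s)).+1.

Definition forest_size (h : forest) : nat := sumn (map ptree_size h).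

Definition fempty : forest := mkforest [::].
Definition fmul (h k : forest) : forest := mkforest (h ++ k).
(* [h]_a *)
Definition fgraft (a : A) (h : forest) : forest := mkforest [:: PNode a h].

Lemma fmulE s1 s2 : fmul (mkforest s1) (mkforest s2) = mkforest (s1 ++ s2).
Proof.
apply/mkforest_eq; rewrite !map_cat; apply: perm_cat.
  by rewrite (permPl (perm_map _ (perm_forest_nf s1))) map_tree_nfK.
by rewrite (permPl (perm_map _ (perm_forest_nf s2))) map_tree_nfK.
Qed.

Lemma fmulA : associative fmul.
Proof.
by move=> h k l; rewrite -[h]mkforestK -[k]mkforestK -[l]mkforestK !fmulE catA.
Qed.
Lemma fmul1f : left_id fempty fmul.
Proof. by move=> h; rewrite -[h]mkforestK fmulE. Qed.
Lemma fmulf1 : right_id fempty fmul.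
Proof. by move=> h; rewrite -[h]mkforestK fmulE cats0. Qed.
Lemma fmulC : commutative fmul.
Proof. by move=> h k; apply/mkforest_eq; rewrite !map_cat perm_catC. Qed.
Lemma fmul_unit h k : fmul h k = fempty -> h = fempty /\ k = fempty.
Proof.
move=> /mkforest_eq /perm_size /=; rewrite size_map size_cat => /eqP.
rewrite addn_eq0 => /andP[/nilP h0 /nilP k0].
by rewrite -[h]mkforestK -[k]mkforestK h0 k0.
Qed.

HB.instance Definition _ := Choice_isMonomialDef.Build forest
  fmulA fmul1f fmulf1 fmul_unit.
HB.instance Definition _ := MonomialDef_isConomialDef.Build forest fmulC.

Fixpoint pforests (n : nat) : seq (seq (ptree A)) :=
  if n is m.+1 then
    [::] :: [seq PNode x.1 x.2.1 :: x.2.2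
            | x <- allpairs pair (enum A)
                     (allpairs pair (pforests m) (pforests m))]
  else [:: [::]].

(* The forests with at most n nodes. *)
Definition forests_upto (n : nat) : seq forest :=
  undup [seq h <- map mkforest (pforests n) | forest_size h <= n].

Lemma mem_pforests n s : sumn (map ptree_size s) <= n -> s \in pforests n.
Proof.
elim: n s => [|n IH] [|[a u] s] //=.
rewrite addSn ltnS => le_n; rewrite inE /=; apply/mapP.
exists (a, (u, s)) => //; apply/allpairsP; exists (a, (u, s)).
split; rewrite ?mem_enum //=; apply/allpairsP; exists (u, s).
by split=> //=; apply: IH; apply: leq_trans le_n; rewrite ?leq_addr ?leq_addl.
Qed.

Lemma mem_forests_upto n h : (h \in forests_upto n) = (forest_size h <= n).
Proof.
rewrite mem_undup mem_filter andb_idr // => le_n.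
by apply/mapP; exists (h : seq _); rewrite ?mkforestK //; exact: mem_pforests.
Qed.

(* The coproduct of a forest is a sum of pure tensors x.1 (x) x.2, listed with
   multiplicity; coprod_mul is the product of the algebra H (x) H. *)
Definition coprod_mul (c d : seq (forest * forest)) : seq (forest * forest) :=
  [seq (fmul x.1 y.1, fmul x.2 y.2) | x <- c, y <- d].

Definition coprod_prod : seq (seq (forest * forest)) -> seq (forest * forest) :=
  foldr coprod_mul [:: (fempty, fempty)].

Fixpoint tree_coprod t : seq (forest * forest) :=
  let: PNode a s := t in
  rcons [seq (x.1, fgraft a x.2) | x <- coprod_prod (map tree_coprod s)]
        (mkforest [:: t], fempty).

Definition coprod (h : forest) : seq (forest * forest) :=
  coprod_prod (map tree_coprod h).

Lemma coprod_mul_perm c c' d d' : perm_eq c c' -> perm_eq d d' ->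
  perm_eq (coprod_mul c d) (coprod_mul c' d').
Proof. exact: perm_allpairs. Qed.



Lemma coprod_mulC c d : perm_eq (coprod_mul c d) (coprod_mul d c).
Proof.
rewrite /coprod_mul; elim: d => [|y d IH] /=.
  by elim: c.
rewrite perm_allpairs_consr perm_cat // (@eq_map _ _ _
  (fun x => (fmul y.1 x.1, fmul y.2 x.2))) // => x.
by rewrite fmulC [X in (_, X)]fmulC.
Qed.

Lemma coprod_mulA c d e :
  coprod_mul c (coprod_mul d e) = coprod_mul (coprod_mul c d) e.
Proof.
elim: c => //= x c IH; rewrite /coprod_mul /= in IH *.
rewrite allpairs_cat -IH; congr (_ ++ _).
elim: d {IH} => //= y d IH; rewrite map_cat IH; congr (_ ++ _).
by rewrite -map_comp; apply: eq_map => z /=; rewrite !fmulA.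
Qed.

Lemma coprod_prod_cat cs ds :
  coprod_prod (cs ++ ds) = coprod_mul (coprod_prod cs) (coprod_prod ds).
Proof.
elim: cs => [|c cs IH] /=; last by rewrite IH coprod_mulA.
rewrite /coprod_mul /= cats0 -[LHS]map_id; apply: eq_map => -[x y] /=.
by rewrite !fmul1f.
Qed.

Lemma coprod_prod1 c : coprod_prod [:: c] = c.
Proof.
rewrite /= /coprod_mul allpairs1r -[RHS]map_id; apply: eq_map => -[x y] /=.
by rewrite !fmulf1.
Qed.

Lemma perm_coprod_prod cs ds :
  perm_eq cs ds -> perm_eq (coprod_prod cs) (coprod_prod ds).
Proof.
move=> e; pose Q es := perm_eq (coprod_prod cs) (coprod_prod es).
apply: (@catCA_perm_ind _ Q _ cs ds e (perm_refl _)) => s1 s2 s3 /permPl e1.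
rewrite /Q e1 !coprod_prod_cat !coprod_mulA; apply: coprod_mul_perm => //.
exact: coprod_mulC.
Qed.

Lemma coprod_prod_map (f g : ptree A -> seq (forest * forest)) s :
  foldr (fun t B => perm_eq (f t) (g t) /\ B) True s ->
  perm_eq (coprod_prod (map f s)) (coprod_prod (map g s)).
Proof.
by elim: s => //= t s IH [? /IH ?]; exact: coprod_mul_perm.
Qed.

Lemma mkforest_nf s : mkforest (forest_nf s) = mkforest s.
Proof. exact: mkforestK (mkforest s). Qed.

Lemma tree_coprod_nf t : perm_eq (tree_coprod (tree_nf t)) (tree_coprod t).
Proof.
elim/ptree_ind_in: t => a s IHs /=.
rewrite -/(forest_nf s).
rewrite (_ : mkforest [:: PNode a (forest_nf s)] = mkforest [:: PNode a s]).
  rewrite perm_rcons perm_sym perm_rcons perm_cons perm_sym; apply: perm_map.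
  rewrite (permPl (perm_coprod_prod (perm_map _ (perm_forest_nf s)))).
  by rewrite -map_comp; exact: coprod_prod_map.
by apply/mkforest_eq => /=; rewrite -/(forest_nf _) forest_nfK.
Qed.

Lemma coprod_mkforest s :
  perm_eq (coprod (mkforest s)) (coprod_prod (map tree_coprod s)).
Proof.
rewrite (permPl (perm_coprod_prod (perm_map _ (perm_forest_nf s)))) -map_comp.
apply: coprod_prod_map; elim: s => //= t s IH; split=> //.
exact: tree_coprod_nf.
Qed.

Lemma coprod1 : coprod fempty = [:: (fempty, fempty)].
Proof. by []. Qed.

Lemma coprod_fmul h k :
  perm_eq (coprod (fmul h k)) (coprod_mul (coprod h) (coprod k)).
Proof. by rewrite (permPl (coprod_mkforest _)) map_cat coprod_prod_cat. Qed.

Lemma coprod_fgraft a h :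
  perm_eq (coprod (fgraft a h))
    (rcons [seq (x.1, fgraft a x.2) | x <- coprod h] (fgraft a h, fempty)).
Proof.
by rewrite (permPl (coprod_mkforest _)) coprod_prod1.
Qed.

(* The forests obtained by grafting all the trees of s at one node, for each
   node of t (resp. of l). *)
Fixpoint tree_insert s t : seq (ptree A) :=
  let: PNode a l := t in
  PNode a (s ++ l) ::
  map (PNode a)
    ((fix insert l := if l is t :: l' then
        [seq t' :: l' | t' <- tree_insert s t] ++ [seq t :: v | v <- insert l']
      else [::]) l).

Definition forest_insert s : seq (ptree A) -> seq (seq (ptree A)) :=
  fix insert l := if l is t :: l' then
    [seq t' :: l' | t' <- tree_insert s t] ++ [seq t :: v | v <- insert l']
  else [::].

Lemma tree_insertE s a l :
  tree_insert s (PNode a l) =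
  PNode a (s ++ l) :: map (PNode a) (forest_insert s l).
Proof. by []. Qed.

Lemma size_tree_insert s t : size (tree_insert s t) = ptree_size t.
Proof.
elim/ptree_ind_in: t => a l; rewrite tree_insertE /= size_map => IHl.
congr S; elim: l IHl => //= t l IH [et /IH el].
by rewrite size_cat !size_map et el.
Qed.

Lemma size_forest_insert s l :
  size (forest_insert s l) = sumn (map ptree_size l).
Proof.
by elim: l => //= t l IH; rewrite size_cat !size_map size_tree_insert IH.
Qed.

End Forests.

Local Open Scope classical_set_scope.
Local Open Scope ring_scope.

Section HopfAlgebra.
Variables (R : realType) (A : finType).
Implicit Types (h k : forest A) (phi psi : forest A -> R).

(* The polynomial algebra H on non-planar trees, with basis the forests. A
   linear functional on H is given by its values phi : forest A -> R on this
   basis. *)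
Definition forest_alg : Type := malg (forest A) R.
HB.instance Definition _ := GRing.Lmodule.on forest_alg.

(* H (x) H, with basis the pairs of forests. *)
Definition forest_alg2 : Type := malg (forest A * forest A)%type R.
HB.instance Definition _ := GRing.Lmodule.on forest_alg2.

Definition forest_vec (h : forest A) : forest_alg := mkmalgU h 1.

Definition pairing phi (x : forest_alg) : R :=
  \sum_(h <- msupp x) mcoeff h x * phi h.

Definition tensor (x y : forest_alg) : forest_alg2 :=
  \sum_(h <- msupp x) \sum_(k <- msupp y)
    mkmalgU (h, k) (mcoeff h x * mcoeff k y).

Definition Delta (x : forest_alg) : forest_alg2 :=
  \sum_(h <- msupp x) \sum_(c <- coprod h) mkmalgU c (mcoeff h x).

Definition star phi psi : forest A -> R :=
  fun h => \sum_(c <- coprod h) phi c.1 * psi c.2.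

Definition fdelta (h : forest A) : forest A -> R := fun k => (k == h)%:R.

Definition character phi : Prop :=
  phi (fempty A) = 1 /\ forall h k, phi (fmul h k) = phi h * phi k.

Definition top_forest h k : forest_alg :=
  (forest_size k)%:R^-1 *:
    \sum_(s <- forest_insert h k) forest_vec (mkforest s).

Definition ftop (x y : forest_alg) : forest_alg :=
  \sum_(h <- msupp x) \sum_(k <- msupp y)
    (mcoeff h x * mcoeff k y) *: top_forest h k.

Definition homogeneous (x : forest_alg) : Prop :=
  exists n, forall h, h \in msupp x -> forest_size h = n.

(* The degree of a nonzero homogeneous element. *)
Definition hdeg (x : forest_alg) : nat := (\max_(h <- msupp x) forest_size h)%N.

Definition primitive (x : forest_alg) : Prop :=
  mcoeff (fempty A) x = 0 /\
  Delta x = tensor x (forest_vec (fempty A)) + tensor (forest_vec (fempty A)) x.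

Definition primitive_basis (P : set forest_alg) : Prop :=
  [/\ forall p, P p -> primitive p /\ homogeneous p,
      forall x, primitive x ->
        exists (s : seq forest_alg) (c : forest_alg -> R),
        (forall p, p \in s -> P p) /\ x = \sum_(p <- s) c p *: p
    & forall (s : seq forest_alg) (c : forest_alg -> R),
        uniq s -> (forall p, p \in s -> P p) ->
        \sum_(p <- s) c p *: p = 0 -> forall p, p \in s -> c p = 0].

Inductive Ptop (P : set forest_alg) : set forest_alg :=
| Ptop_base p : P p -> Ptop P p
| Ptop_step r p : Ptop P r -> P p -> Ptop P (ftop r p).

Definition Ptop1 (P : set forest_alg) : set forest_alg :=
  Ptop P `|` [set forest_vec (fempty A)].

(* g = r^*, the dual basis element of r for the basis Ptop1 P of H. *)
Definition is_top_dual (P : set forest_alg) (r : forest_alg)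
    (g : forest A -> R) : Prop :=
  finite_set [set h | g h != 0] /\
  forall s, Ptop1 P s -> pairing g s = (s == r)%:R.

Definition top_dual (P : set forest_alg) (r : forest_alg) : forest A -> R :=
  xget (fun=> 0) [set g | is_top_dual P r g].

End HopfAlgebra.

Section Integral.
Variables (R : realType) (T : {posnum R}).

Definition time : Type := set_type `[0, T%:num]%classic.
HB.instance Definition _ := PseudoMetric.on time.

Definition time_val (t : time) : R := \val t.

Lemma time0_subproof : (0 : R) \in `[0, T%:num]%classic.
Proof. by rewrite inE /= in_itv /= lexx ge0. Qed.
Definition time0 : time := exist _ 0 time0_subproof.

(* ||F||_gamma *)
Definition hoelder_seminorm (gamma : R) (F : time -> time -> R) : \bar R :=
  ereal_sup [set (`|F st.1 st.2| / `|time_val st.2 - time_val st.1| `^ gamma)%:E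
            | st in [set st | st.1 != st.2]].

Definition hoelder_norm (gamma : R) (f : time -> R) : \bar R :=
  (ereal_sup [set `|f t|%:E | t in setT]
   + hoelder_seminorm gamma (fun s t => f t - f s)%R)%E.

Definition derivative_on (f g : time -> R) : Prop :=
  forall t : time,
    (fun s => (f s - f t) / (time_val s - time_val t)) @ t^' --> g t.

(* f is in C^oo([0, T]); derivatives are one-sided at 0 and T. *)
Definition smooth (f : time -> R) : Prop :=
  exists D : nat -> time -> R,
    D 0%N = f /\ forall n, derivative_on (D n) (D n.+1).

(* C^{0, gamma} *)
Definition little_hoelder (gamma : R) (f : time -> R) : Prop :=
  forall e : R, 0 < e ->
    exists2 g, smooth g & (hoelder_norm gamma (fun t => f t - g t)%R < e%:E)%E.

(* s :: l lists the points of a partition of [s, t]. *)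
Definition is_partition (s t : time) (l : seq time) : bool :=
  path (fun u v => time_val u < time_val v) s l && (last s l == t).

Definition mesh (s : time) (l : seq time) : R :=
  \big[Num.max/0]_(uv <- zip (s :: l) l) (time_val uv.2 - time_val uv.1).

Definition mesh_to0 (s t : time) : set_system (seq time) :=
  filter_from [set d : R | 0 < d]
    (fun d => [set l | is_partition s t l /\ mesh s l < d]).

Definition partition_sum (Xi : time -> time -> R) (s : time) (l : seq time) :
    R :=
  \sum_(uv <- zip (s :: l) l) Xi uv.1 uv.2.

(* For s <= t, I is the limit of the sums of Xi along partitions of [s, t]. *)
Definition has_integral (Xi : time -> time -> R) (s t : time) (I : R) : Prop :=
  partition_sum Xi s @ mesh_to0 s t --> I.

End Integral.

Section RoughPaths.
Variables (R : realType) (A : finType) (T : {posnum R}) (alpha : R).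

Definition level : nat := Num.truncn alpha^-1.

Definition is_rough_path (X : time T -> time T -> forest A -> R) : Prop :=
  [/\ forall s t, character (X s t),
      forall s u t h, star (X s u) (X u t) h = X s t h
    & forall h, (hoelder_seminorm (alpha * (forest_size h)%:R)
                   (fun s t => X s t h) < +oo)%E].

Record rough_path := RoughPath {
  rough_path_val :> time T -> time T -> forest A -> R;
  rough_pathP : is_rough_path rough_path_val }.

HB.instance Definition _ := gen_eqMixin rough_path.
HB.instance Definition _ := gen_choiceMixin rough_path.

(* rho_alpha; the maximum is over the nonempty forests with at most N nodes. *)
Definition rough_dist (X Y : rough_path) : \bar R :=
  \big[maxe/0%E]_(h <- forests_upto A level | h != fempty A)
    hoelder_seminorm ((forest_size h)%:R * alpha)
                     (fun s t => X s t h - Y s t h).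

Definition rough_ball (X : rough_path) (e : R) : set rough_path :=
  [set Y | (rough_dist X Y < e%:E)%E].

Lemma hoelder_seminorm_ge0 gamma (F : time T -> time T -> R) :
  (0 <= hoelder_seminorm gamma F)%E.
Proof.
have T0 : (T%:num : R) \in `[0, T%:num]%classic.
  by rewrite inE /= in_itv /= lexx ge0.
pose t1 : time T := exist _ T%:num T0.
apply: le_trans (ereal_sup_ubound _); last first.
  exists (time0 T, t1) => //=; apply/eqP => /(congr1 (@time_val R T)) /eqP.
  by rewrite /time_val /= lt_eqF.
by rewrite lee_fin divr_ge0 // powR_ge0.
Qed.

Lemma hoelder_seminorm_le gamma (F : time T -> time T -> R) (y : \bar R) :
  (forall s t, s != t ->
    (`|F s t| / `|time_val t - time_val s| `^ gamma)%:E <= y)%E ->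
  (hoelder_seminorm gamma F <= y)%E.
Proof.
by move=> le_y; apply: ge_ereal_sup => _ [[s t] /= st <-]; exact: le_y.
Qed.

Lemma le_hoelder_seminorm gamma (F : time T -> time T -> R) s t : s != t ->
  ((`|F s t| / `|time_val t - time_val s| `^ gamma)%:E
   <= hoelder_seminorm gamma F)%E.
Proof. by move=> st; apply: ereal_sup_ubound; exists (s, t). Qed.

Lemma rough_dist_ge0 X Y : (0 <= rough_dist X Y)%E.
Proof. exact: bigmax_ge_id. Qed.

Lemma rough_dist_refl X : rough_dist X X = 0%E.
Proof.
apply/eqP; rewrite eq_le rough_dist_ge0 andbT; apply: bigmax_le => // h _.
by apply: hoelder_seminorm_le => s t _; rewrite subrr normr0 mul0r.
Qed.

Lemma rough_dist_sym X Y : rough_dist X Y = rough_dist Y X.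
Proof.
apply: eq_bigr => h _; congr ereal_sup; apply: eq_imagel => -[s t] _ /=.
by rewrite distrC.
Qed.

Lemma le_rough_dist (X Y : rough_path) (h : forest A) (s t : time T) :
  h \in forests_upto A level -> h != fempty A -> s != t ->
  ((`|X s t h - Y s t h|
    / `|time_val t - time_val s| `^ ((forest_size h)%:R * alpha))%:E
   <= rough_dist X Y)%E.
Proof.
move=> hN h1 st; pose F s t := X s t h - Y s t h.
apply: le_trans (@le_hoelder_seminorm _ F s t st) _.
exact: (@le_bigmax_seq _ _ _ _ 0%E _ (fun k => k != fempty A) _ hN h1).
Qed.

Lemma rough_dist_triangle Y X Z :
  (rough_dist X Z <= rough_dist X Y + rough_dist Y Z)%E.
Proof.
rewrite {1}/rough_dist big_seq_cond.
apply: bigmax_le => [|h /andP[hN h1]].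
  by rewrite adde_ge0 ?rough_dist_ge0.
apply: hoelder_seminorm_le => s t st; set d := _ `^ _.
apply: (@le_trans _ _ ((`|X s t h - Y s t h| / d)%:E
                       + (`|Y s t h - Z s t h| / d)%:E)%E).
  rewrite -EFinD lee_fin -mulrDl ler_wpM2r ?invr_ge0 ?powR_ge0 //.
  by rewrite -(subrKA (Y s t h)) ler_normD.
by apply: leeD; exact: le_rough_dist.
Qed.

Lemma rough_ball_center X (e : R) : 0 < e -> rough_ball X e X.
Proof. by move=> e0; rewrite /rough_ball /= rough_dist_refl. Qed.

Lemma rough_ball_sym X Y (e : R) : rough_ball X e Y -> rough_ball Y e X.
Proof. by rewrite /rough_ball /= rough_dist_sym. Qed.

Lemma rough_ball_triangle X Y Z (d e : R) :
  rough_ball X d Y -> rough_ball Y e Z -> rough_ball X (d + e) Z.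
Proof.
rewrite /rough_ball /= EFinD => XY YZ.
exact: le_lt_trans (rough_dist_triangle Y X Z) (lteD XY YZ).
Qed.

HB.instance Definition _ :=
  hasNbhs.Build rough_path (nbhs_ (entourage_ rough_ball)).
HB.instance Definition _ := @Nbhs_isPseudoMetric.Build R rough_path
  (entourage_ rough_ball) erefl rough_ball
  rough_ball_center rough_ball_sym rough_ball_triangle erefl.

(* X^{[h]_a}_{s,t} is the Riemann-Stieltjes integral of X^h_{s,r} against
   dx^a_r from s to t, which is minus the integral from t to s when t < s. *)
Definition canonical_lift (x : A -> time T -> R) (X : rough_path) : Prop :=
  forall a h (s t : time T),
    let Xi := fun u v : time T => X s u h * (x a v - x a u) in
    (time_val s <= time_val t -> has_integral Xi s t (X s t (fgraft a h))) /\
    (time_val t <= time_val s -> has_integral Xi t s (- X s t (fgraft a h))).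

(* The subspace C^alpha_g of geometric rough paths. *)
Definition geometric_rough_path : set rough_path :=
  closure [set X | exists2 x : A -> time T -> R,
                     forall a, smooth (x a) & canonical_lift x X].

Local Notation cpath := (time T -> forest_alg R A).

(* Z takes its values in span F_(N-1). *)
Definition truncated (Z : cpath) : Prop :=
  forall t h, (level <= forest_size h)%N -> mcoeff h (Z t) = 0.

Definition remainder (X : rough_path) (Z : cpath) (h : forest A)
    (s t : time T) : R :=
  mcoeff h (Z t) - pairing (star (X s t) (fdelta R h)) (Z s).

(* |||Z|||_gamma *)
Definition controlled_norm (X : rough_path) (gamma : R) (Z : cpath) :
    \bar R :=
  (\sum_(h <- forests_upto A level.-1)
    (`|mcoeff h (Z (time0 T))|%:E
     + hoelder_seminorm ((level - forest_size h)%N%:R * gamma)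
                        (remainder X Z h)))%E.

(* D^alpha_X *)
Definition controlled (X : rough_path) : set cpath :=
  [set Z | truncated Z /\ (controlled_norm X alpha Z < +oo)%E].

(* D^{alpha, beta}_X *)
Definition controlled_closure (beta : R) (X : rough_path) : set cpath :=
  [set Z | truncated Z /\ forall e : R, 0 < e -> exists2 Z', controlled X Z' &
    (controlled_norm X beta (fun t => Z t - Z' t)%R < e%:E)%E].

(* W = \int_0^. Z dX^a, in controlled form. *)
Definition is_rough_integral (a : A) (X : rough_path) (Z W : cpath) :
    Prop :=
  [/\ forall t, has_integral
        (fun u v => \sum_(h <- forests_upto A level.-1)
                      mcoeff h (Z u) * X u v (fgraft a h))
        (time0 T) t (mcoeff (fempty A) (W t)),
      forall h t, (forest_size h + 2 <= level)%N ->
        mcoeff (fgraft a h) (W t) = mcoeff h (Z t)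
    & forall g t, g <> fempty A ->
        (forall h, (forest_size h + 2 <= level)%N -> g <> fgraft a h) ->
        mcoeff g (W t) = 0].

Section Sections.
Variables (P : set (forest_alg R A)) (X : rough_path).

Definition section_germ (G : cpath) (p : forest_alg R A) (h : forest A)
    (u v : time T) : R :=
  \sum_(r \in [set r | Ptop1 P r /\
                       (hdeg r + hdeg p + forest_size h < level)%N])
    pairing (star (star (top_dual P r) (top_dual P p)) (fdelta R h)) (G u)
    * pairing (X u v) (ftop r p).

(* G satisfies the recursion defining Gamma_X(f); J p is the path
   t |-> \int_0^t Gamma_X(f)^{p^* * h} dX^p. *)
Definition is_Gamma (f : forest A -> time T -> R) (G : cpath) : Prop :=
  [/\ truncated G,
      forall h t, (forest_size h).+1 = level -> mcoeff h (G t) = f h t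
    & forall h, ((forest_size h).+1 < level)%N ->
        exists2 J : forest_alg R A -> time T -> R,
          forall p t, P p -> (hdeg p + forest_size h < level)%N ->
            has_integral (section_germ G p h) (time0 T) t (J p t)
        & forall t, mcoeff h (G t) =
            (\sum_(p \in [set p | P p /\ (hdeg p + forest_size h < level)%N])
               J p t) + f h t].

Definition Gamma (f : forest A -> time T -> R) : cpath :=
  xget (fun=> 0) [set G | is_Gamma f G].

End Sections.

(* The index space S_N of the sections. *)
Definition section_data (eps : R) : set (forest A -> time T -> R) :=
  [set f | forall h, (forest_size h < level)%N ->
                     little_hoelder (1 - eps) (f h)].

End RoughPaths.

Record bundle_point (R : realType) (A : finType) (T : {posnum R})
    (alpha beta : R) (B : set (rough_path A T alpha)) := BundlePoint {
  bundle_proj : rough_path A T alpha;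
  bundle_path : time T -> forest_alg R A;
  bundle_projP : B bundle_proj;
  bundle_pathP : controlled_closure beta bundle_proj bundle_path }.

(* The total space over the base B. Its points do not depend on eps and P, which
   determine the sections defining its topology. *)
Definition bundle (R : realType) (A : finType) (T : {posnum R})
    (alpha beta eps : R) (P : set (forest_alg R A))
    (B : set (rough_path A T alpha)) : Type :=
  bundle_point beta B.

Section Bundle.
Variables (R : realType) (A : finType) (T : {posnum R}) (alpha beta eps : R).
Variables (P : set (forest_alg R A)) (B : set (rough_path A T alpha)).
Local Notation E := (bundle beta eps P B).

HB.instance Definition _ := gen_eqMixin E.
HB.instance Definition _ := gen_choiceMixin E.

(* W(Gamma(f), U, delta). It is enough to let U range over the open sets of
   rough_path: their traces on B are the open sets of B. *)
Definition tube (f : forest A -> time T -> R) (U : set (rough_path A T alpha))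
    (delta : R) : set E :=
  [set b | U (bundle_proj b) /\
           (controlled_norm (bundle_proj b) beta
              (fun t => bundle_path b t - Gamma P (bundle_proj b) f t)%R
            < delta%:E)%E].

Definition tubes : set (set E) :=
  [set W | exists f U delta,
     [/\ section_data alpha eps f, open U, 0 < delta & W = tube f U delta]].

(* The topology generated by the tubes; as the tubes form a base of a topology,
   its open sets are the unions of tubes. *)
HB.instance Definition _ := isSubBaseTopological.Build E tubes id.

(* I maps Y in the fibre over X to the element I^a_X(Y) of the same fibre. *)
Definition integration_map (a : A) (I : E -> E) : Prop :=
  forall Y : E, bundle_proj (I Y) = bundle_proj Y /\
    is_rough_integral a (bundle_proj Y) (bundle_path Y) (bundle_path (I Y)).

Definition fibrewise_linear (I : E -> E) : Prop :=
  forall (c : R) (Y1 Y2 Y : E),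
    bundle_proj Y1 = bundle_proj Y -> bundle_proj Y2 = bundle_proj Y ->
    (forall t, bundle_path Y t = c *: bundle_path Y1 t + bundle_path Y2 t) ->
    forall t, bundle_path (I Y) t =
              c *: bundle_path (I Y1) t + bundle_path (I Y2) t.

End Bundle.

(* Main.v *)
Require Import Defs.
From mathcomp Require Import all_boot all_order all_algebra finmap.
From mathcomp Require Import all_classical all_reals all_analysis.
From mathcomp Require Import ring lra zify.
From mathcomp Require monalg.
Import -(notations) monalg.
Import Order.TTheory GRing.Theory Num.Theory numFieldNormedType.Exports.
Set Implicit Arguments.
Unset Strict Implicit.
Unset Printing Implicit Defensive.
Local Open Scope classical_set_scope.
Local Open Scope ring_scope.

(* The coproduct of an insertion h T p along a primitive p shows that X |-> X(. T p),
   like X |-> X([.]_a), is a cocycle for the star product. Hence the germs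
   Xi_{s,t} = <psi(X_{s,t}), Z_s> of the rough integral and of the sections Gamma both
   satisfy Xi_{s,t} - Xi_{s,u} - Xi_{u,t} = - sum_k psi(X_{u,t})(k) R^k_{s,u}, which the
   sewing lemma integrates. Every estimate is proved for two data (X, Z) and (Y, W) at
   once, over different rough paths; existence, uniqueness, bounds and continuity in X
   are special cases. With R^k of order (N - |k|) beta, sewing needs N beta + alpha > 1.

   Continuity of I at a point over X then follows once the sections are dense in the
   fibre. For Z controlled by X, let f^h be the piecewise linear interpolation on a grid
   of the difference between Z^h and the integral part of Gamma(f)^h. Then Gamma(f) = Z
   on the grid, on each cell Gamma(f) has remainders linear in t - s, and the distance
   from Z is O(mesh^(alpha - beta)).

   If N beta + alpha <= 1, no I exists: for lacunary series x and f with frequencies 2^n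
   and amplitudes (n+1)^(-1/2) 2^(-n alpha) and (n+1)^(-1/2) 2^(-n N beta), the Riemann
   sums of f dx along dyadic partitions dominate harmonic sums, while x lifts to a
   geometric rough path X_{s,t}(h) = (x_t - x_s)^|h| / h!, with h! the tree factorial,
   and f defines an element of the fibre over X. *)

(** * Forests and the coproduct *)

(** Points of different fibres cannot be subtracted as controlled paths, since their remainders
    refer to different rough paths; they are compared through their initial values and through the
    differences of their remainders. In this sense Gamma_X(g) is locally Lipschitz in X, so a point
    W over Y is compared with a point Z over X along Z, Gamma_X(g), Gamma_Y(g), W. This is what
    density of the sections is needed for. The sums over the dual basis that define the sections are
    not suited to estimates and are resummed: the sum of r^* (x) r over the basis is the identity,
    and the sum of p^* (x) p over the primitive elements is a projection pi such that x is the sum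
    of x' T pi(x'') when x has no constant term. Hence the germs at h add up to the pairing of X
    star h - h with the path, and the remainder of Gamma(f)^h consists of the increment of f^h and
    of sewing errors alone. Both have order kappa = 1 - eps, where N alpha < kappa < 1 and kappa +
    alpha > 1. The germ at h involves only forests larger than h, so construction and estimates
    proceed one level of |h| at a time, from the top. *)

Section ForestCombinatorics.
Variable A : finType.
Implicit Types (h k : forest A) (s l : seq (ptree A)) (t : ptree A).

Lemma mkforest_cons t l : mkforest (t :: l) = fmul (mkforest [:: t]) (mkforest l).
Proof. by rewrite fmulE. Qed.

Lemma mkforest1 a l : mkforest [:: PNode a l] = fgraft a (mkforest l).
Proof.
by apply/esym/mkforest_eq => /=; rewrite -/(forest_nf _) forest_nfK.
Qed.

(** Identities of the coproduct are proved by this induction: [coprod] is described, up to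
    permutation, by its values on [fgraft] and [fmul], whereas planar representatives are reordered
    by sorting. *)
Lemma forest_ind (Q : forest A -> Prop) :
  Q (fempty A) -> (forall a h, Q h -> Q (fgraft a h)) ->
  (forall h k, Q h -> Q k -> Q (fmul h k)) -> forall h, Q h.
Proof.
move=> Q0 Qg Qm.
have Qs s : foldr (fun t B => Q (mkforest [:: t]) /\ B) True s -> Q (mkforest s).
  elim: s => [|t s IH] //= [Qt /IH Qs]; rewrite mkforest_cons; exact: Qm.
have Qt t : Q (mkforest [:: t]).
  by elim/ptree_ind_in: t => a s /Qs Q1; rewrite mkforest1; exact: Qg.
move=> h; rewrite -[h]mkforestK; apply: Qs.
by elim: (h : seq _) => //= t s; split.
Qed.

Lemma ptree_size_nf t : ptree_size (tree_nf t) = ptree_size t.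
Proof.
elim/ptree_ind_in: t => a s IHs /=; congr S.
rewrite -/(forest_nf s) (perm_sumn (perm_map _ (perm_forest_nf s))).
by elim: s IHs => //= t s IH [-> /IH ->].
Qed.

Lemma forest_size_mk s : forest_size (mkforest s) = sumn (map (@ptree_size A) s).
Proof.
rewrite /forest_size /= (perm_sumn (perm_map _ (perm_forest_nf s))) -map_comp.
by congr sumn; apply: eq_map => t /=; exact: ptree_size_nf.
Qed.

Lemma forest_size1 : forest_size (fempty A) = 0%N.
Proof. by rewrite forest_size_mk. Qed.

Lemma forest_size_mul h k : forest_size (fmul h k) = (forest_size h + forest_size k)%N.
Proof. by rewrite forest_size_mk map_cat sumn_cat. Qed.

Lemma forest_size_graft a h : forest_size (fgraft a h) = (forest_size h).+1.
Proof. by rewrite forest_size_mk /= addn0. Qed.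

Lemma forest_size_eq0 h : forest_size h = 0%N -> h = fempty A.
Proof.
case: h => -[|[a l] s] e; first by move=> _; apply: val_inj.
by rewrite /forest_size /= addSn.
Qed.

Lemma forest_size_gt0 h : (0 < forest_size h)%N = (h != fempty A).
Proof.
rewrite lt0n; congr (~~ _); apply/eqP/eqP => [/forest_size_eq0 //|->].
exact: forest_size1.
Qed.

Lemma forest_ltn_ind (Q : forest A -> Prop) :
  (forall h, (forall k, (forest_size k < forest_size h)%N -> Q k) -> Q h) ->
  forall h, Q h.
Proof.
move=> IH h; have [n] := ubnP (forest_size h).
elim: n h => // n IHn h; rewrite ltnS => hn; apply: IH => k kh.
by apply: IHn; apply: leq_trans kh hn.
Qed.

Lemma fgraft_inj a b h k : fgraft a h = fgraft b k -> a = b /\ h = k.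
Proof.
move=> /mkforest_eq; move=> /perm_small_eq - /(_ isT); case=> -> e; split=> //.
by rewrite -[h]mkforestK -[k]mkforestK; exact: val_inj.
Qed.

Lemma fgraft_neq1 a h : fgraft a h != fempty A.
Proof. by rewrite -forest_size_gt0 forest_size_graft. Qed.

(** The list [coprod h] is meaningful only up to permutation. Testing it by sums of an arbitrary
    function into a commutative monoid replaces equality in the tensor square of H. *)
Lemma coprod_sum_mul (V : nmodType) (O : forest A -> forest A -> V) h k :
  \sum_(c <- coprod (fmul h k)) O c.1 c.2 =
  \sum_(x <- coprod h) \sum_(y <- coprod k) O (fmul x.1 y.1) (fmul x.2 y.2).
Proof. by rewrite (perm_big _ (coprod_fmul h k)) big_allpairs_dep. Qed.

Lemma coprod_sum_graft (V : nmodType) (O : forest A -> forest A -> V) a h :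
  \sum_(c <- coprod (fgraft a h)) O c.1 c.2 =
  \sum_(x <- coprod h) O x.1 (fgraft a x.2) + O (fgraft a h) (fempty A).
Proof.
by rewrite (perm_big _ (coprod_fgraft a h)) -cats1 big_cat big_seq1 /= big_map.
Qed.

Lemma coprod_sum1 (V : nmodType) (O : forest A -> forest A -> V) :
  \sum_(c <- coprod (fempty A)) O c.1 c.2 = O (fempty A) (fempty A).
Proof. by rewrite coprod1 big_seq1. Qed.

Lemma coprod_size h c : c \in coprod h ->
  (forest_size c.1 + forest_size c.2 = forest_size h)%N.
Proof.
elim/forest_ind: h c => [|a h IH|h k IHh IHk] c.
- by rewrite coprod1 inE => /eqP -> /=; rewrite forest_size1.
- rewrite (perm_mem (coprod_fgraft a h)) mem_rcons inE => /orP[/eqP -> /=|].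
    by rewrite forest_size1 addn0.
  by move=> /mapP[x /IH e ->] /=; rewrite !forest_size_graft addnS e.
rewrite (perm_mem (coprod_fmul h k)) => /allpairsP[[x y] /= [/IHh ex /IHk ey ->]] /=.
by rewrite !forest_size_mul -ex -ey addnACA.
Qed.

(** As [O] is arbitrary, in the product case the hypothesis for [h] applies with the cuts of [k]
    frozen inside [O], and then the one for [k] with the sums over the cuts of [h] inside [O]. *)
Lemma coprod_coassoc (V : nmodType) (O : forest A -> forest A -> forest A -> V) h :
  \sum_(x <- coprod h) \sum_(u <- coprod x.1) O u.1 u.2 x.2 =
  \sum_(x <- coprod h) \sum_(u <- coprod x.2) O x.1 u.1 u.2.
Proof.
elim/forest_ind: h O => [|a h IH|h k IHh IHk] O.
- by rewrite coprod1 !big_seq1.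
- rewrite (coprod_sum_graft (fun y1 y2 => \sum_(u <- coprod y1) O u.1 u.2 y2)).
  rewrite (coprod_sum_graft (fun y1 y2 => \sum_(u <- coprod y2) O y1 u.1 u.2)).
  rewrite (IH (fun x y z => O x y (fgraft a z))).
  rewrite (coprod_sum_graft (fun x y => O x y (fempty A))) coprod_sum1 addrA.
  rewrite -big_split /=; congr (_ + _); apply: eq_bigr => x _.
  by rewrite (coprod_sum_graft (fun y z => O x.1 y z)).
rewrite (coprod_sum_mul (fun y1 y2 => \sum_(u <- coprod y1) O u.1 u.2 y2)).
rewrite (coprod_sum_mul (fun y1 y2 => \sum_(u <- coprod y2) O y1 u.1 u.2)).
transitivity (\sum_(y <- coprod k) \sum_(v <- coprod y.1)
   \sum_(x <- coprod h) \sum_(u <- coprod x.1)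
     O (fmul u.1 v.1) (fmul u.2 v.2) (fmul x.2 y.2)).
  rewrite exchange_big; apply: eq_bigr => y _.
  rewrite [RHS]exchange_big; apply: eq_bigr => x _.
  rewrite [RHS]exchange_big.
  by rewrite (coprod_sum_mul (fun p q => O p q (fmul x.2 y.2))).
transitivity (\sum_(y <- coprod k) \sum_(v <- coprod y.2)
   \sum_(x <- coprod h) \sum_(u <- coprod x.2)
     O (fmul x.1 y.1) (fmul u.1 v.1) (fmul u.2 v.2)); last first.
  rewrite [RHS]exchange_big; apply: eq_bigr => y _.
  rewrite exchange_big; apply: eq_bigr => x _.
  rewrite exchange_big.
  by rewrite (coprod_sum_mul (fun p q => O (fmul x.1 y.1) p q)).
under eq_bigr => y _ do under eq_bigr => v _ do
  rewrite (IHh (fun p q r => O (fmul p v.1) (fmul q v.2) (fmul r y.2))).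
rewrite (IHk (fun p q r => \sum_(x <- coprod h) \sum_(u <- coprod x.2)
  O (fmul x.1 p) (fmul u.1 q) (fmul u.2 r))).
by [].
Qed.

Lemma coprod_counitl (V : nmodType) (O : forest A -> V) h :
  \sum_(c <- coprod h | c.1 == fempty A) O c.2 = O h.
Proof.
rewrite big_mkcond /=.
elim/forest_ind: h O => [|a h IH|h k IHh IHk] O.
- by rewrite coprod1 big_seq1 eqxx.
- rewrite (coprod_sum_graft (fun x y => if x == fempty A then O y else 0)).
  by rewrite (negbTE (fgraft_neq1 a h)) addr0 (IH (fun z => O (fgraft a z))).
rewrite (coprod_sum_mul (fun x y => if x == fempty A then O y else 0)).
rewrite -(IHh (fun z => O (fmul z k))); apply: eq_bigr => x _.
case: ifP => [/eqP ->|x1].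
  rewrite -(IHk (fun z => O (fmul x.2 z))); apply: eq_bigr => y _.
  by rewrite fmul1f.
rewrite big1 // => y _; case: eqP => // /fmul_unit[x1' _].
by rewrite x1' eqxx in x1.
Qed.

Lemma coprod_counitr (V : nmodType) (O : forest A -> V) h :
  \sum_(c <- coprod h | c.2 == fempty A) O c.1 = O h.
Proof.
rewrite big_mkcond /=.
elim/forest_ind: h O => [|a h IH|h k IHh IHk] O.
- by rewrite coprod1 big_seq1 eqxx.
- rewrite (coprod_sum_graft (fun x y => if y == fempty A then O x else 0)).
  rewrite eqxx -[RHS]add0r; congr (_ + _); exact: big1.
rewrite (coprod_sum_mul (fun x y => if y == fempty A then O x else 0)).
rewrite -(IHh (fun z => O (fmul z k))); apply: eq_bigr => x _.
case: ifP => [/eqP ->|x1].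
  rewrite -(IHk (fun z => O (fmul x.1 z))); apply: eq_bigr => y _.
  by rewrite fmul1f.
rewrite big1 // => y _; case: eqP => // /fmul_unit[x1' _].
by rewrite x1' eqxx in x1.
Qed.

Lemma coprod_reduced (V : nmodType) (O : forest A -> forest A -> V) h :
  h != fempty A ->
  \sum_(c <- coprod h) O c.1 c.2 = O (fempty A) h + (O h (fempty A) +
   \sum_(c <- coprod h | (c.1 != fempty A) && (c.2 != fempty A)) O c.1 c.2).
Proof.
move=> h1; rewrite (bigID (fun c => c.1 == fempty A)) /=; congr (_ + _).
  rewrite -(coprod_counitl (O (fempty A)) h); apply: eq_bigr => c /eqP -> //.
rewrite (bigID (fun c => c.2 == fempty A)) /=; congr (_ + _).
rewrite -(coprod_counitr (fun z => O z (fempty A)) h).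
(* If [c.2] is empty then [c.1] has the size of [h], hence is nonempty: the condition on [c.1] costs
   nothing in this sum. *)
rewrite big_seq_cond [RHS]big_seq_cond; apply: congr_big => // [c|c].
  have [ce /=|//] := boolP (c \in _); rewrite andb_idl // => /eqP c2.
  have := coprod_size ce; rewrite c2 forest_size1 addn0 => e.
  by rewrite -forest_size_gt0 e forest_size_gt0.
by move=> /andP[_ /andP[_ /eqP ->]].
Qed.

Definition finsert h k : seq (forest A) := [seq mkforest v | v <- forest_insert h k].

Lemma eq_perm (S : eqType) (r1 r2 : seq S) : r1 = r2 -> perm_eq r1 r2.
Proof. by move=> ->. Qed.

Lemma forest_insert_cat s l1 l2 : forest_insert s (l1 ++ l2) =
  [seq v ++ l2 | v <- forest_insert s l1] ++ [seq l1 ++ v | v <- forest_insert s l2].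
Proof.
elim: l1 => [|t l1 IH] /=; first by rewrite map_id.
rewrite IH !map_cat -!map_comp -catA; congr (_ ++ (_ ++ _)).
Qed.

Lemma perm_forest_insert s l1 l2 : perm_eq l1 l2 ->
  perm_eq (map (@mkforest A) (forest_insert s l1)) (map (@mkforest A) (forest_insert s l2)).
Proof.
move=> e; pose Q l := perm_eq (map (@mkforest A) (forest_insert s l1))
                              (map (@mkforest A) (forest_insert s l)).
apply: (@catCA_perm_ind _ Q _ l1 l2 e (perm_refl _)) => u1 u2 u3 /permPl e1.
rewrite /Q e1 !forest_insert_cat !map_cat -!map_comp.
rewrite perm_catCA; apply: perm_cat; last apply: perm_cat.
- apply: eq_perm; apply: eq_map => v /=.
  by apply/mkforest_eq/perm_map; rewrite perm_catCA.
- apply: eq_perm; apply: eq_map => v /=.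
  by apply/mkforest_eq/perm_map; rewrite perm_catCA.
apply: eq_perm; apply: eq_map => v /=.
by apply/mkforest_eq/perm_map; rewrite perm_catCA.
Qed.

(** Normalisation changes the order in which nodes are visited, so the results agree only as
    multisets of non-planar forests. Trees and lists of trees call each other: [QT] is the claim for
    one tree, and [QF] derives the claim for a list from it. *)
Lemma forest_insert_nf s s' l : perm_eq (map (@tree_nf A) s) (map (@tree_nf A) s') ->
  perm_eq (map (@mkforest A) (forest_insert s (map (@tree_nf A) l)))
          (map (@mkforest A) (forest_insert s' l)).
Proof.
move=> ss'.
pose QT t := perm_eq (map (@tree_nf A) (tree_insert s (tree_nf t)))
                     (map (@tree_nf A) (tree_insert s' t)).
have QF m : foldr (fun t B => QT t /\ B) True m ->
    perm_eq (map (@mkforest A) (forest_insert s (map (@tree_nf A) m)))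
            (map (@mkforest A) (forest_insert s' m)).
  elim: m => //= t m IH [Qt /IH Qm]; rewrite !map_cat -!map_comp.
  apply: perm_cat.
    have E (r : seq (ptree A)) z : map (@mkforest A \o cons^~ z) r =
        map (fun u => fmul (mkforest [:: u]) (mkforest z)) (map (@tree_nf A) r).
      rewrite -map_comp; apply: eq_map => u /=; rewrite mkforest_cons.
      by congr fmul; apply/mkforest_eq; rewrite /= tree_nfK.
    rewrite !E (_ : mkforest (map (@tree_nf A) m) = mkforest m).
      exact: perm_map.
    by apply/mkforest_eq; rewrite map_tree_nfK.
  rewrite (@eq_map _ _ _ (fun v => fmul (mkforest [:: t]) (mkforest v))); last first.
    move=> v /=; rewrite mkforest_cons; congr fmul; apply/mkforest_eq.
    by rewrite /= tree_nfK.
  rewrite [X in perm_eq _ X](@eq_map _ _ _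
    (fun v => fmul (mkforest [:: t]) (mkforest v))); last first.
    by move=> v /=; rewrite mkforest_cons.
  by rewrite (map_comp (fmul _)) [X in perm_eq _ X](map_comp (fmul _)); exact: perm_map.
apply: (QF l); elim: l => //= t l IH; split=> // {l IH}.
elim/ptree_ind_in: t => a l /QF IHl.
rewrite /QT [tree_nf _]/= -/(forest_nf l) !tree_insertE !map_cons.
have -> : tree_nf (PNode a (s ++ forest_nf l)) = tree_nf (PNode a (s' ++ l)).
  congr PNode; apply: eq_forest_nf; rewrite !map_cat; apply: perm_cat => //.
  by rewrite (permPl (perm_map _ (perm_forest_nf l))) map_tree_nfK.
rewrite perm_cons -!map_comp.
have e : perm_eq (map (@mkforest A) (forest_insert s (forest_nf l)))
                 (map (@mkforest A) (forest_insert s' l)).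
  exact: perm_trans (perm_forest_insert s (perm_forest_nf l)) IHl.
by have := perm_map (fun h : forest A => PNode a h) e; rewrite -!map_comp.
Qed.

Lemma finsert_mk s l : perm_eq (finsert (mkforest s) (mkforest l))
  (map (@mkforest A) (forest_insert s l)).
Proof.
rewrite /finsert (permPl (perm_forest_insert _ (perm_forest_nf l))).
by apply: forest_insert_nf; rewrite (permPl (perm_map _ (perm_forest_nf s))) map_tree_nfK.
Qed.

Lemma finsert1 h : finsert h (fempty A) = [::].
Proof. by []. Qed.

Lemma finsert_mul h k (l : forest A) : perm_eq (finsert h (fmul k l))
  ([seq fmul v l | v <- finsert h k] ++ [seq fmul k v | v <- finsert h l]).
Proof.
rewrite -{1}[h]mkforestK (permPl (finsert_mk _ _)) forest_insert_cat map_cat.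
rewrite /finsert -!map_comp; apply: perm_cat; apply: eq_perm; apply: eq_map => v /=.
  by rewrite -[l in RHS]mkforestK fmulE.
by rewrite -[k in RHS]mkforestK fmulE.
Qed.

Lemma finsert_graft h a k : perm_eq (finsert h (fgraft a k))
  (fgraft a (fmul h k) :: [seq fgraft a v | v <- finsert h k]).
Proof.
rewrite -{1}[h]mkforestK (permPl (finsert_mk _ _)) /= -/(forest_insert h k) cats0.
rewrite mkforest1 perm_cons /finsert -!map_comp; apply: eq_perm.
by apply: eq_map => v /=; rewrite mkforest1.
Qed.

Lemma size_finsert h k : size (finsert h k) = forest_size k.
Proof. by rewrite size_map size_forest_insert. Qed.

Lemma finsert_size h k v : v \in finsert h k ->
  forest_size v = (forest_size h + forest_size k)%N.
Proof.
elim/forest_ind: k v => [|a k IH|k l IHk IHl] v //.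
- rewrite (perm_mem (finsert_graft h a k)) inE => /orP[/eqP ->|/mapP[w /IH e ->]].
    by rewrite !forest_size_graft forest_size_mul addnS.
  by rewrite !forest_size_graft e addnS.
rewrite (perm_mem (finsert_mul h k l)) mem_cat => /orP[]/mapP[w].
  by move=> /IHk e ->; rewrite !forest_size_mul e addnA.
by move=> /IHl e ->; rewrite !forest_size_mul e addnCA.
Qed.

(* A cut of a forest obtained by grafting h at a node of k either leaves that
   node in the trunk, and then cuts h as well, or removes it. *)
Lemma coprod_finsert (V : nmodType) (O : forest A -> forest A -> V) h k :
  \sum_(v <- finsert h k) \sum_(c <- coprod v) O c.1 c.2 =
  \sum_(y <- coprod k)
    (\sum_(x <- coprod h) \sum_(w <- finsert x.2 y.2) O (fmul x.1 y.1) w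
     + \sum_(v <- finsert h y.1) O v y.2).
Proof.
elim/forest_ind: k O => [|a k IH|k l IHk IHl] O.
- rewrite coprod1 big_seq1 /= finsert1 !big_nil addr0 big1 // => x _.
  by rewrite finsert1 big_nil.
- rewrite (perm_big _ (finsert_graft h a k)) big_cons big_map.
  under eq_bigr => v _ do rewrite coprod_sum_graft.
  rewrite big_split /= (IH (fun p q => O p (fgraft a q))) coprod_sum_graft
    (coprod_sum_mul (fun p q => O p (fgraft a q))).
  rewrite (coprod_sum_graft (fun y1 y2 =>
    \sum_(x <- coprod h) \sum_(w <- finsert x.2 y2) O (fmul x.1 y1) w
     + \sum_(v <- finsert h y1) O v y2)).
  under [in RHS]eq_bigr => y _ do under eq_bigr => x _ do
    rewrite (perm_big _ (finsert_graft x.2 a y.2)) big_cons big_map.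
  under [in RHS]eq_bigr => y _ do rewrite big_split /= -addrA.
  rewrite [in RHS]big_split /= exchange_big /=.
  rewrite [X in _ = _ + (X + _)]big1 ?add0r; last first.
    by move=> x _; rewrite finsert1 big_nil.
  rewrite (perm_big _ (finsert_graft h a k)) big_cons big_map.
  by rewrite addrACA; congr (_ + (_ + _)); rewrite /finsert !big_map.
have bm (f : forest A -> forest A) u (F : forest A -> V) z :
    \sum_(i <- [seq f v | v <- finsert u z]) F i = \sum_(v <- finsert u z) F (f v).
  exact: big_map.
rewrite (perm_big _ (finsert_mul h k l)) big_cat !bm /=.
under eq_bigr => v _ do rewrite coprod_sum_mul exchange_big /=.
under [X in _ + X = _]eq_bigr => v _ do rewrite coprod_sum_mul /=.
rewrite exchange_big /=.
under eq_bigr => y _ do rewrite (IHk (fun p q => O (fmul p y.1) (fmul q y.2))).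
rewrite [X in _ + X = _]exchange_big /=.
under [X in _ + X = _]eq_bigr => x _ do
  rewrite (IHl (fun p q => O (fmul x.1 p) (fmul x.2 q))).
rewrite exchange_big -big_split /=.
rewrite (coprod_sum_mul (fun y1 y2 =>
    \sum_(x <- coprod h) \sum_(w <- finsert x.2 y2) O (fmul x.1 y1) w
     + \sum_(v <- finsert h y1) O v y2)).
apply: eq_bigr => x _; rewrite -big_split /=; apply: eq_bigr => y _.
rewrite (perm_big _ (finsert_mul h x.1 y.1)) big_cat !bm /=.
rewrite addrACA; congr (_ + _).
rewrite -big_split; apply: eq_bigr => z _.
rewrite (perm_big _ (finsert_mul z.2 x.2 y.2)) big_cat !bm /=.
by congr (_ + _); apply: eq_bigr => w _; rewrite ?fmulA // [fmul z.1 x.1]fmulC.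
Qed.

End ForestCombinatorics.

(** * The pairing and the cocycle of a primitive element *)

Section MalgPairing.
Variables (R : realType) (K : choiceType).
Implicit Types (f g : K -> R) (x y : malg K R).

(** Over any index type, because the same calculus serves H and its tensor square. *)
Definition mpair f x : R := \sum_(h <- msupp x) mcoeff h x * f h.

Lemma mpair_sub f x (S : seq K) : uniq S -> {subset msupp x <= S} ->
  mpair f x = \sum_(h <- S) mcoeff h x * f h.
Proof.
move=> uS sub; rewrite [RHS](bigID (mem (msupp x))) /= [X in _ + X]big1 ?addr0.
  rewrite -[RHS]big_filter; apply: perm_big; apply: uniq_perm.
  - exact: fset_uniq.
  - exact: filter_uniq.
  by move=> h; rewrite mem_filter /= andb_idr //; exact: sub.
by move=> h hx; rewrite mcoeff_outdom ?mul0r.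
Qed.

Lemma mpair_lin f (c : R) x y : mpair f (c *: x + y) = c * mpair f x + mpair f y.
Proof.
pose S := undup (msupp x ++ msupp y ++ msupp (c *: x + y)).
have S1 : {subset msupp x <= S} by move=> h; rewrite mem_undup !mem_cat => ->.
have S2 : {subset msupp y <= S}.
  by move=> h; rewrite mem_undup !mem_cat => ->; rewrite orbT.
have S3 : {subset msupp (c *: x + y) <= S}.
  by move=> h; rewrite mem_undup !mem_cat => ->; rewrite !orbT.
rewrite !(@mpair_sub _ _ S) ?undup_uniq //.
rewrite mulr_sumr -big_split; apply: eq_bigr => h _ /=.
by rewrite mcoeffD mcoeffZ mulrDl mulrA.
Qed.

Lemma mpairU f k (c : R) : mpair f (mkmalgU k c) = c * f k.
Proof.
rewrite (@mpair_sub _ _ [:: k]) //; first by rewrite big_seq1 mcoeffUU.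
by move=> h /(fsubsetP msuppU_le); rewrite !inE.
Qed.

Lemma mpair0 f : mpair f 0 = 0.
Proof. by rewrite /mpair msupp0 big_seq_fset0. Qed.

Lemma mpairD f x y : mpair f (x + y) = mpair f x + mpair f y.
Proof. by have := mpair_lin f 1 x y; rewrite scale1r mul1r. Qed.

Lemma mpairZ f (c : R) x : mpair f (c *: x) = c * mpair f x.
Proof. by have := mpair_lin f c x 0; rewrite mpair0 !addr0. Qed.

Lemma mpair_sum f I (r : seq I) (Q : pred I) F :
  mpair f (\sum_(i <- r | Q i) F i) = \sum_(i <- r | Q i) mpair f (F i).
Proof. by apply: (big_morph (mpair f) (mpairD f) (mpair0 f)). Qed.

Lemma mpair_delta k x : mpair (fun h => (h == k)%:R) x = mcoeff k x.
Proof.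
rewrite (@mpair_sub _ _ (undup (k :: msupp x))) ?undup_uniq //; last first.
  by move=> h hx; rewrite mem_undup inE hx orbT.
rewrite (bigD1_seq k) ?undup_uniq ?mem_undup ?mem_head //= eqxx mulr1 big1 ?addr0 //.
by move=> h /negbTE ->; rewrite mulr0.
Qed.

Lemma mpair_inj x y : (forall f, mpair f x = mpair f y) -> x = y.
Proof. by move=> e; apply/malgP => k; rewrite -!mpair_delta. Qed.

Lemma eq_mpair f g x : {in msupp x, f =1 g} -> mpair f x = mpair g x.
Proof. by move=> e; apply: eq_big_seq => h hx; rewrite e. Qed.

End MalgPairing.

Section Pairing.
Variables (R : realType) (A : finType).
Local Notation H := (forest_alg R A).
Local Notation vec := (@forest_vec R A).
Local Notation one := (fempty A).
Implicit Types (f g phi psi : forest A -> R) (x y z : H) (h k : forest A).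

Lemma pairing_vec f h : pairing f (vec h) = f h.
Proof. by rewrite /pairing -/(mpair f _) mpairU mul1r. Qed.
Lemma pairing0 f : pairing f 0 = 0. Proof. exact: mpair0. Qed.
Lemma pairingD f x y : pairing f (x + y) = pairing f x + pairing f y.
Proof. exact: mpairD. Qed.
Lemma pairingZ f c x : pairing f (c *: x) = c * pairing f x.
Proof. exact: mpairZ. Qed.
Lemma pairingB f x y : pairing f (x - y) = pairing f x - pairing f y.
Proof. by rewrite -scaleN1r pairingD pairingZ mulN1r. Qed.
Lemma pairing_sum f I (r : seq I) (Q : pred I) (F : I -> H) :
  pairing f (\sum_(i <- r | Q i) F i) = \sum_(i <- r | Q i) pairing f (F i).
Proof. exact: mpair_sum. Qed.
Lemma pairing_delta k x : pairing (fdelta R k) x = mcoeff k x.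
Proof. exact: mpair_delta. Qed.
Lemma pairing_inj x y : (forall f, pairing f x = pairing f y) -> x = y.
Proof. exact: mpair_inj. Qed.
Lemma pairing_sub f x (S : seq (forest A)) : uniq S -> {subset msupp x <= S} ->
  pairing f x = \sum_(h <- S) mcoeff h x * f h.
Proof. exact: mpair_sub. Qed.
Lemma eq_pairing_in f g x : {in msupp x, f =1 g} -> pairing f x = pairing g x.
Proof. exact: eq_mpair. Qed.
Lemma eq_pairing f g x : f =1 g -> pairing f x = pairing g x.
Proof. by move=> e; apply: eq_pairing_in => h _. Qed.

Lemma pairing_fun0 x : pairing (fun=> 0) x = 0.
Proof. by rewrite /pairing big1 // => h _; rewrite mulr0. Qed.
Lemma pairing_funD f g x : pairing (fun h => f h + g h) x = pairing f x + pairing g x.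
Proof. by rewrite /pairing -big_split; apply: eq_bigr => h _; rewrite mulrDr. Qed.
Lemma pairing_funZ c f x : pairing (fun h => c * f h) x = c * pairing f x.
Proof. by rewrite /pairing mulr_sumr; apply: eq_bigr => h _; rewrite mulrCA. Qed.
Lemma pairing_funZr c f x : pairing (fun h => f h * c) x = pairing f x * c.
Proof. by rewrite mulrC -pairing_funZ; apply: eq_pairing => h; rewrite mulrC. Qed.
Lemma pairing_funB f g x : pairing (fun h => f h - g h) x = pairing f x - pairing g x.
Proof.
by rewrite -mulN1r -pairing_funZ -pairing_funD; apply: eq_pairing => h; rewrite mulN1r.
Qed.
Lemma pairing_fun_sum I (r : seq I) (Q : pred I) (F : I -> forest A -> R) x :
  pairing (fun h => \sum_(i <- r | Q i) F i h) x =
  \sum_(i <- r | Q i) pairing (F i) x.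
Proof.
rewrite /pairing exchange_big /=; apply: eq_bigr => h _.
by rewrite mulr_sumr.
Qed.
Definition hom n x := forall h, h \in msupp x -> forest_size h = n.

(** The dual form of homogeneity passes through linear combinations and T without computing
    supports, which may shrink by cancellation. *)
Lemma homP n x :
  hom n x <-> forall f, (forall h, forest_size h = n -> f h = 0) -> pairing f x = 0.
Proof.
split=> [hx f f0|hx h].
  by rewrite -(pairing_fun0 x); apply: eq_pairing_in => h /hx /f0.
rewrite -mcoeff_neq0 -pairing_delta => nz; apply/eqP; apply: contraNT nz => hn.
by apply/eqP/hx => k kn; rewrite /fdelta; case: eqP => // kh; rewrite -kn kh eqxx in hn.
Qed.

Lemma hom_sum n I (r : seq I) (Q : pred I) (F : I -> H) :
  (forall i, Q i -> hom n (F i)) -> hom n (\sum_(i <- r | Q i) F i).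
Proof.
move=> hF; apply/homP => f f0; rewrite pairing_sum big1 // => i /hF /homP; exact.
Qed.
Lemma homZ n c x : hom n x -> hom n (c *: x).
Proof. by move/homP => hx; apply/homP => f f0; rewrite pairingZ hx ?mulr0. Qed.
Lemma homB n x y : hom n x -> hom n y -> hom n (x - y).
Proof.
by move=> /homP hx /homP hy; apply/homP => f f0; rewrite pairingB hx // hy // subr0.
Qed.
Lemma hom_vec h : hom (forest_size h) (vec h).
Proof. by apply/homP => f f0; rewrite pairing_vec f0. Qed.

Lemma hom_hdeg n x : hom n x -> x != 0 -> hdeg x = n.
Proof.
move=> hx x0; rewrite /hdeg.
have [k kx] : exists k, k \in msupp x.
  by apply/fset0Pn; apply: contraNneq x0 => e; rewrite -msupp_eq0 e.
apply/eqP; rewrite eqn_leq; apply/andP; split.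
  by apply/bigmax_leqP_seq => h /hx -> _.
by rewrite -(hx _ kx); apply: (@leq_bigmax_seq _ _ _ (@forest_size A)).
Qed.

(** The transpose of T: [tins phi h k] is phi(h T k). Identities in H are tested against all
    functionals ([pairing_inj]), so T is handled in this form. *)
Definition tins phi h k : R := (forest_size k)%:R^-1 * \sum_(v <- finsert h k) phi v.

Lemma pairing_ftop phi x y :
  pairing phi (ftop x y) = pairing (fun h => pairing (tins phi h) y) x.
Proof.
rewrite /ftop pairing_sum [RHS]/pairing; apply: eq_bigr => h _.
rewrite pairing_sum /pairing mulr_sumr; apply: eq_bigr => k _.
rewrite -!/(pairing _ _) pairingZ /top_forest pairingZ pairing_sum mulrA.
rewrite /tins /finsert big_map !mulrA; congr (_ * _).
by apply: eq_bigr => v _; rewrite pairing_vec.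
Qed.

Local Opaque ftop.

Lemma pairing_ftop_vec phi k y : pairing phi (ftop (vec k) y) = pairing (tins phi k) y.
Proof. by rewrite pairing_ftop pairing_vec. Qed.

Lemma pairing_ftopl phi x y :
  pairing phi (ftop x y) = pairing (fun k => pairing phi (ftop (vec k) y)) x.
Proof.
by rewrite [LHS]pairing_ftop; apply: eq_pairing => k; rewrite pairing_ftop_vec.
Qed.

Lemma finsert_one k v : v \in finsert one k -> v = k.
Proof.
elim/forest_ind: k v => [|a k IH|k l IHk IHl] v //.
- rewrite (perm_mem (finsert_graft one a k)) inE => /orP[/eqP ->|/mapP[w /IH -> ->]] //.
  by rewrite fmul1f.
by rewrite (perm_mem (finsert_mul one k l)) mem_cat => /orP[] /mapP[w] => [/IHk|/IHl] ->.
Qed.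

Lemma tins_one phi k : k != one -> tins phi one k = phi k.
Proof.
move=> k1; rewrite /tins (eq_big_seq (fun=> phi k)); last by move=> v /finsert_one ->.
rewrite big_const_seq count_predT size_finsert iter_addr_0 -[phi k *+ _]mulr_natl mulrA mulVf ?mul1r //.
by rewrite pnatr_eq0 -lt0n forest_size_gt0.
Qed.

Lemma ftop1 x : mcoeff one x = 0 -> ftop (vec one) x = x.
Proof.
move=> x1; apply: pairing_inj => f; rewrite pairing_ftop_vec.
apply: eq_pairing_in => h; rewrite -mcoeff_neq0 => hx; rewrite tins_one //.
by apply: contraNneq hx => ->; rewrite x1.
Qed.

Lemma hom_ftop m n x y : hom m x -> hom n y -> hom (m + n) (ftop x y).
Proof.
move=> hx hy; apply/homP => f f0; rewrite pairing_ftop -(pairing_fun0 x).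
apply: eq_pairing_in => h /hx hm; rewrite -(pairing_fun0 y).
apply: eq_pairing_in => k /hy kn; rewrite /tins big_seq big1 ?mulr0 // => v vk.
by apply: f0; rewrite (finsert_size vk) hm kn.
Qed.

Definition cosum (O : forest A -> forest A -> R) h := \sum_(c <- coprod h) O c.1 c.2.

Definition pairing2 (O : forest A -> forest A -> R) (z : forest_alg2 R A) : R :=
  mpair (fun c => O c.1 c.2) z.

Lemma pairing2D O (z1 z2 : forest_alg2 R A) :
  pairing2 O (z1 + z2) = pairing2 O z1 + pairing2 O z2.
Proof. exact: mpairD. Qed.

Lemma pairing2_sum O I (r : seq I) (Q : pred I) (F : I -> forest_alg2 R A) :
  pairing2 O (\sum_(i <- r | Q i) F i) = \sum_(i <- r | Q i) pairing2 O (F i).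
Proof. exact: mpair_sum. Qed.

Lemma pairing2U O (c : forest A * forest A) (e : R) :
  pairing2 O (mkmalgU c e) = e * O c.1 c.2.
Proof. exact: mpairU. Qed.

Lemma pairing2_inj (z1 z2 : forest_alg2 R A) :
  (forall O, pairing2 O z1 = pairing2 O z2) -> z1 = z2.
Proof.
move=> e; have E (f : forest A * forest A -> R) : mpair f z1 = mpair f z2; last exact: (mpair_inj E).
have -> : f = (fun c => (fun a b => f (a, b)) c.1 c.2) by apply/funext => -[].
exact: (e (fun a b => f (a, b))).
Qed.

Lemma pairing2_tensor O x y :
  pairing2 O (tensor x y) = pairing (fun h => pairing (O h) y) x.
Proof.
rewrite /tensor pairing2_sum [RHS]/pairing; apply: eq_bigr => h _.
rewrite pairing2_sum /pairing mulr_sumr; apply: eq_bigr => k _.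
by rewrite pairing2U mulrA.
Qed.

Lemma pairing2_Delta O x : pairing2 O (Delta x) = pairing (cosum O) x.
Proof.
rewrite /Delta pairing2_sum /pairing; apply: eq_bigr => h _.
by rewrite pairing2_sum mulr_sumr; apply: eq_bigr => c _; rewrite pairing2U.
Qed.

(** The kernels [O] separate the elements of the tensor square, so the tensor equation may be tested
    against them; later arguments use only this form. *)
Lemma primitive_kernelP x : primitive x <-> mcoeff one x = 0 /\
  forall O, pairing (cosum O) x = pairing (O^~ one) x + pairing (O one) x.
Proof.
have vec_r O y : pairing (fun h => pairing (O h) (vec one)) y = pairing (O^~ one) y.
  by apply: eq_pairing => h; rewrite pairing_vec.
split=> -[x1 e]; split=> //.
  move=> O; rewrite -[LHS]pairing2_Delta e [LHS]pairing2D.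
  by rewrite [X in X + _]pairing2_tensor [X in _ + X]pairing2_tensor vec_r pairing_vec.
have E O : pairing2 O (Delta x) = pairing2 O
    (tensor x (vec one) + tensor (vec one) x); last exact: (pairing2_inj E).
rewrite [LHS]pairing2_Delta e [RHS]pairing2D.
by rewrite [X in _ = X + _]pairing2_tensor [X in _ = _ + X]pairing2_tensor vec_r pairing_vec.
Qed.

(* x |-> x T p satisfies the cocycle identity of a grafting operator. *)
Lemma cosum_ftop O n p k : primitive p -> hom n p ->
  pairing (cosum O) (ftop (vec k) p) = pairing (O^~ one) (ftop (vec k) p)
    + cosum (fun a b => pairing (O a) (ftop (vec b) p)) k.
Proof.
move=> /primitive_kernelP[_ pp] hp.
pose K a b := \sum_(x <- coprod k) \sum_(w <- finsert x.2 b) O (fmul x.1 a) w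
     + \sum_(v <- finsert k a) O v b.
(* On the support of the homogeneous [p] the factor 1/|h| in T is the constant 1/n, so it can be
   moved across the coproduct. *)
have e f g : (forall h, f h = (forest_size h)%:R^-1 * g h) ->
    pairing f p = n%:R^-1 * pairing g p.
  move=> fg; rewrite -pairing_funZ; apply: eq_pairing_in => h /hp hn.
  by rewrite fg hn.
rewrite pairing_ftop_vec (e _ (cosum K)); last first.
  by move=> h; rewrite /tins; congr (_ * _); exact: coprod_finsert.
(* Primitivity keeps only [K h one] and [K one h]. In the first no trunk is left to graft on, which
   gives k T p uncut; in the second only the grafted forest is cut. *)
rewrite pp mulrDr; congr (_ + _).
  rewrite pairing_ftop_vec; apply/esym/e => h; rewrite /tins /K; congr (_ * _).
  rewrite [X in _ = X + _]big1 ?add0r // => x _; exact: big_nil.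
rewrite /cosum -[RHS]mul1r; under eq_bigr => c _ do rewrite pairing_ftop_vec.
rewrite mul1r -pairing_fun_sum; apply/esym/e => h; rewrite /tins /K.
rewrite finsert1 big_nil addr0 mulr_sumr; apply: eq_bigr => c _; congr (_ * _).
by apply: eq_bigr => v _; rewrite fmulf1.
Qed.

End Pairing.

(** * The primitive basis and its dual *)

Section PrimitivePart.
Variables (R : realType) (A : finType).
Local Notation H := (forest_alg R A).
Local Notation vec := (@forest_vec R A).
Local Notation one := (fempty A).
Implicit Types (f phi psi : forest A -> R) (p q : H) (h k : forest A).
Local Opaque ftop pairing forest_vec fempty.

Definition proper (c : forest A * forest A) := (c.1 != one) && (c.2 != one).

Definition rsum (V : nmodType) (O : forest A -> forest A -> V) h :=
  \sum_(c <- coprod h | proper c) O c.1 c.2.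

Lemma proper_size h c : c \in coprod h -> proper c ->
  (forest_size c.1 < forest_size h)%N /\ (forest_size c.2 < forest_size h)%N.
Proof.
move=> /coprod_size; rewrite /proper -!forest_size_gt0 => + /andP[].
by move: (forest_size c.1) (forest_size c.2) => a b <- a0 b0; split; lia.
Qed.

Lemma eq_rsum (V : nmodType) (O1 O2 : forest A -> forest A -> V) h :
  (forall c1 c2, c1 != one -> c2 != one ->
    (forest_size c1 < forest_size h)%N -> (forest_size c2 < forest_size h)%N ->
    (forest_size c1 + forest_size c2 = forest_size h)%N ->
    O1 c1 c2 = O2 c1 c2) ->
  rsum O1 h = rsum O2 h.
Proof.
move=> e; rewrite /rsum big_seq_cond [RHS]big_seq_cond; apply: eq_bigr => c /andP[ch pc].
have [s1 s2] := proper_size ch pc; have s := coprod_size ch.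
by case/andP: pc => p1 p2; apply: e.
Qed.

Lemma rsumD (V : nmodType) (O1 O2 : forest A -> forest A -> V) h :
  rsum (fun a b => O1 a b + O2 a b) h = rsum O1 h + rsum O2 h.
Proof. exact: big_split. Qed.

Lemma cosum_rsum (O : forest A -> forest A -> R) h : h != one ->
  cosum O h = O one h + (O h one + rsum O h).
Proof. exact: coprod_reduced. Qed.

Lemma rsum_coassoc (V : nmodType) (O : forest A -> forest A -> forest A -> V) h :
  rsum (fun a c => rsum (fun x y => O x y c) a) h =
  rsum (fun a c => rsum (fun x y => O a x y) c) h.
Proof.
(* [O'] vanishes as soon as one factor is empty, so full coassociativity for [O'] is reduced
   coassociativity for [O]. *)
pose O' x y z := if [&& x != one, y != one & z != one] then O x y z else 0.
have := coprod_coassoc O' h; rewrite /rsum.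
have one_coprod c : c \in coprod one -> c = (one, one).
  by rewrite coprod1 inE => /eqP.
have -> : \sum_(x <- coprod h) \sum_(u <- coprod x.1) O' u.1 u.2 x.2 =
    \sum_(c <- coprod h | proper c) \sum_(u <- coprod c.1 | proper u) O u.1 u.2 c.2.
  rewrite [RHS]big_mkcond; apply: eq_bigr => c _; rewrite [in RHS]big_mkcond /O' /proper.
  have [->|c2] := eqVneq c.2 one; first by rewrite andbF big1 // => u _; rewrite !andbF.
  rewrite andbT; have [->|c1] := eqVneq c.1 one.
    by rewrite /= coprod1 big_seq1 /= ?eqxx.
  by apply: eq_bigr => u _; rewrite andbT.
have -> : \sum_(x <- coprod h) \sum_(u <- coprod x.2) O' x.1 u.1 u.2 =
    \sum_(c <- coprod h | proper c) \sum_(u <- coprod c.2 | proper u) O c.1 u.1 u.2.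
  rewrite [RHS]big_mkcond; apply: eq_bigr => c _; rewrite [in RHS]big_mkcond /O' /proper.
  have [->|c1] := eqVneq c.1 one; first by rewrite /= big1.
  have [->|c2] /= := eqVneq c.2 one; last by [].
  by rewrite /= coprod1 big_seq1 /= ?eqxx.
by [].
Qed.

Lemma pairing_rsum f (O : forest A -> forest A -> H) h :
  pairing f (rsum O h) = rsum (fun a b => pairing f (O a b)) h.
Proof. exact: pairing_sum. Qed.

(** [n] is fuel: the recursive calls concern smaller forests found in a list, and every [n] of at
    least |h| gives the same value ([prim_iterE]). *)
Fixpoint prim_iter n h : H :=
  if n is m.+1 then
    if h == one then 0
    else vec h - rsum (fun c1 c2 => ftop (vec c1) (prim_iter m c2)) h
  else 0.

(* The projection of H onto its primitive elements that vanishes on 1 and on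
   the image of T; the recursion subtracts the terms x' T pi(x''). *)
Definition prim_part h : H := prim_iter (forest_size h) h.

Lemma prim_iterE n h : (forest_size h <= n)%N -> prim_iter n h = prim_part h.
Proof.
rewrite /prim_part; elim/forest_ltn_ind: h n => h IH n hn.
case: n hn => [|n] hn.
  by move: hn; rewrite leqn0 => /eqP ->.
have [->|h1] := eqVneq h one; first by rewrite forest_size1 /= ?eqxx.
have := h1; rewrite -forest_size_gt0; case E : (forest_size h) => [//|m] _ /=.
rewrite (negbTE h1); apply: pairing_inj => f.
rewrite [LHS]pairingB [RHS]pairingB [X in _ - X = _]pairing_rsum [X in _ = _ - X]pairing_rsum.
apply: (congr1 (fun z => pairing f (vec h) - z)).
apply: eq_rsum => c1 c2 c11 c21 s1 s2 _.
have n2 : (forest_size c2 <= n)%N by rewrite -ltnS (leq_trans s2 hn).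
have m2 : (forest_size c2 <= m)%N by rewrite -ltnS -E.
by rewrite (IH _ s2 n n2) (IH _ s2 m m2).
Qed.

Lemma prim_part1 : prim_part one = 0.
Proof. by rewrite /prim_part forest_size1. Qed.

Lemma prim_partE h : h != one ->
  vec h = prim_part h + rsum (fun c1 c2 => ftop (vec c1) (prim_part c2)) h.
Proof.
move=> h1; have := h1; rewrite -forest_size_gt0 {1}/prim_part.
case E : (forest_size h) => [//|m] _ /=; rewrite (negbTE h1); apply: pairing_inj => f.
rewrite [RHS]pairingD [X in _ = X + _]pairingB.
rewrite [X in _ = _ - X + _]pairing_rsum [X in _ = _ + X]pairing_rsum.
rewrite -addrA -[LHS]addr0; apply: (congr1 (fun z => pairing f (vec h) + z)).
apply/esym/eqP; rewrite addrC subr_eq0; apply/eqP.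
apply: eq_rsum => c1 c2 _ _ _ s2 _.
by rewrite prim_iterE // -ltnS -E.
Qed.

Lemma prim_part_def h : h != one ->
  prim_part h = vec h - rsum (fun c1 c2 => ftop (vec c1) (prim_part c2)) h.
Proof. by move=> /prim_partE ->; rewrite addrK. Qed.

Lemma hom_prim_part h : hom (forest_size h) (prim_part h).
Proof.
elim/forest_ltn_ind: h => h IH; have [->|h1] := eqVneq h one.
  by rewrite prim_part1 => k; rewrite msupp0.
rewrite prim_part_def //; apply: homB; first exact: hom_vec.
rewrite /rsum big_seq_cond; apply: hom_sum => c /andP[ch pc].
rewrite -(coprod_size ch); apply: hom_ftop; first exact: hom_vec.
by apply: IH; have [] := proper_size ch pc.
Qed.

Lemma hom_mcoeff1 n (x : H) : hom n x -> (0 < n)%N -> mcoeff one x = 0.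
Proof.
move=> hx n0; apply/mcoeff_outdom/negP => /hx; rewrite forest_size1 => e.
by rewrite -e in n0.
Qed.

Lemma prim_part_mcoeff1 h : mcoeff one (prim_part h) = 0.
Proof.
have [->|h1] := eqVneq h one; first by rewrite prim_part1 mcoeff0.
by apply: hom_mcoeff1 (@hom_prim_part h) _; rewrite forest_size_gt0.
Qed.

(** Apply the coproduct to the recursion. By [cosum_ftop] each subtracted x' T pi(x'') yields two
    trivial terms, the term x' (x) pi(x''), and terms from proper cuts of x'. By coassociativity and
    [prim_partE] for the smaller x'', the last two kinds add up to the reduced coproduct of [h],
    which is thereby cancelled. *)
Lemma prim_part_primitive h : primitive (prim_part h).
Proof.
elim/forest_ltn_ind: h => h IH; apply/primitive_kernelP.
split; first exact: prim_part_mcoeff1.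
move=> O; have [->|h1] := eqVneq h one; first by rewrite prim_part1 !pairing0 addr0.
rewrite prim_part_def // [LHS]pairingB [X in _ = X + _]pairingB [X in _ = _ + X]pairingB.
rewrite !pairing_vec !pairing_rsum (cosum_rsum _ h1).
set S1 := rsum O h.
set S2 := rsum (fun a b => pairing (O^~ one) _) h.
set S3 := rsum (fun a b => pairing (O one) _) h.
suff -> : rsum (fun a b => pairing (cosum O) (ftop (vec a) (prim_part b))) h =
    S2 + (S3 + S1) by ring.
have -> : S1 = rsum (fun a b => pairing (O a) (prim_part b)) h +
    rsum (fun a b => rsum (fun x y => pairing (O x) (ftop (vec y) (prim_part b))) a) h.
  rewrite (rsum_coassoc (fun x y b => pairing (O x) (ftop (vec y) (prim_part b)))).
  rewrite -rsumD; apply: eq_rsum => a b _ b1 _ _ _.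
  by rewrite -[LHS](pairing_vec (O a)) [in LHS](prim_partE b1) pairingD pairing_rsum.
rewrite -!rsumD; apply: eq_rsum => a b a1 b1 sa sb _.
rewrite (@cosum_ftop _ _ O (forest_size b)) ?IH //; last exact: hom_prim_part.
rewrite cosum_rsum // ftop1; last exact: prim_part_mcoeff1.
  reflexivity.
exact: IH.
Qed.

Lemma prim_part_cosum f h :
  cosum (fun a b => pairing f (ftop (vec a) (prim_part b))) h =
  if h == one then 0 else f h.
Proof.
have O1 a : pairing f (ftop (vec a) (prim_part one)) = 0.
  by rewrite prim_part1 [LHS]pairing_ftop_vec pairing0.
case: eqP => [->|/eqP h1].
  rewrite /cosum (coprod_sum1 (fun a b => pairing f (ftop (vec a) (prim_part b)))).
  exact: O1.
rewrite cosum_rsum // O1 add0r -[RHS](pairing_vec f) [in RHS](prim_partE h1).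
apply: esym; apply: etrans (pairingD _ _ _) _.
by apply: f_equal2; [rewrite ftop1 ?prim_part_mcoeff1|exact: pairing_rsum].
Qed.

Definition pext f (x : H) := pairing (fun k => pairing f (prim_part k)) x.

(** pi fixes primitive elements and kills k T q for nonempty [k]. Expanding k T q by
    [prim_part_cosum] and [cosum_ftop] turns f(k T q) into the sum of f(k' T pi(k'' T q)) over the
    cuts of [k]. By induction the cut k'' = 1 gives f(k T q) back and the proper cuts vanish, so the
    cut k' = 1, which is f(pi(k T q)), must vanish too. *)
Lemma pext_ftop f n q k : primitive q -> hom n q -> (0 < n)%N ->
  pext f (ftop (vec k) q) = if k == one then pairing f q else 0.
Proof.
move=> pq hq n0; have q1 := hom_mcoeff1 hq n0.
elim/forest_ltn_ind: k f => k IH f.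
pose O a b := pairing f (ftop (vec a) (prim_part b)).
have O1 a : O a one = 0.
  by rewrite /O prim_part1 [LHS]pairing_ftop_vec pairing0.
have fO h : h != one -> f h = cosum O h.
  by move=> h1; rewrite /O prim_part_cosum (negbTE h1).
have OE a x : pairing (O a) x = pext (tins f a) x.
  by apply: eq_pairing => b; rewrite /O [LHS]pairing_ftop_vec.
have x1 : mcoeff one (ftop (vec k) q) = 0.
  apply: (hom_mcoeff1 (hom_ftop (@hom_vec R A k) hq)).
  exact: leq_trans n0 (leq_addl _ _).
have pext1 x : mcoeff one x = 0 -> pext (tins f one) x = pext f x.
  move=> e; apply: eq_pairing => b; apply: eq_pairing_in => h.
  rewrite -mcoeff_neq0 => hb; rewrite tins_one //.
  by apply: contraNneq hb => ->; rewrite prim_part_mcoeff1.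
have main : pairing f (ftop (vec k) q) =
    cosum (fun a b => pext (tins f a) (ftop (vec b) q)) k.
  have -> : pairing f (ftop (vec k) q) = pairing (cosum O) (ftop (vec k) q).
    apply: eq_pairing_in => h; rewrite -mcoeff_neq0 => hb; rewrite fO //.
    by apply: contraNneq hb => ->; rewrite x1.
  apply: etrans (cosum_ftop O k pq hq) _; apply: etrans (f_equal2 _ _ _) (add0r _).
    by apply: etrans (eq_pairing _ (O1 : O^~ one =1 fun=> 0)) _; exact: pairing_fun0.
  by apply: eq_bigr => c _; exact: OE.
case: eqVneq main IH => [-> |k1] main IH.
  move: main; rewrite /cosum (coprod_sum1 (fun a b => pext (tins f a) (ftop (vec b) q))).
  by rewrite ftop1 // pext1 // => ->.
have k0 : (forest_size one < forest_size k)%N by rewrite forest_size1 forest_size_gt0.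
have r0 : rsum (fun a b => pext (tins f a) (ftop (vec b) q)) k = 0.
  rewrite /rsum big_seq_cond big1 // => c /andP[ck pc].
  have [_ s2] := proper_size ck pc.
  by rewrite (IH _ s2); case/andP: pc => _ /negbTE ->.
have e : pairing f (ftop (vec k) q) =
    pext f (ftop (vec k) q) + (pairing f (ftop (vec k) q) + 0).
  apply: etrans main _; apply: etrans (cosum_rsum _ k1) _.
  apply: f_equal2; first exact: pext1.
  apply: f_equal2; last exact: r0.
  apply: etrans (IH _ k0 _) _; rewrite ?eqxx; apply: esym; exact: pairing_ftop_vec.
by move/eqP: e; rewrite addr0 -subr_eq subrr eq_sym => /eqP.
Qed.

End PrimitivePart.

(** * The dual basis of [Ptop1] and its resolutions of the identity *)

Section TopBasis.
Variables (R : realType) (A : finType) (P : set (forest_alg R A)).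
Hypothesis hP : primitive_basis P.
Local Notation H := (forest_alg R A).
Local Notation vec := (@forest_vec R A).
Local Notation one := (fempty A).
Implicit Types (f phi psi : forest A -> R) (p q r s : H) (h k : forest A).
Local Opaque ftop pairing forest_vec fempty.

Lemma P_prim p : P p -> primitive p.
Proof. by case: hP => e _ _ /e[]. Qed.

Lemma P_neq0 p : P p -> p != 0.
Proof.
case: hP => _ _ ind Pp; apply/eqP => p0.
have : (1 : R) = 0.
  apply: (ind [:: p] (fun=> 1) isT _ _ p (mem_head _ _)).
    by move=> q; rewrite inE => /eqP ->.
  by rewrite big_seq1 scale1r.
by move/eqP; rewrite oner_eq0.
Qed.

Lemma P_hom p : P p -> hom (hdeg p) p.
Proof.
move=> Pp; case: hP => e _ _; have [_ [n hn]] := e p Pp.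
by rewrite (hom_hdeg hn (P_neq0 Pp)).
Qed.

Lemma P_mcoeff1 p : P p -> mcoeff one p = 0.
Proof. by move=> /P_prim[]. Qed.

Lemma P_deg_gt0 p : P p -> (0 < hdeg p)%N.
Proof.
move=> Pp; rewrite lt0n; apply/negP => /eqP p0; have /eqP[] := P_neq0 Pp.
apply/malgP => k; rewrite mcoeff0; apply/eqP.
rewrite mcoeff_eq0; apply/negP => kp; have := P_hom Pp kp; rewrite p0.
move=> /forest_size_eq0 k1; move: kp; rewrite k1 -mcoeff_neq0 => /eqP[].
exact: P_mcoeff1.
Qed.

Lemma P_indep (S : seq H) (c d : H -> R) : uniq S -> (forall p, p \in S -> P p) ->
  (forall f, \sum_(p <- S) c p * pairing f p = \sum_(p <- S) d p * pairing f p) ->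
  forall p, p \in S -> c p = d p.
Proof.
move=> uS PS e p pS; case: hP => _ _ ind.
apply/eqP; rewrite -subr_eq0; apply/eqP.
apply: (ind S (fun p => c p - d p) uS PS) => //.
apply: pairing_inj => f; rewrite pairing0 pairing_sum.
have -> : \sum_(i <- S) pairing f ((c i - d i) *: i) =
    \sum_(i <- S) c i * pairing f i - \sum_(i <- S) d i * pairing f i.
  by rewrite -sumrB; apply: eq_bigr => i _; rewrite pairingZ mulrBl.
by rewrite e subrr.
Qed.

(** An expansion given by [primitive_basis] may repeat elements and mix degrees. Multiplicities are
    merged into the coefficients, and functionals supported in degree |k| discard the other
    degrees. *)
Lemma prim_part_decomp k : exists sc : seq H * (H -> R),
  [/\ uniq sc.1, forall p, p \in sc.1 -> P p /\ hdeg p = forest_size k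
    & forall f, pairing f (prim_part R k) = \sum_(p <- sc.1) sc.2 p * pairing f p].
Proof.
case: hP => _ /(_ _ (@prim_part_primitive R A k)) [s [c [Ps e]]] _.
have {}e f : pairing f (prim_part R k) =
    \sum_(p <- undup s) (c p *+ count_mem p s) * pairing f p.
  rewrite e pairing_sum -big_undup_iterop_count; apply: eq_bigr => p _.
  rewrite -[X in iterop _ _ X _]/(pairing f (c p *: p)) pairingZ.
  by rewrite Monoid.iteropE iter_addr_0 mulrnAl.
exists ([seq p <- undup s | hdeg p == forest_size k], fun p => c p *+ count_mem p s).
split=> /=; first by rewrite filter_uniq ?undup_uniq.
  by move=> p; rewrite mem_filter mem_undup => /andP[/eqP -> /Ps].
move=> f; pose g h := if forest_size h == forest_size k then f h else 0.
have -> : pairing f (prim_part R k) = pairing g (prim_part R k).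
  by apply: eq_pairing_in => h /hom_prim_part hk; rewrite /g hk eqxx.
rewrite e big_filter [RHS]big_mkcond; apply: eq_big_seq => p.
rewrite mem_undup => /Ps Pp; case: ifP => pk.
  by congr (_ * _); apply: eq_pairing_in => h /(P_hom Pp) hp; rewrite /g hp pk.
have -> : pairing g p = 0; last by rewrite mulr0.
rewrite -(pairing_fun0 p); apply: eq_pairing_in => h /(P_hom Pp) hp.
by rewrite /g hp pk.
Qed.

Definition pdec k := sval (cid (prim_part_decomp k)).

Lemma pdecP k : [/\ uniq (pdec k).1,
    forall p, p \in (pdec k).1 -> P p /\ hdeg p = forest_size k
  & forall f, pairing f (prim_part R k) =
              \sum_(p <- (pdec k).1) (pdec k).2 p * pairing f p].
Proof. exact: svalP (cid (prim_part_decomp k)). Qed.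

(** The dual element p^*: pi kills 1 and every r T q with r in [Ptop P], so the coordinate of [p] in
    pi is dual to [p] within the basis [Ptop1] ([top_dual_pstar]). *)
Definition pstar p k : R := if p \in (pdec k).1 then (pdec k).2 p else 0.

Lemma pstar_neq0 p k : pstar p k != 0 -> p \in (pdec k).1 /\ hdeg p = forest_size k.
Proof.
rewrite /pstar; case: ifP => [pk _|]; last by rewrite eqxx.
by split=> //; have [_ /(_ _ pk)[]] := pdecP k.
Qed.

Lemma prim_part_pstar f k (S : seq H) : uniq S -> {subset (pdec k).1 <= S} ->
  pairing f (prim_part R k) = \sum_(p <- S) pstar p k * pairing f p.
Proof.
move=> uS sub; have [uk _ ->] := pdecP k.
rewrite [RHS](bigID (mem (pdec k).1)) /= [X in _ + X]big1 ?addr0; last first.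
  by move=> p /negbTE e; rewrite /pstar e mul0r.
rewrite -[RHS]big_filter; apply: etrans (perm_big _ _).
  by apply: eq_big_seq => p pk; rewrite /pstar pk.
apply: uniq_perm => // [|p]; first exact: filter_uniq.
by rewrite mem_filter /= andb_idr //; exact: sub.
Qed.

Lemma pstar_ftop p q k : P p -> P q ->
  pairing (pstar p) (ftop (vec k) q) = ((k == one) && (q == p))%:R.
Proof.
move=> Pp Pq; set x := ftop (vec k) q.
(* [S] contains every basis element that occurs, so coefficients can be compared by linear
   independence. *)
pose S := undup (p :: q :: flatten [seq (pdec v).1 | v <- msupp x]).
have PS r : r \in S -> P r.
  rewrite mem_undup !inE => /or3P[/eqP ->|/eqP ->|/flattenP[_ /mapP[v _ ->]]] //.
  by have [_ /(_ r) h _] := pdecP v => /h[].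
have sub v : v \in msupp x -> {subset (pdec v).1 <= S}.
  move=> vx r rv; rewrite mem_undup !inE; apply/or3P/Or33.
  by apply/flattenP; exists (pdec v).1 => //; apply: map_f.
have pS : p \in S by rewrite mem_undup mem_head.
have qS : q \in S by rewrite mem_undup !inE eqxx orbT.
apply: (@P_indep S (fun r => pairing (pstar r) x) (fun r => ((k == one) && (q == r))%:R)) => //.
  exact: undup_uniq.
move=> f; have -> : \sum_(r <- S) pairing (pstar r) x * pairing f r = pext f x.
  rewrite /pext [RHS](eq_pairing_in (g := fun v => \sum_(r <- S) pstar r v * pairing f r)).
    by rewrite pairing_fun_sum; apply: eq_bigr => r _; rewrite pairing_funZr.
  by move=> v vx; apply: prim_part_pstar; [exact: undup_uniq|exact: sub].
apply: etrans (pext_ftop f k (P_prim Pq) (P_hom Pq) (P_deg_gt0 Pq)) _.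
case: eqP => _ /=; last by rewrite big1 // => r _; rewrite mul0r.
rewrite (bigD1_seq q) ?undup_uniq //= eqxx mul1r big1 ?addr0 // => r.
by rewrite eq_sym => /negbTE ->; rewrite mul0r.
Qed.

Lemma Ptop_hom r : Ptop P r -> exists2 n, (0 < n)%N & hom n r.
Proof.
elim=> {r} [p Pp|r p _ [n n0 hn] Pp]; first by exists (hdeg p); [exact: P_deg_gt0|exact: P_hom].
exists (n + hdeg p)%N; first by rewrite addn_gt0 n0.
exact: hom_ftop hn (P_hom Pp).
Qed.

Lemma Ptop_mcoeff1 r : Ptop P r -> mcoeff one r = 0.
Proof. by move=> /Ptop_hom[n n0 hn]; exact: hom_mcoeff1 hn n0. Qed.

Lemma pstar1 p : pstar p one = 0.
Proof.
apply/eqP/negP => /negP /pstar_neq0[pk e].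
have [_ /(_ _ pk)[Pp _] _] := pdecP one.
by have := P_deg_gt0 Pp; rewrite e forest_size1.
Qed.

(** The coproduct of r T q consists of (r T q) (x) 1 and of the r' (x) (r'' T q), and [pstar p]
    vanishes on 1 and on k T q for nonempty k. So if [g] is dual to r, then [star g (pstar p)] is
    the candidate for the dual of r T p. *)
Lemma pairing_star_ftop f p q r : P p -> P q ->
  pairing (star f (pstar p)) (ftop r q) = pairing f r * (q == p)%:R.
Proof.
move=> Pp Pq; rewrite [LHS]pairing_ftopl -pairing_funZr; apply: eq_pairing => k.
apply: etrans (cosum_ftop (fun a b => f a * pstar p b) k (P_prim Pq) (P_hom Pq)) _.
apply: etrans (f_equal2 _ _ _) (add0r _).
  apply: etrans (pairing_fun0 (ftop (vec k) q)); apply: eq_pairing => h.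
  by rewrite pstar1 mulr0.
rewrite /cosum -(coprod_counitr (fun z => f z * (q == p)%:R) k) [RHS]big_mkcond.
apply: eq_bigr => c _; apply: etrans (pairing_funZ _ _ _) _.
by rewrite pstar_ftop //; case: eqP => _ /=; rewrite ?mulr0.
Qed.

Lemma pairing_star_P f p q : P p -> P q -> f one = 0 ->
  pairing (star f (pstar p)) q = 0.
Proof.
move=> Pp Pq f1; rewrite -(ftop1 (P_mcoeff1 Pq)); apply: etrans (pairing_star_ftop _ _ Pp Pq) _.
by rewrite pairing_vec f1 mul0r.
Qed.

Lemma finite_forest_le n : finite_set [set h : forest A | (forest_size h <= n)%N].
Proof.
apply: (@sub_finite_set _ _ [set` forests_upto A n]); last exact: finite_seq.
by move=> h /= hn; rewrite mem_forests_upto.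
Qed.

Lemma pstar_P p : P p -> pairing (pstar p) p = 1.
Proof.
by move=> Pp; have := pstar_ftop one Pp Pp; rewrite (ftop1 (P_mcoeff1 Pp)) !eqxx.
Qed.

Lemma pstar_dual p s : P p -> Ptop1 P s -> pairing (pstar p) s = (s == p)%:R.
Proof.
move=> Pp; have pp := pstar_P Pp.
case=> [[q Pq|r q Pr Pq]|->].
- by have := pstar_ftop one Pp Pq; rewrite (ftop1 (P_mcoeff1 Pq)) eqxx.
- have e : pairing (pstar p) (ftop r q) = 0.
    rewrite [LHS]pairing_ftopl -(pairing_fun0 r); apply: eq_pairing_in => k.
    rewrite -mcoeff_neq0 => kr; rewrite pstar_ftop //; case: (k =P one) kr => // ->.
    by rewrite Ptop_mcoeff1 ?eqxx.
  case: eqP => [e'|_]; last exact: e.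
  by move: pp; rewrite -{2}e' e => /eqP; rewrite eq_sym oner_eq0.
rewrite pairing_vec pstar1; case: eqP => // e.
by move: pp; rewrite -e pairing_vec pstar1 => /eqP; rewrite eq_sym oner_eq0.
Qed.

(** The dual of r T p is r^* star p^*. The induction carries [g one = 0], by which the new
    functional vanishes on the elements of [P], and a degree bound, from which finite support
    follows. *)
Lemma dual_exists_top r : Ptop P r -> exists2 g : forest A -> R, g one = 0 &
  (exists n, forall h, g h != 0 -> (forest_size h <= n)%N) /\
  forall s, Ptop1 P s -> pairing g s = (s == r)%:R.
Proof.
elim=> {r} [p Pp|r p Pr [g g1 [[n gn] gs]] Pp].
  exists (pstar p); first exact: pstar1.
  split; first by exists (hdeg p) => h /pstar_neq0[_ ->].
  by move=> s; exact: pstar_dual.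
pose g' := star g (pstar p).
have g'1 : g' one = 0 by rewrite /g' /star coprod1 big_seq1 g1 mul0r.
have g'r s q : Ptop1 P s -> P q -> pairing g' (ftop s q) = ((s == r) && (q == p))%:R.
  move=> Ps Pq; apply: etrans (pairing_star_ftop _ _ Pp Pq) _.
  by rewrite gs // -natrM mulnb.
have g'rp : pairing g' (ftop r p) = 1 by rewrite g'r ?eqxx //; left.
exists g' => //; split.
  exists (n + hdeg p)%N => h; apply: contraR; rewrite -ltnNge => hn.
  rewrite /g' /star big_seq big1 // => c /coprod_size ch.
  have [->|/gn c1] := eqVneq (g c.1) 0; first by rewrite mul0r.
  have [->|/pstar_neq0[_ c2]] := eqVneq (pstar p c.2) 0; first by rewrite mulr0.
  by move: hn; rewrite -ch c2 ltnNge leq_add2r c1.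
(* Equality with r T p is detected by the value 1, so injectivity of (r, p) -> r T p is a
   consequence and not an assumption. *)
have neq s : pairing g' s = 0 -> pairing g' s = (s == ftop r p)%:R.
  by case: eqP => // ->; rewrite g'rp.
move=> s [[q Pq|r' q Pr' Pq]|->].
- by apply: neq; exact: pairing_star_P.
- have e := g'r r' q (or_introl Pr') Pq.
  have [/andP[/eqP -> /eqP ->]|ne] := boolP ((r' == r) && (q == p)).
    by rewrite eqxx g'rp.
  by apply: neq; rewrite e (negbTE ne).
by apply: neq; rewrite pairing_vec.
Qed.

Lemma dual_exists r : Ptop1 P r -> exists g, is_top_dual P r g.
Proof.
case=> [/dual_exists_top[g _ [[n gn] gs]]|->].
  exists g; split=> //; apply: sub_finite_set (finite_forest_le n) => h /=.
  exact: gn.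
exists (fdelta R one); split.
  apply: sub_finite_set (finite_forest_le 0) => h /=; rewrite /fdelta.
  by case: (h =P one) => [->|_]; rewrite ?eqxx // forest_size1.
move=> s [Ps|->]; last by rewrite eqxx pairing_vec /fdelta eqxx.
rewrite pairing_delta Ptop_mcoeff1 //; case: eqP => // e.
have := Ptop_mcoeff1 Ps; rewrite e -pairing_delta pairing_vec /fdelta eqxx.
by move/eqP; rewrite oner_eq0.
Qed.

Lemma top_dualP r : Ptop1 P r -> is_top_dual P r (top_dual P r).
Proof. by move=> /dual_exists[g gP]; rewrite /top_dual; exact: xgetPex (ex_intro _ g gP). Qed.

Lemma Ptop1_neq0 r : Ptop1 P r -> r != 0.
Proof.
move=> Pr; apply/eqP => r0; have [_ /(_ _ Pr)] := top_dualP Pr.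
rewrite [X in pairing _ X]r0 eqxx => e; have := etrans (esym (pairing0 _)) e.
by move/eqP; rewrite eq_sym oner_eq0.
Qed.

Lemma Ptop1_hom r : Ptop1 P r -> hom (hdeg r) r.
Proof.
move=> Pr; have r0 := Ptop1_neq0 Pr; suff [n hn] : exists n, hom n r by rewrite (hom_hdeg hn r0).
case: Pr => [/Ptop_hom[n _ hn]|->]; first by exists n.
by exists (forest_size one); exact: hom_vec.
Qed.

(** By [prim_partE], k is pi(k) plus products k' T pi(k''). The values of pi lie in the span of [P],
    and k' is covered by induction on the size. *)
Lemma forest_span k : exists l : seq (R * H),
  (forall z, z \in l -> Ptop1 P z.2 /\ hom (forest_size k) z.2) /\
  forall f, f k = \sum_(z <- l) z.1 * pairing f z.2.
Proof.
elim/forest_ltn_ind: k => k IH; have [->|k1] := eqVneq k one.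
  exists [:: (1, vec one)]; split=> [z|f].
    by rewrite inE => /eqP -> /=; split; [right|exact: hom_vec].
  by rewrite big_seq1 /= mul1r pairing_vec.
have pspan h : exists l : seq (R * H), (forall z, z \in l -> P z.2) /\
    forall f, pairing f (prim_part R h) = \sum_(z <- l) z.1 * pairing f z.2.
  have [_ e1 e2] := pdecP h.
  exists [seq ((pdec h).2 p, p) | p <- (pdec h).1]; split=> [z /mapP[p ph ->] /=|f].
    by have [] := e1 p ph.
  by rewrite big_map e2.
have tspan c : c \in coprod k -> c.2 != one -> exists l : seq (R * H),
    (forall z, z \in l -> Ptop1 P z.2) /\
    forall f, pairing f (ftop (vec c.1) (prim_part R c.2)) =
              \sum_(z <- l) z.1 * pairing f z.2.
  move=> ck c2; have [l1 [h1 e1]] : exists l : seq (R * H),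
      (forall z, z \in l -> Ptop1 P z.2) /\
      forall f, f c.1 = \sum_(z <- l) z.1 * pairing f z.2.
    have [|l [hl e]] := IH c.1; last by exists l; split=> // z /hl[].
    rewrite -(coprod_size ck) -[X in (X < _)%N]addn0 ltn_add2l.
    by rewrite forest_size_gt0.
  have [l2 [h2 e2]] := pspan c.2.
  exists [seq (x.1 * y.1, ftop x.2 y.2) | x <- l1, y <- l2]; split.
    move=> z /allpairsP[[x y] /= [/h1 Px /h2 Py ->]] /=; left.
    case: Px => [Px|->]; first exact: Ptop_step.
    by rewrite (ftop1 (P_mcoeff1 Py)); exact: Ptop_base.
  move=> f; rewrite big_allpairs_dep /=; apply: etrans (pairing_ftop_vec _ _ _) _.
  rewrite e2 exchange_big; apply: eq_bigr => y _ /=.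
  have -> : pairing (tins f c.1) y.2 = pairing f (ftop (vec c.1) y.2).
    by apply: esym; exact: pairing_ftop_vec.
  rewrite (e1 (fun h => pairing f (ftop (vec h) y.2))) mulr_sumr.
  apply: eq_bigr => x _; rewrite mulrCA mulrA; congr (_ * _).
  by apply: esym; exact: pairing_ftopl.
have [l [hl e]] : exists l : seq (R * H), (forall z, z \in l -> Ptop1 P z.2) /\
    forall f, f k = \sum_(z <- l) z.1 * pairing f z.2.
  have [l0 [h0 e0]] := pspan k.
  have [F hF] : exists F : forest A * forest A -> seq (R * H), forall c,
      c \in coprod k -> c.2 != one -> (forall z, z \in F c -> Ptop1 P z.2) /\
      forall f, pairing f (ftop (vec c.1) (prim_part R c.2)) =
              \sum_(z <- F c) z.1 * pairing f z.2.
    have ch c : exists l : seq (R * H), c \in coprod k -> c.2 != one ->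
      (forall z, z \in l -> Ptop1 P z.2) /\
      forall f, pairing f (ftop (vec c.1) (prim_part R c.2)) =
              \sum_(z <- l) z.1 * pairing f z.2.
      have [ck|ck] := boolP (c \in coprod k); last by exists [::].
      have [c2|c2] := boolP (c.2 != one); last by exists [::].
      by have [l hl] := tspan c ck c2; exists l.
    by have [F hF] := choice ch; exists F.
  exists (l0 ++ flatten [seq F c | c <- coprod k & @proper A c]); split.
    move=> z; rewrite mem_cat => /orP[/h0 Pz|]; first by left; exact: Ptop_base.
    move=> /flattenP[_ /mapP[c + ->]]; rewrite mem_filter => /andP[/andP[_ c2] ck].
    by have [h _] := hF c ck c2; exact: h.
  move=> f; rewrite big_cat -e0 big_flatten big_map big_filter.
  apply: etrans (esym (pairing_vec f k)) _.
  rewrite [X in pairing f X](prim_partE R k1).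
  apply: etrans (pairingD _ _ _) _.
  apply: f_equal2 => //; apply: etrans (pairing_rsum _ _ _) _.
  rewrite /rsum big_seq_cond [RHS]big_seq_cond; apply: eq_bigr => c /andP[ck /andP[_ c2]].
  by have [_ ->] := hF c ck c2.
exists [seq z <- l | hdeg z.2 == forest_size k]; split=> [z|f].
  by rewrite mem_filter => /andP[/eqP <- /hl Pz]; split=> //; exact: Ptop1_hom.
(* Passing from [f] to its part in degree |k| removes the terms of other degrees from the
   expansion. *)
pose g h := if forest_size h == forest_size k then f h else 0.
have -> : f k = g k by rewrite /g eqxx.
rewrite e big_filter [RHS]big_mkcond; apply: eq_big_seq => z zl; have hz := Ptop1_hom (hl _ zl).
case: ifP => zk; first by congr (_ * _); apply: eq_pairing_in => h /hz hh; rewrite /g hh zk.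
have -> : pairing g z.2 = 0; last by rewrite mulr0.
rewrite -(pairing_fun0 z.2); apply: eq_pairing_in => h /hz hh.
by rewrite /g hh zk.
Qed.

Lemma dual_ext (f g : forest A -> R) :
  (forall r, Ptop1 P r -> pairing f r = pairing g r) -> f = g.
Proof.
move=> e; apply/funext => k; have [l [hl E]] := forest_span k.
by rewrite !E; apply: eq_big_seq => z /hl[/e ->].
Qed.

Lemma top_dual_pstar p : P p -> top_dual P p = pstar p.
Proof.
move=> Pp; have P1p : Ptop1 P p by left; exact: Ptop_base.
by apply: dual_ext => r Pr; rewrite (pstar_dual Pp Pr) (top_dualP P1p).2.
Qed.

Lemma top_dual_in r k (l : seq (R * H)) :
  (forall z, z \in l -> Ptop1 P z.2 /\ hom (forest_size k) z.2) ->
  (forall f, f k = \sum_(z <- l) z.1 * pairing f z.2) -> Ptop1 P r ->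
  top_dual P r k = \sum_(z <- l) z.1 * (z.2 == r)%:R.
Proof.
move=> hl E Pr; rewrite E; apply: eq_big_seq => z /hl[Pz _].
by rewrite (top_dualP Pr).2.
Qed.

Lemma top_dual_neq0 r k (l : seq (R * H)) :
  (forall z, z \in l -> Ptop1 P z.2 /\ hom (forest_size k) z.2) ->
  (forall f, f k = \sum_(z <- l) z.1 * pairing f z.2) -> Ptop1 P r ->
  top_dual P r k != 0 -> r \in map snd l /\ forest_size k = hdeg r.
Proof.
move=> hl E Pr; rewrite (top_dual_in hl E Pr) => nz.
suff rl : r \in map snd l.
  split=> //; case/mapP: rl => z /hl[_ hz] e; apply/esym/hom_hdeg; last exact: Ptop1_neq0.
  by rewrite e.
apply: contraNT nz => rl; rewrite big_seq big1 // => z zl.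
by case: eqP => [e|_]; [rewrite -e map_f in rl|rewrite mulr0].
Qed.

Lemma top_dual_deg r k : Ptop1 P r -> top_dual P r k != 0 -> forest_size k = hdeg r.
Proof. by move=> Pr nz; have [l [hl E]] := forest_span k; have [] := top_dual_neq0 hl E Pr nz. Qed.

Lemma finite_Ptop1 n : finite_set [set r | Ptop1 P r /\ (hdeg r <= n)%N].
Proof.
have [l hl] := choice forest_span.
apply: (@sub_finite_set _ _ [set` flatten [seq map snd (l k) | k <- forests_upto A n]]);
  last exact: finite_seq.
move=> r [Pr rn] /=.
have [k [kr nz]] : exists k, k \in msupp r /\ top_dual P r k != 0.
  apply: contrapT => nex; have := (top_dualP Pr).2 r Pr; rewrite eqxx => e.
  suff z : pairing (top_dual P r) r = 0 by move/eqP: e; rewrite z eq_sym oner_eq0.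
  apply: etrans (pairing_fun0 r); apply: eq_pairing_in => k kr.
  by apply/eqP/negP => nz; apply: nex; exists k; split=> //; exact/negP.
have [hlk E] := hl k; have [rl kn] := top_dual_neq0 hlk E Pr nz.
apply/flattenP; exists (map snd (l k)) => //.
by apply: map_f; rewrite mem_forests_upto kn.
Qed.

Lemma finite_P n : finite_set [set p | P p /\ (hdeg p <= n)%N].
Proof.
apply: sub_finite_set (finite_Ptop1 n) => p [Pp pn]; split=> //.
by left; exact: Ptop_base.
Qed.

(** The resolution of the identity, the sum of r^* (x) r, in degree |k|. [D] may be any finite part
    of the basis that contains this degree. *)
Lemma top_dual_expand (f : forest A -> R) k (D : set H) : finite_set D ->
  (forall r, D r -> Ptop1 P r) -> (forall r, Ptop1 P r -> hdeg r = forest_size k -> D r) ->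
  \sum_(r <- fset_set D) top_dual P r k * pairing f r = f k.
Proof.
move=> fD DP PD; have [l [hl E]] := forest_span k.
rewrite [RHS]E; under eq_big_seq => r rD.
  rewrite (top_dual_in hl E); last by apply: DP; move: rD; rewrite in_fset_set // inE.
  rewrite mulr_suml; over.
rewrite exchange_big; apply: eq_big_seq => z zl /=; have [Pz hz] := hl z zl.
rewrite (bigD1_seq z.2) ?fset_uniq //=; last first.
  rewrite in_fset_set // inE; apply: PD => //; apply: hom_hdeg hz _.
  exact: Ptop1_neq0.
rewrite eqxx mulr1 big1 ?addr0 // => r; rewrite eq_sym => /negbTE ->.
by rewrite mulr0 mul0r.
Qed.

(** Restricted to primitive elements, the same sum is the projection pi. *)
Lemma prim_part_expand (f : forest A -> R) k (D : set H) : finite_set D ->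
  (forall p, P p -> hdeg p = forest_size k -> D p) -> (forall p, D p -> P p) ->
  \sum_(p <- fset_set D) top_dual P p k * pairing f p = pairing f (prim_part R k).
Proof.
move=> fD PD DP; rewrite (@prim_part_pstar f k (fset_set D)) ?fset_uniq //; last first.
  move=> p pk; have [_ /(_ _ pk)[Pp e] _] := pdecP k.
  by rewrite in_fset_set // inE; exact: PD.
by apply: eq_big_seq => p; rewrite in_fset_set // inE => /DP Pp; rewrite top_dual_pstar.
Qed.

End TopBasis.

(** * Section germs *)

Section StarAlgebra.
Variables (R : realType) (A : finType).
Local Notation one := (fempty A).
Implicit Types (f phi psi : forest A -> R) (h k : forest A).
Local Opaque ftop pairing forest_vec fempty.

Lemma starA f phi psi : star (star f phi) psi = star f (star phi psi).
Proof.
apply/funext => h; rewrite /star.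
under eq_bigr => c _ do rewrite mulr_suml.
under [RHS]eq_bigr => c _ do rewrite mulr_sumr.
rewrite (coprod_coassoc (fun x y z => f x * phi y * psi z)).
by apply: eq_bigr => c _; apply: eq_bigr => d _; rewrite mulrA.
Qed.

Lemma star_counitl phi : star (fdelta R one) phi = phi.
Proof.
apply/funext => h; rewrite -[RHS](coprod_counitl phi) big_mkcond.
by apply: eq_bigr => c _; rewrite /fdelta; case: eqP => _; rewrite ?mul1r ?mul0r.
Qed.

Lemma star_counitr phi : star phi (fdelta R one) = phi.
Proof.
apply/funext => h; rewrite -[RHS](coprod_counitr phi) big_mkcond.
by apply: eq_bigr => c _; rewrite /fdelta; case: eqP => _; rewrite ?mulr1 ?mulr0.
Qed.

Lemma starDl f phi psi : star (fun h => f h + phi h) psi = (fun h => star f psi h + star phi psi h).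
Proof.
apply/funext => h; rewrite /star -big_split; apply: eq_bigr => c _.
exact: mulrDl.
Qed.

Lemma starBl f phi psi : star (fun h => f h - phi h) psi = (fun h => star f psi h - star phi psi h).
Proof.
apply/funext => h; rewrite /star -sumrB; apply: eq_bigr => c _.
exact: mulrBl.
Qed.

Lemma star_one f phi : star f phi one = f one * phi one.
Proof. by rewrite /star coprod1 big_seq1. Qed.

Lemma star_delta0 phi h k : (forest_size k < forest_size h)%N ->
  star phi (fdelta R h) k = 0.
Proof.
move=> kh; rewrite /star big_seq big1 // => c ck; rewrite /fdelta.
case: eqP => [ch|_]; last by rewrite mulr0.
by move: kh; rewrite -(coprod_size ck) ch ltnNge leq_addl.
Qed.

Lemma star_delta_bound phi h k (e : R) : 0 <= e ->
  (forall m, (forest_size m + forest_size h)%N = forest_size k -> `|phi m| <= e) ->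
  `|star phi (fdelta R h) k| <= (size (coprod k))%:R * e.
Proof.
move=> e0 he; apply: le_trans (ler_norm_sum _ _ _) _.
have -> : (size (coprod k))%:R * e = \sum_(c <- coprod k) e.
  by rewrite big_const_seq count_predT iter_addr_0 mulr_natl.
rewrite big_seq [leRHS]big_seq; apply: ler_sum => c ck; rewrite /fdelta.
case: eqP => [ch|_]; last by rewrite mulr0 normr0.
by rewrite mulr1 he // -ch; exact: coprod_size.
Qed.

End StarAlgebra.

Section Germs.
Variables (R : realType) (A : finType) (P : set (forest_alg R A)).
Hypothesis hP : primitive_basis P.
Local Notation H := (forest_alg R A).
Local Notation vec := (@forest_vec R A).
Local Notation one := (fempty A).
Implicit Types (f phi psi : forest A -> R) (p r : H) (h k : forest A).
Local Opaque ftop pairing forest_vec fempty.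

(** The germ at [h] of the integral against X^p after summation over r: phi(. T p) star p^* star h.
    The only dual element left in it is p^*. *)
Definition psi p h phi : forest A -> R :=
  star (star (fun k => pairing phi (ftop (vec k) p)) (top_dual P p)) (fdelta R h).

Lemma psiE p h phi k : psi p h phi k = \sum_(c <- coprod k) \sum_(d <- coprod c.1)
  pairing phi (ftop (vec d.1) p) * top_dual P p d.2 * fdelta R h c.2.
Proof.
by apply: eq_bigr => c _; rewrite -mulr_suml.
Qed.

(** The sum of r^* (x) (r T p) sends k' to k' T p. The bound on the degree of r loses nothing: p^*
    and h fix the degrees of the two other factors of a forest with fewer than [n] nodes. *)
Lemma psi_germ n p h phi (x : H) :
  P p -> (forall k, k \in msupp x -> (forest_size k < n)%N) ->
  \sum_(r \in [set r | Ptop1 P r /\ (hdeg r + hdeg p + forest_size h < n)%N])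
    pairing (star (star (top_dual P r) (top_dual P p)) (fdelta R h)) x
    * pairing phi (ftop r p) = pairing (psi p h phi) x.
Proof.
move=> Pp xn; set D := [set r | _].
have fD : finite_set D.
  apply: sub_finite_set (finite_Ptop1 hP n) => r [Pr rn]; split=> //.
  by apply: ltnW; apply: leq_ltn_trans rn; rewrite -addnA leq_addr.
rewrite fsbig_finite //=.
under eq_bigr => r _ do rewrite -pairing_funZr.
rewrite -pairing_fun_sum; apply: eq_pairing_in => k /xn kn.
rewrite psiE; under eq_bigr => r _ do rewrite /star mulr_suml.
rewrite exchange_big; apply: eq_big_seq => c ck /=.
under eq_bigr => r _ do rewrite mulr_suml mulr_suml.
rewrite exchange_big; apply: eq_big_seq => d dc /=.
have [->|nz] := eqVneq (top_dual P p d.2) 0.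
  by rewrite mulr0 mul0r big1 // => r _; rewrite mulr0 !mul0r.
rewrite /fdelta; case: eqP => [ch|_]; last first.
  by rewrite mulr0 big1 // => r _; rewrite mulr0 mul0r.
have d2 := top_dual_deg hP (or_introl (Ptop_base Pp)) nz.
have sz : (forest_size d.1 + hdeg p + forest_size h < n)%N.
  by rewrite -d2 (coprod_size dc) -ch (coprod_size ck).
rewrite -[X in _ = X * _ * _](@top_dual_expand _ _ _ hP (fun k => pairing phi (ftop (vec k) p)) d.1 D) //.
- rewrite !mulr_suml; apply: eq_bigr => r _; have <- := pairing_ftopl phi r p.
  ring.
- by move=> r [].
- by move=> r Pr e; split=> //; rewrite e.
Qed.

(** Summed over p, the elements p^* and p combine to pi, and the sum of x' T pi(x'') is x unless x =
    1. So exactly the term phi(1) h of phi star h is missing. *)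
Lemma psi_total n h phi (x : H) : phi one = 1 ->
  (forall k, k \in msupp x -> (forest_size k < n)%N) ->
  \sum_(p \in [set p | P p /\ (hdeg p + forest_size h < n)%N]) pairing (psi p h phi) x
  = pairing (star phi (fdelta R h)) x - mcoeff h x.
Proof.
move=> phi1 xn; set D := [set p | _].
have fD : finite_set D.
  apply: sub_finite_set (finite_P hP n) => r [Pr rn]; split=> //.
  by apply: ltnW; apply: leq_ltn_trans rn; rewrite leq_addr.
rewrite fsbig_finite //= -pairing_fun_sum -pairing_delta -pairing_funB.
apply: eq_pairing_in => k /xn kn.
under eq_bigr => p _ do rewrite psiE.
rewrite exchange_big /=.
have -> : fdelta R h k = \sum_(c <- coprod k | c.1 == one) fdelta R h c.2.
  by rewrite coprod_counitl.
rewrite /star [X in _ = _ - X]big_mkcond -sumrB.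
apply: eq_big_seq => c ck /=; rewrite exchange_big /=.
rewrite [in RHS]/fdelta; case: eqP => [ch|ch]; last first.
  rewrite mulr0 if_same subr0 big1 // => d _; rewrite big1 // => p _.
  by rewrite /fdelta; case: eqP => // _; rewrite mulr0.
have -> : \sum_(d <- coprod c.1) \sum_(p <- fset_set D)
      pairing phi (ftop (vec d.1) p) * top_dual P p d.2 * fdelta R h c.2
   = cosum (fun a b => pairing phi (ftop (vec a) (prim_part R b))) c.1.
  apply: eq_big_seq => d dc; apply: etrans _ (esym (pairing_ftop_vec _ _ _)).
  rewrite -(@prim_part_expand _ _ _ hP (tins phi d.1) d.2 D) //.
  - apply: eq_bigr => p _; rewrite /fdelta ch eqxx mulr1 mulrC; congr (_ * _).
    exact: pairing_ftop_vec.
  - move=> p Pp e; split=> //; apply: leq_ltn_trans kn.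
    by rewrite -(coprod_size ck) -(coprod_size dc) ch e -addnA leq_addl.
  - by move=> p [].
rewrite prim_part_cosum mulr1; case: eqP => [->|_]; last by rewrite subr0.
by rewrite phi1 subrr.
Qed.

(** Multiplication by p^* and h from the right is linear and associative, so the cocycle identity is
    inherited from x -> x T p. *)
Lemma psi_star p h phi phi' : P p -> phi' one = 1 ->
  psi p h (star phi phi') = fun k => psi p h phi k + star phi (psi p h phi') k.
Proof.
move=> Pp phi1; rewrite /psi -!starA -!starDl; congr star; congr star.
apply/funext => k.
apply: etrans (cosum_ftop (fun a b => phi a * phi' b) k (P_prim hP Pp) (P_hom hP Pp)) _.
congr (_ + _).
  by apply: eq_pairing => m; rewrite phi1 mulr1.
by apply: eq_bigr => c _; rewrite pairing_funZ.
Qed.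

Lemma psi_B p h phi phi' k : psi p h phi k - psi p h phi' k =
  psi p h (fun m => phi m - phi' m) k.
Proof.
rewrite !psiE -sumrB; apply: eq_bigr => c _; rewrite -sumrB; apply: eq_bigr => d _.
by rewrite pairing_funB !mulrBl.
Qed.

Lemma psi0 p h phi k : P p -> (forest_size k < hdeg p + forest_size h)%N -> psi p h phi k = 0.
Proof.
move=> Pp kn; rewrite psiE big_seq big1 // => c ck; rewrite big_seq big1 // => d dc.
rewrite /fdelta; case: eqP => [ch|_]; last by rewrite mulr0.
have [->|nz] := eqVneq (top_dual P p d.2) 0; first by rewrite mulr0 mul0r.
have d2 := top_dual_deg hP (or_introl (Ptop_base Pp)) nz.
move: kn; rewrite ltnNge -(coprod_size ck) ch -(coprod_size dc) d2.
by rewrite -addnA leq_addl.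
Qed.

(** [psi] evaluates [phi] on a fixed element of degree |k| - |h|; thus it inherits the Hoelder
    exponent that X has on forests of that size. *)
Lemma psi_rep p h k : P p -> exists2 x : H,
  forall m, m \in msupp x -> (forest_size m + forest_size h)%N = forest_size k &
  forall phi, psi p h phi k = pairing phi x.
Proof.
move=> Pp; exists (\sum_(c <- coprod k | c.2 == h) \sum_(d <- coprod c.1)
   top_dual P p d.2 *: ftop (vec d.1) p).
  have [hk|hk] := leqP (forest_size h) (forest_size k); last first.
    rewrite big_seq_cond big_pred0; first by move=> m; rewrite msupp0.
    move=> c; apply/negP => /andP[ck /eqP ch]; move: hk; rewrite -(coprod_size ck) ch.
    by rewrite ltnNge leq_addl.
  suff hx : hom (forest_size k - forest_size h) (\sum_(c <- coprod k | c.2 == h)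
      \sum_(d <- coprod c.1) top_dual P p d.2 *: ftop (vec d.1) p).
    by move=> m /hx ->; rewrite subnK.
  rewrite big_seq_cond; apply: hom_sum => c /andP[ck /eqP ch].
  rewrite big_seq_cond; apply: hom_sum => d /andP[dc _].
  have [->|nz] := eqVneq (top_dual P p d.2) 0.
    by rewrite scale0r => m; rewrite msupp0.
  have d2 := top_dual_deg hP (or_introl (Ptop_base Pp)) nz.
  apply: homZ; rewrite -(coprod_size ck) ch addnK -(coprod_size dc) d2.
  apply: hom_ftop; [exact: hom_vec|exact: (P_hom hP)].
move=> phi; rewrite psiE pairing_sum [RHS]big_mkcond; apply: eq_bigr => c _ /=.
rewrite /fdelta; case: eqP => _; last by rewrite big1 // => d _; rewrite mulr0.
rewrite pairing_sum; apply: eq_bigr => d _.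
by rewrite pairingZ mulr1 mulrC.
Qed.

Local Transparent pairing.

Lemma psi_bound p h k : P p -> exists2 C : R, 0 <= C & forall phi (e : R), 0 <= e ->
  (forall m, (forest_size m + forest_size h)%N = forest_size k -> `|phi m| <= e) ->
  `|psi p h phi k| <= C * e.
Proof.
move=> Pp; have [x hx E] := psi_rep h k Pp.
exists (\sum_(m <- msupp x) `|mcoeff m x|); first exact: sumr_ge0.
move=> phi e e0 he; rewrite E; rewrite /pairing.
apply: le_trans (ler_norm_sum _ _ _) _; rewrite mulr_suml big_seq [leRHS]big_seq.
by apply: ler_sum => m mx; rewrite normrM ler_wpM2l // he //; exact: hx.
Qed.

End Germs.

(** * The sewing lemma *)

Section TimePoints.
Variables (R : realType) (T : {posnum R}).
Local Notation time := (time T).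
Local Notation tv := (@time_val R T).
Implicit Types (s t u v : time) (l : seq time).

Lemma time_val_inj : injective tv.
Proof. by move=> s t; exact: val_inj. Qed.

Lemma time_ge0 t : 0 <= tv t.
Proof. by have := set_mem (valP t); rewrite /= in_itv /= => /andP[]. Qed.

Lemma time_leT t : tv t <= T%:num.
Proof. by have := set_mem (valP t); rewrite /= in_itv /= => /andP[]. Qed.

Lemma mktime_subproof (x : R) (H : 0 <= x <= T%:num) : x \in `[0, T%:num]%classic.
Proof. by rewrite inE /= in_itv. Qed.

(* The point of [0, T] with value x, and the junk value 0 if there is none. *)
Definition mktime (x : R) : time :=
  match @idP (0 <= x <= T%:num) with
  | ReflectT H => exist _ x (mktime_subproof H)
  | ReflectF _ => time0 T
  end.

Lemma mktimeE x : 0 <= x <= T%:num -> tv (mktime x) = x.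
Proof. by rewrite /mktime; case: {-}_ / idP. Qed.

Lemma mktimeK t : mktime (tv t) = t.
Proof. by apply: time_val_inj; rewrite mktimeE // time_ge0 time_leT. Qed.

End TimePoints.

Section PowR.
Variable R : realType.
Implicit Types x y a b c d L q : R.

Lemma powRDge0 x a b : 0 <= x -> 0 <= a -> 0 <= b -> x `^ (a + b) = x `^ a * x `^ b.
Proof.
move=> x0 a0 b0; have [->|a1] := eqVneq a 0; first by rewrite add0r powRr0 mul1r.
rewrite powRD //; apply/implyP; rewrite paddr_eq0 // => /andP[/eqP e].
by rewrite e eqxx in a1.
Qed.

Lemma powR_ge1 L q : 1 <= L -> 0 <= q -> 1 <= L `^ q.
Proof. by move=> L1 q0; have := ler_powR L1 q0; rewrite powRr0. Qed.

Lemma le_powR x y a : 0 <= a -> 0 <= x -> x <= y -> x `^ a <= y `^ a.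
Proof.
by move=> a0 x0 xy; apply: ge0_ler_powR; rewrite ?nnegrE //; exact: le_trans xy.
Qed.

Lemma powR_weaken L q a b x : 1 <= L -> 0 <= x <= L -> 0 <= b <= a -> a <= q ->
  x `^ a <= L `^ q * x `^ b.
Proof.
move=> L1 /andP[x0 xL] /andP[b0 ba] aq.
have -> : x `^ a = x `^ (a - b) * x `^ b by rewrite -powRDge0 ?subr_ge0 // subrK.
rewrite ler_wpM2r ?powR_ge0 //.
apply: (@le_trans _ _ (L `^ (a - b))); first by rewrite le_powR ?subr_ge0.
by apply: ler_powR => //; apply: le_trans aq; rewrite gerBl.
Qed.

Lemma powRS x a : 0 <= x -> 0 <= a -> x `^ (1 + a) = x * x `^ a.
Proof. by move=> x0 a0; rewrite powRDge0 // powRr1. Qed.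

End PowR.

Section Partitions.
Variables (R : realType) (T : {posnum R}).
Local Notation time := (time T).
Local Notation tv := (@time_val R T).
Implicit Types (s t u v : time) (l : seq time) (Xi : time -> time -> R) (d : R).

Local Notation ltT := (fun u v : time => tv u < tv v).

Lemma psum_cons Xi s u l :
  partition_sum Xi s (u :: l) = Xi s u + partition_sum Xi u l.
Proof. by rewrite /partition_sum /= big_cons. Qed.

Lemma psum_nil Xi s : partition_sum Xi s [::] = 0.
Proof. by rewrite /partition_sum big_nil. Qed.

Lemma psum_cat Xi s l1 l2 : partition_sum Xi s (l1 ++ l2) =
  partition_sum Xi s l1 + partition_sum Xi (last s l1) l2.
Proof.
elim: l1 s => [|u l1 IH] s /=; first by rewrite psum_nil add0r.
by rewrite !psum_cons IH addrA.
Qed.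

Lemma psumB Xi Xi' s l : partition_sum (fun u v => Xi u v - Xi' u v) s l =
  partition_sum Xi s l - partition_sum Xi' s l.
Proof. by rewrite /partition_sum sumrB. Qed.

Lemma mesh_cons s u l : mesh s (u :: l) = Num.max (tv u - tv s) (mesh u l).
Proof. by rewrite /mesh /= big_cons. Qed.

Lemma mesh_cat d s l1 l2 : mesh s l1 < d -> mesh (last s l1) l2 < d ->
  mesh s (l1 ++ l2) < d.
Proof.
elim: l1 s => [|u l1 IH] s //=; rewrite !mesh_cons !gt_max => /andP[-> /IH]; exact.
Qed.

Lemma path_lt_last s l : path ltT s l -> tv s <= tv (last s l).
Proof.
by elim: l s => [|u l IH] s //= /andP[su /IH]; apply: le_trans; exact: ltW.
Qed.

Lemma path_le_all s l u : path ltT s l -> u \in s :: l ->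
  tv s <= tv u <= tv (last s l).
Proof.
elim: l s => [|v l IH] s /=; first by rewrite inE => _ /eqP ->; rewrite !lexx.
move=> /andP[sv vl]; rewrite inE => /orP[/eqP ->|/(IH _ vl)].
  by rewrite lexx (le_trans (ltW sv)) //; exact: path_lt_last.
by move=> /andP[vu ->]; rewrite andbT (le_trans (ltW sv)).
Qed.

Lemma partition_nil s l : is_partition s s l -> l = [::].
Proof.
case: l => // u l /andP[/= /andP[su /path_lt_last ul] /eqP e].
by rewrite e leNgt su in ul.
Qed.

(* The error of a partition is bounded by splitting it at the interval that
   contains the midpoint: both remaining parts are at most half as long. *)
Definition sew_const (theta : R) : R := 2 / (1 - 2 `^ (1 - theta)).

Lemma powR2_lt1 theta : 1 < theta -> (2 : R) `^ (1 - theta) < 1.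
Proof.
move=> th; rewrite /powR pnatr_eq0 /= -[ltRHS]expR0 ltr_expR.
by rewrite nmulr_rlt0 ?subr_lt0 // ln_gt0 // ltr1n.
Qed.

Lemma sew_const_gt0 theta : 1 < theta -> 0 < sew_const theta.
Proof. by move=> th; rewrite divr_gt0 // subr_gt0 powR2_lt1. Qed.

Lemma sew_partition Xi theta e s t l : 1 < theta -> 0 <= e ->
  (forall u v w, tv s <= tv u -> tv u <= tv v -> tv v <= tv w -> tv w <= tv t ->
     `|Xi u w - Xi u v - Xi v w| <= e * (tv w - tv u) `^ theta) ->
  is_partition s t l ->
  `|partition_sum Xi s l - Xi s t| <= sew_const theta * e * (tv t - tv s) `^ theta.
Proof.
move=> th e0; have K0 := sew_const_gt0 th.
have [n] := ubnP (size l); elim: n s t l => // n IH s t l ln hXi pl.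
(* The bound at u = v = w forces the germ to vanish on the diagonal, as 0 to the power theta is
   0. *)
have xi0 u : tv s <= tv u -> tv u <= tv t -> Xi u u = 0.
  move=> su ut; have := hXi u u u su (lexx _) (lexx _) ut.
  rewrite !subrr powR0 ?mulr0; last by rewrite gt_eqF // (lt_trans ltr01).
  by rewrite sub0r normrN normr_le0 => /eqP.
have [st|st] := eqVneq s t.
  subst t; rewrite (partition_nil pl) psum_nil xi0 ?lexx // subrr normr0.
  by rewrite mulr_ge0 ?powR_ge0 // mulr_ge0 // ltW.
have [hp hl] := andP pl; have st' : tv s < tv t.
  rewrite lt_neqAle -(eqP hl) path_lt_last // andbT (eqP hl).
  by apply: contra_neq st => /time_val_inj.
pose m := (tv s + tv t) / 2.
have tm : m < tv t by rewrite /m; lra.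
have hasm : has (fun u => m < tv u) l.
  apply/hasP; exists t => //; rewrite -(eqP hl).
  by case: (l) hl st => [|x l' _ _]; [move=> /= /eqP ->; rewrite eqxx|rewrite /= mem_last].
case/split_find: hasm pl ln hp hl => v l1 l2 mv nm pl ln hp hl.
set u := last s l1; rewrite -cats1 -catA /= in ln pl hp hl *.
rewrite size_cat /= addnS in ln.
move: hp; rewrite cat_path /= -/u => /and3P[p1 uv p2].
have um : tv u <= m.
  rewrite /u; case/lastP: (l1) nm => [_|l1' x]; first by rewrite /m /=; lra.
  by rewrite last_rcons has_rcons => /norP[]; rewrite -leNgt.
rewrite last_cat /= in hl.
have su : tv s <= tv u by exact: path_lt_last.
have vt : tv v <= tv t by rewrite -(eqP hl); exact: path_lt_last.
have h1 : `|partition_sum Xi s l1 - Xi s u| <= sew_const theta * e * (tv u - tv s) `^ theta.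
  apply: IH => //.
  - by rewrite ltnS in ln; apply: leq_ltn_trans (leq_addr _ _) ln.
  - move=> a b c sa ab bc cu; apply: hXi => //; apply: le_trans cu _.
    by apply: le_trans (ltW uv) vt.
  - by rewrite /is_partition p1 eqxx.
have h2 : `|partition_sum Xi v l2 - Xi v t| <= sew_const theta * e * (tv t - tv v) `^ theta.
  apply: IH => //.
  - by rewrite ltnS in ln; apply: leq_ltn_trans (leq_addl _ _) ln.
  - move=> a b c va ab bc ct; apply: hXi => //; apply: le_trans va.
    by apply: le_trans su (ltW uv).
  - by rewrite /is_partition p2 hl.
have d1 : `|Xi s t - Xi s u - Xi u t| <= e * (tv t - tv s) `^ theta.
  by apply: hXi; rewrite ?lexx // (le_trans (ltW uv)).
have d2 : `|Xi u t - Xi u v - Xi v t| <= e * (tv t - tv s) `^ theta.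
  apply: le_trans (hXi u v t su (ltW uv) vt (lexx _)) _; apply: ler_wpM2l => //.
  apply: le_powR; first by rewrite (le_trans ler01) // ltW.
    by rewrite subr_ge0 (le_trans (ltW uv)).
  by rewrite lerD2l lerN2.
rewrite psum_cat psum_cons -/u.
have half x : 0 <= x -> x <= (tv t - tv s) / 2 ->
    x `^ theta <= 2 `^ (- theta) * (tv t - tv s) `^ theta.
  move=> x0 xh; have th0 : 0 <= theta by rewrite (le_trans ler01) // ltW.
  apply: le_trans (le_powR th0 x0 xh) _.
  rewrite powRM ?invr_ge0 ?ler0n ?subr_ge0 ?(ltW st') //.
  by rewrite -powR_inv1 ?ler0n // -powRrM mulN1r mulrC.
have b1 := half _ (_ : 0 <= tv u - tv s) (_ : tv u - tv s <= (tv t - tv s) / 2).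
have b2 := half _ (_ : 0 <= tv t - tv v) (_ : tv t - tv v <= (tv t - tv s) / 2).
set W := (tv t - tv s) `^ theta in d1 d2 b1 b2 *.
have {}b1 : (tv u - tv s) `^ theta <= 2 `^ (- theta) * W.
  by apply: b1; move: um; rewrite /m; lra.
have {}b2 : (tv t - tv v) `^ theta <= 2 `^ (- theta) * W.
  by apply: b2; move: mv; rewrite /m; lra.
have W0 : 0 <= W by exact: powR_ge0.
(* The constant solves K = 2^(1-theta) K + 2: the first term comes from the two parts of at most
   half length, the second from the defects [d1] and [d2]. *)
have -> : sew_const theta * e * W = 2 * (sew_const theta * e * (2 `^ (- theta) * W)) + 2 * (e * W).
  have nz : 1 - 2 `^ (1 - theta) != 0 by rewrite gt_eqF // subr_gt0 powR2_lt1.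
  have -> : 2 * (sew_const theta * e * (2 `^ (- theta) * W)) =
     2 `^ (1 - theta) * (sew_const theta * e * W).
    rewrite powRD; last by rewrite pnatr_eq0 implybT.
    by rewrite powRr1 ?ler0n //; ring.
  by rewrite /sew_const; field.
have {}h1 := le_trans h1 (ler_wpM2l (mulr_ge0 (ltW K0) e0) b1).
have {}h2 := le_trans h2 (ler_wpM2l (mulr_ge0 (ltW K0) e0) b2).
set B := sew_const theta * e * _ in h1 h2 *.
move: h1 h2 d1 d2; rewrite !ler_norml.
set p1' := partition_sum Xi s l1; set p2' := partition_sum Xi v l2.
move=> /andP[? ?] /andP[? ?] /andP[? ?] /andP[? ?].
apply/andP; split; lra.
Qed.

Lemma psum_powR theta d s t l : 1 < theta -> is_partition s t l -> mesh s l < d ->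
  partition_sum (fun u v => (tv v - tv u) `^ theta) s l <=
  d `^ (theta - 1) * (tv t - tv s).
Proof.
move=> th /andP[+ /eqP <-]; elim: l s => [|u l IH] s /=.
  by rewrite psum_nil subrr mulr0.
move=> /andP[su pl]; rewrite mesh_cons gt_max => /andP[sd /(IH _ pl) h].
rewrite psum_cons.
have -> : (tv u - tv s) `^ theta = (tv u - tv s) `^ (theta - 1) * (tv u - tv s).
  by rewrite mulrC -powRS ?subr_ge0 ?ltW //; congr (_ `^ _); ring.
have : (tv u - tv s) `^ (theta - 1) * (tv u - tv s) <= d `^ (theta - 1) * (tv u - tv s).
  rewrite ler_wpM2r ?subr_ge0 ?(ltW su) // le_powR ?subr_ge0 ?(ltW su) ?(ltW th) //.
  exact: ltW.
rewrite !mulrBr in h *; lra.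
Qed.

Lemma sew_refine Xi theta e s t l l' : 1 < theta -> 0 <= e ->
  (forall u v w, tv s <= tv u -> tv u <= tv v -> tv v <= tv w -> tv w <= tv t ->
     `|Xi u w - Xi u v - Xi v w| <= e * (tv w - tv u) `^ theta) ->
  is_partition s t l -> is_partition s t l' -> {subset l <= l'} ->
  `|partition_sum Xi s l' - partition_sum Xi s l| <=
  sew_const theta * e * partition_sum (fun u v => (tv v - tv u) `^ theta) s l.
Proof.
move=> th e0; elim: l s l' => [|u l IH] s l' hXi.
  move=> /andP[_ /= /eqP e1]; rewrite -e1 => /partition_nil -> _.
  by rewrite !psum_nil subrr normr0 mulr0.
move=> /andP[/= /andP[su pl] hl] /andP[pl' hl'] sub.
have ul' := sub u (mem_head _ _).
(* Cut [l'] at the first point [u] of [l]: the initial segment is a partition of [s, u], to which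
   [sew_partition] applies. *)
case/splitPr: ul' hl' pl' sub => l1 l2; rewrite last_cat cat_path /= => hl' /and3P[p1 lu p2] sub.
have ut : tv u <= tv t by rewrite -(eqP hl); exact: path_lt_last.
have sub' : {subset l <= l2}.
  move=> x xl; have := sub x; rewrite inE xl orbT => /(_ isT).
  have ux : tv u < tv x.
    move: pl; clear -xl => pl; elim: l u pl xl => // v l IH u /= /andP[uv vl].
    by rewrite inE => /orP[/eqP -> //|/(IH _ vl)]; exact: lt_trans.
  rewrite mem_cat inE => /or3P[x1|/eqP e1|//]; last by rewrite e1 ltxx in ux.
  have x1' : x \in s :: l1 by rewrite inE x1 orbT.
  have /andP[_ xle] := path_le_all p1 x1'; have xu := le_lt_trans xle lu.
  by have := lt_trans ux xu; rewrite ltxx.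
have h1 : `|partition_sum Xi u l2 - partition_sum Xi u l| <=
    sew_const theta * e * partition_sum (fun u v => (tv v - tv u) `^ theta) u l.
  apply: IH => //.
  - by move=> a b c ua ab bc ct; apply: hXi => //; exact: le_trans (ltW su) ua.
  - by rewrite /is_partition pl.
  - by rewrite /is_partition p2.
have h2 : `|partition_sum Xi s (rcons l1 u) - Xi s u| <=
    sew_const theta * e * (tv u - tv s) `^ theta.
  apply: sew_partition => //.
    by move=> a b c sa ab bc cu; apply: hXi => //; exact: le_trans cu ut.
  by rewrite /is_partition rcons_path p1 lu last_rcons eqxx.
rewrite psum_cons [leRHS](_ : _ = sew_const theta * e * (tv u - tv s) `^ theta +
  sew_const theta * e * partition_sum (fun u v => (tv v - tv u) `^ theta) u l).
  move: h2; rewrite -cats1 !psum_cat !psum_cons psum_nil addr0.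
  move: h1; rewrite !ler_norml => /andP[? ?] /andP[? ?]; apply/andP; split; lra.
by rewrite psum_cons mulrDr.
Qed.

Lemma common_refinement s t l l' : is_partition s t l -> is_partition s t l' ->
  exists l'', [/\ is_partition s t l'', {subset l <= l''} & {subset l' <= l''}].
Proof.
have [->|st] := eqVneq s t.
  by move=> /partition_nil -> /partition_nil ->; exists [::]; rewrite /is_partition /= eqxx.
move=> pl pl'; pose leT := relpre tv (<=%O : rel R).
have leTtot : total leT by move=> a b; exact: le_total.
have leTtr : transitive leT by move=> a b c; exact: le_trans.
pose m := sort leT (undup (l ++ l')).
have mE x : x \in m = (x \in l) || (x \in l') by rewrite mem_sort mem_undup mem_cat.
have bnd x : x \in m -> tv s < tv x <= tv t.
  have gen k : is_partition s t k -> x \in k -> tv s < tv x <= tv t.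
    move=> /andP[pk /eqP <-] xk; have xk' : x \in s :: k by rewrite inE xk orbT.
    have /andP[_ ->] := path_le_all pk xk'.
    rewrite andbT; clear xk'; case: k pk xk => // y k /= /andP[sy yk].
    by move=> /(path_le_all yk)/andP[yx _]; exact: lt_le_trans sy yx.
  by rewrite mE => /orP[/(gen _ pl)|/(gen _ pl')].
have sm : sorted ltT m.
  have : sorted <%O (map tv m).
    rewrite lt_sorted_uniq_le map_inj_uniq; last exact: time_val_inj.
    by rewrite sort_uniq undup_uniq /= sorted_map; exact: sort_sorted.
  by rewrite sorted_map.
have tm : t \in m.
  rewrite mE; case/andP: pl => _ /eqP; case: (l) => [|y k] /=.
    by move=> e; rewrite e eqxx in st.
  by move=> <-; rewrite mem_last.
exists m; split; last 2 first.
- by move=> x xl; rewrite mE xl.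
- by move=> x xl; rewrite mE xl orbT.
have pm : path ltT s m.
  move: sm bnd; case: (m) => // y k /= -> /(_ y); rewrite mem_head => /(_ isT).
  by move=> /andP[->].
rewrite /is_partition pm /=; apply/eqP/time_val_inj/le_anti.
have tm' : t \in s :: m by rewrite inE tm orbT.
have /andP[_ ->] := path_le_all pm tm'; rewrite andbT.
have lm : last s m \in m by case: (m) tm => // y k _; rewrite /= mem_last.
by have /andP[] := bnd _ lm.
Qed.

End Partitions.

Section Sewing.
Variables (R : realType) (T : {posnum R}).
Local Notation time := (time T).
Local Notation tv := (@time_val R T).
Implicit Types (s t u v : time) (l : seq time) (Xi : time -> time -> R) (d e : R).
Local Notation ltT := (fun u v : time => tv u < tv v).
Local Notation dist s t := `|tv t - tv s|.

Lemma distC s t : dist s t = dist t s. Proof. exact: distrC. Qed.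
Lemma dist_leT s t : dist s t <= T%:num.
Proof.
rewrite ler_norml; have := time_ge0 s; have := time_leT s.
have := time_ge0 t; have := time_leT t; lra.
Qed.

Definition unif_part s t n : seq time :=
  [seq mktime T (tv s + (tv t - tv s) * i%:R / n%:R) | i <- iota 1 n].

Lemma unif_point s t n i : tv s <= tv t -> (i <= n)%N -> (0 < n)%N ->
  tv (mktime T (tv s + (tv t - tv s) * i%:R / n%:R)) = tv s + (tv t - tv s) * i%:R / n%:R.
Proof.
move=> st ni n0; apply: mktimeE.
have n0' : 0 < n%:R :> R by rewrite ltr0n.
have q0 : 0 <= i%:R / n%:R :> R by rewrite divr_ge0.
have q1 : i%:R / n%:R <= 1 :> R by rewrite ler_pdivrMr // mul1r ler_nat.
rewrite -mulrA; have := time_ge0 s; have := time_leT t; nra.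
Qed.

Lemma unif_partP s t n d : tv s < tv t -> (tv t - tv s) / n.+1%:R < d ->
  is_partition s t (unif_part s t n.+1) /\ mesh s (unif_part s t n.+1) < d.
Proof.
move=> st hd; set p := fun i => mktime T (tv s + (tv t - tv s) * i%:R / n.+1%:R).
have n0 : 0 < n.+1%:R :> R by rewrite ltr0n.
have d0 : 0 < d by apply: le_lt_trans hd; rewrite divr_ge0 ?subr_ge0 ?ltW.
have pE i : (i <= n.+1)%N -> tv (p i) = tv s + (tv t - tv s) * i%:R / n.+1%:R.
  by move=> ni; apply: unif_point => //; exact: ltW.
have p0 : p 0%N = s by rewrite /p mulr0 mul0r addr0 mktimeK.
have step i : (i < n.+1)%N -> tv (p i.+1) - tv (p i) = (tv t - tv s) / n.+1%:R.
  move=> ni; rewrite (pE _ ni) (pE _ (ltnW ni)).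
  have -> : i.+1%:R = i%:R + 1 :> R by rewrite -addn1 natrD.
  by rewrite mulrDr mulr1 mulrDl; ring.
have main k m : (k + m <= n.+1)%N ->
    [/\ path ltT (p k) [seq p i | i <- iota k.+1 m],
     last (p k) [seq p i | i <- iota k.+1 m] = p (k + m)%N
     & mesh (p k) [seq p i | i <- iota k.+1 m] < d].
  elim: m k => [|m IH] k; first by rewrite addn0 => _; split=> //; rewrite /mesh big_nil.
  rewrite addnS -addSn => km; have [h1 h2 h3] := IH k.+1 km.
  have kn : (k < n.+1)%N by apply: leq_trans km; rewrite addSn ltnS leq_addr.
  split=> /=.
  - by rewrite h1 andbT -subr_gt0 step // divr_gt0 // subr_gt0.
  - by rewrite h2.
  - by rewrite mesh_cons gt_max h3 andbT step.
have [h1 h2 h3] := main 0%N n.+1 (leqnn _); rewrite p0 in h1 h2 h3.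
split=> //; rewrite /is_partition; apply/andP; split=> //.
rewrite (_ : unif_part _ _ _ = [seq p i | i <- iota 1 n.+1]) // h2; apply/eqP/time_val_inj.
by rewrite add0n (pE _ (leqnn _)) mulfK ?gt_eqF // subrKC.
Qed.

Lemma partition_exists s t d : tv s <= tv t -> 0 < d ->
  exists l, is_partition s t l /\ mesh s l < d.
Proof.
move=> st d0; have [e|ne] := eqVneq s t.
  by exists [::]; rewrite /is_partition e /= eqxx /mesh big_nil.
have st' : tv s < tv t.
  by rewrite lt_neqAle st andbT; apply: contra_neq ne => /time_val_inj.
pose n := Num.truncn ((tv t - tv s) / d).
exists (unif_part s t n.+1); apply: unif_partP => //.
rewrite ltr_pdivrMr ?ltr0n // mulrC -ltr_pdivrMr //.
by rewrite truncnS_gt.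
Qed.

Lemma mesh_to0_proper s t : tv s <= tv t -> ProperFilter (mesh_to0 s t).
Proof.
move=> st; apply: filter_from_proper; last first.
  by move=> d d0; have [l hl] := partition_exists st d0; exists l.
apply: filter_from_filter; first by exists 1; rewrite /= ltr01.
move=> d1 d2 /= d10 d20; exists (Num.min d1 d2); first by rewrite lt_min d10.
by move=> l [pl]; rewrite lt_min => /andP[l1 l2]; split.
Qed.

Lemma has_integral_unique Xi s t (I1 I2 : R) : tv s <= tv t ->
  has_integral Xi s t I1 -> has_integral Xi s t I2 -> I1 = I2.
Proof.
move=> st h1 h2; have ? := mesh_to0_proper st.
exact: (cvg_unique (@Rhausdorff R) h1 h2).
Qed.

Lemma has_integral_lin (c : R) Xi1 Xi2 s t (I1 I2 : R) : tv s <= tv t ->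
  has_integral Xi1 s t I1 -> has_integral Xi2 s t I2 ->
  has_integral (fun u v => c * Xi1 u v + Xi2 u v) s t (c * I1 + I2).
Proof.
move=> st h1 h2; have ? := mesh_to0_proper st; rewrite /has_integral.
rewrite (_ : partition_sum _ s = (fun l => c * partition_sum Xi1 s l + partition_sum Xi2 s l)).
  by apply: cvgD => //; apply: cvgM => //; exact: cvg_cst.
apply/funext => l; rewrite /partition_sum mulr_sumr -big_split.
by apply: eq_bigr => uv _.
Qed.

Lemma has_integralB Xi1 Xi2 s t (I1 I2 : R) : tv s <= tv t ->
  has_integral Xi1 s t I1 -> has_integral Xi2 s t I2 ->
  has_integral (fun u v => Xi1 u v - Xi2 u v) s t (I1 - I2).
Proof.
move=> st h1 h2; have := @has_integral_lin (-1) _ _ _ _ _ _ st h2 h1.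
rewrite mulN1r addrC (_ : (fun u v => -1 * _ + _) = (fun u v => Xi1 u v - Xi2 u v)) //.
by apply/funext => u; apply/funext => v; rewrite mulN1r addrC.
Qed.

Lemma has_integral0 s t : tv s <= tv t -> has_integral (fun _ _ => 0) s t 0.
Proof.
move=> st; have ? := mesh_to0_proper st; rewrite /has_integral.
rewrite (_ : partition_sum _ s = cst 0); first exact: cvg_cst.
by apply/funext => l; rewrite /partition_sum big1.
Qed.

Lemma has_integral_diag Xi s I : has_integral Xi s s I -> I = 0.
Proof.
move=> h; apply: (has_integral_unique (lexx _) h).
have ? := mesh_to0_proper (lexx (tv s)).
rewrite /has_integral; apply: cvg_near_cst; exists 1 => /=; first exact: ltr01.
by move=> l [/partition_nil -> _]; rewrite psum_nil.
Qed.

Lemma has_integralP Xi s t I : tv s <= tv t -> has_integral Xi s t I <->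
  forall e, 0 < e -> exists2 d, 0 < d &
    forall l, is_partition s t l -> mesh s l < d -> `|partition_sum Xi s l - I| < e.
Proof.
move=> st; have ? := mesh_to0_proper st; split=> [h e e0|h].
  move/cvgrPdist_lt: h => /(_ e e0) [d /= d0 hd]; exists d => // l pl ml.
  by rewrite distrC; apply: hd.
apply/cvgrPdist_lt => e /h[d d0 hd]; exists d => // l /= [pl ml].
by rewrite distrC; exact: hd.
Qed.

Lemma psum_bound Xi Y s t l : is_partition s t l ->
  (forall u v, tv s <= tv u -> tv u < tv v -> tv v <= tv t -> `|Xi u v| <= Y u v) ->
  `|partition_sum Xi s l| <= partition_sum Y s l.
Proof.
case/andP; elim: l s => [|u l IH] s /=; first by rewrite !psum_nil normr0.
move=> /andP[su pl] hl h; rewrite !psum_cons.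
have ut : tv u <= tv t by rewrite -(eqP hl); exact: path_lt_last.
apply: le_trans (ler_normD _ _) _; apply: lerD; first exact: h.
by apply: IH => // a b ua ab bt; apply: h => //; exact: le_trans (ltW su) ua.
Qed.

Lemma psum_telescope (J : time -> R) s l :
  partition_sum (fun u v => J v - J u) s l = J (last s l) - J s.
Proof.
elim: l s => [|u l IH] s /=; first by rewrite psum_nil subrr.
by rewrite psum_cons IH addrC subrKA.
Qed.

Lemma psumZ (c : R) Xi s l :
  partition_sum (fun u v => c * Xi u v) s l = c * partition_sum Xi s l.
Proof. by rewrite /partition_sum mulr_sumr. Qed.

Lemma small_powR (a C e : R) : 0 < a -> 0 <= C -> 0 < e ->
  exists2 d, 0 < d & C * d `^ a < e.
Proof.
move=> a0 C0 e0; have C1 : 0 < C + 1 by rewrite ltr_wpDl.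
exists ((e / (C + 1)) `^ a^-1); first by rewrite powR_gt0 // divr_gt0.
rewrite -powRrM mulVf ?gt_eqF // powRr1 ?ltW ?divr_gt0 // mulrA ltr_pdivrMr //.
by rewrite mulrC ltr_pM2l // ltrDl.
Qed.

Lemma has_integral_of_bound Xi (J : time -> R) C theta s t : 1 < theta -> 0 <= C ->
  tv s <= tv t ->
  (forall u v, tv s <= tv u -> tv u <= tv v -> tv v <= tv t ->
    `|J v - J u - Xi u v| <= C * (tv v - tv u) `^ theta) ->
  has_integral Xi s t (J t - J s).
Proof.
move=> th C0 st hJ; apply/has_integralP => // e e0.
have th1 : 0 < theta - 1 by rewrite subr_gt0.
have CT : 0 <= C * (tv t - tv s) by rewrite mulr_ge0 // subr_ge0.
have [d d0 hd] := small_powR th1 CT e0; exists d => // l pl ml.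
apply: le_lt_trans hd; case/andP: (pl) => _ /eqP el.
have -> : partition_sum Xi s l - (J t - J s) =
    - partition_sum (fun u v => (J v - J u) - Xi u v) s l.
  by rewrite (psumB (fun u v => J v - J u) Xi) psum_telescope el [RHS]opprB.
rewrite normrN; apply: le_trans (psum_bound (Y := fun u v => C * (tv v - tv u) `^ theta) pl _) _.
  by move=> u v su uv vt; apply: hJ => //; exact: ltW.
by rewrite psumZ -mulrA ler_wpM2l // mulrC; exact: psum_powR.
Qed.

(** The triples are not ordered, since remainders are also estimated for t < s; the length of the
    detour through v replaces |w - u|. The window [a, b] allows sewing inside a single grid cell. *)
Definition sew_bounded (a b : R) theta e Xi := forall u v w,
  a <= tv u <= b -> a <= tv v <= b -> a <= tv w <= b ->
  `|Xi u w - Xi u v - Xi v w| <= e * (dist u v + dist v w) `^ theta.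

Lemma sew_mono a b theta e Xi u v w : sew_bounded a b theta e Xi ->
  a <= tv u -> tv u <= tv v -> tv v <= tv w -> tv w <= b ->
  `|Xi u w - Xi u v - Xi v w| <= e * (tv w - tv u) `^ theta.
Proof.
move=> hXi au uv vw wb.
have := hXi u v w; rewrite au wb (le_trans au uv) (le_trans vw wb).
rewrite (le_trans uv (le_trans vw wb)) (le_trans au (le_trans uv vw)).
have <- : dist u v + dist v w = tv w - tv u by rewrite !ger0_norm ?subr_ge0 //; ring.
exact.
Qed.

Lemma sewing_exists theta e Xi : 1 < theta -> 0 <= e ->
  sew_bounded 0 T%:num theta e Xi ->
  exists I : time -> R, forall t, has_integral Xi (time0 T) t (I t).
Proof.
move=> th e0 hXi; suff h t : exists I, has_integral Xi (time0 T) t I.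
  by have [I hI] := choice h; exists I.
have t0 := time_ge0 t; have pF := mesh_to0_proper (t0 : tv (time0 T) <= tv t).
suff : cvg (partition_sum Xi (time0 T) @ mesh_to0 (time0 T) t) by exists (lim (partition_sum Xi (time0 T) @ mesh_to0 (time0 T) t)).
apply: cauchy_cvg; apply: cauchy_exP => eta eta0.
have th1 : 0 < theta - 1 by rewrite subr_gt0.
have K0 := sew_const_gt0 th.
have KT : 0 <= 2 * (sew_const theta * e * (tv t - tv (time0 T))).
  by rewrite mulr_ge0 // mulr_ge0 ?subr_ge0 // mulr_ge0 // ltW.
have [d d0 hd] := small_powR th1 KT eta0.
have [l0 [p0 m0]] := partition_exists (t0 : tv (time0 T) <= tv t) d0.
exists (partition_sum Xi (time0 T) l0); exists d => // l [pl ml].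
rewrite /ball /= ; apply: le_lt_trans hd.
(* Two fine partitions are compared through a common refinement, which gives the Cauchy property. *)
have [l1 [p1 s0 s1]] := common_refinement p0 pl.
have mono u v w : tv (time0 T) <= tv u -> tv u <= tv v -> tv v <= tv w -> tv w <= tv t ->
    `|Xi u w - Xi u v - Xi v w| <= e * (tv w - tv u) `^ theta.
  by move=> ? ? ? wt; apply: sew_mono hXi _ _ _ _ => //; exact: le_trans wt (time_leT t).
have r0 := sew_refine th e0 mono p0 p1 s0.
have r1 := sew_refine th e0 mono pl p1 s1.
have b0 := psum_powR th p0 m0; have b1 := psum_powR th pl ml.
have {}r0 := le_trans r0 (ler_wpM2l (mulr_ge0 (ltW K0) e0) b0).
have {}r1 := le_trans r1 (ler_wpM2l (mulr_ge0 (ltW K0) e0) b1).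
rewrite (_ : _ * d `^ (theta - 1) = sew_const theta * e * (d `^ (theta - 1) * (tv t - tv (time0 T))) + sew_const theta * e * (d `^ (theta - 1) * (tv t - tv (time0 T)))); last ring.
apply: le_trans (lerD r0 r1); rewrite [X in _ <= X + _]distrC.
by rewrite -(subrKA (partition_sum Xi (time0 T) l1)) ler_normD.
Qed.

Lemma sewing_bound theta a b e Xi (I : time -> R) s t : 1 < theta -> 0 <= e ->
  sew_bounded a b theta e Xi -> (forall u, has_integral Xi (time0 T) u (I u)) ->
  a <= tv s <= b -> a <= tv t <= b ->
  `|I t - I s - Xi s t| <= (sew_const theta + 2 `^ theta) * e * dist s t `^ theta.
Proof.
move=> th e0 hXi hI.
have K0 := sew_const_gt0 th.
have le u v : a <= tv u -> tv u <= tv v -> tv v <= b ->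
    `|I v - I u - Xi u v| <= sew_const theta * e * (tv v - tv u) `^ theta.
  move=> au uv vb; apply/ler_addgt0Pr => eta eta0.
  have eta2 : 0 < eta / 2 by rewrite divr_gt0.
  have [d1 d10 h1] := (has_integralP Xi (I u) (time_ge0 u : tv (time0 T) <= _)).1 (hI u) _ eta2.
  have [d2 d20 h2] := (has_integralP Xi (I v) (time_ge0 v : tv (time0 T) <= _)).1 (hI v) _ eta2.
  have d0 : 0 < Num.min d1 d2 by rewrite lt_min d10.
  (* Concatenating partitions of [0, u] and [u, v] makes the sum over the second one an
     approximation of I v - I u. *)
  have [l1 [p1]] := partition_exists (time_ge0 u : tv (time0 T) <= _) d0.
  have [l2 [p2]] := partition_exists uv d0.
  rewrite !lt_min => /andP[m21 m22] /andP[m11 m12].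
  have e1 : last (time0 T) l1 = u by case/andP: p1 => _ /eqP.
  have p : is_partition (time0 T) v (l1 ++ l2).
    by move: p1 p2 => /andP[q1 _] /andP[q2 q3]; rewrite /is_partition cat_path last_cat e1 q1 q2.
  have {}h1 := h1 l1 p1 m11.
  have {}h2 : `|partition_sum Xi (time0 T) (l1 ++ l2) - I v| < eta / 2.
    by apply: h2 => //; apply: mesh_cat => //; rewrite e1.
  have h3 : `|partition_sum Xi u l2 - Xi u v| <= sew_const theta * e * (tv v - tv u) `^ theta.
    apply: sew_partition => // x y z ux xy yz zv.
    by apply: sew_mono hXi _ _ _ _ => //; [exact: le_trans au ux|exact: le_trans zv vb].
  move: h2 h1 h3; rewrite psum_cat e1 !ler_norml !ltr_norml.
  move=> /andP[? ?] /andP[? ?] /andP[? ?]; apply/andP; split; lra.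
have W2 : 0 <= 2 `^ theta * e by rewrite mulr_ge0 ?powR_ge0.
move=> /andP[as' sb] /andP[at' tb]; have [st|/ltW ts] := leP (tv s) (tv t).
  apply: le_trans (le _ _ as' st tb) _; rewrite ger0_norm ?subr_ge0 //.
  by rewrite ler_wpM2r ?powR_ge0 // mulrDl lerDl.
have h := le _ _ at' ts sb.
have hs : Xi s s = 0.
  have := @sew_mono a b theta e Xi s s s hXi as' (lexx _) (lexx _) sb.
  rewrite !subrr powR0 ?mulr0 ?gt_eqF ?(lt_trans ltr01 th) //.
  by rewrite sub0r normrN normr_le0 => /eqP.
(* For t < s the germ is reversed: Xi s t + Xi t s is the defect of the detour from s to t and back,
   of length 2 |t - s|, whence the summand 2^theta. *)
have h2 : `|Xi s s - Xi s t - Xi t s| <= e * (dist s t + dist t s) `^ theta.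
  by apply: hXi; rewrite ?as' ?at'.
rewrite (_ : (sew_const theta + _) * e * _ =
  sew_const theta * e * (tv s - tv t) `^ theta + e * (dist s t + dist t s) `^ theta).
  apply: le_trans (lerD h h2); rewrite hs sub0r -[X in _ <= X + _]normrN.
  apply: le_trans (ler_normD _ _); rewrite le_eqVlt; apply/orP; left; apply/eqP.
  by congr `|_|; ring.
have -> : dist s t + dist t s = 2 * dist s t by rewrite (distC t s); ring.
rewrite powRM ?ler0n //.
by rewrite [dist s t]ler0_norm ?subr_le0 // opprB; ring.
Qed.

End Sewing.

(** * Estimates for controlled paths *)

Section Hoelder.
Variables (R : realType) (T : {posnum R}).
Local Notation time := (time T).
Local Notation tv := (@time_val R T).
Local Notation dist s t := `|tv t - tv s|.
Implicit Types (s t u : time) (f : time -> time -> R).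

Lemma dist_gt0 s t : s != t -> 0 < dist s t.
Proof.
move=> st; rewrite normr_gt0 subr_eq0; apply: contra_neq st => /time_val_inj.
exact: esym.
Qed.

Lemma hoelder_leP g f (e : R) : (hoelder_seminorm g f <= e%:E)%E ->
  forall s t, s != t -> `|f s t| <= e * dist s t `^ g.
Proof.
move=> he s t st; have := le_trans (le_hoelder_seminorm g f st) he.
by rewrite lee_fin ler_pdivrMr // powR_gt0 // dist_gt0.
Qed.

Lemma hoelder_geP g f (e : R) : (forall s t, s != t -> `|f s t| <= e * dist s t `^ g) ->
  (hoelder_seminorm g f <= e%:E)%E.
Proof.
move=> h; apply: hoelder_seminorm_le => s t st.
by rewrite lee_fin ler_pdivrMr ?h // powR_gt0 // dist_gt0.
Qed.

Lemma hoelder_fin g f : (hoelder_seminorm g f < +oo)%E ->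
  exists2 M, 0 <= M & forall s t, s != t -> `|f s t| <= M * dist s t `^ g.
Proof.
have := hoelder_seminorm_ge0 g f; case E : (hoelder_seminorm g f) => [M| |] //= M0 _.
by exists M => //; apply: hoelder_leP; rewrite E.
Qed.

End Hoelder.

Section RoughBounds.
Variables (R : realType) (A : finType) (T : {posnum R}) (alpha : R).
Hypothesis halpha : 0 < alpha < 1.
Hypothesis halpha_inv : forall n : nat, (0 < n)%N -> alpha <> n%:R^-1.
Local Notation time := (time T).
Local Notation tv := (@time_val R T).
Local Notation dist s t := `|tv t - tv s|.
Local Notation H := (forest_alg R A).
Local Notation one := (fempty A).
Local Notation N := (level alpha).
Local Notation F := (forests_upto A N.-1).
Local Notation rp := (rough_path A T alpha).
Local Notation cpath := (time -> H).
Implicit Types (s t u : time) (h k m : forest A) (X Y : rp) (Z W G : cpath).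
Local Opaque pairing forest_vec fempty.

Let alpha0 : 0 < alpha. Proof. by case/andP: halpha. Qed.
Let alpha1 : alpha < 1. Proof. by case/andP: halpha. Qed.

Lemma level_gt0 : (0 < N)%N.
Proof.
rewrite truncn_gt0.
by rewrite invf_ge1 // ltW.
Qed.

(** Here alpha different from 1/n enters: it makes the inequality strict. *)
Lemma level_lt1 : N%:R * alpha < 1.
Proof.
have ai : 0 <= alpha^-1 by rewrite invr_ge0 ltW.
rewrite -ltr_pdivlMr // mul1r lt_neqAle truncn_le ai andbT.
by apply/eqP => e; apply: (halpha_inv level_gt0); rewrite e invrK.
Qed.

Lemma levelS_gt1 : 1 < N.+1%:R * alpha.
Proof. by rewrite -ltr_pdivrMr // mul1r truncnS_gt. Qed.

Lemma mem_F h : (h \in F) = (forest_size h < N)%N.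
Proof. by rewrite mem_forests_upto; case: N level_gt0. Qed.

Lemma uniq_F : uniq F. Proof. exact: undup_uniq. Qed.

Lemma X1 X s t : X s t one = 1.
Proof. by have [/(_ s t)[]] := rough_pathP X. Qed.

Lemma chen X s u t : star (X s u) (X u t) = X s t.
Proof. by apply/funext => h; have [_ /(_ s u t h)] := rough_pathP X. Qed.

(** The seminorms exclude s = t, so diagonal values must come from Chen's relation: by induction its
    proper terms vanish, and X^h = 2 X^h remains. *)
Lemma Xtt X t : X t t = fdelta R one.
Proof.
apply/funext => h; elim/forest_ltn_ind: h => h IH; rewrite /fdelta.
case: eqP => [->|/eqP h1]; first exact: X1.
have : star (X t t) (X t t) h = X t t h by rewrite chen.
rewrite [star _ _ h](cosum_rsum (fun a b => X t t a * X t t b)) // X1 mul1r mulr1.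
rewrite /rsum big_seq_cond big1 ?addr0 => [/eqP|c /andP[ch pc]].
  by rewrite -subr_eq0 addrK => /eqP.
have [c1 _] := proper_size ch pc; rewrite IH // /fdelta.
by case/andP: pc => /negbTE -> _; rewrite mul0r.
Qed.

Definition xbound X (K : R) := forall h s t, (forest_size h <= N)%N ->
  `|X s t h| <= K * dist s t `^ ((forest_size h)%:R * alpha).

Definition xclose X Y (e : R) := forall h s t, (forest_size h <= N)%N ->
  `|X s t h - Y s t h| <= e * dist s t `^ ((forest_size h)%:R * alpha).

Lemma xbound_exists X : exists2 K, 1 <= K & xbound X K.
Proof.
have ex h : exists2 M, 0 <= M & forall s t,
    `|X s t h| <= M * dist s t `^ ((forest_size h)%:R * alpha).
  have [->|h1] := eqVneq h one.
    by exists 1 => // s t; rewrite X1 forest_size1 mul0r powRr0 normr1 mulr1.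
  have [_ _ /(_ h)] := rough_pathP X; rewrite mulrC => /hoelder_fin[M M0 hM].
  exists M => // s t; have [->|st] := eqVneq s t; last exact: hM.
  by rewrite Xtt /fdelta (negbTE h1) normr0 mulr_ge0 ?powR_ge0.
have [M M0 hM] : exists2 M : forest A -> R, (forall h, 0 <= M h) & forall h s t,
    `|X s t h| <= M h * dist s t `^ ((forest_size h)%:R * alpha).
  have ex' h : exists M, 0 <= M /\ forall s t,
      `|X s t h| <= M * dist s t `^ ((forest_size h)%:R * alpha).
    by have [M M0 hM] := ex h; exists M.
  by have [M hM] := choice ex'; exists M => [h|h s t]; have [] := hM h.
exists (1 + \sum_(h <- forests_upto A N) M h).
  by rewrite lerDl sumr_ge0.
move=> h s t hN; apply: le_trans (hM h s t) _; rewrite ler_wpM2r ?powR_ge0 //.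
rewrite (bigD1_seq h) ?mem_forests_upto ?undup_uniq //=.
by rewrite addrCA lerDl addr_ge0 // sumr_ge0.
Qed.

Lemma xclose_ball X Y e : rough_ball X e Y -> xclose X Y e.
Proof.
move=> XY h s t hN; have e0 : 0 < e.
  by rewrite -lte_fin; apply: le_lt_trans XY; exact: rough_dist_ge0.
have [->|h1] := eqVneq h one; first by rewrite !X1 subrr normr0 mulr_ge0 ?powR_ge0 ?ltW.
have [->|st] := eqVneq s t; first by rewrite !Xtt subrr normr0 mulr_ge0 ?powR_ge0 ?ltW.
have hN' : h \in forests_upto A N by rewrite mem_forests_upto.
have := le_lt_trans (le_rough_dist X Y hN' h1 st) XY.
by rewrite lte_fin ltr_pdivrMr ?powR_gt0 ?dist_gt0 // => /ltW.
Qed.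

Lemma xbound_close X Y K e : 0 <= e -> xbound X K -> xclose X Y e -> xbound Y (K + e).
Proof.
move=> e0 hK he h s t hN; have {hK}hK := hK h s t hN; have {he}he := he h s t hN.
rewrite mulrDl -[Y s t h](subKr (X s t h)).
by apply: le_trans (ler_normB _ _) _; apply: lerD.
Qed.

Lemma pairing_F f (x : H) : (forall k, k \in msupp x -> (forest_size k < N)%N) ->
  pairing f x = \sum_(k <- F) mcoeff k x * f k.
Proof. by move=> hx; apply: pairing_sub uniq_F _ => k /hx; rewrite mem_F. Qed.

Lemma truncated_supp Z t : truncated alpha Z ->
  forall k, k \in msupp (Z t) -> (forest_size k < N)%N.
Proof.
move=> tZ k; rewrite -mcoeff_neq0 ltnNge; apply: contra => kN.
by apply/eqP; exact: tZ.
Qed.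

(** On the truncation psi is the sum of psi(k) [fdelta R k], and for each of these terms the
    difference is R^k by definition. *)
Lemma pairing_rem X Z psi s u : truncated alpha Z ->
  pairing psi (Z u) - pairing (star (X s u) psi) (Z s) =
  \sum_(k <- F) psi k * remainder X Z k s u.
Proof.
move=> tZ; have -> : pairing (star (X s u) psi) (Z s) =
    \sum_(k <- F) psi k * pairing (star (X s u) (fdelta R k)) (Z s).
  under [RHS]eq_bigr => k _ do rewrite -pairing_funZ.
  rewrite -pairing_fun_sum; apply: eq_pairing_in => m /(truncated_supp tZ) mN.
  rewrite /star; under [RHS]eq_bigr => k _ do rewrite mulr_sumr.
  rewrite exchange_big; apply: eq_big_seq => c cm /=.
  rewrite (bigD1_seq c.2) ?uniq_F //=; last first.
    rewrite mem_F; apply: leq_ltn_trans mN.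
    by rewrite -(coprod_size cm) leq_addl.
  rewrite /fdelta eqxx mulr1 mulrC big1 ?addr0 // => k; rewrite eq_sym => /negbTE ->.
  by rewrite !mulr0.
rewrite (pairing_F _ (truncated_supp (t := u) tZ)) -sumrB.
by apply: eq_bigr => k _; rewrite /remainder mulrBr [mcoeff _ _ * _]mulrC.
Qed.

Definition cocycle (Psi : (forest A -> R) -> forest A -> R) :=
  forall phi phi', phi' one = 1 ->
    Psi (star phi phi') = fun k => Psi phi k + star phi (Psi phi') k.

Lemma germ_delta Psi X Z s u t : truncated alpha Z -> cocycle Psi ->
  pairing (Psi (X s t)) (Z s) - pairing (Psi (X s u)) (Z s)
  - pairing (Psi (X u t)) (Z u) = - \sum_(k <- F) Psi (X u t) k * remainder X Z k s u.
Proof.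
move=> tZ cPsi; rewrite -(pairing_rem X (Psi (X u t)) s u tZ) -(chen X s u t).
by rewrite cPsi ?X1 // pairing_funD; ring.
Qed.

Lemma cocycle_graft a : cocycle (fun phi k => phi (fgraft a k)).
Proof.
move=> phi phi' e; apply/funext => k.
rewrite /star (coprod_sum_graft (fun x y => phi x * phi' y)) e mulr1.
by rewrite addrC.
Qed.

Lemma remainder0 X h s t : remainder X (fun=> 0) h s t = 0.
Proof. by rewrite /remainder mcoeff0 pairing0 subr0. Qed.

Lemma remainderB X Z Z' h s t : remainder X (fun t => Z t - Z' t) h s t =
  remainder X Z h s t - remainder X Z' h s t.
Proof. by rewrite /remainder mcoeffB pairingB; ring. Qed.

Lemma remainder_tt X Z h t : remainder X Z h t t = 0.
Proof. by rewrite /remainder Xtt star_counitl pairing_delta subrr. Qed.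

(** A real-valued distance between paths controlled by two different rough paths. The weight [w] is
    left free: [bweight alpha] and [bweight beta] for the fibre norms, the constant kappa for
    sections. *)
Definition pclose (w : nat -> R) X Y Z W (e : R) :=
  (forall h, (forest_size h < N)%N ->
     `|mcoeff h (Z (time0 T)) - mcoeff h (W (time0 T))| <= e) /\
  (forall h s t, (forest_size h < N)%N ->
     `|remainder X Z h s t - remainder Y W h s t| <= e * dist s t `^ w (forest_size h)).

Definition pbound w X Z M := pclose w X X Z (fun=> 0) M.

Lemma pboundP w X Z M : pbound w X Z M <->
  (forall h, (forest_size h < N)%N -> `|mcoeff h (Z (time0 T))| <= M) /\
  (forall h s t, (forest_size h < N)%N ->
     `|remainder X Z h s t| <= M * dist s t `^ w (forest_size h)).
Proof.
split=> -[h1 h2]; split=> [h hN|h s t hN]; have := h1; have := h2.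
- by move=> _ /(_ h hN); rewrite mcoeff0 subr0.
- by move=> /(_ h s t hN) + _; rewrite remainder0 subr0.
- by move=> _ /(_ h hN); rewrite mcoeff0 subr0.
- by move=> /(_ h s t hN) + _; rewrite remainder0 subr0.
Qed.

Lemma pbound_sub w X Z W e : pbound w X (fun t => Z t - W t) e <-> pclose w X X Z W e.
Proof.
rewrite pboundP; split=> -[h1 h2]; split=> [h hN|h s t hN].
- by have := h1 h hN; rewrite mcoeffB.
- by have := h2 h s t hN; rewrite remainderB.
- by rewrite mcoeffB h1.
- by rewrite remainderB h2.
Qed.

Lemma pclose_ge0 w X Y Z W e : pclose w X Y Z W e -> 0 <= e.
Proof.
case=> /(_ one); rewrite forest_size1 level_gt0 => /(_ isT) h _.
exact: le_trans (normr_ge0 _) h.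
Qed.

Lemma pclose_le w X Y Z W e e' : e <= e' -> pclose w X Y Z W e -> pclose w X Y Z W e'.
Proof.
move=> ee [h1 h2]; split=> [h hN|h s t hN]; first exact: le_trans (h1 h hN) ee.
by apply: le_trans (h2 h s t hN) _; rewrite ler_wpM2r ?powR_ge0.
Qed.

Lemma pclose_sym w X Y Z W e : pclose w X Y Z W e -> pclose w Y X W Z e.
Proof. by case=> h1 h2; split=> *; rewrite distrC; [exact: h1|exact: h2]. Qed.

Lemma pclose_trans w X Y X' Z W Z' e e' : pclose w X Y Z W e -> pclose w Y X' W Z' e' ->
  pclose w X X' Z Z' (e + e').
Proof.
move=> [h1 h2] [k1 k2]; split=> [h hN|h s t hN].
  rewrite -(subrKA (mcoeff h (W (time0 T)))); apply: le_trans (ler_normD _ _) _.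
  by apply: lerD; [exact: h1|exact: k1].
rewrite -(subrKA (remainder Y W h s t)) mulrDl; apply: le_trans (ler_normD _ _) _.
by apply: lerD; [exact: h2|exact: k2].
Qed.

Lemma pcloseB w X Y Z Z' W W' e e' : pclose w X Y Z Z' e -> pclose w X Y W W' e' ->
  pclose w X Y (fun t => Z t - W t) (fun t => Z' t - W' t) (e + e').
Proof.
move=> [h1 h2] [k1 k2]; split=> [h hN|h s t hN].
  rewrite !mcoeffB.
  rewrite (_ : _ - _ - _ = (mcoeff h (Z (time0 T)) - mcoeff h (Z' (time0 T))) -
    (mcoeff h (W (time0 T)) - mcoeff h (W' (time0 T)))); last ring.
  by apply: le_trans (ler_normB _ _) _; apply: lerD; [exact: h1|exact: k1].
rewrite !remainderB mulrDl.
rewrite (_ : _ - _ - _ = (remainder X Z h s t - remainder Y Z' h s t) -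
    (remainder X W h s t - remainder Y W' h s t)); last ring.
by apply: le_trans (ler_normB _ _) _; apply: lerD; [exact: h2|exact: k2].
Qed.

(** At least 1, and at least the sum of any two distances: a Hoelder exponent can then be lowered at
    the price of a power of [L], also for the detours of the sewing lemma. *)
Let L := 1 + 2 * T%:num.
Let L1 : 1 <= L. Proof. by rewrite lerDl mulr_ge0. Qed.

Lemma dist_leL s t : 0 <= dist s t <= L.
Proof.
rewrite normr_ge0 /=; apply: le_trans (dist_leT s t) _.
by rewrite /L; have : 0 < T%:num by []; lra.
Qed.

Definition Lpow (q : R) := L `^ q.

Lemma Lpow_ge1 q : 0 <= q -> 1 <= Lpow q. Proof. exact: powR_ge1. Qed.

Lemma Lpow_ge0 q : 0 <= Lpow q. Proof. exact: powR_ge0. Qed.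

Lemma dist_weaken s t a b q : 0 <= b -> b <= a -> a <= q ->
  dist s t `^ a <= Lpow q * dist s t `^ b.
Proof. by move=> b0 ba aq; apply: powR_weaken => //; [exact: dist_leL|rewrite b0]. Qed.

Lemma dist2_weaken s u t a b c q : 0 <= a -> 0 <= b -> 0 <= c -> c <= a + b -> a + b <= q ->
  dist s u `^ a * dist u t `^ b <= Lpow q * (dist s u + dist u t) `^ c.
Proof.
move=> a0 b0 c0 cab abq.
have D0 : 0 <= dist s u + dist u t by rewrite addr_ge0.
apply: (@le_trans _ _ ((dist s u + dist u t) `^ (a + b))).
  rewrite powRDge0 //; apply: ler_pM; rewrite ?powR_ge0 //; apply: le_powR => //.
    by rewrite lerDl.
  by rewrite lerDr.
apply: powR_weaken => //; last by rewrite c0.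
rewrite D0 /=; have := dist_leT s u; have := dist_leT u t; rewrite /L; lra.
Qed.

Lemma pclose_weaken w w' q X Y Z W e :
  (forall n, (n < N)%N -> [/\ 0 <= w' n, w' n <= w n & w n <= q]) ->
  pclose w X Y Z W e -> pclose w' X Y Z W (Lpow q * e).
Proof.
move=> hw hp; have e0 := pclose_ge0 hp; case: hp => h1 h2.
have q0 : 0 <= q by have [a b c] := hw 0%N level_gt0; exact: le_trans a (le_trans b c).
split=> [h hN|h s t hN].
  by apply: le_trans (h1 h hN) _; rewrite ler_peMl // Lpow_ge1.
have [a b c] := hw _ hN; apply: le_trans (h2 h s t hN) _.
rewrite [Lpow q * e]mulrC -mulrA ler_wpM2l //; exact: dist_weaken.
Qed.

(** One constant that dominates the number of forests in the truncation and the length of each of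
    their coproducts. *)
Definition cardB : R := \sum_(k <- F) (size (coprod k))%:R + (size F)%:R + 1.

Lemma cardB_ge1 : 1 <= cardB.
Proof. by rewrite /cardB lerDr addr_ge0 // sumr_ge0. Qed.

Lemma size_F_le : (size F)%:R <= cardB.
Proof. by rewrite /cardB -addrA addrCA lerDl addr_ge0 // sumr_ge0. Qed.

Lemma coprod_le k : (forest_size k < N)%N -> (size (coprod k))%:R <= cardB.
Proof.
rewrite -mem_F => kF; rewrite /cardB (bigD1_seq k) ?uniq_F //= -!addrA lerDl.
by rewrite !addr_ge0 // sumr_ge0.
Qed.

Lemma sum_F_le (f : forest A -> R) (e : R) : 0 <= e ->
  (forall k, (forest_size k < N)%N -> `|f k| <= e) ->
  `|\sum_(k <- F) f k| <= cardB * e.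
Proof.
move=> e0 he; apply: le_trans (ler_norm_sum _ _ _) _.
apply: (@le_trans _ _ ((size F)%:R * e)); last by rewrite ler_wpM2r // size_F_le.
have -> : (size F)%:R * e = \sum_(k <- F) e.
  by rewrite big_const_seq count_predT iter_addr_0 mulr_natl.
by rewrite big_seq [leRHS]big_seq; apply: ler_sum => k; rewrite mem_F => /he.
Qed.

Definition sizeB h k : R := (forest_size k - forest_size h)%N%:R * alpha.

Lemma star_bound X K h k s t : 0 <= K -> xbound X K -> (forest_size k < N)%N ->
  `|star (X s t) (fdelta R h) k| <= cardB * (K * dist s t `^ sizeB h k).
Proof.
move=> K0 hX kN; have B0 : 0 <= K * dist s t `^ sizeB h k by rewrite mulr_ge0 ?powR_ge0.
apply: le_trans (star_delta_bound B0 _) _; last by rewrite ler_wpM2r // coprod_le.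
move=> m e; have mk : forest_size m = (forest_size k - forest_size h)%N by rewrite -e addnK.
by rewrite /sizeB -mk; apply: hX; rewrite mk; apply: leq_trans (leq_subr _ _) (ltnW kN).
Qed.

Lemma star_close X Y e h k s t : 0 <= e -> xclose X Y e -> (forest_size k < N)%N ->
  `|star (X s t) (fdelta R h) k - star (Y s t) (fdelta R h) k|
  <= cardB * (e * dist s t `^ sizeB h k).
Proof.
move=> e0 hX kN; have B0 : 0 <= e * dist s t `^ sizeB h k by rewrite mulr_ge0 ?powR_ge0.
have := @star_delta_bound _ _ (fun m => X s t m - Y s t m) h k _ B0.
rewrite starBl => hb; apply: le_trans (hb _) _; last by rewrite ler_wpM2r // coprod_le.
move=> m em; have mk : forest_size m = (forest_size k - forest_size h)%N by rewrite -em addnK.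
by rewrite /sizeB -mk; apply: hX; rewrite mk; apply: leq_trans (leq_subr _ _) (ltnW kN).
Qed.

Lemma prod_close (x y x' y' ax ay bx by_ : R) : `|x| <= ax -> `|y - y'| <= by_ ->
  `|x - x'| <= bx -> `|y'| <= ay -> 0 <= ax -> 0 <= bx ->
  `|x * y - x' * y'| <= ax * by_ + bx * ay.
Proof.
move=> hx hy hxx hy' ax0 bx0.
rewrite (_ : _ - _ = x * (y - y') + (x - x') * y'); last ring.
apply: le_trans (ler_normD _ _) _; rewrite !normrM.
by apply: lerD; apply: ler_pM.
Qed.

End RoughBounds.

(** * The rough integral *)

Section PairData.
Variables (R : realType) (A : finType) (T : {posnum R}) (alpha : R).
Hypothesis halpha : 0 < alpha < 1.
Hypothesis halpha_inv : forall n : nat, (0 < n)%N -> alpha <> n%:R^-1.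
Local Notation time := (time T).
Local Notation tv := (@time_val R T).
Local Notation dist s t := `|tv t - tv s|.
Local Notation H := (forest_alg R A).
Local Notation N := (level alpha).
Local Notation F := (forests_upto A N.-1).
Local Notation rp := (rough_path A T alpha).
Local Notation cpath := (time -> H).
Local Notation cB := (cardB A alpha).
Local Notation Lq := (Lpow T).
Implicit Types (s t u : time) (h k m : forest A) (X Y : rp) (Z W G : cpath).
Local Opaque pairing forest_vec fempty.

Let alpha0 : 0 < alpha. Proof. by case/andP: halpha. Qed.

(** [e1] is the distance of the rough paths and [M] the size of W. The condition [M * e1 <= e]
    absorbs the change of the rough path acting on W, so that conclusions are linear in [e]. With Y
    = X, W = 0 and M = e1 = 0 they become bounds for Z. *)
Definition pair_data (w : nat -> R) K X Y Z W e e1 M :=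
  [/\ 0 <= K, xbound X K, xbound Y K, 0 <= e1 & xclose X Y e1] /\
  [/\ pclose w X Y Z W e, pbound w Y W M, M * e1 <= e,
     truncated alpha Z & truncated alpha W].

Lemma cB_ge0 : 0 <= cB. Proof. exact: le_trans ler01 (cardB_ge1 _ _). Qed.

Lemma sizeB_ge0 h k : 0 <= sizeB alpha h k.
Proof. by rewrite mulr_ge0 // ltW. Qed.

Lemma sizeB_le1 h k : (forest_size k < N)%N -> sizeB alpha h k <= 1.
Proof.
move=> kN; apply: le_trans (ltW (level_lt1 halpha halpha_inv)).
rewrite ler_wpM2r ?(ltW alpha0) // ler_nat; apply: leq_trans (leq_subr _ _) _; exact: ltnW.
Qed.

Lemma star_prod_close K e1 e M X Y h k s t (x y q : R) : 0 <= K -> 0 <= e1 ->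
  xbound X K -> xclose X Y e1 -> (forest_size k < N)%N -> 0 <= e -> M * e1 <= e ->
  0 <= q -> `|x - y| <= q * e -> `|y| <= q * M ->
  `|star (X s t) (fdelta R h) k * x - star (Y s t) (fdelta R h) k * y| <=
  cB * (K + 1) * q * e * dist s t `^ sizeB alpha h k.
Proof.
move=> K0 e10 hX hXY kN e0 Me q0 hxy hy.
have p0 : 0 <= dist s t `^ sizeB alpha h k by exact: powR_ge0.
have b0 := cB_ge0.
apply: le_trans (prod_close (star_bound halpha h s t K0 hX kN) hxy
  (star_close halpha h s t e10 hXY kN) hy _ _) _; rewrite ?mulr_ge0 //.
have -> : cB * (K * dist s t `^ sizeB alpha h k) * (q * e) +
   cB * (e1 * dist s t `^ sizeB alpha h k) * (q * M) =
   cB * q * dist s t `^ sizeB alpha h k * (K * e + M * e1) by ring.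
have -> : cB * (K + 1) * q * e * dist s t `^ sizeB alpha h k =
  cB * q * dist s t `^ sizeB alpha h k * (K * e + e) by ring.
by rewrite ler_wpM2l ?mulr_ge0 // lerD2l.
Qed.

Definition sup_const K q : R := Lq q + cB * (cB * (K + 1) * 1 * Lq q).

(** Z^h at time t is rebuilt from time 0 as R^h_{0,t} plus the sum of (X_{0,t} star h)(k) Z^k_0, and
    both parts are controlled by the data. *)
Lemma sup_close w q K X Y Z W e e1 M : 1 <= q ->
  (forall n, (n < N)%N -> 0 <= w n <= q) -> pair_data w K X Y Z W e e1 M ->
  forall h t, (forest_size h < N)%N ->
  `|mcoeff h (Z t) - mcoeff h (W t)| <= sup_const K q * e.
Proof.
move=> q1 hw [[K0 hX hY e10 hXY] [hp hb Me tZ tW]] h t hN.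
have e0 := pclose_ge0 halpha hp; have M0 := pclose_ge0 halpha hb.
case: hp => hp0 hp; have [hb0 _] := (pboundP _ _ _ _).1 hb.
pose t0 := time0 T.
have E X' Z' : truncated alpha Z' -> mcoeff h (Z' t) = remainder X' Z' h t0 t +
    \sum_(k <- F) star (X' t0 t) (fdelta R h) k * mcoeff k (Z' t0).
  move=> tZ'; rewrite /remainder (pairing_F halpha _ (truncated_supp (t := t0) tZ')).
  by rewrite -addrA -[LHS]addr0; congr (_ + _); apply/esym/eqP;
    rewrite addrC subr_eq0; apply/eqP; apply: eq_bigr => k _; rewrite mulrC.
rewrite (E X Z tZ) (E Y W tW).
rewrite (_ : _ + _ - _ = (remainder X Z h t0 t - remainder Y W h t0 t) +
  \sum_(k <- F) (star (X t0 t) (fdelta R h) k * mcoeff k (Z t0) -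
    star (Y t0 t) (fdelta R h) k * mcoeff k (W t0))); last by rewrite sumrB; ring.
rewrite /sup_const mulrDl; apply: le_trans (ler_normD _ _) _; apply: lerD.
  apply: le_trans (hp h t0 t hN) _; rewrite mulrC ler_wpM2r //.
  have /andP[a b] := hw _ hN; have := @dist_weaken _ _ t0 t _ 0 q (lexx _) a b.
  by rewrite powRr0 mulr1.
have B0 : 0 <= cB * (K + 1) * 1 * Lq q by rewrite !mulr_ge0 ?cB_ge0 ?powR_ge0 // addr_ge0.
rewrite -[leRHS]mulrA; apply: sum_F_le => //; first exact: mulr_ge0.
move=> k kN; apply: le_trans (@star_prod_close K e1 e M X Y h k t0 t _ _ 1 K0 e10 hX hXY kN e0 Me ler01 _ _) _.
- by rewrite mul1r; exact: hp0.
- by rewrite mul1r; exact: hb0.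
rewrite -mulrA [leRHS](_ : _ = cB * (K + 1) * 1 * (e * Lq q)); last ring.
rewrite ler_wpM2l ?mulr_ge0 ?cB_ge0 ?addr_ge0 // ler_wpM2l //.
have := @dist_weaken _ _ t0 t _ 0 q (lexx _) (sizeB_ge0 h k) (le_trans (sizeB_le1 h kN) q1).
by rewrite powRr0 mulr1.
Qed.

Lemma pair_data_self w K X Y Z W e e1 M : pair_data w K X Y Z W e e1 M ->
  pair_data w K Y Y W (fun=> 0) M 0 0.
Proof.
move=> [[K0 hX hY e10 hXY] [hp hb Me tZ tW]]; split; split=> //.
- by move=> h s t _; rewrite subrr normr0 mul0r.
- split=> [h _|h s t _]; first by rewrite subrr normr0.
  by rewrite subrr normr0 mul0r.
- by rewrite mul0r; exact: pclose_ge0 hb.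
- by move=> t h _; rewrite mcoeff0.
Qed.

Lemma sup_bound w q K X Y Z W e e1 M : 1 <= q ->
  (forall n, (n < N)%N -> 0 <= w n <= q) -> pair_data w K X Y Z W e e1 M ->
  forall h t, (forest_size h < N)%N -> `|mcoeff h (W t)| <= sup_const K q * M.
Proof.
move=> q1 hw hd h t hN.
by have := sup_close q1 hw (pair_data_self hd) t hN; rewrite mcoeff0 subr0.
Qed.

End PairData.

Section IntegralEstimate.
Variables (R : realType) (A : finType) (T : {posnum R}) (alpha beta : R) (a : A).
Hypothesis halpha : 0 < alpha < 1.
Hypothesis halpha_inv : forall n : nat, (0 < n)%N -> alpha <> n%:R^-1.
Hypothesis hbeta : 0 < beta <= alpha.
Local Notation time := (time T).
Local Notation tv := (@time_val R T).
Local Notation dist s t := `|tv t - tv s|.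
Local Notation H := (forest_alg R A).
Local Notation one := (fempty A).
Local Notation N := (level alpha).
Local Notation F := (forests_upto A N.-1).
Local Notation rp := (rough_path A T alpha).
Local Notation cpath := (time -> H).
Local Notation cB := (cardB A alpha).
Local Notation Lq := (Lpow T).
Implicit Types (s t u : time) (h k m : forest A) (X Y : rp) (Z W G : cpath).
Local Opaque pairing forest_vec fempty.

Let alpha0 : 0 < alpha. Proof. by case/andP: halpha. Qed.

Definition graft_op (phi : forest A -> R) k := phi (fgraft a k).

Definition bweight (n : nat) : R := (N - n)%N%:R * beta.

Lemma bweight_bounds n : 0 <= bweight n <= 1.
Proof.
have [b0 ba] := andP hbeta.
rewrite mulr_ge0 ?(ltW b0) //=; apply: le_trans (ltW (level_lt1 halpha halpha_inv)).
by apply: ler_pM => //; [exact: ltW|rewrite ler_nat leq_subr].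
Qed.

Lemma graft_germE X Z u v : truncated alpha Z ->
  \sum_(h <- F) mcoeff h (Z u) * X u v (fgraft a h) = pairing (graft_op (X u v)) (Z u).
Proof. by move=> tZ; rewrite (pairing_F halpha _ (truncated_supp (t := u) tZ)). Qed.

Lemma rough_integral_trunc X Z W : is_rough_integral a X Z W -> truncated alpha W.
Proof.
case=> _ _ h3 t h hN; apply: h3.
  by move=> h1; move: hN; rewrite h1 forest_size1 leqNgt level_gt0.
move=> k kN e; move: hN; rewrite e forest_size_graft => hN.
by move: kN; rewrite addn2 leqNgt ltnS hN.
Qed.

Lemma sum_F_delta (f : forest A -> R) x : (forest_size x < N)%N ->
  \sum_(g <- F) (g == x)%:R * f g = f x.
Proof.
move=> xN; rewrite (bigD1_seq x) ?uniq_F ?mem_F //= eqxx mul1r big1 ?addr0 //.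
by move=> g /negbTE ->; rewrite mul0r.
Qed.

Local Notation short k := (forest_size k + 2 <= N)%N.

Lemma rough_integral_pairing X Z W phi t : is_rough_integral a X Z W ->
  pairing phi (W t) = mcoeff one (W t) * phi one +
    \sum_(k <- F | short k) mcoeff k (Z t) * phi (fgraft a k).
Proof.
move=> hI; case: (hI) => _ h2 h3.
have tW := rough_integral_trunc hI.
have E g : mcoeff g (W t) = (g == one)%:R * mcoeff one (W t) +
    \sum_(k <- F | short k) (g == fgraft a k)%:R * mcoeff k (Z t).
  have [->|g1] := eqVneq g one.
    rewrite mul1r big1 ?addr0 // => k _.
    by rewrite eq_sym (negbTE (fgraft_neq1 a k)) mul0r.
  rewrite mul0r add0r.
  have [[m [mN ->]]|ne] := pselect (exists m, short m /\ g = fgraft a m).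
    rewrite h2 // big_mkcond (bigD1_seq m) ?uniq_F ?mem_F //=; last first.
      by apply: leq_trans mN; rewrite addn2.
    rewrite mN eqxx mul1r big1 ?addr0 // => k km; case: ifP => // _.
    by case: eqP => [/fgraft_inj[_ e]|_]; [rewrite e eqxx in km|rewrite mul0r].
  rewrite h3; [|exact/eqP|by move=> k kN e; apply: ne; exists k].
  rewrite big1 // => k kN; case: eqP => [e|_]; last by rewrite mul0r.
  by exfalso; apply: ne; exists k.
rewrite (pairing_F halpha _ (truncated_supp (t := t) tW)).
under eq_bigr => g _ do rewrite E mulrDl mulr_suml.
rewrite big_split /= exchange_big /=; congr (_ + _).
  rewrite -(@sum_F_delta (fun g => mcoeff one (W t) * phi g) one); last first.
    by rewrite forest_size1 level_gt0.
  by apply: eq_bigr => g _; rewrite mulrA.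
apply: eq_bigr => k kN.
rewrite -(@sum_F_delta (fun g => mcoeff k (Z t) * phi g) (fgraft a k)); last first.
  by rewrite forest_size_graft -addn2 addnC; move: kN; rewrite addnC.
by apply: eq_bigr => g _; rewrite mulrA.
Qed.

(** Grafting a forest with N - 1 nodes leaves the truncation, so such forests enter the germ but not
    the path W. They reappear as a sum of order N alpha beside the sewing error. *)
Lemma remainder_integral1 X Z W s t : truncated alpha Z -> is_rough_integral a X Z W ->
  remainder X W one s t =
  (mcoeff one (W t) - mcoeff one (W s) - pairing (graft_op (X s t)) (Z s)) +
  \sum_(k <- F | ~~ short k) graft_op (X s t) k * mcoeff k (Z s).
Proof.
move=> tZ hI; rewrite /remainder star_counitr (rough_integral_pairing _ s hI) X1 mulr1.
rewrite (pairing_F halpha _ (truncated_supp (t := s) tZ)).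
rewrite [X in _ = _ - X + _](bigID (fun k => short k)) /=.
have -> : \sum_(k <- F | ~~ short k) graft_op (X s t) k * mcoeff k (Z s) =
    \sum_(k <- F | ~~ short k) mcoeff k (Z s) * graft_op (X s t) k.
  by apply: eq_bigr => k _; rewrite mulrC.
by rewrite /graft_op; ring.
Qed.

Lemma star_delta_graft phi m k :
  star phi (fdelta R (fgraft a m)) (fgraft a k) = star phi (fdelta R m) k.
Proof.
rewrite /star (coprod_sum_graft (fun x y => phi x * fdelta R (fgraft a m) y)).
rewrite /fdelta eq_sym (negbTE (fgraft_neq1 a m)) mulr0 addr0.
apply: eq_bigr => c _; congr (_ * (nat_of_bool _)%:R).
by apply/eqP/eqP => [/fgraft_inj[]|->].
Qed.

(** Here too the forests with N - 1 nodes are missing from W; their terms have order (N - 1 - |m|)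
    alpha, which suffices for the component [m]_a. *)
Lemma remainder_integral_graft X Z W m s t : truncated alpha Z ->
  is_rough_integral a X Z W -> short m ->
  remainder X W (fgraft a m) s t = remainder X Z m s t +
  \sum_(k <- F | ~~ short k) star (X s t) (fdelta R m) k * mcoeff k (Z s).
Proof.
move=> tZ hI mN; rewrite /remainder (rough_integral_pairing _ s hI) star_one.
rewrite {1}/fdelta eq_sym (negbTE (fgraft_neq1 a m)) !mulr0 add0r.
rewrite (pairing_F halpha _ (truncated_supp (t := s) tZ)).
rewrite [X in _ = _ - X + _](bigID (fun k => short k)) /=.
case: hI => _ -> // _; under eq_bigr => k _ do rewrite star_delta_graft.
have -> : \sum_(k <- F | ~~ short k) star (X s t) (fdelta R m) k * mcoeff k (Z s) =
    \sum_(k <- F | ~~ short k) mcoeff k (Z s) * star (X s t) (fdelta R m) k.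
  by apply: eq_bigr => k _; rewrite mulrC.
by ring.
Qed.

Lemma remainder_integral0 X Z W h s t : truncated alpha Z ->
  is_rough_integral a X Z W -> h <> one -> (forall m, short m -> h <> fgraft a m) ->
  remainder X W h s t = 0.
Proof.
move=> tZ hI h1 hm; rewrite /remainder (rough_integral_pairing _ s hI) star_one.
case: hI => _ _ /(_ h t h1 hm) ->; rewrite {1}/fdelta.
case: eqP => [e|_]; first by case: h1.
rewrite !mulr0 !add0r big1 ?oppr0 // => k kN.
rewrite /star big_seq big1 ?mulr0 // => c.
rewrite (perm_mem (coprod_fgraft a k)) mem_rcons inE => /orP[/eqP -> /=|].
  by rewrite /fdelta; case: eqP => [e|_]; [case: h1|rewrite mulr0].
move=> /mapP[d dk ->] /=; rewrite /fdelta; case: eqP => [e|_]; last by rewrite mulr0.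
case: (hm d.2) => //; apply: leq_trans kN; rewrite leq_add2r -(coprod_size dk).
exact: leq_addl.
Qed.

(** In the defect of the germ R^k has order (N - |k|) beta and X^{[k]_a} has order (|k| + 1) alpha.
    As beta <= alpha, the sum of the exponents is least for the empty forest, where it is this
    number. *)
Definition theta := N%:R * beta + alpha.

(** The summands bound the initial values, the sewing error, the terms lost by truncation and the
    shift of the components by one node. The 3 is merely larger than every exponent that gets
    lowered. *)
Definition int_const K : R := 1 + (sew_const theta + 2 `^ theta) * cB * (K + 1) * Lq 3 * Lq 3
  + (cB + cB * cB) * (K + 1) * sup_const A T alpha K 1 * Lq 3 + Lq 3.

Hypothesis hth : 1 < theta.

Lemma theta_le2 : theta <= 2.
Proof.
rewrite /theta; have := level_lt1 halpha halpha_inv; have := halpha.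
have : N%:R * beta <= N%:R * alpha by rewrite ler_wpM2l //; case/andP: hbeta.
lra.
Qed.

Lemma graft_bound (phi : forest A -> R) K k s t :
  (forall h, (forest_size h <= N)%N -> `|phi h| <= K * dist s t `^ ((forest_size h)%:R * alpha)) ->
  (forest_size k < N)%N ->
  `|graft_op phi k| <= K * dist s t `^ ((forest_size k).+1%:R * alpha).
Proof. by move=> h kN; rewrite /graft_op -(forest_size_graft a); apply: h; rewrite forest_size_graft. Qed.

Lemma bweight_sub n : (n <= N)%N -> bweight n = N%:R * beta - n%:R * beta.
Proof. by move=> nN; rewrite /bweight natrB // mulrBl. Qed.

Lemma integral_sew K X Y Z W e e1 M : pair_data bweight K X Y Z W e e1 M ->
  sew_bounded (T := T) 0 T%:num theta (cB * ((K + 1) * Lq 3 * e))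
    (fun s t => pairing (graft_op (X s t)) (Z s) - pairing (graft_op (Y s t)) (W s)).
Proof.
move=> [[K0 hX hY e10 hXY] [hp hb Me tZ tW]] s u t _ _ _.
have e0 := pclose_ge0 halpha hp; case: hp => _ hp; have [_ hb2] := (pboundP _ _ _ _).1 hb.
rewrite (_ : _ - _ - _ = (pairing (graft_op (X s t)) (Z s) - pairing (graft_op (X s u)) (Z s)
  - pairing (graft_op (X u t)) (Z u)) - (pairing (graft_op (Y s t)) (W s) -
  pairing (graft_op (Y s u)) (W s) - pairing (graft_op (Y u t)) (W u))); last ring.
rewrite !(germ_delta halpha (Psi := graft_op)) //; try exact: cocycle_graft.
rewrite opprK addrC -sumrB -[leRHS]mulrA; apply: (sum_F_le halpha).
  by rewrite !mulr_ge0 ?addr_ge0 ?powR_ge0.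
move=> k kN.
have hx := graft_bound (fun h hN => hX h u t hN) kN.
have hxy := graft_bound (phi := fun h => X u t h - Y u t h) (fun h hN => hXY h u t hN) kN.
have pa : 0 <= dist u t `^ ((forest_size k).+1%:R * alpha) by exact: powR_ge0.
rewrite distrC; apply: le_trans (prod_close hx (hp k s u kN) hxy (hb2 k s u kN) _ _) _;
  try exact: mulr_ge0.
have [b0 ba] := andP hbeta; have /andP[w0 w1] := bweight_bounds (forest_size k).
have k1 : (forest_size k).+1%:R * alpha <= 1.
  apply: le_trans (ltW (level_lt1 halpha halpha_inv)); rewrite ler_wpM2r ?(ltW alpha0) //.
  by rewrite ler_nat.
have c1 : theta <= bweight (forest_size k) + (forest_size k).+1%:R * alpha.
  rewrite bweight_sub ?(ltnW kN) // /theta.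
  have -> : (forest_size k).+1%:R = (forest_size k)%:R + 1 :> R by rewrite -addn1 natrD.
  rewrite mulrDl mul1r.
  have : (forest_size k)%:R * beta <= (forest_size k)%:R * alpha by rewrite ler_wpM2l.
  by lra.
have c2 : bweight (forest_size k) + (forest_size k).+1%:R * alpha <= 3 by lra.
have h := @dist2_weaken _ _ s u t (bweight (forest_size k)) ((forest_size k).+1%:R * alpha) theta 3
   w0 (mulr_ge0 (ler0n _ _) (ltW alpha0)) (le_trans ler01 (ltW hth)) c1 c2.
have -> : K * dist u t `^ ((forest_size k).+1%:R * alpha) *
   (e * dist s u `^ bweight (forest_size k)) +
   e1 * dist u t `^ ((forest_size k).+1%:R * alpha) *
   (M * dist s u `^ bweight (forest_size k)) =
   (K * e + M * e1) * (dist s u `^ bweight (forest_size k) *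
     dist u t `^ ((forest_size k).+1%:R * alpha)) by ring.
have -> : (K + 1) * Lq 3 * e * (dist s u + dist u t) `^ theta =
  (K * e + e) * (Lq 3 * (dist s u + dist u t) `^ theta) by ring.
apply: ler_pM; rewrite ?mulr_ge0 ?powR_ge0 //.
- by have M0 := pclose_ge0 halpha hb; rewrite addr_ge0 // mulr_ge0.
- by rewrite lerD2l.
Qed.

Let sup_ge0 K : 0 <= K -> 0 <= sup_const A T alpha K 1.
Proof.
by move=> K0; rewrite /sup_const addr_ge0 ?powR_ge0 // !mulr_ge0 ?cB_ge0 ?powR_ge0 ?addr_ge0.
Qed.

Let long k : ~~ short k -> (forest_size k < N)%N -> (forest_size k).+1 = N.
Proof. by rewrite -ltnNge addn2 ltnS => Nk kN; apply/eqP; rewrite eqn_leq kN. Qed.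

Let wb01 n : (n < N)%N -> 0 <= bweight n <= 1.
Proof. by move=> _; exact: bweight_bounds. Qed.

Lemma integral_tail K X Y Z W e e1 M h s t : pair_data bweight K X Y Z W e e1 M ->
  `|\sum_(k <- F | ~~ short k) star (X s t) (fdelta R h) k * mcoeff k (Z s) -
    \sum_(k <- F | ~~ short k) star (Y s t) (fdelta R h) k * mcoeff k (W s)| <=
  cB * (cB * (K + 1) * sup_const A T alpha K 1 * e *
    (Lq 3 * dist s t `^ bweight (forest_size h).+1)).
Proof.
move=> hd; have hs := sup_close halpha halpha_inv (lexx 1) wb01 hd.
have hs' := sup_bound halpha halpha_inv (lexx 1) wb01 hd.
case: hd => [[K0 hX hY e10 hXY] [hp hb Me tZ tW]].
have e0 := pclose_ge0 halpha hp.
have C0 : 0 <= cB * (K + 1) * sup_const A T alpha K 1 * e.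
  by rewrite !mulr_ge0 ?cB_ge0 ?sup_ge0 ?addr_ge0.
rewrite -sumrB big_mkcond; apply: (sum_F_le halpha) => [|k kN].
  by rewrite !mulr_ge0 ?powR_ge0 ?cB_ge0 ?sup_ge0 ?addr_ge0.
case: ifP => kl; last by rewrite normr0 mulr_ge0 // mulr_ge0 ?powR_ge0.
have := @star_prod_close _ _ _ _ halpha K e1 e M X Y h k s t _ _ _ K0 e10 hX hXY kN e0 Me (sup_ge0 K0) (hs k s kN) (hs' k s kN).
move/le_trans; apply; apply: ler_wpM2l => //.
have [b0 ba] := andP hbeta; have /andP[w0 w1] := bweight_bounds (forest_size h).+1.
have s1 := sizeB_le1 halpha halpha_inv h kN.
apply: dist_weaken => //; last lra.
rewrite /bweight /sizeB -(long kl kN) subSS.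
by apply: ler_wpM2l.
Qed.

Lemma integral_tail1 K X Y Z W e e1 M s t : pair_data bweight K X Y Z W e e1 M ->
  `|\sum_(k <- F | ~~ short k) graft_op (X s t) k * mcoeff k (Z s) -
    \sum_(k <- F | ~~ short k) graft_op (Y s t) k * mcoeff k (W s)| <=
  cB * ((K + 1) * sup_const A T alpha K 1 * e * (Lq 3 * dist s t `^ bweight 0)).
Proof.
move=> hd; have hs := sup_close halpha halpha_inv (lexx 1) wb01 hd.
have hs' := sup_bound halpha halpha_inv (lexx 1) wb01 hd.
case: hd => [[K0 hX hY e10 hXY] [hp hb Me tZ tW]].
have e0 := pclose_ge0 halpha hp; have S0 := sup_ge0 K0.
have C0 : 0 <= (K + 1) * sup_const A T alpha K 1 * e.
  by rewrite mulr_ge0 // mulr_ge0 // addr_ge0.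
rewrite -sumrB big_mkcond; apply: (sum_F_le halpha) => [|k kN].
  by rewrite mulr_ge0 // mulr_ge0 ?powR_ge0.
case: ifP => kl; last by rewrite normr0 mulr_ge0 // mulr_ge0 ?powR_ge0.
have hx := graft_bound (fun h hN => hX h s t hN) kN.
have hxy := graft_bound (phi := fun h => X s t h - Y s t h) (fun h hN => hXY h s t hN) kN.
have pa : 0 <= dist s t `^ ((forest_size k).+1%:R * alpha) by exact: powR_ge0.
apply: le_trans (prod_close hx (hs k s kN) hxy (hs' k s kN) _ _) _; try exact: mulr_ge0.
have dw : dist s t `^ ((forest_size k).+1%:R * alpha) <= Lq 3 * dist s t `^ bweight 0.
  have /andP[w0 w1] := bweight_bounds 0; have [b0 ba] := andP hbeta.
  have := level_lt1 halpha halpha_inv; rewrite (long kl kN) => nl.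
  apply: dist_weaken => //; last lra.
  by rewrite /bweight subn0 ler_wpM2l.
set D := dist s t `^ _ in pa dw *; set D' := _ * _ `^ bweight 0 in dw *.
set S := sup_const _ _ _ _ _ in S0 C0 *.
rewrite (_ : _ + _ = S * D * (K * e + M * e1)); last ring.
rewrite (_ : (K + 1) * S * e * D' = S * D' * (K * e + e)); last ring.
have M0 := pclose_ge0 halpha hb.
have n0 : 0 <= K * e + M * e1 by rewrite addr_ge0 // mulr_ge0.
by apply: ler_pM => //; [exact: mulr_ge0|exact: ler_wpM2l|rewrite lerD2l].
Qed.

Theorem integral_estimate K X Y Z W e e1 M IZ IW :
  pair_data bweight K X Y Z W e e1 M ->
  is_rough_integral a X Z IZ -> is_rough_integral a Y W IW ->
  pclose bweight X Y IZ IW (int_const K * e).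
Proof.
move=> hd hZ hW; have hsew := integral_sew hd.
have ht := integral_tail _ _ _ hd; have ht1 := integral_tail1 _ _ hd.
case: (hd) => [[K0 hX hY e10 hXY] [hp hb Me tZ tW]].
have e0 := pclose_ge0 halpha hp; have S0 := sup_ge0 K0; have B0 := cB_ge0 A alpha.
have sw0 : 0 <= sew_const theta + 2 `^ theta.
  by rewrite addr_ge0 ?powR_ge0 // ltW // sew_const_gt0.
have L0 : 0 <= Lq 3 by exact: powR_ge0.
have K10 : 0 <= K + 1 by rewrite addr_ge0.
pose c1 := (sew_const theta + 2 `^ theta) * cB * (K + 1) * Lq 3 * Lq 3.
pose c2 := (cB + cB * cB) * (K + 1) * sup_const A T alpha K 1 * Lq 3.
have c10 : 0 <= c1 by rewrite /c1 !mulr_ge0.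
have c20 : 0 <= c2 by rewrite /c2 mulr_ge0 // mulr_ge0 // mulr_ge0 // addr_ge0 // mulr_ge0.
have cE : int_const K = 1 + c1 + c2 + Lq 3 by [].
have C0 : 0 <= int_const K by rewrite cE !addr_ge0.
have eC : e <= int_const K * e by rewrite ler_peMl // cE -!addrA lerDl !addr_ge0.
have [hp0 hp2] := hp.
have [hZ1 hZ2 hZ3] := hZ; have [hW1 hW2 hW3] := hW.
have C0e : 0 <= int_const K * e by rewrite mulr_ge0.
split=> [h hN|h s t hN].
  have [->|/eqP h1] := eqVneq h one.
    by rewrite (has_integral_diag (hZ1 _)) (has_integral_diag (hW1 _)) subrr normr0.
  have [[m [mN ->]]|ne] := pselect (exists m, short m /\ h = fgraft a m).
    rewrite hZ2 // hW2 //; apply: le_trans (hp0 m _) eC.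
    by apply: leq_trans mN; rewrite addn2.
  rewrite hZ3 ?hW3 ?subrr ?normr0 // => m mN e'; apply: ne; exists m => //.
have p0 : 0 <= dist s t `^ bweight (forest_size h) by exact: powR_ge0.
have [h1|/eqP h1] := eqVneq h one.
  rewrite h1 (remainder_integral1 _ _ tZ hZ) (remainder_integral1 _ _ tW hW).
  (* The difference of the two integrals is itself the integral of the difference of the germs, even
     though these belong to different rough paths. *)
  pose I t := mcoeff one (IZ t) - mcoeff one (IW t).
  pose Xi s t := pairing (graft_op (X s t)) (Z s) - pairing (graft_op (Y s t)) (W s).
  have hI u : has_integral Xi (time0 T) u (I u).
    have := has_integralB (time_ge0 u : tv (time0 T) <= tv u) (hZ1 u) (hW1 u).
    rewrite (_ : (fun u0 v => _ - _) = Xi) //; apply/funext => v; apply/funext => v'.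
    by rewrite !graft_germE.
  have E0 : 0 <= cB * ((K + 1) * Lq 3 * e) by rewrite !mulr_ge0.
  have hb1 := @sewing_bound _ _ theta 0 T%:num _ Xi I s t hth E0 hsew hI.
  have {}hb1 := hb1 (introT andP (conj (time_ge0 s) (time_leT s)))
    (introT andP (conj (time_ge0 t) (time_leT t))).
  rewrite (_ : _ - _ = (I t - I s - Xi s t) +
    (\sum_(k <- F | ~~ short k) graft_op (X s t) k * mcoeff k (Z s) -
     \sum_(k <- F | ~~ short k) graft_op (Y s t) k * mcoeff k (W s))); last first.
    by rewrite /I /Xi; ring.
  apply: le_trans (ler_normD _ _) _; apply: le_trans (lerD hb1 (ht1 s t)) _.
  rewrite forest_size1.
  have dth : dist s t `^ theta <= Lq 3 * dist s t `^ bweight 0.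
    have /andP[w0 w1] := bweight_bounds 0; have := theta_le2 => t2.
    apply: dist_weaken => //; last lra.
    by rewrite /bweight subn0 /theta lerDl ltW.
  have {}dth := ler_wpM2l (mulr_ge0 sw0 E0) dth.
  apply: le_trans (lerD dth (lexx _)) _.
  set D := dist s t `^ _.
  rewrite (_ : _ + _ = (c1 + cB * (K + 1) * sup_const A T alpha K 1 * Lq 3) * e * D); last first.
    by rewrite /c1; ring.
  rewrite ler_wpM2r ?powR_ge0 // ler_wpM2r //.
  have -> : int_const K = (c1 + cB * (K + 1) * sup_const A T alpha K 1 * Lq 3) +
     (1 + Lq 3 + cB * cB * (K + 1) * sup_const A T alpha K 1 * Lq 3).
    by rewrite cE /c2; ring.
  by rewrite lerDl !addr_ge0 // !mulr_ge0.
have [[m [mN hm]]|ne] := pselect (exists m, short m /\ h = fgraft a m); last first.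
  have hne m : short m -> h <> fgraft a m by move=> mN e'; apply: ne; exists m.
  rewrite (remainder_integral0 _ _ tZ hZ) // (remainder_integral0 _ _ tW hW) //.
  by rewrite subrr normr0 mulr_ge0.
have mN' : (forest_size m < N)%N by apply: leq_trans mN; rewrite addn2.
rewrite hm (remainder_integral_graft _ _ tZ hZ) // (remainder_integral_graft _ _ tW hW) //.
rewrite (_ : _ - _ = (remainder X Z m s t - remainder Y W m s t) +
    (\sum_(k <- F | ~~ short k) star (X s t) (fdelta R m) k * mcoeff k (Z s) -
     \sum_(k <- F | ~~ short k) star (Y s t) (fdelta R m) k * mcoeff k (W s))); last ring.
apply: le_trans (ler_normD _ _) _; apply: le_trans (lerD (hp2 m s t mN') (ht m s t)) _.
rewrite forest_size_graft; have [b0 ba] := andP hbeta.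
(* The tree [m]_a has one node more than [m], so a smaller exponent is required than the one
   available. *)
have dw : dist s t `^ bweight (forest_size m) <= Lq 3 * dist s t `^ bweight (forest_size m).+1.
  have /andP[w0 w1] := bweight_bounds (forest_size m).
  have /andP[w0' w1'] := bweight_bounds (forest_size m).+1.
  apply: dist_weaken => //; last lra.
  by rewrite /bweight ler_wpM2r ?(ltW b0) // ler_nat leq_sub2l.
apply: le_trans (lerD (ler_wpM2l e0 dw) (lexx _)) _.
set D := dist s t `^ _.
rewrite (_ : _ + _ = (Lq 3 + cB * cB * (K + 1) * sup_const A T alpha K 1 * Lq 3) * e * D); last ring.
rewrite ler_wpM2r ?powR_ge0 // ler_wpM2r //.
have -> : int_const K = (Lq 3 + cB * cB * (K + 1) * sup_const A T alpha K 1 * Lq 3) +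
   (1 + c1 + cB * (K + 1) * sup_const A T alpha K 1 * Lq 3).
  by rewrite cE /c2; ring.
by rewrite lerDl !addr_ge0 // !mulr_ge0.
Qed.

End IntegralEstimate.

(** * The fibre norm and the closure in terms of [pclose], and existence of the integral *)

Section ControlledNorm.
Variables (R : realType) (A : finType) (T : {posnum R}) (alpha : R).
Hypothesis halpha : 0 < alpha < 1.
Hypothesis halpha_inv : forall n : nat, (0 < n)%N -> alpha <> n%:R^-1.
Local Notation time := (time T).
Local Notation tv := (@time_val R T).
Local Notation dist s t := `|tv t - tv s|.
Local Notation H := (forest_alg R A).
Local Notation N := (level alpha).
Local Notation F := (forests_upto A N.-1).
Local Notation rp := (rough_path A T alpha).
Local Notation cpath := (time -> H).
Local Notation bw := (bweight alpha).
Implicit Types (s t u : time) (h k m : forest A) (X Y : rp) (Z W G : cpath) (b : R).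
Local Opaque pairing forest_vec fempty.

Let alpha0 : 0 < alpha. Proof. by case/andP: halpha. Qed.

Lemma controlled_norm_ge0 X b Z : (0 <= controlled_norm X b Z)%E.
Proof. by apply: sume_ge0 => h _; rewrite adde_ge0 ?lee_fin ?hoelder_seminorm_ge0. Qed.

(** Every forest contributes [e] twice, for the initial value and for the seminorm. As X and Y may
    differ, this transports norms between fibres. *)
Lemma pclose_controlled_norm X Y b Z W e : pclose (bw b) X Y Z W e ->
  (controlled_norm X b Z <= controlled_norm Y b W + ((2 * (size F)%:R) * e)%:E)%E.
Proof.
move=> [h1 h2]; have -> : ((2 * (size F)%:R) * e)%:E = (\sum_(h <- F) (e + e)%:E)%E.
  by rewrite sumEFin big_const_seq count_predT iter_addr_0 -mulr_natr; congr EFin; ring.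
rewrite -big_split /= /controlled_norm big_seq [leRHS]big_seq; apply: lee_sum => h.
rewrite (mem_F halpha) => hN; rewrite EFinD addeACA; apply: leeD.
  rewrite -EFinD lee_fin -lerBlDl; apply: le_trans (lerB_dist _ _) _; exact: h1.
apply: hoelder_seminorm_le => s t st.
have p0 : 0 < dist s t `^ ((N - forest_size h)%N%:R * b) by rewrite powR_gt0 // dist_gt0.
apply: (@le_trans _ _ ((`|remainder Y W h s t| / dist s t `^ ((N - forest_size h)%N%:R * b))%:E + e%:E)%E).
  rewrite -EFinD lee_fin ler_pdivrMr // mulrDl divfK ?gt_eqF // -lerBlDl.
  by apply: le_trans (lerB_dist _ _) _; exact: h2.
by apply: leeD => //; exact: le_hoelder_seminorm.
Qed.

Lemma controlled_norm0 X b : controlled_norm X b (fun=> 0) = 0%E.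
Proof.
rewrite /controlled_norm big1 // => h _; rewrite mcoeff0 normr0 add0e.
apply/eqP; rewrite eq_le hoelder_seminorm_ge0 andbT; apply: hoelder_seminorm_le => s t _.
by rewrite remainder0 normr0 mul0r.
Qed.

Lemma pbound_controlled_norm X b Z M : pbound (bw b) X Z M ->
  (controlled_norm X b Z <= ((2 * (size F)%:R) * M)%:E)%E.
Proof. by move=> /pclose_controlled_norm; rewrite controlled_norm0 add0e. Qed.

Lemma controlled_norm_pbound X b Z e : (controlled_norm X b Z <= e%:E)%E ->
  pbound (bw b) X Z e.
Proof.
move=> he; have term h : (forest_size h < N)%N ->
    (`|mcoeff h (Z (time0 T))|%:E + hoelder_seminorm ((N - forest_size h)%N%:R * b)
                        (remainder X Z h) <= e%:E)%E.
  rewrite -(mem_F halpha) => hF; apply: le_trans he.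
  rewrite /controlled_norm (bigD1_seq h) ?uniq_F //= leeDl //.
  by apply: sume_ge0 => k _; rewrite adde_ge0 ?lee_fin ?hoelder_seminorm_ge0.
apply/pboundP; split=> [h /term|h s t hN].
  by move=> th; rewrite -lee_fin; apply: le_trans th; rewrite leeDl // hoelder_seminorm_ge0.
have e0 : 0 <= e by rewrite -lee_fin; apply: le_trans he; exact: controlled_norm_ge0.
have [->|st] := eqVneq s t; first by rewrite remainder_tt normr0 mulr_ge0 ?powR_ge0.
apply: (hoelder_leP (f := remainder X Z h)) => //; apply: le_trans (term h hN).
by rewrite leeDr // lee_fin.
Qed.

Lemma controlled_norm_pclose X b Z W e :
  (controlled_norm X b (fun t => Z t - W t)%R < e%:E)%E -> pclose (bw b) X X Z W e.
Proof. by move=> /ltW /controlled_norm_pbound /pbound_sub. Qed.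

Lemma pclose_controlled_norm_sub X b Z W e : pclose (bw b) X X Z W e ->
  (controlled_norm X b (fun t => Z t - W t)%R <= ((2 * (size F)%:R) * e)%:E)%E.
Proof. by move=> h; apply: pbound_controlled_norm; apply/pbound_sub. Qed.

Lemma controlledP X Z : controlled X Z <-> truncated alpha Z /\
  exists M, pbound (bw alpha) X Z M.
Proof.
split=> -[tZ h]; split=> //; last first.
  by case: h => M /pbound_controlled_norm h; apply: le_lt_trans h (ltry _).
have := controlled_norm_ge0 X alpha Z; case E : (controlled_norm X alpha Z) h => [M| |] // _ _.
by exists M; apply: controlled_norm_pbound; rewrite E.
Qed.

Lemma bw_weaken X Y b Z W e : 0 < b <= alpha -> pclose (bw alpha) X Y Z W e ->
  pclose (bw b) X Y Z W (Lpow T 1 * e).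
Proof.
move=> hb; apply: (pclose_weaken halpha) => n nN.
have /andP[p0 p1] := @bweight_bounds _ _ alpha halpha halpha_inv (introT andP (conj alpha0 (lexx _))) n.
have /andP[q0 q1] := bweight_bounds halpha halpha_inv hb n.
by case/andP: hb => b0 ba; split=> //; rewrite ler_wpM2l.
Qed.

Lemma closureP b X Z : 0 < b <= alpha -> (controlled_closure b X Z <-> truncated alpha Z /\
  forall e, 0 < e -> exists2 Z', controlled X Z' & pclose (bw b) X X Z Z' e).
Proof.
move=> hb; split=> -[tZ h]; split=> // e e0.
  by have [Z' cZ' /controlled_norm_pclose hZ'] := h e e0; exists Z'.
have c0 : 0 < 2 * (size F)%:R + 1 :> R by rewrite ltr_wpDl // mulr_ge0.
have [Z' cZ' hZ'] := h (e / (2 * (size F)%:R + 1)) (divr_gt0 e0 c0); exists Z' => //.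
apply: le_lt_trans (pclose_controlled_norm_sub hZ') _; rewrite lte_fin.
by rewrite mulrA ltr_pdivrMr // mulrC ltr_pM2l // ltrDl.
Qed.

Lemma closure_bound b X Z : 0 < b <= alpha -> controlled_closure b X Z ->
  exists2 M, 0 <= M & pbound (bw b) X Z M.
Proof.
move=> hb /(closureP _ _ hb)[tZ /(_ 1 ltr01)[Z' /controlledP[_ [M hM]] hZ']].
have {hM}hM := bw_weaken hb hM; have h := pclose_trans hZ' hM.
by exists (1 + Lpow T 1 * M); [exact: (pclose_ge0 halpha h)|exact: h].
Qed.

Lemma pair_data_one b K X Z e : xbound X K -> 0 <= K -> truncated alpha Z ->
  pbound (bw b) X Z e -> pair_data (bw b) K X X Z (fun=> 0) e 0 0.
Proof.
move=> hX K0 tZ hZ; split; split=> //.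
- by move=> h s t _; rewrite subrr normr0 mul0r.
- by split=> [h _|h s t _]; rewrite subrr normr0 ?mul0r.
- by rewrite mul0r; exact: (pclose_ge0 halpha hZ).
- by move=> t h _; rewrite mcoeff0.
Qed.

Section Integral.
Variables (b : R) (a : A).
Hypothesis hb : 0 < b <= alpha.
Hypothesis hth : 1 < theta alpha b.

Lemma rough_integral_exists X Z : truncated alpha Z -> (exists M, pbound (bw b) X Z M) ->
  exists W, is_rough_integral a X Z W.
Proof.
move=> tZ [M hM]; have [K K1 hX] := xbound_exists X.
have K0 : 0 <= K by exact: le_trans ler01 K1.
have M0 := pclose_ge0 halpha hM.
have hs := integral_sew a halpha halpha_inv hb hth (pair_data_one hX K0 tZ hM).
have E0 : 0 <= cardB A alpha * ((K + 1) * Lpow T 3 * M).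
  rewrite mulr_ge0 ?cB_ge0 // mulr_ge0 // mulr_ge0 ?powR_ge0 // addr_ge0 //.
have [I hI] := sewing_exists hth E0 hs.
exists (fun t => I t *: forest_vec R one +
  \sum_(k <- F | (forest_size k + 2 <= N)%N) mcoeff k (Z t) *: forest_vec R (fgraft a k)).
have mE g t : mcoeff g (I t *: forest_vec R one + \sum_(k <- F | (forest_size k + 2 <= N)%N)
    mcoeff k (Z t) *: forest_vec R (fgraft a k)) = I t * (one == g)%:R +
    \sum_(k <- F | (forest_size k + 2 <= N)%N) mcoeff k (Z t) * (fgraft a k == g)%:R.
  rewrite -pairing_delta pairingD pairingZ pairing_vec pairing_sum; congr (_ + _).
  by apply: eq_bigr => k _; rewrite pairingZ pairing_vec.
split=> [t|h t hN|g t g1 gk].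
- rewrite mE eqxx mulr1 big1 ?addr0; last by move=> k _; rewrite (negbTE (fgraft_neq1 a k)) mulr0.
  have := hI t; congr (has_integral _ _ _ _); apply/funext => u; apply/funext => v.
  by rewrite (graft_germE a halpha) // pairing0 subr0.
- rewrite mE eq_sym (negbTE (fgraft_neq1 a h)) mulr0 add0r big_mkcond.
  rewrite (bigD1_seq h) ?uniq_F ?(mem_F halpha) //=; last by apply: leq_trans hN; rewrite addn2.
  rewrite hN eqxx mulr1 big1 ?addr0 // => k kh; case: ifP => // _.
  by case: eqP => [/fgraft_inj[_ e]|_]; [rewrite e eqxx in kh|rewrite mulr0].
rewrite mE; case: eqP => [e|_]; first by case: g1.
rewrite mulr0 add0r big1 // => k kN; case: eqP => [e|_]; last by rewrite mulr0.
by case: (gk k kN).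
Qed.

Lemma rough_integralB X Z Z' W W' : truncated alpha Z -> truncated alpha Z' ->
  is_rough_integral a X Z W -> is_rough_integral a X Z' W' ->
  is_rough_integral a X (fun t => Z t - Z' t) (fun t => W t - W' t).
Proof.
move=> tZ tZ' [h1 h2 h3] [k1 k2 k3]; split=> [t|h t hN|g t g1 gk].
- rewrite mcoeffB; have := has_integralB (time_ge0 t : tv (time0 T) <= tv t) (h1 t) (k1 t).
  congr (has_integral _ _ _ _); apply/funext => u; apply/funext => v.
  by rewrite -sumrB; apply: eq_bigr => k _; rewrite mcoeffB mulrBl.
- by rewrite !mcoeffB h2 // k2.
- by rewrite mcoeffB h3 // k3 // subrr.
Qed.

Lemma rough_integral_bound X Z W K M : 0 <= K -> xbound X K -> truncated alpha Z ->
  is_rough_integral a X Z W -> pbound (bw b) X Z M ->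
  pbound (bw b) X W (int_const A T alpha b K * M).
Proof.
move=> K0 hX tZ hW hM.
apply: (integral_estimate halpha halpha_inv hb hth (pair_data_one hX K0 tZ hM) hW).
split=> [t|h t _|g t _ _]; rewrite ?mcoeff0 //.
have := has_integral0 (time_ge0 t : tv (time0 T) <= tv t).
congr (has_integral _ _ _ _); apply/funext => u; apply/funext => v.
by rewrite big1 // => k _; rewrite mcoeff0 mul0r.
Qed.

End Integral.

End ControlledNorm.

Section IntegralClosure.
Variables (R : realType) (A : finType) (T : {posnum R}) (alpha beta : R) (a : A).
Hypothesis halpha : 0 < alpha < 1.
Hypothesis halpha_inv : forall n : nat, (0 < n)%N -> alpha <> n%:R^-1.
Hypothesis hb : 0 < beta <= alpha.
Hypothesis hth : 1 < theta alpha beta.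

(** Over a fixed X, integration preserves D^alpha and is bounded for the beta norm, hence it
    preserves the closure. Sewing with exponent N alpha + alpha is available for the approximants
    since beta <= alpha. *)
Lemma integral_closure (X : rough_path A T alpha) Z : controlled_closure beta X Z ->
  exists2 W, controlled_closure beta X W & is_rough_integral a X Z W.
Proof.
move=> cZ; have [M M0 hM] := closure_bound halpha halpha_inv hb cZ.
have [tZ apx] := (closureP halpha X Z hb).1 cZ.
have [W hW] := rough_integral_exists halpha halpha_inv a hb hth tZ (ex_intro _ M hM).
exists W => //; apply/(closureP halpha X W hb); split; first exact: (rough_integral_trunc halpha hW).
have [K K1 hX] := xbound_exists X; have K0 : 0 <= K by exact: le_trans ler01 K1.
have ha : 0 < alpha <= alpha by case/andP: halpha => -> _; rewrite lexx.
have htha : 1 < theta alpha alpha.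
  apply: lt_le_trans hth _; rewrite /theta lerD2r ler_wpM2l //; by case/andP: hb.
move=> e e0; pose c := Num.max (int_const A T alpha beta K) 1.
have c0 : 0 < c by rewrite lt_max ltr01 orbT.
have [Z' cZ' hZ'] := apx (e / c) (divr_gt0 e0 c0).
have [tZ' [M' hM']] := (controlledP halpha X Z').1 cZ'.
have [W' hW'] := rough_integral_exists halpha halpha_inv a ha htha tZ' (ex_intro _ M' hM').
exists W'.
  apply/(controlledP halpha); split; first exact: (rough_integral_trunc halpha hW').
  by eexists; exact: (rough_integral_bound halpha halpha_inv ha htha K0 hX tZ' hW' hM').
apply/pbound_sub; have hd := rough_integralB tZ tZ' hW hW'.
have tD : truncated alpha (fun t => Z t - Z' t).
  by move=> t h hN; rewrite mcoeffB tZ // tZ' // subrr.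
have {}hZ' := (pbound_sub _ _ _ _ _).2 hZ'.
have := rough_integral_bound halpha halpha_inv hb hth K0 hX tD hd hZ'.
apply: pclose_le; rewrite mulrA ler_pdivrMr // mulrC ler_wpM2l // ?(ltW e0) //.
by rewrite le_max lexx.
Qed.

End IntegralClosure.

(** * Smooth functions, little Hoelder spaces and interpolation *)

Section SmoothFunctions.
Variables (R : realType) (T : {posnum R}).
Local Notation time := (time T).
Local Notation tv := (@time_val R T).
Local Notation dist s t := `|tv t - tv s|.
Implicit Types (f g : time -> R) (s t u : time).

Lemma derivative_onP f g : derivative_on f g <->
  forall t e, 0 < e -> exists2 d, 0 < d & forall s, s != t -> dist t s < d ->
    `|g t - (f s - f t) / (tv s - tv t)| < e.
Proof.
split=> h t.
  move=> e e0; have /cvgrPdist_lt/(_ e e0) := h t.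
  rewrite near_withinE => /nbhs_ballP[d /= d0 hd]; exists d => // s st sd.
  apply: hd => //; change (`|tv t - tv s| < d); by rewrite distrC.
apply/cvgrPdist_lt => e e0; have [d d0 hd] := h t e e0.
rewrite near_withinE; apply/nbhs_ballP; exists d => // s sd st; apply: hd => //.
by rewrite distrC.
Qed.

Lemma derivative_on_R (F G : R -> R) : (forall x : R, is_derive x (1 : R) F (G x)) ->
  derivative_on (F \o tv) (G \o tv).
Proof.
move=> hF; apply/derivative_onP => t e e0.
have [dF eG] := hF (tv t); have /cvgrPdist_lt/(_ e e0) := dF; rewrite /= -eG.
rewrite near_withinE => /nbhs_ballP[d /= d0 hd]; exists d => // s st sd.
have st0 : tv s - tv t != 0 by rewrite subr_eq0; apply: contra_neq st => /time_val_inj.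
have := hd (tv s - tv t); rewrite /ball /= sub0r normrN => /(_ sd st0).
rewrite /= [_ *: 1]mulr1 subrK /GRing.scale /= mulrC.
by [].
Qed.

Lemma derivative_on_lin (c : R) f f' g g' : derivative_on f f' -> derivative_on g g' ->
  derivative_on (fun t => c * f t + g t) (fun t => c * f' t + g' t).
Proof.
move=> hf hg t; rewrite (_ : (fun s => _) = (fun s => c * ((f s - f t) / (tv s - tv t)) +
  (g s - g t) / (tv s - tv t))).
  by apply: cvgD; [apply: cvgM; [exact: cvg_cst|exact: hf]|exact: hg].
by apply/funext => s; rewrite mulrA -mulrDl; congr (_ / _); ring.
Qed.

Lemma smooth_lin (c : R) f g : smooth f -> smooth g -> smooth (fun t => c * f t + g t).
Proof.
move=> [D [D0 hD]] [E [E0 hE]]; exists (fun n t => c * D n t + E n t); split.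
  by rewrite D0 E0.
by move=> n; exact: derivative_on_lin.
Qed.

Lemma smooth_R (D : nat -> R -> R) : (forall n x, is_derive x (1 : R) (D n) (D n.+1 x)) ->
  smooth (D 0%N \o tv).
Proof.
by move=> h; exists (fun n => D n \o tv); split=> // n; apply: derivative_on_R => x; exact: h.
Qed.

Lemma smooth_poly (p : {poly R}) : smooth (fun t => p.[tv t]).
Proof.
pose D n x := p^`(n).[x].
have -> : (fun t => p.[tv t]) = D 0%N \o tv by apply/funext => t; rewrite /D derivn0.
by apply: smooth_R => n x; rewrite /D derivnS; exact: is_derive_poly.
Qed.

(** Compactness in the form of Cousin's lemma: a property of intervals that is additive and holds
    near each point holds on [a, b]. It replaces extreme and mean value theorems for functions on
    the subtype [time]. *)
Lemma cousin (Q : R -> R -> Prop) (a b : R) : a <= b ->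
  (forall x y z, a <= x <= y -> y <= z <= b -> Q x y -> Q y z -> Q x z) ->
  (forall c, a <= c <= b -> exists2 d, 0 < d & forall x y, a <= x <= c -> c <= y <= b ->
     c - x < d -> y - c < d -> Q x y) -> Q a b.
Proof.
move=> ab add loc; pose S := [set x : R | a <= x <= b /\ Q a x].
have [d0 d00 hd0] := loc a (introT andP (conj (lexx a) ab)).
have Sa : S a by split; [rewrite lexx|apply: hd0; rewrite ?lexx ?ab // subrr].
have hS : has_sup S by split; [exists a|exists b => x [/andP[]]].
pose c := sup S.
have ac : a <= c by exact: (ub_le_sup hS.2 Sa).
have cb : c <= b by apply: sup_le_ub; [exists a|move=> x [/andP[]]].
have [d d1 hd] := loc c (introT andP (conj ac cb)).
have [x [/andP[ax xb] Qx] cx] := sup_adherent d1 hS.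
have xc : x <= c by apply: (ub_le_sup hS.2); split=> //; rewrite ax.
have ext y : c <= y -> y <= b -> y - c < d -> Q a y.
  move=> cy yb yd; apply: (add a x y); rewrite ?lexx ?ax ?yb ?(le_trans xc) //.
  by apply: hd; rewrite ?ax ?xc ?cy ?yb //; move: cx; rewrite -/c; lra.
have [cb'|bc] := ltP c b; last by apply: ext => //; move: bc cb d1; lra.
pose y := Num.min b (c + d / 2).
have cy : c < y by rewrite lt_min cb' ltrDl divr_gt0.
have yb : y <= b by rewrite ge_min lexx.
have yd : y - c < d.
  have : y <= c + d / 2 by rewrite ge_min lexx orbT.
  by move: d1; lra.
have : S y by split; [rewrite yb (le_trans ac) // ltW|apply: ext => //; exact: ltW].
by move=> /(ub_le_sup hS.2); rewrite -/c leNgt cy.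
Qed.

(** [cousin] is used twice: the derivative is bounded because it is differentiable in turn, and the
    increments of [f] are at most M + 1 times the length because this holds near each point and is
    additive. *)
Lemma smooth_lipschitz f : smooth f -> exists2 M, 0 <= M &
  forall s t, `|f t - f s| <= M * dist s t.
Proof.
move=> [D [D0 hD]]; have hf := hD 0%N; rewrite D0 in hf; set g := D 1%N in hf.
have hg : derivative_on g (D 2%N) by exact: hD.
have T0 : 0 <= T%:num by exact: ltW.
have [M hM] : exists M, forall t, `|g t| <= M.
  have : exists M, forall t, 0 <= tv t <= T%:num -> `|g t| <= M.
    apply: (@cousin (fun x y => exists M, forall t, x <= tv t <= y -> `|g t| <= M) _ _ T0).
      move=> x y z _ _ [M1 h1] [M2 h2]; exists (Num.max M1 M2) => t /andP[xt tz].
      have [ty|/ltW yt] := leP (tv t) y.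
        by rewrite le_max h1 ?xt.
      by rewrite le_max h2 ?yt ?orbT.
    move=> c c0T; pose tc := mktime T c; have ec : tv tc = c by exact: mktimeE.
    have [d d0 hd] := (derivative_onP _ _).1 hg tc 1 ltr01; exists d => // x y.
    move=> /andP[x0 xc] /andP[cy yT] cxd ycd.
    exists (`|g tc| + (`|D 2%N tc| + 1) * d) => t /andP[xt ty].
    have [->|tne] := eqVneq t tc.
      by rewrite lerDl mulr_ge0 ?(ltW d0) // addr_ge0.
    have td : dist tc t < d by rewrite ec ltr_norml; apply/andP; split; lra.
    have {hd} := hd t tne td.
    have n0 : tv t - tv tc != 0 by rewrite subr_eq0; apply: contra_neq tne => /time_val_inj.
    set q := (g t - g tc) / (tv t - tv tc) => hq.
    have -> : g t = g tc + q * (tv t - tv tc) by rewrite /q divfK // subrKC.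
    apply: le_trans (ler_normD _ _) _; rewrite lerD2l normrM.
    apply: ler_pM => //; last exact: ltW.
    rewrite -[q](subKr (D 2%N tc)); apply: le_trans (ler_normB _ _) _.
    by rewrite lerD2l ltW.
  by move=> [M hM]; exists M => t; apply: hM; rewrite time_ge0 time_leT.
have M0 : 0 <= M by apply: le_trans (hM (time0 T)).
exists (M + 1); first by rewrite addr_ge0.
have le s t : tv s <= tv t -> `|f t - f s| <= (M + 1) * (tv t - tv s).
  move=> st; rewrite -{1}[s]mktimeK -{1}[t]mktimeK.
  apply: (@cousin (fun x y => `|f (mktime T y) - f (mktime T x)| <= (M + 1) * (y - x)) _ _ st).
    move=> x y z _ _ h1 h2; rewrite -(subrKA (f (mktime T y))).
    apply: le_trans (ler_normD _ _) _; apply: le_trans (lerD h2 h1) _.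
    by rewrite -mulrDr subrKA.
  move=> c /andP[sc ct]; pose tc := mktime T c.
  have c0T : 0 <= c <= T%:num by rewrite (le_trans (time_ge0 s)) // (le_trans ct) // time_leT.
  have ec : tv tc = c by exact: mktimeE.
  have [d d0 hd] := (derivative_onP _ _).1 hf tc 1 ltr01; exists d => // x y.
  move=> /andP[sx xc] /andP[cy yt] cxd ycd.
  have near u : dist tc u < d -> `|f u - f tc| <= (M + 1) * dist tc u.
    move=> ud; have [->|une] := eqVneq u tc; first by rewrite !subrr normr0 mulr0.
    have n0 : tv u - tv tc != 0 by rewrite subr_eq0; apply: contra_neq une => /time_val_inj.
    have := hd u une ud; set q := (f u - f tc) / (tv u - tv tc) => hq.
    have -> : f u - f tc = q * (tv u - tv tc) by rewrite /q divfK.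
    rewrite normrM ler_wpM2r // -[q](subKr (g tc)); apply: le_trans (ler_normB _ _) _.
    by apply: lerD => //; exact: ltW.
  have ex : tv (mktime T x) = x.
    by apply: mktimeE; rewrite (le_trans (time_ge0 s)) // (le_trans xc) //; case/andP: c0T.
  have ey : tv (mktime T y) = y.
    by apply: mktimeE; rewrite (le_trans _ cy) ?(le_trans yt) ?time_leT //; case/andP: c0T.
  have h1 := near (mktime T x); have h2 := near (mktime T y).
  rewrite ex ec ler0_norm ?subr_le0 // opprB in h1; rewrite ey ec ger0_norm ?subr_ge0 // in h2.
  rewrite -(subrKA (f tc)) -[y - x](subrKA c) mulrDr; apply: le_trans (ler_normD _ _) _.
  by apply: lerD; [exact: h2|rewrite distrC; exact: h1].
move=> s t; have [st|/ltW ts] := leP (tv s) (tv t).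
  by rewrite [X in _ * X]ger0_norm ?subr_ge0 //; exact: le.
by rewrite distrC [X in _ * X]distrC [X in _ * X]ger0_norm ?subr_ge0 //; exact: le.
Qed.

End SmoothFunctions.

(** * Smooth approximation of the ramp max(x, 0) *)

Section Softplus.
Variables (R : realType) (eta : R).
Hypothesis eta0 : 0 < eta.

(** Within [eta] of max(x, 0) and with slope between 0 and 1. Ramps are the building blocks of
    piecewise linear functions, so this puts the latter into the little Hoelder space. *)
Definition softplus (x : R) : R := eta * ln (1 + expR (x / eta)).

Let v (x : R) : R := (1 + expR (x / eta))^-1.

Let e_gt0 (x : R) : 0 < 1 + expR (x / eta).
Proof. by rewrite addr_gt0 // expR_gt0. Qed.

Let is_derive_e (x : R) : is_derive x (1 : R) (fun x => 1 + expR (x / eta)) (expR (x / eta) / eta).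
Proof.
have d1 : is_derive x (1 : R) (fun y : R => y / eta) (eta^-1).
  rewrite (_ : (fun y => _) = eta^-1 *: (@id R)); last by apply/funext => y; rewrite /= mulrC.
  by apply: is_derive_eq; rewrite /GRing.scale /= mulr1.
have d2 : is_derive x (1 : R) (fun y => expR (y / eta)) (expR (x / eta) / eta).
  exact: (@is_derive1_comp _ expR (fun y : R => y / eta) x _ _ _ d1).
have d3 : is_derive x (1 : R) ((cst (1 : R) : R -> R) + (fun y : R => expR (y / eta)))
    (0 + expR (x / eta) / eta) by exact: is_deriveD.
by rewrite add0r in d3.
Qed.

Lemma is_derive_softplus (x : R) : is_derive x (1 : R) softplus (1 - v x).
Proof.
have d1 : is_derive x (1 : R) ((@ln R) \o (fun y => 1 + expR (y / eta)))
    ((1 + expR (x / eta))^-1 * (expR (x / eta) / eta)).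
  by apply: is_derive1_comp; [exact: is_derive1_ln|exact: is_derive_e].
have d2 : is_derive x (1 : R) (eta *: ((@ln R) \o (fun y => 1 + expR (y / eta))) : R -> R) _ := is_deriveZ _ d1.
refine (is_derive_eq d2 _); rewrite /v /GRing.scale /=.
have := e_gt0 x; set E := expR _ => E1; field.
by rewrite (gt_eqF E1) (gt_eqF eta0).
Qed.

Let is_derive_v (x : R) : is_derive x (1 : R) v (- eta^-1 * (v x - v x ^+ 2)).
Proof.
have d := @is_deriveV _ (fun y => 1 + expR (y / eta)) x _ 1 (lt0r_neq0 (e_gt0 x)) (is_derive_e x).
refine (is_derive_eq d _); rewrite /v /GRing.scale /=.
have := e_gt0 x; set E := expR _ => E1; field.
by rewrite (gt_eqF E1) (gt_eqF eta0).
Qed.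

(* The derivatives of softplus are polynomials in the logistic function. *)
Fixpoint sp_poly n : {poly R} :=
  if n is m.+1 then (- eta^-1) *: ((sp_poly m)^`() * ('X - 'X ^+ 2)) else 1 - 'X.

Definition sp_deriv n (x : R) : R := if n is m.+1 then (sp_poly m).[v x] else softplus x.

Lemma is_derive_sp n x : is_derive x (1 : R) (sp_deriv n) (sp_deriv n.+1 x).
Proof.
case: n => [|n].
  refine (is_derive_eq (is_derive_softplus x) _).
  by rewrite /= !hornerE.
have d : is_derive x (1 : R) (horner (sp_poly n) \o v)
    ((sp_poly n)^`().[v x] * (- eta^-1 * (v x - v x ^+ 2))).
  by have dv := is_derive_v x; exact: is_derive1_comp.
refine (is_derive_eq d _); rewrite /= hornerZ hornerM hornerD hornerN hornerXn hornerX; ring.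
Qed.

Lemma softplus_incr x y : x <= y -> 0 <= softplus y - softplus x <= y - x.
Proof.
move=> xy; rewrite /softplus -mulrBr mulr_ge0 ?(ltW eta0) ?subr_ge0 //=; last first.
  rewrite ler_ln ?posrE // lerD2l ler_expR ler_wpM2r // invr_ge0; exact: ltW.
rewrite [leRHS](_ : _ = eta * ((y - x) / eta)); last by rewrite mulrC divfK ?gt_eqF.
rewrite ler_pM2l // lerBlDr -[(y - x) / eta]expRK -lnM ?posrE ?expR_gt0 //.
rewrite ler_ln ?posrE ?mulr_gt0 ?expR_gt0 // mulrDr mulr1 -expRD -mulrDl subrK lerD2r.
by rewrite -expR0 ler_expR divr_ge0 ?subr_ge0 // ltW.
Qed.

Lemma softplus_max x : 0 <= softplus x - Num.max x 0 <= eta.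
Proof.
have ln1 (y : R) : 0 <= y -> 0 <= eta * ln (1 + expR (- y / eta)) <= eta.
  move=> y0; rewrite mulr_ge0 ?(ltW eta0) ?ln_ge0 ?lerDl ?expR_ge0 //=.
  rewrite ger_pMr //; apply: le_trans (le_ln1Dx _) _.
    by apply: lt_trans (expR_gt0 _); rewrite oppr_lt0.
  by rewrite -expR0 ler_expR mulNr oppr_le0 divr_ge0 // ltW.
have [x0|x0] := leP x 0.
  by rewrite subr0 -[x]opprK; apply: ln1; rewrite oppr_ge0.
have -> : softplus x - x = eta * ln (1 + expR (- x / eta)); last by apply: ln1; exact: ltW.
rewrite /softplus.
have -> : 1 + expR (x / eta) = expR (x / eta) * (1 + expR (- x / eta)).
  by rewrite mulrDr mulr1 -expRD mulNr subrr expR0 addrC.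
rewrite lnM ?posrE ?expR_gt0 ?addr_gt0 ?expR_gt0 // expRK mulrDr mulrCA divff ?gt_eqF //.
by rewrite mulr1 addrC addKr.
Qed.

End Softplus.

Section LittleHoelder.
Variables (R : realType) (T : {posnum R}).
Local Notation time := (time T).
Local Notation tv := (@time_val R T).
Local Notation dist s t := `|tv t - tv s|.
Implicit Types (f g : time -> R) (s t u : time) (kappa : R).

Lemma hoelder_norm_lt kappa f (e : R) : (hoelder_norm kappa f < e%:E)%E ->
  (forall t, `|f t| <= e) /\ forall s t, `|f t - f s| <= e * dist s t `^ kappa.
Proof.
move=> /ltW he.
have s0 : (0 <= ereal_sup [set `|f t|%:E | t in setT])%E.
  apply: (@le_trans _ _ `|f (time0 T)|%:E); first by rewrite lee_fin.
  by apply: ereal_sup_ubound; exists (time0 T).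
have h0 := hoelder_seminorm_ge0 kappa (fun s t => f t - f s).
have e0 : 0 <= e by rewrite -lee_fin; apply: le_trans he; exact: adde_ge0.
split=> [t|s t].
  rewrite -lee_fin; apply: le_trans he; apply: le_trans (leeDl _ h0).
  by apply: ereal_sup_ubound; exists t.
have [->|st] := eqVneq s t; first by rewrite !subrr normr0 mulr_ge0 ?powR_ge0.
apply: (hoelder_leP (f := fun s t => f t - f s)) => //.
by apply: le_trans he; exact: leeDr.
Qed.

Lemma hoelder_norm_ge kappa f (e : R) : (forall t, `|f t| <= e) ->
  (forall s t, `|f t - f s| <= e * dist s t `^ kappa) -> (hoelder_norm kappa f <= (e + e)%:E)%E.
Proof.
move=> h1 h2; rewrite EFinD; apply: leeD; last by apply: hoelder_geP => s t _; exact: h2.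
by apply: ge_ereal_sup => _ [t _ <-]; rewrite lee_fin.
Qed.

Definition happrox kappa f g (e : R) := (forall t, `|f t - g t| <= e) /\
  forall s t, `|(f t - g t) - (f s - g s)| <= e * dist s t `^ kappa.

Lemma little_hoelderP kappa f : little_hoelder kappa f <->
  forall e, 0 < e -> exists2 g, smooth g & happrox kappa f g e.
Proof.
split=> h e e0.
  by have [g sg /hoelder_norm_lt hg] := h e e0; exists g.
(* The supremum and the seminorm take e / 3 each; the rest keeps the inequality strict. *)
have e3 : 0 < e / 3 by rewrite divr_gt0.
have [g sg [h1 h2]] := h _ e3; exists g => //.
by apply: le_lt_trans (hoelder_norm_ge h1 h2) _; rewrite lte_fin; lra.
Qed.

Lemma little_hoelder_lin kappa (c : R) f g : little_hoelder kappa f -> little_hoelder kappa g ->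
  little_hoelder kappa (fun t => c * f t + g t).
Proof.
move=> /little_hoelderP hf /little_hoelderP hg; apply/little_hoelderP => e e0.
have c1 : 0 < `|c| + 1 by rewrite ltr_wpDl.
pose d := e / 2 / (`|c| + 1).
have d0 : 0 < d by rewrite !divr_gt0.
have de : `|c| * d + d = e / 2 by rewrite -[X in _ + X]mul1r -mulrDl /d mulrC divfK // gt_eqF.
have [f' sf [f1 f2]] := hf d d0; have [g' sg [g1 g2]] := hg (e / 2) (divr_gt0 e0 (ltr0n _ 2)).
have cd : `|c| * d <= e / 2 by rewrite -de lerDl ltW.
exists (fun t => c * f' t + g' t); first exact: smooth_lin.
split=> [t|s t].
  rewrite (_ : _ - _ = c * (f t - f' t) + (g t - g' t)); last ring.
  apply: le_trans (ler_normD _ _) _; rewrite normrM [e]splitr.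
  by apply: lerD => //; apply: le_trans cd; rewrite ler_wpM2l.
rewrite (_ : _ - _ = c * ((f t - f' t) - (f s - f' s)) + ((g t - g' t) - (g s - g' s))); last ring.
apply: le_trans (ler_normD _ _) _; rewrite normrM [e]splitr mulrDl.
apply: lerD => //; apply: le_trans (ler_wpM2l (normr_ge0 c) (f2 s t)) _.
by rewrite mulrA ler_wpM2r ?powR_ge0.
Qed.

Lemma smooth_little_hoelder kappa f : smooth f -> little_hoelder kappa f.
Proof.
move=> sf; apply/little_hoelderP => e e0; exists f => //; split=> [t|s t].
  by rewrite subrr normr0 ltW.
by rewrite !subrr normr0 mulr_ge0 ?powR_ge0 // ltW.
Qed.

Lemma smooth_cst (c : R) : smooth (fun _ : time => c).
Proof. by have := smooth_poly T c%:P; congr smooth; apply/funext => t; rewrite hornerC. Qed.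

Lemma little_hoelder_sum kappa I (r : seq I) (c : I -> R) (f : I -> time -> R) :
  (forall i, little_hoelder kappa (f i)) ->
  little_hoelder kappa (fun t => \sum_(i <- r) c i * f i t).
Proof.
move=> hf; elim: r => [|i r IH].
  under eq_fun do rewrite big_nil.
  exact/smooth_little_hoelder/smooth_cst.
under eq_fun do rewrite big_cons.
exact: little_hoelder_lin.
Qed.

Lemma little_hoelder_max kappa (c : R) : 0 < kappa < 1 ->
  little_hoelder kappa (fun t : time => Num.max (tv t - c) 0).
Proof.
move=> /andP[k0 k1]; apply/little_hoelderP => e e0.
have k1' : 0 < 1 - kappa by rewrite subr_gt0.
have [d d0 hd] := small_powR k1' ler01 e0; rewrite mul1r in hd.
pose eta := Num.min e d.
have eta0 : 0 < eta by rewrite lt_min e0.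
pose g := fun t : time => softplus eta (tv t - c).
exists g.
  rewrite (_ : g = (fun x => softplus eta (x - c)) \o tv) //.
  rewrite (_ : (fun x => softplus eta (x - c)) = (fun x => sp_deriv eta 0 (x - c))) //.
  apply: (@smooth_R _ _ (fun n x => sp_deriv eta n (x - c))) => n x.
  have d1 : is_derive x (1 : R) (fun y : R => y - c) 1.
    have df : is_derive x (1 : R) ((@id R : R -> R) - (cst c : R -> R)) (1 - 0) by exact: is_deriveB.
    by rewrite subr0 in df.
  have dg : is_derive x (1 : R) (sp_deriv eta n \o (fun y : R => y - c))
      (sp_deriv eta n.+1 (x - c) * 1).
    by have dsp := is_derive_sp eta0 n (x - c); exact: is_derive1_comp.
  by refine (is_derive_eq dg _); rewrite mulr1.
have ge t : - eta <= Num.max (tv t - c) 0 - g t <= 0.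
  by have := softplus_max eta0 (tv t - c); rewrite -/(g t); lra.
have le s t : tv s <= tv t ->
   `|(Num.max (tv t - c) 0 - g t) - (Num.max (tv s - c) 0 - g s)| <= e * dist s t `^ kappa.
  move=> st.
  have m1 : 0 <= Num.max (tv t - c) 0 - Num.max (tv s - c) 0 <= tv t - tv s.
    by rewrite !maxElt; case: ifP; case: ifP; lra.
  have g1 : 0 <= g t - g s <= tv t - tv s.
    have := @softplus_incr _ _ eta0 (tv s - c) (tv t - c); rewrite /g lerD2r st.
    by move=> /(_ isT); rewrite (_ : tv t - c - (tv s - c) = tv t - tv s) //; ring.
  have gt := ge t; have gs := ge s; set x := _ - _ - (_ - _).
  have x1 : `|x| <= eta by rewrite /x ler_norml; apply/andP; split; lra.
  have x2 : `|x| <= dist s t.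
    by rewrite (ger0_norm (_ : 0 <= tv t - tv s)) ?subr_ge0 // /x ler_norml; apply/andP; split; lra.
  (* Interpolation: the factor with exponent 1 - kappa is small since |x| <= eta, the other is
     controlled by |x| <= |t - s|. *)
  have -> : `|x| = `|x| `^ (1 - kappa) * `|x| `^ kappa.
    by rewrite -powRDge0 ?(ltW k1') ?(ltW k0) // subrK powRr1.
  apply: ler_pM; rewrite ?powR_ge0 //; last by apply: le_powR => //; exact: ltW.
  apply: le_trans (ltW hd); apply: le_powR; [exact: ltW|exact: normr_ge0|].
  by apply: le_trans x1 _; rewrite ge_min lexx orbT.
split=> [t|s t].
  have := ge t; have : eta <= e by rewrite ge_min lexx.
  by move=> ? ?; rewrite ler_norml; apply/andP; split; lra.
have [st|/ltW ts] := leP (tv s) (tv t); first exact: le.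
by rewrite distrC [dist s t]distrC; exact: le.
Qed.

Lemma little_hoelder_bound kappa f : 0 < kappa <= 1 -> little_hoelder kappa f ->
  exists2 C, 0 <= C & forall s t, `|f t - f s| <= C * dist s t `^ kappa.
Proof.
move=> /andP[k0 k1] /little_hoelderP /(_ 1 ltr01)[g /smooth_lipschitz[M M0 hM] [_ hg]].
exists (1 + M * Lpow T 1); first by rewrite addr_ge0 // mulr_ge0 ?powR_ge0.
move=> s t; rewrite (_ : _ - _ = (f t - g t - (f s - g s)) + (g t - g s)); last ring.
apply: le_trans (ler_normD _ _) _; rewrite mulrDl; apply: lerD; first exact: hg.
apply: le_trans (hM s t) _; rewrite -mulrA ler_wpM2l //.
have := @dist_weaken _ _ s t 1 kappa 1 (ltW k0) k1 (lexx 1).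
by rewrite powRr1.
Qed.

Section Interpolation.
Variable n : nat.
Let delta : R := T%:num / n.+1%:R.
Definition grid i : time := mktime T (delta * i%:R).

Let n0 : 0 < n.+1%:R :> R. Proof. by rewrite ltr0n. Qed.
Let delta0 : 0 < delta. Proof. by rewrite divr_gt0. Qed.

Lemma gridE i : (i <= n.+1)%N -> tv (grid i) = delta * i%:R.
Proof.
move=> ni; apply: mktimeE; rewrite mulr_ge0 ?(ltW delta0) //=.
by rewrite /delta mulrAC ler_pdivrMr // ler_wpM2l // ler_nat.
Qed.

Lemma grid0 : grid 0 = time0 T.
Proof. by apply: time_val_inj; rewrite gridE // mulr0. Qed.

Lemma gridS i : (i <= n)%N -> tv (grid i.+1) - tv (grid i) = delta.
Proof.
move=> ni; rewrite !gridE //; last exact: leqW.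
have -> : i.+1%:R = i%:R + 1 :> R by rewrite -addn1 natrD.
ring.
Qed.

(** Written as a sum of ramps and not by cases, so that regularity follows from [little_hoelder_max]
    by linearity. *)
Definition interp (F : time -> R) (t : time) : R := F (grid 0) +
  \sum_(0 <= i < n.+1) ((F (grid i.+1) - F (grid i)) / delta) *
    (Num.max (tv t - delta * i%:R) 0 - Num.max (tv t - delta * i.+1%:R) 0).

Lemma little_hoelder_interp kappa F : 0 < kappa < 1 -> little_hoelder kappa (interp F).
Proof.
move=> hk; rewrite (_ : interp F = (fun t => 1 * (\sum_(0 <= i < n.+1)
  ((F (grid i.+1) - F (grid i)) / delta) *
    (-1 * Num.max (tv t - delta * i.+1%:R) 0 + Num.max (tv t - delta * i%:R) 0)) + F (grid 0))).
  apply: little_hoelder_lin; last exact/smooth_little_hoelder/smooth_cst.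
  apply: little_hoelder_sum => i; apply: little_hoelder_lin; exact: little_hoelder_max.
apply/funext => t; rewrite /interp mul1r addrC; congr (_ + _).
by apply: eq_bigr => i _; rewrite mulN1r [- _ + _]addrC.
Qed.

Lemma interp_cell F i t : (i <= n)%N -> tv (grid i) <= tv t <= tv (grid i.+1) ->
  interp F t = F (grid i) + (F (grid i.+1) - F (grid i)) * ((tv t - tv (grid i)) / delta).
Proof.
move=> ni; move=> /andP[it ti]; rewrite /interp (@big_cat_nat _ _ _ i) //=; last exact: leqW.
rewrite [X in _ + (_ + X)]big_ltn ?ltnS //.
have gi := gridE (leqW ni); have giS := gridE (ni : (i.+1 <= n.+1)%N).
rewrite gi in it *; rewrite giS in ti.
(* Over the earlier cells both ramps are positive and differ by [delta]; the sum telescopes. Over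
   the later cells both vanish. *)
have -> : \sum_(0 <= j < i) ((F (grid j.+1) - F (grid j)) / delta) *
    (Num.max (tv t - delta * j%:R) 0 - Num.max (tv t - delta * j.+1%:R) 0) = F (grid i) - F (grid 0).
  rewrite -(telescope_sumr (fun j => F (grid j))) //; apply: eq_big_nat => j /andP[_ ji].
  have jS : delta * j.+1%:R <= tv t.
    by apply: le_trans it; rewrite ler_wpM2l ?(ltW delta0) // ler_nat.
  have j0 : delta * j%:R <= tv t.
    by apply: le_trans jS; rewrite ler_wpM2l ?(ltW delta0) // ler_nat.
  rewrite !max_l ?subr_ge0 // (_ : tv t - _ - (tv t - _) = delta); first by rewrite divfK // gt_eqF.
  have -> : j.+1%:R = j%:R + 1 :> R by rewrite -addn1 natrD.
  ring.
have -> : \sum_(i.+1 <= j < n.+1) ((F (grid j.+1) - F (grid j)) / delta) *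
    (Num.max (tv t - delta * j%:R) 0 - Num.max (tv t - delta * j.+1%:R) 0) = 0.
  apply: big1_seq => j /=; rewrite mem_index_iota => /andP[ij _].
  have j0 : tv t <= delta * j%:R.
    by apply: le_trans ti _; rewrite ler_wpM2l ?(ltW delta0) // ler_nat.
  have jS : tv t <= delta * j.+1%:R.
    by apply: le_trans j0 _; rewrite ler_wpM2l ?(ltW delta0) // ler_nat.
  by rewrite !max_r ?subr_le0 // subrr mulr0.
rewrite max_l ?subr_ge0 // max_r ?subr_le0 //; ring.
Qed.

Lemma grid_cell t : exists2 i, (i <= n)%N & tv (grid i) <= tv t <= tv (grid i.+1).
Proof.
(* The minimum matters for t = T, whose quotient is n + 1. *)
pose i := minn n (Num.truncn (tv t / delta)).
have q0 : 0 <= tv t / delta by rewrite divr_ge0 ?time_ge0 // ltW.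
have ni : (i <= n)%N by exact: geq_minl.
exists i => //; rewrite !gridE //; last exact: leqW.
apply/andP; split.
  rewrite mulrC -ler_pdivlMr //; apply: le_trans (_ : (Num.truncn (tv t / delta))%:R <= _).
    by rewrite ler_nat geq_minr.
  by rewrite truncn_le.
rewrite mulrC -ler_pdivrMr //; rewrite /i /minn; case: ifP => _; last exact/ltW/truncnS_gt.
have e : delta * n.+1%:R = T%:num by rewrite /delta divfK // gt_eqF.
by rewrite ler_pdivrMr // mulrC e time_leT.
Qed.

End Interpolation.
End LittleHoelder.

(** * The sections Gamma *)

Section Levels.
Variables (R : realType) (A : finType) (T : {posnum R}) (alpha : R).
Variable (P : set (forest_alg R A)).
Hypothesis halpha : 0 < alpha < 1.
Hypothesis halpha_inv : forall n : nat, (0 < n)%N -> alpha <> n%:R^-1.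
Hypothesis hP : primitive_basis P.
Local Notation time := (time T).
Local Notation H := (forest_alg R A).
Local Notation N := (level alpha).
Local Notation F := (forests_upto A N.-1).
Local Notation rp := (rough_path A T alpha).
Local Notation cpath := (time -> H).
Implicit Types (s t u : time) (h k m : forest A) (X Y : rp) (Z W G : cpath).
Local Opaque ftop pairing forest_vec fempty psi.

Let alpha0 : 0 < alpha. Proof. by case/andP: halpha. Qed.

Definition prim_set h : set H := [set p | P p /\ (hdeg p + forest_size h < N)%N].

Lemma finite_prim_set h : finite_set (prim_set h).
Proof.
apply: sub_finite_set (finite_P hP N) => p [Pp pN]; split=> //.
by apply: leq_trans (ltnW pN); exact: leq_addr.
Qed.

Definition prim_seq h : seq H := fset_set (prim_set h).

Lemma mem_prim_seq h p : p \in prim_seq h <-> P p /\ (hdeg p + forest_size h < N)%N.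
Proof.
have fs := finite_prim_set h; rewrite /prim_seq in_fset_set //; split.
  by rewrite inE.
by move=> hp; rewrite inE.
Qed.

Lemma prim_sumE h (f : H -> R) : \sum_(p \in prim_set h) f p = \sum_(p <- prim_seq h) f p.
Proof. by have fs := finite_prim_set h; rewrite fsbig_finite. Qed.

Lemma prim_seq_nil h : (forest_size h).+1 = N -> prim_seq h = [::].
Proof.
move=> hN; case E : (prim_seq h) => [|p r] //.
have : p \in prim_seq h by rewrite E mem_head.
move=> /mem_prim_seq[Pp]; have := P_deg_gt0 hP Pp; rewrite -hN ltnS.
by case: (hdeg p) => // d _; rewrite addSn ltnNge leq_addl.
Qed.

Definition germ X G p h u v : R := pairing (psi P p h (X u v)) (G u).

(** The equation of the recursion at one forest. For |h| = N - 1 there is no admissible p and it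
    reads G^h = f^h, so the top level needs no separate treatment. *)
Definition lev_ok X (f : time -> R) G h (J : H -> time -> R) :=
  (forall p t, p \in prim_seq h -> has_integral (germ X G p h) (time0 T) t (J p t)) /\
  forall t, mcoeff h (G t) = (\sum_(p <- prim_seq h) J p t) + f t.

Lemma section_germE X G p h : truncated alpha G -> P p ->
  section_germ P X G p h = germ X G p h.
Proof.
move=> tG Pp; apply/funext => u; apply/funext => v.
exact: (psi_germ hP h (X u v) Pp (truncated_supp (t := u) tG)).
Qed.

Lemma is_GammaP X f G : is_Gamma P X f G <-> truncated alpha G /\
  forall h, (forest_size h < N)%N -> exists J, lev_ok X (f h) G h J.
Proof.
split=> [[tG h1 h2]|[tG hG]]; split=> //.
- move=> h hN; have [hN'|] := ltnP (forest_size h).+1 N.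
    have [J J1 J2] := h2 h hN'; exists J; split=> [p t /mem_prim_seq[Pp pN]|t].
      by rewrite -(section_germE X h tG Pp); exact: J1.
    by rewrite J2 -/(prim_set h) prim_sumE.
  move=> hN'; have hN'' : (forest_size h).+1 = N by apply/eqP; rewrite eqn_leq hN.
  exists (fun _ _ => 0); rewrite /lev_ok (prim_seq_nil hN''); split=> [p t|t] //.
  by rewrite big_nil add0r h1.
- move=> h t hN; have hN' : (forest_size h < N)%N by rewrite -hN.
  have [J [_ ->]] := hG h hN'.
  by rewrite (prim_seq_nil hN) big_nil add0r.
move=> h hN; have [J [J1 J2]] := hG h (ltnW hN); exists J.
  move=> p t Pp pN; rewrite (section_germE X h tG Pp); apply: J1.
  exact/mem_prim_seq.
by move=> t; rewrite J2 -prim_sumE.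
Qed.

Lemma lev_ok0 X f G h J : lev_ok X f G h J -> mcoeff h (G (time0 T)) = f (time0 T).
Proof.
move=> [J1 J2]; rewrite J2 big_seq big1 ?add0r // => p pP.
exact: has_integral_diag (J1 p _ pP).
Qed.

(** By [psi_total] the germs at h add up to the difference between R^h and the increment of G^h.
    What is left, the increment of f^h and the sewing errors, is of order kappa for every [h],
    however large |h| is. *)
Lemma lev_ok_rem X f G h J s t : truncated alpha G -> lev_ok X f G h J ->
  remainder X G h s t = (f t - f s) +
   \sum_(p <- prim_seq h) (J p t - J p s - germ X G p h s t).
Proof.
move=> tG [_ J2]; have := psi_total hP h (X1 X s t) (truncated_supp (t := s) tG).
rewrite -/(prim_set h) prim_sumE => E.
rewrite sumrB E sumrB /remainder !J2; ring.
Qed.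

Lemma cocycle_psi p h : P p -> cocycle (psi P p h).
Proof. by move=> Pp phi phi' e; exact: psi_star. Qed.

Lemma psi_const : exists2 C : R, 0 <= C & forall p h k phi (e : R),
  p \in prim_seq h -> (forest_size h < N)%N -> (forest_size k < N)%N -> 0 <= e ->
  (forall m, (forest_size m + forest_size h)%N = forest_size k -> `|phi m| <= e) ->
  `|psi P p h phi k| <= C * e.
Proof.
have ex (x : H * forest A * forest A) : exists C : R, 0 <= C /\ (P x.1.1 -> forall phi (e : R), 0 <= e ->
    (forall m, (forest_size m + forest_size x.1.2)%N = forest_size x.2 -> `|phi m| <= e) ->
    `|psi P x.1.1 x.1.2 phi x.2| <= C * e).
  have [Pp|nP] := pselect (P x.1.1); last by exists 0.
  by have [C C0 hC] := psi_bound hP x.1.2 x.2 Pp; exists C.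
have {ex}[C hC] := choice ex.
have C0 x : 0 <= C x by case: (hC x).
exists (\sum_(h <- F) \sum_(k <- F) \sum_(p <- prim_seq h) C (p, h, k)).
  by do 3![apply: sumr_ge0 => ? _].
move=> p h k phi e pP hN kN e0 he; have [Pp _] := (mem_prim_seq _ _).1 pP.
apply: le_trans ((hC (p, h, k)).2 Pp phi e e0 he) _; rewrite ler_wpM2r //.
have up : uniq (prim_seq h) by exact: fset_uniq.
rewrite (bigD1_seq h) ?uniq_F ?(mem_F halpha) //= -[leLHS]addr0; apply: lerD; last first.
  by do 3![apply: sumr_ge0 => ? _].
rewrite (bigD1_seq k) ?uniq_F ?(mem_F halpha) //= -[leLHS]addr0; apply: lerD; last first.
  by do 2![apply: sumr_ge0 => ? _].
by rewrite (bigD1_seq p) //= lerDl; apply: sumr_ge0.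
Qed.

End Levels.

(** * Estimates for two sections over two rough paths *)

Section GammaEstimate.
Variables (R : realType) (A : finType) (T : {posnum R}) (alpha kappa : R).
Variable (P : set (forest_alg R A)).
Hypothesis halpha : 0 < alpha < 1.
Hypothesis halpha_inv : forall n : nat, (0 < n)%N -> alpha <> n%:R^-1.
Hypothesis hP : primitive_basis P.
Hypothesis hkappa : (level alpha)%:R * alpha < kappa < 1.
Local Notation time := (time T).
Local Notation tv := (@time_val R T).
Local Notation dist s t := `|tv t - tv s|.
Local Notation H := (forest_alg R A).
Local Notation N := (level alpha).
Local Notation F := (forests_upto A N.-1).
Local Notation rp := (rough_path A T alpha).
Local Notation cpath := (time -> H).
Local Notation cB := (cardB A alpha).
Local Notation Lq := (Lpow T).
Local Notation prims := (prim_seq alpha P).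
Local Notation germ := (germ P).
Implicit Types (s t u : time) (h k m : forest A) (X Y : rp) (Z W G : cpath).
Local Opaque ftop pairing forest_vec fempty psi.

Let alpha0 : 0 < alpha. Proof. by case/andP: halpha. Qed.
Let kappa0 : 0 < kappa.
Proof. by case/andP: hkappa => k0 _; apply: le_lt_trans k0; rewrite mulr_ge0 // ltW. Qed.
(** kappa comes from the remainders above h, and alpha from psi, which vanishes unless |k| > |h|.
    The sum exceeds (N + 1) alpha, hence 1. *)
Let theta1 : 1 < kappa + alpha.
Proof.
case/andP: hkappa => k0 _; have := levelS_gt1 halpha.
have -> : N.+1%:R = N%:R + 1 :> R by rewrite -addn1 natrD.
rewrite mulrDl mul1r; lra.
Qed.

Definition psi_bounded (C : R) := 0 <= C /\ forall p h k phi (e : R),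
  p \in prims h -> (forest_size h < N)%N -> (forest_size k < N)%N -> 0 <= e ->
  (forall m, (forest_size m + forest_size h)%N = forest_size k -> `|phi m| <= e) ->
  `|psi P p h phi k| <= C * e.

(** Chosen once from alpha and P, so that later constants are explicit terms and not existential
    witnesses. *)
Definition psiC : R := xget 0 psi_bounded.

Lemma psiCP : psi_bounded psiC.
Proof.
have [C C0 hC] := psi_const halpha hP.
by apply: (xgetPex 0 (P := psi_bounded)); exists C.
Qed.

Lemma psiC_ge0 : 0 <= psiC. Proof. by case: psiCP. Qed.

Lemma psi_rough (x : forest A -> R) (K : R) p h k (d : R) : p \in prims h ->
  (forest_size h < N)%N -> (forest_size k < N)%N -> 0 <= K ->
  (forall m, (forest_size m <= N)%N -> `|x m| <= K * d `^ ((forest_size m)%:R * alpha)) ->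
  `|psi P p h x k| <= psiC * (K * d `^ sizeB alpha h k).
Proof.
move=> pP hN kN K0 hx; case: psiCP => _; apply => //; first by rewrite mulr_ge0 ?powR_ge0.
move=> m e; have em : forest_size m = (forest_size k - forest_size h)%N by rewrite -e addnK.
rewrite /sizeB -em; apply: hx; rewrite em; apply: leq_trans (ltnW kN); exact: leq_subr.
Qed.

(** A primitive basis element has positive degree, so the germ at [h] sees only components at larger
    forests: the recursion is triangular. *)
Lemma psi_low p h phi k : p \in prims h -> (forest_size k <= forest_size h)%N ->
  psi P p h phi k = 0.
Proof.
move=> /(mem_prim_seq alpha hP)[Pp _] kh; apply: psi0 => //.
by apply: leq_ltn_trans kh _; rewrite -[X in (X < _)%N]add0n ltn_add2r (P_deg_gt0 hP).
Qed.

Lemma sizeB_gt h k : (forest_size h < forest_size k)%N -> alpha <= sizeB alpha h k.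
Proof. by move=> hk; rewrite /sizeB ler_peMl ?(ltW alpha0) // ler1n subn_gt0. Qed.

Definition above h X Y Z W e := forall k s t, (forest_size h < forest_size k)%N ->
  (forest_size k < N)%N ->
  `|remainder X Z k s t - remainder Y W k s t| <= e * dist s t `^ kappa.

Lemma germ_sew K X Y Z W e e1 M h p : 0 <= K -> xbound X K -> 0 <= e1 ->
  xclose X Y e1 -> 0 <= M -> M * e1 <= e -> truncated alpha Z -> truncated alpha W ->
  (forest_size h < N)%N -> p \in prims h ->
  above h X Y Z W e -> above h Y Y W (fun=> 0) M ->
  sew_bounded (T := T) 0 T%:num (kappa + alpha) (cB * (psiC * (K + 1) * Lq 2 * e))
    (fun s t => germ X Z p h s t - germ Y W p h s t).
Proof.
move=> K0 hX e10 hXY M0 Me tZ tW hN pP hZW hW s u t _ _ _.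
have e0 : 0 <= e by apply: le_trans Me; rewrite mulr_ge0.
have C0 := psiC_ge0; have [Pp _] := (mem_prim_seq alpha hP _ _).1 pP.
rewrite /germ (_ : _ - _ - _ = (pairing (psi P p h (X s t)) (Z s) - pairing (psi P p h (X s u)) (Z s)
  - pairing (psi P p h (X u t)) (Z u)) - (pairing (psi P p h (Y s t)) (W s) -
  pairing (psi P p h (Y s u)) (W s) - pairing (psi P p h (Y u t)) (W u))); last ring.
rewrite !(germ_delta halpha (Psi := psi P p h)) //; try exact: cocycle_psi.
rewrite opprK addrC -sumrB -[leRHS]mulrA; apply: (sum_F_le halpha).
  by rewrite !mulr_ge0 ?addr_ge0 ?powR_ge0.
move=> k kN; have [kh|hk] := leqP (forest_size k) (forest_size h).
  by rewrite !psi_low // !mul0r subrr normr0 !mulr_ge0 ?addr_ge0 ?powR_ge0.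
have hx := psi_rough pP hN kN K0 (fun h hN => hX h u t hN).
have hxy := psi_rough pP hN kN e10 (fun h hN => hXY h u t hN).
have pa : 0 <= dist u t `^ sizeB alpha h k by exact: powR_ge0.
have hw := hW k s u hk kN; rewrite remainder0 subr0 in hw.
rewrite -psi_B in hxy.
rewrite distrC; apply: le_trans (prod_close hx (hZW k s u hk kN) hxy hw _ _) _;
  try by rewrite !mulr_ge0.
have [_ k1] := andP hkappa.
have s1 := sizeB_le1 halpha halpha_inv h kN; have sa := sizeB_gt hk.
have c1 : kappa + alpha <= kappa + sizeB alpha h k by rewrite lerD2l.
have c2 : kappa + sizeB alpha h k <= 2 by lra.
have hd := @dist2_weaken _ _ s u t kappa (sizeB alpha h k) (kappa + alpha) 2
   (ltW kappa0) (le_trans (ltW alpha0) sa) (le_trans ler01 (ltW theta1)) c1 c2.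
have -> : psiC * (K * dist u t `^ sizeB alpha h k) * (e * dist s u `^ kappa) +
   psiC * (e1 * dist u t `^ sizeB alpha h k) * (M * dist s u `^ kappa) =
   psiC * (K * e + M * e1) * (dist s u `^ kappa * dist u t `^ sizeB alpha h k) by ring.
have -> : psiC * (K + 1) * Lq 2 * e * (dist s u + dist u t) `^ (kappa + alpha) =
  psiC * (K * e + e) * (Lq 2 * (dist s u + dist u t) `^ (kappa + alpha)) by ring.
have n0 : 0 <= K * e + M * e1 by rewrite addr_ge0 // mulr_ge0.
apply: ler_pM => //; rewrite ?mulr_ge0 ?powR_ge0 //.
by rewrite ler_wpM2l // lerD2l.
Qed.

Definition sewC : R := sew_const (kappa + alpha) + 2 `^ (kappa + alpha).

Lemma sewC_ge0 : 0 <= sewC.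
Proof. by rewrite addr_ge0 ?powR_ge0 // ltW // sew_const_gt0. Qed.

Definition primB : R := \sum_(h <- F) (size (prims h))%:R.

Lemma sum_prim_le h (f : H -> R) (e : R) : (forest_size h < N)%N -> 0 <= e ->
  (forall p, p \in prims h -> `|f p| <= e) -> `|\sum_(p <- prims h) f p| <= primB * e.
Proof.
move=> hN e0 he; apply: le_trans (ler_norm_sum _ _ _) _.
apply: (@le_trans _ _ ((size (prims h))%:R * e)).
  have -> : (size (prims h))%:R * e = \sum_(k <- prims h) e.
    by rewrite big_const_seq count_predT iter_addr_0 mulr_natl.
  by rewrite big_seq [leRHS]big_seq; apply: ler_sum.
rewrite ler_wpM2r // /primB (bigD1_seq h) ?uniq_F ?(mem_F halpha) //= lerDl.
exact: sumr_ge0.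
Qed.

Lemma primB_ge0 : 0 <= primB. Proof. exact: sumr_ge0. Qed.

(** The factor lost in passing to [h] from the forests above it: 1 for the increment of f^h, the
    rest for the sewing errors. *)
Definition stepC (K : R) : R :=
  1 + primB * (sewC * (cB * (psiC * (K + 1) * Lq 2)) * Lq 2).

Lemma stepC_ge1 K : 0 <= K -> 1 <= stepC K.
Proof.
move=> K0; have cB0 := cB_ge0 A alpha; have p0 := psiC_ge0; have s0 := sewC_ge0.
have b0 := primB_ge0.
by rewrite lerDl !mulr_ge0 ?powR_ge0 // addr_ge0.
Qed.

Lemma gamma_step K X Y Z W f g J J' e e1 M h s t : 0 <= K -> xbound X K -> 0 <= e1 ->
  xclose X Y e1 -> 0 <= M -> M * e1 <= e -> truncated alpha Z -> truncated alpha W ->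
  (forest_size h < N)%N -> above h X Y Z W e -> above h Y Y W (fun=> 0) M ->
  (forall s t, `|(f t - f s) - (g t - g s)| <= e * dist s t `^ kappa) ->
  lev_ok P X f Z h J -> lev_ok P Y g W h J' ->
  `|remainder X Z h s t - remainder Y W h s t| <= stepC K * e * dist s t `^ kappa.
Proof.
move=> K0 hX e10 hXY M0 Me tZ tW hN hZW hW hfg lZ lW.
have e0 : 0 <= e by apply: le_trans Me; rewrite mulr_ge0.
have cB0 := cB_ge0 A alpha; have p0 := psiC_ge0; have s0 := sewC_ge0.
have K10 : 0 <= K + 1 by rewrite addr_ge0.
have L0 : 0 <= Lq 2 by exact: powR_ge0.
rewrite (lev_ok_rem hP s t tZ lZ) (lev_ok_rem hP s t tW lW).
rewrite (_ : _ + _ - _ = ((f t - f s) - (g t - g s)) + \sum_(p <- prims h)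
  ((J p t - J' p t) - (J p s - J' p s) - (germ X Z p h s t - germ Y W p h s t))); last first.
  have -> : \sum_(p <- prims h) ((J p t - J' p t) - (J p s - J' p s) -
     (germ X Z p h s t - germ Y W p h s t)) =
     \sum_(p <- prims h) (J p t - J p s - germ X Z p h s t) -
     \sum_(p <- prims h) (J' p t - J' p s - germ Y W p h s t).
    by rewrite -sumrB; apply: eq_bigr => p _; ring.
  by ring.
rewrite /stepC mulrDl mul1r mulrDl; apply: le_trans (ler_normD _ _) _; apply: lerD => //.
set E := cB * (psiC * (K + 1) * Lq 2 * e).
have E0 : 0 <= E by rewrite /E !mulr_ge0.
rewrite (_ : primB * _ * e * _ = primB * (sewC * E * (Lq 2 * dist s t `^ kappa))); last first.
  by rewrite /E; ring.
apply: sum_prim_le => // [|p pP]; first by rewrite !mulr_ge0 ?powR_ge0.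
have hs := germ_sew K0 hX e10 hXY M0 Me tZ tW hN pP hZW hW.
pose I t := J p t - J' p t.
have hI u : has_integral (fun s t => germ X Z p h s t - germ Y W p h s t) (time0 T) u (I u).
  by have := has_integralB (time_ge0 u : tv (time0 T) <= tv u) (lZ.1 p u pP) (lW.1 p u pP).
have hb1 := @sewing_bound _ _ (kappa + alpha) 0 T%:num _ _ I s t theta1 E0 hs hI
  (introT andP (conj (time_ge0 s) (time_leT s))) (introT andP (conj (time_ge0 t) (time_leT t))).
apply: le_trans hb1 _; rewrite -/sewC ler_wpM2l ?mulr_ge0 //.
have [_ k1] := andP hkappa; have [_ a1] := andP halpha.
apply: dist_weaken; [exact: ltW|by rewrite lerDl ltW|lra].
Qed.

Lemma lev_ok_zero X h : lev_ok P X (fun=> 0) (fun=> 0) h (fun _ _ => 0).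
Proof.
split=> [p t _|t]; last by rewrite mcoeff0 big1 ?addr0.
have := has_integral0 (time_ge0 t : tv (time0 T) <= tv t).
by congr has_integral; apply/funext => u; apply/funext => v; rewrite /germ pairing0.
Qed.

(** [m] counts the levels treated, from the top down. The bound on W is carried along with the
    difference, because it takes the role of [M] in the next [gamma_step]. *)
Lemma gamma_levels K X Y Z W (f g : forest A -> time -> R) e e1 M (m : nat) : 0 <= K ->
  xbound X K -> xbound Y K -> 0 <= e1 ->
  xclose X Y e1 -> 0 <= M -> M * e1 <= e -> truncated alpha Z -> truncated alpha W ->
  (forall h, (N - m <= forest_size h < N)%N -> (exists J, lev_ok P X (f h) Z h J) /\
     (exists J, lev_ok P Y (g h) W h J)) ->
  (forall h s t, (forest_size h < N)%N ->
    `|(f h t - f h s) - (g h t - g h s)| <= e * dist s t `^ kappa) ->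
  (forall h s t, (forest_size h < N)%N -> `|g h t - g h s| <= M * dist s t `^ kappa) ->
  forall h s t, (N - m <= forest_size h < N)%N ->
  `|remainder X Z h s t - remainder Y W h s t| <= stepC K ^+ m * e * dist s t `^ kappa /\
  `|remainder Y W h s t| <= stepC K ^+ m * M * dist s t `^ kappa.
Proof.
move=> K0 hX hY e10 hXY M0 Me tZ tW + hfg hg.
have e0 : 0 <= e by apply: le_trans Me; rewrite mulr_ge0.
have c1 := stepC_ge1 K0; have c0 : 0 <= stepC K by exact: le_trans ler01 c1.
elim: m => [|m IH] lev h s t /andP[h1 h2]; first by rewrite subn0 leqNgt h2 in h1.
have {}IH k u v : (forest_size h < forest_size k)%N -> (forest_size k < N)%N ->
  `|remainder X Z k u v - remainder Y W k u v| <= stepC K ^+ m * e * dist u v `^ kappa /\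
  `|remainder Y W k u v| <= stepC K ^+ m * M * dist u v `^ kappa.
  move=> hk kN; apply: IH => [l /andP[l1 l2]|].
    by apply: lev; rewrite l2 andbT; apply: leq_trans l1; rewrite leq_sub2l.
  by rewrite kN andbT leq_subLR (leq_trans _ (_ : (m + (forest_size h).+1 <= _)%N)) ?leq_add2l // addnS -addSn -leq_subLR.
have cm1 : 1 <= stepC K ^+ m by rewrite exprn_ege1.
have cm0 : 0 <= stepC K ^+ m by exact: le_trans ler01 cm1.
have [[J lZ] [J' lW]] := lev h (introT andP (conj h1 h2)).
have hW : above h Y Y W (fun=> 0) (stepC K ^+ m * M).
  by move=> k u v hk kN; rewrite remainder0 subr0; exact: (IH k u v hk kN).2.
have hZW : above h X Y Z W (stepC K ^+ m * e).
  by move=> k u v hk kN; exact: (IH k u v hk kN).1.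
split.
  rewrite exprS -[stepC K * _ * e]mulrA.
  apply: (gamma_step s t K0 hX e10 hXY _ _ tZ tW h2 hZW hW _ lZ lW).
  - by rewrite mulr_ge0.
  - by rewrite -mulrA ler_wpM2l.
  by move=> u v; apply: le_trans (hfg h u v h2) _; rewrite ler_wpM2r ?powR_ge0 // ler_peMl.
have t0 : truncated alpha (fun _ : time => (0 : H)) by move=> u k kN; rewrite mcoeff0.
have hW0 : above h Y Y (fun=> 0) (fun=> 0) 0.
  by move=> k u v _ _; rewrite remainder0 subr0 normr0 mul0r.
have xx : xclose Y Y 0 by move=> k u v _; rewrite subrr normr0 mul0r.
have M0' : 0 <= stepC K ^+ m * M by rewrite mulr_ge0.
have := gamma_step s t K0 hY (lexx _) xx (lexx 0) _ tW t0 h2 hW hW0 _ lW (lev_ok_zero Y h).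
rewrite remainder0 exprS -[stepC K * _ * M]mulrA -[X in _ -> `|X| <= _]subr0; apply.
  by rewrite mul0r.
move=> u v; rewrite subr0 subr0; apply: le_trans (hg h u v h2) _.
by rewrite ler_wpM2r ?powR_ge0 // ler_peMl.
Qed.

Lemma gamma_estimate K X Y Z W (f g : forest A -> time -> R) e e1 M : 0 <= K ->
  xbound X K -> xbound Y K -> 0 <= e1 -> xclose X Y e1 -> 0 <= M -> M * e1 <= e ->
  is_Gamma P X f Z -> is_Gamma P Y g W ->
  (forall h, (forest_size h < N)%N -> `|f h (time0 T) - g h (time0 T)| <= e) ->
  (forall h s t, (forest_size h < N)%N ->
    `|(f h t - f h s) - (g h t - g h s)| <= e * dist s t `^ kappa) ->
  (forall h s t, (forest_size h < N)%N -> `|g h t - g h s| <= M * dist s t `^ kappa) ->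
  pclose (fun=> kappa) X Y Z W (stepC K ^+ N * e).
Proof.
move=> K0 hX hY e10 hXY M0 Me gZ gW fg0 hfg hg.
have [tZ lZ] := (is_GammaP hP _ _ _).1 gZ; have [tW lW] := (is_GammaP hP _ _ _).1 gW.
have e0 : 0 <= e by apply: le_trans Me; rewrite mulr_ge0.
split=> [h hN|h s t hN].
  have [J lJ] := lZ h hN; have [J' lJ'] := lW h hN; rewrite (lev_ok0 lJ) (lev_ok0 lJ').
  by apply: le_trans (fg0 h hN) _; rewrite ler_peMl // exprn_ege1 // stepC_ge1.
apply: (gamma_levels (m := N) K0 hX hY e10 hXY M0 Me tZ tW _ hfg hg s t _).1; last by rewrite subnn hN.
by move=> k /andP[_ kN]; split; [exact: lZ|exact: lW].
Qed.

End GammaEstimate.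

(** * Construction of the sections level by level *)

Section GammaExists.
Variables (R : realType) (A : finType) (T : {posnum R}) (alpha kappa : R).
Variable (P : set (forest_alg R A)).
Hypothesis halpha : 0 < alpha < 1.
Hypothesis halpha_inv : forall n : nat, (0 < n)%N -> alpha <> n%:R^-1.
Hypothesis hP : primitive_basis P.
Hypothesis hkappa : (level alpha)%:R * alpha < kappa < 1.
Local Notation time := (time T).
Local Notation tv := (@time_val R T).
Local Notation dist s t := `|tv t - tv s|.
Local Notation H := (forest_alg R A).
Local Notation N := (level alpha).
Local Notation F := (forests_upto A N.-1).
Local Notation rp := (rough_path A T alpha).
Local Notation cpath := (time -> H).
Local Notation prims := (prim_seq alpha P).
Local Notation germ := (germ P).
Implicit Types (s t u : time) (h k : forest A) (X Y : rp) (Z W G : cpath).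
Local Opaque ftop pairing forest_vec fempty psi.

Let alpha0 : 0 < alpha. Proof. by case/andP: halpha. Qed.
Let theta1 : 1 < kappa + alpha.
Proof.
case/andP: hkappa => k0 _; have := levelS_gt1 halpha.
have -> : N.+1%:R = N%:R + 1 :> R by rewrite -addn1 natrD.
rewrite mulrDl mul1r; lra.
Qed.

Definition hoelder_path (f : time -> R) :=
  exists2 C : R, 0 <= C & forall s t, `|f t - f s| <= C * dist s t `^ kappa.

Lemma hoelder_uniform (f : forest A -> time -> R) :
  (forall h, (forest_size h < N)%N -> hoelder_path (f h)) ->
  exists2 C : R, 0 <= C & forall h s t, (forest_size h < N)%N ->
    `|f h t - f h s| <= C * dist s t `^ kappa.
Proof.
move=> hf; have ex h : exists C : R, 0 <= C /\ ((forest_size h < N)%N ->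
    forall s t, `|f h t - f h s| <= C * dist s t `^ kappa).
  have [hN|] := boolP (forest_size h < N)%N; last by exists 0.
  by have [C C0 hC] := hf h hN; exists C.
have [C hC] := choice ex; exists (\sum_(h <- F) C h).
  by apply: sumr_ge0 => h _; case: (hC h).
move=> h s t hN; apply: le_trans ((hC h).2 hN s t) _; rewrite ler_wpM2r ?powR_ge0 //.
rewrite (bigD1_seq h) ?uniq_F ?(mem_F halpha) //= lerDl; apply: sumr_ge0 => k _.
by case: (hC k).
Qed.

Lemma trunc0 : truncated alpha (fun _ : time => (0 : H)).
Proof. by move=> t h _; rewrite mcoeff0. Qed.

Lemma germ_integrable X G (f : forest A -> time -> R) (m : nat) h p :
  truncated alpha G ->
  (forall h, (N - m <= forest_size h < N)%N -> exists J, lev_ok P X (f h) G h J) ->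
  (forall h, (forest_size h < N)%N -> hoelder_path (f h)) ->
  (N - m <= (forest_size h).+1)%N -> (forest_size h < N)%N -> p \in prims h ->
  exists J, forall t, has_integral (germ X G p h) (time0 T) t (J t).
Proof.
move=> tG lev hf hm hN pP; have [C C0 hC] := hoelder_uniform hf.
have [K K1 hX] := xbound_exists X; have K0 : 0 <= K by exact: le_trans ler01 K1.
have xx : xclose X X 0 by move=> k u v _; rewrite subrr normr0 mul0r.
have c1 := stepC_ge1 T halpha hP hkappa K0.
have m0 : 0 * 0 <= C by rewrite mul0r.
have hb := @gamma_levels _ _ _ _ _ _ halpha halpha_inv hP hkappa K X X G (fun=> 0) f
  (fun _ _ => 0) C 0 0 m K0 hX hX (lexx _) xx (lexx _) m0 tG trunc0.
have {}hb : forall k s t, (N - m <= forest_size k < N)%N ->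
    `|remainder X G k s t| <= stepC T alpha kappa P K ^+ m * C * dist s t `^ kappa.
  move=> k s t kN; have := (hb _ _ _ k s t kN).1; rewrite remainder0 -[X in _ -> `|X| <= _]subr0; apply.
  - move=> l lN; split; first exact: lev.
    by exists (fun _ _ => 0); exact: (lev_ok_zero P X l).
  - by move=> l u v lN; rewrite !subr0 hC.
  - by move=> l u v _; rewrite subrr normr0 mul0r.
have c0 : 0 <= stepC T alpha kappa P K ^+ m * C.
  by rewrite mulr_ge0 // exprn_ge0 // (le_trans ler01).
have hab : above kappa h X X G (fun=> 0) (stepC T alpha kappa P K ^+ m * C).
  move=> k u v hk kN; rewrite remainder0 subr0; apply: hb.
  by rewrite kN andbT; exact: leq_trans hm hk.
have hab0 : above kappa h X X (fun=> 0) (fun=> 0) 0.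
  by move=> k u v _ _; rewrite remainder0 subr0 normr0 mul0r.
have m1 : 0 * 0 <= stepC T alpha kappa P K ^+ m * C by rewrite mul0r.
have hs := germ_sew halpha halpha_inv hP hkappa K0 hX (lexx _) xx (lexx 0) m1 tG trunc0 hN pP hab hab0.
have [|I hI] := sewing_exists theta1 _ hs.
  by rewrite mulr_ge0 ?cB_ge0 // mulr_ge0 // mulr_ge0 ?powR_ge0 // mulr_ge0 ?addr_ge0 ?(psiC_ge0 halpha hP).
exists I => t; have := hI t; congr has_integral; apply/funext => u; apply/funext => v.
by rewrite /germ pairing0 subr0.
Qed.

Lemma germ_add X G (D : cpath) p h : p \in prims h ->
  (forall k t, (forest_size h < forest_size k)%N -> mcoeff k (D t) = 0) ->
  germ X (fun t => G t + D t) p h = germ X G p h.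
Proof.
move=> pP hD; apply/funext => u; apply/funext => v; rewrite /germ pairingD.
rewrite -[RHS]addr0; congr (_ + _); apply: etrans (pairing_fun0 (D u)).
apply: eq_pairing_in => k kD; apply: (psi_low hP _ pP).
by rewrite leqNgt; apply/negP => hk; move: kD; rewrite -mcoeff_neq0 hD // eqxx.
Qed.

Variable X : rp.
Variable op : forest A -> (time -> R) -> time -> R.
Hypothesis hop : forall h J, hoelder_path (op h J).

(** The operator [op] lets the datum f^h depend on the integral part of G^h, which is known once the
    larger forests are treated. A constant [op] gives the section of a prescribed f; an
    interpolating one gives the approximation of a controlled path. *)
Lemma gamma_levels_exist (m : nat) : (m <= N)%N ->
  exists (f : forest A -> time -> R) G,
  [/\ truncated alpha G,
      forall h t, (forest_size h < N - m)%N -> mcoeff h (G t) = 0,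
      forall h, (forest_size h < N)%N -> hoelder_path (f h)
    & forall h, (N - m <= forest_size h < N)%N ->
      (exists J, lev_ok P X (f h) G h J) /\ f h = op h (fun t => mcoeff h (G t) - f h t)].
Proof.
elim: m => [|m IH] mN.
  exists (fun _ _ => 0), (fun=> 0); split=> [|h t _|h hN|h].
  - exact: trunc0.
  - by rewrite mcoeff0.
  - by exists 0 => // s t; rewrite subrr normr0 mul0r.
  by rewrite subn0 => /andP[h1 h2]; move: h2; rewrite ltnNge h1.
have {IH}[f [G [tG G0 hf lev]]] := IH (ltnW mN).
pose n := (N - m.+1)%N; have nS : (N - m = n.+1)%N by rewrite /n -subSn.
have nN : (n < N)%N by rewrite -nS leq_subr.
(* The junk value 0 for irrelevant pairs allows one choice of [J] for all of them. *)
have ex x : exists J, forall t, x.2 \in prims x.1 -> forest_size x.1 = n ->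
    has_integral (germ X G x.2 x.1) (time0 T) t (J t).
  have [[pP xn]|nx] := pselect (x.2 \in prims x.1 /\ forest_size x.1 = n); last first.
    by exists (fun=> 0) => t pP xn; case: nx.
  have [|||J hJ] := @germ_integrable X G f m x.1 x.2 tG _ hf _ _ pP.
  - by move=> h hN; exact: (lev h hN).1.
  - by rewrite nS xn.
  - by rewrite xn.
  by exists J => t _ _; exact: hJ.
have {ex}[J hJ] := choice ex.
pose Js h t := \sum_(p <- prims h) J (h, p) t.
pose f' h := if forest_size h == n then op h (Js h) else f h.
pose D t : H := \sum_(k <- F | forest_size k == n) (Js k t + f' k t) *: forest_vec R k.
have mD h t : mcoeff h (D t) = if forest_size h == n then Js h t + f' h t else 0.
  rewrite -pairing_delta /D pairing_sum.
  have -> : \sum_(k <- F | forest_size k == n) pairing (fdelta R h) ((Js k t + f' k t) *: forest_vec R k)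
     = \sum_(k <- F | forest_size k == n) (Js k t + f' k t) * (k == h)%:R.
    by apply: eq_bigr => k _; rewrite pairingZ pairing_vec.
  case: eqP => [hn|hn]; last first.
    by rewrite big1 // => k /eqP kn; case: eqP => [kh|_]; [case: hn; rewrite -kh|rewrite mulr0].
  rewrite big_mkcond (bigD1_seq h) ?uniq_F ?(mem_F halpha) ?hn //= eqxx eqxx mulr1.
  by rewrite big1 ?addr0 // => k /negbTE kh; rewrite kh mulr0 if_same.
exists f', (fun t => G t + D t); split.
- by move=> t h hN; rewrite mcoeffD tG // mD add0r; case: eqP => // e; move: nN; rewrite -e ltnNge hN.
- move=> h t hn; rewrite mcoeffD G0 ?mD ?nS; last by rewrite ltnS; exact: ltnW.
  by rewrite (ltn_eqF hn) addr0.
- by move=> h hN; rewrite /f'; case: ifP => _; [exact: hop|exact: hf].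
move=> h; rewrite -/n => /andP[nh hN].
(* The new components have size n <= |h|, so they do not change the germs at [h]. *)
have gE p : p \in prims h -> germ X (fun t => G t + D t) p h = germ X G p h.
  move=> pP; apply: germ_add => // k t hk; rewrite mD.
  by rewrite (gtn_eqF (leq_ltn_trans nh hk)).
have [hn|hn] := eqVneq (forest_size h) n; last first.
  have nh' : (N - m <= forest_size h < N)%N by rewrite nS ltn_neqAle eq_sym hn nh.
  have [[Jh [l1 l2]] l3] := lev h nh'.
  have mE t : mcoeff h (G t + D t) = mcoeff h (G t) by rewrite mcoeffD mD (negbTE hn) addr0.
  rewrite {1 2 3}/f' (negbTE hn); split.
    exists Jh; split=> [p t pP|t]; first by rewrite gE //; exact: l1.
    by rewrite mE l2.
  by rewrite {1}l3; congr op; apply/funext => t; rewrite mE.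
have mE t : mcoeff h (G t + D t) = Js h t + f' h t.
  by rewrite mcoeffD mD hn eqxx G0 ?add0r // nS hn.
split.
  exists (fun p => J (h, p)); split=> [p t pP|t]; last by rewrite mE.
  by rewrite gE //; exact: hJ.
rewrite {1}/f' hn eqxx; congr op; apply/funext => t; rewrite mE addrK //.
Qed.

Lemma gamma_exists : exists (f : forest A -> time -> R) G,
  is_Gamma P X f G /\
  forall h, (forest_size h < N)%N -> f h = op h (fun t => mcoeff h (G t) - f h t).
Proof.
have [f [G [tG _ hf lev]]] := gamma_levels_exist (leqnn N).
rewrite subnn in lev; exists f, G; split; last by move=> h hN; exact: (lev h hN).2.
by apply/(is_GammaP hP); split=> // h hN; exact: (lev h hN).1.
Qed.

End GammaExists.

Section GammaProperties.
Variables (R : realType) (A : finType) (T : {posnum R}) (alpha kappa : R).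
Variable (P : set (forest_alg R A)).
Hypothesis halpha : 0 < alpha < 1.
Hypothesis halpha_inv : forall n : nat, (0 < n)%N -> alpha <> n%:R^-1.
Hypothesis hP : primitive_basis P.
Hypothesis hkappa : (level alpha)%:R * alpha < kappa < 1.
Local Notation time := (time T).
Local Notation tv := (@time_val R T).
Local Notation dist s t := `|tv t - tv s|.
Local Notation H := (forest_alg R A).
Local Notation N := (level alpha).
Local Notation F := (forests_upto A N.-1).
Local Notation rp := (rough_path A T alpha).
Local Notation cpath := (time -> H).
Implicit Types (s t u : time) (h k : forest A) (X Y : rp) (Z W G : cpath).
Implicit Type f : forest A -> time -> R.
Local Opaque ftop pairing forest_vec fempty psi.

Let alpha0 : 0 < alpha. Proof. by case/andP: halpha. Qed.
Let kappa0 : 0 < kappa.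
Proof. by case/andP: hkappa => k0 _; apply: le_lt_trans k0; rewrite mulr_ge0 // ltW. Qed.
Let kappa1 : kappa < 1. Proof. by case/andP: hkappa. Qed.

Definition hoelder_data f := forall h, (forest_size h < N)%N -> hoelder_path kappa (f h).

Definition data_bound f (M : R) := [/\ 0 <= M,
  forall h, (forest_size h < N)%N -> `|f h (time0 T)| <= M
  & forall h s t, (forest_size h < N)%N -> `|f h t - f h s| <= M * dist s t `^ kappa].

Lemma data_bound_exists f : hoelder_data f -> exists M, data_bound f M.
Proof.
move=> hf; have [C C0 hC] := hoelder_uniform halpha hf.
have S0 : 0 <= \sum_(h <- F) `|f h (time0 T)| by exact: sumr_ge0.
exists (C + \sum_(h <- F) `|f h (time0 T)|); split=> [|h hN|h s t hN].
- exact: addr_ge0.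
- rewrite (bigD1_seq h) ?uniq_F ?(mem_F halpha) //= addrCA lerDl.
  by apply: addr_ge0 => //; exact: sumr_ge0.
by apply: le_trans (hC h s t hN) _; rewrite ler_wpM2r ?powR_ge0 // lerDl.
Qed.

Lemma is_Gamma_zero X : is_Gamma P X (fun _ _ => 0) (fun=> 0).
Proof.
apply/(is_GammaP hP); split; first exact: trunc0.
by move=> h _; exists (fun _ _ => 0); exact: (lev_ok_zero P X h).
Qed.

Lemma gamma_close K M e X Y f Z W : 0 <= K -> xbound X K -> xbound Y K -> 0 <= e ->
  xclose X Y e -> data_bound f M -> is_Gamma P X f Z -> is_Gamma P Y f W ->
  pclose (fun=> kappa) X Y Z W (stepC T alpha kappa P K ^+ N * (M * e)).
Proof.
move=> K0 hX hY e0 hXY [M0 f0 fM] gZ gW.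
apply: (gamma_estimate halpha halpha_inv hP hkappa K0 hX hY e0 hXY M0 (lexx _) gZ gW) => //.
  by move=> h _; rewrite subrr normr0 mulr_ge0.
by move=> h s t _; rewrite subrr normr0 !mulr_ge0 ?powR_ge0.
Qed.

Lemma xclose_refl X : xclose X X 0.
Proof. by move=> k u v _; rewrite subrr normr0 mul0r. Qed.

Lemma gamma_bound K M X f Z : 0 <= K -> xbound X K -> data_bound f M ->
  is_Gamma P X f Z -> pbound (fun=> kappa) X Z (stepC T alpha kappa P K ^+ N * M).
Proof.
move=> K0 hX [M0 f0 fM] gZ.
apply: (gamma_estimate halpha halpha_inv hP hkappa K0 hX hX (lexx 0) (xclose_refl X) (lexx 0) _ gZ
  (is_Gamma_zero X)); first by rewrite mul0r.
- by move=> h hN; rewrite subr0 f0.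
- by move=> h s t hN; rewrite !subr0 fM.
by move=> h s t _; rewrite subrr normr0 mul0r.
Qed.

Lemma gamma_unique X f Z W : hoelder_data f -> is_Gamma P X f Z -> is_Gamma P X f W -> Z = W.
Proof.
move=> hf gZ gW; have [M hM] := data_bound_exists hf.
have [K K1 hX] := xbound_exists X; have K0 : 0 <= K by exact: le_trans ler01 K1.
have hc := gamma_close K0 hX hX (lexx 0) (xclose_refl X) hM gZ gW.
have hb := gamma_bound K0 hX hM gW.
rewrite !mulr0 in hc.
have [tZ _] := (is_GammaP hP _ _ _).1 gZ; have [tW _] := (is_GammaP hP _ _ _).1 gW.
have hd : pair_data (fun=> kappa) K X X Z W 0 0 (stepC T alpha kappa P K ^+ N * M).
  by split; split=> //; [exact: xclose_refl|rewrite mulr0].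
apply/funext => t; apply/malgP => h; have [hN|hN] := ltnP (forest_size h) N; last first.
  by rewrite tZ // tW.
have w0 n : (n < N)%N -> 0 <= kappa <= 1 by move=> _; rewrite !ltW.
have := sup_close halpha halpha_inv (lexx 1) w0 hd t hN.
by rewrite mulr0 normr_le0 subr_eq0 => /eqP.
Qed.

Lemma GammaE X f G : hoelder_data f -> is_Gamma P X f G -> Gamma P X f = G.
Proof.
move=> hf hG; apply: (gamma_unique hf _ hG).
by apply: (xgetPex _ (P := [set G | is_Gamma P X f G])); exists G.
Qed.

Lemma GammaP X f : hoelder_data f -> is_Gamma P X f (Gamma P X f).
Proof.
(* [op] ignores the integral part; outside the truncation it must be Hoelder as well, whence the
   value 0. *)
move=> hf; pose op h (J : time -> R) := if (forest_size h < N)%N then f h else fun=> 0.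
have hop h J : hoelder_path kappa (op h J).
  rewrite /op; case: ifP => [/hf //|_]; exists 0 => // s t.
  by rewrite subrr normr0 mul0r.
have [f' [G [gG fE]]] := gamma_exists halpha halpha_inv hP hkappa X hop.
suff gG' : is_Gamma P X f G by rewrite (GammaE hf gG').
apply/(is_GammaP hP); have [tG lev] := (is_GammaP hP _ _ _).1 gG; split=> // h hN.
by have [J lJ] := lev h hN; exists J; move: lJ; rewrite fE // /op hN.
Qed.

Lemma section_data_hoelder eps f : kappa = 1 - eps -> section_data alpha eps f -> hoelder_data f.
Proof.
move=> ke hf h hN; have := hf h hN; rewrite -ke => /little_hoelder_bound; apply.
by rewrite kappa0 ltW.
Qed.

Variable beta : R.
Hypothesis hbeta : 0 < beta <= alpha.

Lemma kappa_weaken X Y Z W e : pclose (fun=> kappa) X Y Z W e ->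
  pclose (bweight alpha beta) X Y Z W (Lpow T 1 * e).
Proof.
apply: (pclose_weaken halpha) => n nN; have /andP[b0 ba] := hbeta.
have /andP[w0 _] := bweight_bounds halpha halpha_inv hbeta n; split=> //; last exact: ltW.
have /andP[ka _] := hkappa; apply: le_trans (ltW ka).
by apply: ler_pM => //; [exact: ltW|rewrite ler_nat leq_subr].
Qed.

Lemma Gamma_continuous X f : hoelder_data f -> exists2 C, 0 <= C & forall Y e,
  0 <= e <= 1 -> xclose X Y e ->
  pclose (bweight alpha beta) X Y (Gamma P X f) (Gamma P Y f) (C * e).
Proof.
move=> hf; have [M hM] := data_bound_exists hf; have [M0 _ _] := hM.
have [K K1 hX] := xbound_exists X; have K0 : 0 <= K by exact: le_trans ler01 K1.
have K10 : 0 <= K + 1 by exact: addr_ge0.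
have s0 : 0 <= stepC T alpha kappa P (K + 1).
  by apply: le_trans ler01 _; exact: (stepC_ge1 T halpha hP hkappa).
exists (Lpow T 1 * (stepC T alpha kappa P (K + 1) ^+ N * M)).
  by rewrite mulr_ge0 ?Lpow_ge0 // mulr_ge0 // exprn_ge0.
move=> Y e /andP[e0 e1] hXY; rewrite -!mulrA; apply: kappa_weaken.
have mono Y' (Q Q' : R) : Q <= Q' -> xbound Y' Q -> xbound Y' Q'.
  move=> QQ hQ h s t hN; apply: le_trans (hQ h s t hN) _.
  by rewrite ler_wpM2r ?powR_ge0.
apply: (gamma_close K10 _ _ e0 hXY hM (GammaP X hf) (GammaP Y hf)).
  by apply: mono hX; rewrite lerDl.
by apply: mono (xbound_close e0 hX hXY); rewrite lerD2l.
Qed.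

End GammaProperties.

(** * Density of the sections *)

Section Cells.
Variables (R : realType) (A : finType) (T : {posnum R}) (alpha : R).
Variable (P : set (forest_alg R A)).
Hypothesis halpha : 0 < alpha < 1.
Hypothesis halpha_inv : forall n : nat, (0 < n)%N -> alpha <> n%:R^-1.
Hypothesis hP : primitive_basis P.
Local Notation time := (time T).
Local Notation tv := (@time_val R T).
Local Notation dist s t := `|tv t - tv s|.
Local Notation H := (forest_alg R A).
Local Notation N := (level alpha).
Local Notation rp := (rough_path A T alpha).
Local Notation cpath := (time -> H).
Local Notation prims := (prim_seq alpha P).
Local Notation germ := (germ P).
Local Notation cB := (cardB A alpha).
Implicit Types (s t u : time) (h k : forest A) (Z W G : cpath).
Local Opaque ftop pairing forest_vec fempty psi.

Let alpha0 : 0 < alpha. Proof. by case/andP: halpha. Qed.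

Definition qexp h : R := (N - forest_size h)%N%:R * alpha.

Lemma qexp_bounds h : 0 <= qexp h <= 1.
Proof.
rewrite /qexp mulr_ge0 ?(ltW alpha0) //=.
apply: le_trans (ltW (level_lt1 halpha halpha_inv)).
by rewrite ler_wpM2r ?(ltW alpha0) // ler_nat leq_subr.
Qed.

Lemma qexp_sizeB h k : (forest_size h <= forest_size k)%N -> (forest_size k < N)%N ->
  sizeB alpha h k + qexp k = qexp h.
Proof.
move=> hk kN; rewrite /sizeB /qexp -mulrDl -natrD; congr (_%:R * _).
by rewrite addnC addnBA // subnK // ltnW.
Qed.

Variables (X : rp) (f : forest A -> time -> R) (Z G : cpath) (K M : R).
Variables (a b : time) (delta : R).
Hypothesis delta0 : 0 < delta.
Hypothesis ab : tv b - tv a = delta.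
Hypothesis K0 : 0 <= K.
Hypothesis M0 : 0 <= M.
Hypothesis hX : xbound X K.
Hypothesis gG : is_Gamma P X f G.
Hypothesis Za : Z a = G a.
Hypothesis Zb : Z b = G b.
Hypothesis hZ : forall h s t, (forest_size h < N)%N ->
  `|remainder X Z h s t| <= M * dist s t `^ qexp h.
Hypothesis affine : forall h s t, (forest_size h < N)%N -> tv a <= tv s <= tv b ->
  tv a <= tv t <= tv b -> f h t - f h s = (f h b - f h a) * ((tv t - tv s) / delta).

Definition cellC : R := 1 + 2 * (primB alpha P * ((sew_const (1 + alpha) + 2 `^ (1 + alpha)) *
   (cB * (psiC alpha P * K)))).

Let s0 : 0 <= sew_const (1 + alpha) + 2 `^ (1 + alpha).
Proof. by rewrite addr_ge0 ?powR_ge0 // ltW // sew_const_gt0 // ltrDl. Qed.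

Let dle s t : tv a <= tv s <= tv b -> tv a <= tv t <= tv b -> dist s t <= delta.
Proof. by move=> /andP[a1 a2] /andP[a3 a4]; rewrite -ab ler_norml; apply/andP; split; lra. Qed.

(** Above [h] the remainders of G are linear in the distance on the cell, so the germ has a defect
    with exponent 1 + alpha there; the power of [delta] restores the homogeneity. *)
Lemma cell_germ D h p : 0 <= D -> (forest_size h < N)%N -> p \in prims h ->
  (forall k s t, (forest_size h < forest_size k)%N -> (forest_size k < N)%N ->
    tv a <= tv s <= tv b -> tv a <= tv t <= tv b ->
    `|remainder X G k s t| <= D * delta `^ (qexp k - 1) * dist s t) ->
  sew_bounded (tv a) (tv b) (1 + alpha)
    (cB * (psiC alpha P * K * D * delta `^ (qexp h - alpha - 1))) (germ X G p h).
Proof.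
move=> D0 hN pP hG s u t hs hu ht; have C0 := psiC_ge0 halpha hP.
have [tG _] := (is_GammaP hP _ _ _).1 gG; have [Pp _] := (mem_prim_seq alpha hP _ _).1 pP.
rewrite /germ (germ_delta halpha (Psi := psi P p h)) //; last exact: cocycle_psi.
rewrite normrN -mulrA; apply: (sum_F_le halpha).
  by rewrite !mulr_ge0 ?addr_ge0 ?powR_ge0.
move=> k kN; have [kh|hk] := leqP (forest_size k) (forest_size h).
  by rewrite (psi_low hP _ pP kh) mul0r normr0 !mulr_ge0 ?addr_ge0 ?powR_ge0.
have hx := psi_rough halpha hP pP hN kN K0 (fun h hN => hX u t hN).
have hr := hG k s u hk kN hs hu; have sa := sizeB_gt halpha hk.
rewrite normrM; apply: le_trans (ler_pM (normr_ge0 _) (normr_ge0 _) hx hr) _.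
have e1 : dist u t `^ sizeB alpha h k <= dist u t `^ alpha * delta `^ (sizeB alpha h k - alpha).
  have {1}-> : sizeB alpha h k = alpha + (sizeB alpha h k - alpha) by ring.
  rewrite powRDge0 ?subr_ge0 ?(ltW alpha0) //.
  by rewrite ler_wpM2l ?powR_ge0 // le_powR ?subr_ge0 // dle.
have e2 : delta `^ (sizeB alpha h k - alpha) * delta `^ (qexp k - 1) = delta `^ (qexp h - alpha - 1).
  rewrite -powRD; last by rewrite (gt_eqF delta0) implybT.
  by congr powR; rewrite -(qexp_sizeB (ltnW hk) kN); ring.
have S0 : 0 <= dist s u + dist u t by rewrite addr_ge0.
have e3 : dist u t `^ alpha * dist s u <= (dist s u + dist u t) `^ (1 + alpha).
  rewrite powRS ?(ltW alpha0) // [leRHS]mulrC; apply: ler_pM; rewrite ?powR_ge0 //.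
    by rewrite le_powR ?(ltW alpha0) // lerDr.
  by rewrite lerDl.
apply: (@le_trans _ _ (psiC alpha P * (K * (dist u t `^ alpha * delta `^ (sizeB alpha h k - alpha)))
    * (D * delta `^ (qexp k - 1) * dist s u))).
  apply: ler_wpM2r; first by rewrite !mulr_ge0 ?powR_ge0.
  by do 2![apply: ler_wpM2l => //].
rewrite (_ : _ * _ = psiC alpha P * K * D * delta `^ (qexp h - alpha - 1) *
  (dist u t `^ alpha * dist s u)); last by rewrite -e2; ring.
by apply: ler_wpM2l => //; rewrite !mulr_ge0 ?powR_ge0.
Qed.

(** Since Z and G agree at both ends of the cell, the increment of f^h over it is the remainder of Z
    minus sewing errors, hence of order delta^q. As f^h is affine there, its other increments are at
    most of order delta^(q-1) times the distance, and so are the sewing errors. *)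
Lemma cell_step D h : M <= D -> (forest_size h < N)%N ->
  (forall k s t, (forest_size h < forest_size k)%N -> (forest_size k < N)%N ->
    tv a <= tv s <= tv b -> tv a <= tv t <= tv b ->
    `|remainder X G k s t| <= D * delta `^ (qexp k - 1) * dist s t) ->
  forall s t, tv a <= tv s <= tv b -> tv a <= tv t <= tv b ->
    `|remainder X G h s t| <= cellC * D * delta `^ (qexp h - 1) * dist s t.
Proof.
move=> MD hN hG; have D0 : 0 <= D by exact: le_trans MD.
have C0 := psiC_ge0 halpha hP; have b0 := cB_ge0 A alpha; have n0 := primB_ge0 alpha P.
have [tG lev] := (is_GammaP hP _ _ _).1 gG; have [J lJ] := lev h hN.
pose S := (sew_const (1 + alpha) + 2 `^ (1 + alpha)) * (cB * (psiC alpha P * K)) * D.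
have S0 : 0 <= S by rewrite /S !mulr_ge0.
pose rest s t := \sum_(p <- prims h) (J p t - J p s - germ X G p h s t).
have hrest s t : tv a <= tv s <= tv b -> tv a <= tv t <= tv b ->
    `|rest s t| <= primB alpha P * (S * delta `^ (qexp h - 1) * dist s t).
  move=> hs ht; apply: sum_prim_le => // [|p pP]; first by rewrite !mulr_ge0 ?powR_ge0.
  have hsew := cell_germ D0 hN pP hG.
  set E := cB * _ in hsew; have E0 : 0 <= E by rewrite /E !mulr_ge0 ?powR_ge0.
  have th : 1 < 1 + alpha by rewrite ltrDl.
  apply: le_trans (sewing_bound th E0 hsew (lJ.1 p ^~ pP) hs ht) _.
  have -> : S * delta `^ (qexp h - 1) * dist s t = (sew_const (1 + alpha) + 2 `^ (1 + alpha)) * E *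
     (dist s t * delta `^ alpha).
    rewrite /S /E (_ : qexp h - 1 = (qexp h - alpha - 1) + alpha); last ring.
    rewrite powRD ?(gt_eqF delta0) ?implybT //; ring.
  apply: ler_wpM2l; first by rewrite mulr_ge0.
  rewrite powRS ?(ltW alpha0) //; apply: ler_wpM2l => //.
  by rewrite le_powR ?(ltW alpha0) // dle.
have ha : tv a <= tv a <= tv b by rewrite lexx /= -subr_ge0 ab ltW.
have hb : tv a <= tv b <= tv b by rewrite lexx andbT -subr_ge0 ab ltW.
have fab : `|f h b - f h a| <= (M + primB alpha P * S) * delta `^ qexp h.
  have -> : f h b - f h a = remainder X Z h a b - rest a b.
    apply/eqP; rewrite -subr_eq opprK -(lev_ok_rem hP a b tG lJ) /remainder Za Zb.
    exact: eqxx.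
  apply: le_trans (ler_normB _ _) _; rewrite mulrDl; apply: lerD.
    by have := @hZ h a b hN; rewrite ab (gtr0_norm delta0).
  apply: le_trans (hrest a b ha hb) _; rewrite ab (gtr0_norm delta0) -!mulrA.
  do 2![apply: ler_wpM2l => //].
  rewrite -{2}[delta]powRr1 ?(ltW delta0) // -powRD ?(gt_eqF delta0) ?implybT //.
  by rewrite subrK.
move=> s t hs ht; rewrite (lev_ok_rem hP s t tG lJ) -/(rest s t) (affine hN hs ht).
apply: le_trans (ler_normD _ _) _.
have e1 : delta `^ qexp h * (dist s t / delta) = delta `^ (qexp h - 1) * dist s t.
  rewrite powRD ?(gt_eqF delta0) ?implybT // powR_inv1 ?(ltW delta0) //; ring.
have h1 : `|(f h b - f h a) * ((tv t - tv s) / delta)| <=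
    (M + primB alpha P * S) * (delta `^ (qexp h - 1) * dist s t).
  rewrite -e1 normrM [X in _ * X]normrM normfV (gtr0_norm delta0) [leRHS]mulrA.
  by rewrite ler_wpM2r // divr_ge0 // ltW.
apply: le_trans (lerD h1 (hrest s t hs ht)) _.
set Q := delta `^ (qexp h - 1); have Q0 : 0 <= Q * dist s t by rewrite mulr_ge0 ?powR_ge0.
rewrite (_ : _ + _ = (M + 2 * (primB alpha P * S)) * (Q * dist s t)); last ring.
rewrite -[leRHS]mulrA ler_wpM2r //.
have -> : cellC * D = D + 2 * (primB alpha P * S) by rewrite /cellC /S; ring.
by rewrite lerD2r.
Qed.

Lemma cellC_ge1 : 1 <= cellC.
Proof.
have C0 := psiC_ge0 halpha hP; have b0 := cB_ge0 A alpha; have n0 := primB_ge0 alpha P.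
by rewrite lerDl !mulr_ge0.
Qed.

Lemma cell_rem h s t : (forest_size h < N)%N -> tv a <= tv s <= tv b ->
  tv a <= tv t <= tv b ->
  `|remainder X G h s t| <= cellC ^+ N * M * delta `^ (qexp h - 1) * dist s t.
Proof.
have c1 := cellC_ge1; have c0 : 0 <= cellC by exact: le_trans c1.
suff main n k u v : (N - n <= forest_size k < N)%N -> tv a <= tv u <= tv b -> tv a <= tv v <= tv b ->
    `|remainder X G k u v| <= cellC ^+ n * M * delta `^ (qexp k - 1) * dist u v.
  by move=> hN; apply: main; rewrite subnn hN.
elim: n k u v => [|n IH] k u v /andP[k1 k2]; first by rewrite subn0 leqNgt k2 in k1.
move=> hu hv; rewrite exprS -[cellC * _ * M]mulrA; apply: (cell_step _ k2 _ hu hv).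
  by rewrite ler_peMl // exprn_ege1.
move=> l s' t' kl lN hs ht; apply: IH => //; rewrite lN andbT.
apply: leq_trans kl; rewrite leq_subLR addnS -addSn -leq_subLR; exact: k1.
Qed.

(** On the cell |t - s| <= delta, and q <= 1, so delta^(q-1) |t - s| <= |t - s|^q: the linear bound
    for G is as good as the one assumed for Z. *)
Lemma cell_diff h s t : (forest_size h < N)%N -> tv a <= tv s <= tv b ->
  tv a <= tv t <= tv b ->
  `|remainder X (fun t => Z t - G t) h s t| <= (M + cellC ^+ N * M) * dist s t `^ qexp h.
Proof.
move=> hN hs ht; rewrite remainderB mulrDl; apply: le_trans (ler_normB _ _) _.
apply: lerD; first exact: hZ.
apply: le_trans (cell_rem hN hs ht) _; rewrite -[leLHS]mulrA ler_wpM2l //.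
  by rewrite mulr_ge0 // exprn_ge0 // (le_trans ler01) // cellC_ge1.
have /andP[q0 q1] := qexp_bounds h; have q1' : 0 <= 1 - qexp h by rewrite subr_ge0.
have {1}-> : dist s t = dist s t `^ (1 - qexp h) * dist s t `^ qexp h.
  by rewrite -powRDge0 // subrK powRr1.
rewrite mulrA ler_piMl ?powR_ge0 //.
apply: (@le_trans _ _ (delta `^ (qexp h - 1) * delta `^ (1 - qexp h))).
  by rewrite ler_wpM2l ?powR_ge0 // le_powR // dle.
rewrite -powRD ?(gt_eqF delta0) ?implybT //.
by rewrite (_ : _ + _ = 0) ?powRr0 //; ring.
Qed.

End Cells.

(** * From one cell to the whole interval, and density of the sections *)

Section Density.
Variables (R : realType) (A : finType) (T : {posnum R}) (alpha beta kappa : R).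
Variable (P : set (forest_alg R A)).
Hypothesis halpha : 0 < alpha < 1.
Hypothesis halpha_inv : forall n : nat, (0 < n)%N -> alpha <> n%:R^-1.
Hypothesis hbeta : 0 < beta < alpha.
Hypothesis hP : primitive_basis P.
Hypothesis hkappa : (level alpha)%:R * alpha < kappa < 1.
Local Notation time := (time T).
Local Notation tv := (@time_val R T).
Local Notation dist s t := `|tv t - tv s|.
Local Notation H := (forest_alg R A).
Local Notation N := (level alpha).
Local Notation F := (forests_upto A N.-1).
Local Notation rp := (rough_path A T alpha).
Local Notation cpath := (time -> H).
Local Notation cB := (cardB A alpha).
Local Notation bw := (bweight alpha beta).
Implicit Types (s t u : time) (h k : forest A) (X : rp) (Z W G V : cpath).
Local Opaque ftop pairing forest_vec fempty psi.

Let alpha0 : 0 < alpha. Proof. by case/andP: halpha. Qed.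
Let beta0 : 0 < beta. Proof. by case/andP: hbeta. Qed.
Let hb : 0 < beta <= alpha. Proof. by case/andP: hbeta => -> /ltW. Qed.

Definition in_cell n i s := tv (grid T n i) <= tv s <= tv (grid T n i.+1).

Lemma grid_le n i j : (i <= j)%N -> (j <= n.+1)%N -> tv (grid T n i) <= tv (grid T n j).
Proof.
move=> ij jn; rewrite !gridE //; last exact: leq_trans ij jn.
by rewrite ler_wpM2l ?divr_ge0 // ler_nat.
Qed.

Lemma interp_grid n (f : time -> R) i : (i <= n.+1)%N -> interp n f (grid T n i) = f (grid T n i).
Proof.
rewrite leq_eqVlt => /orP[/eqP ->|]; last rewrite ltnS => ni.
  rewrite (interp_cell f (leqnn n)); last by rewrite lexx andbT grid_le.
  have d0 : T%:num / n.+1%:R != 0 :> R by rewrite gt_eqF // divr_gt0.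
  by rewrite gridS // divff // mulr1 addrC subrK.
rewrite (interp_cell f ni); last by rewrite lexx /= grid_le.
by rewrite subrr mul0r mulr0 addr0.
Qed.

(* Two points of different cells are separated by grid points, where V vanishes. *)
Lemma grid_global n X V K e : 0 <= K -> xbound X K -> truncated alpha V -> 0 <= e ->
  (forall i, (i <= n.+1)%N -> V (grid T n i) = 0) ->
  (forall i h s t, (i <= n)%N -> (forest_size h < N)%N -> in_cell n i s -> in_cell n i t ->
    `|remainder X V h s t| <= e * dist s t `^ bw (forest_size h)) ->
  pbound bw X V ((1 + cB * (cB * K) * Lpow T 2) * e).
Proof.
move=> K0 hX tV e0 V0 hV; have b0 := cB_ge0 A alpha.
have C0 : 0 <= cB * (cB * K) * Lpow T 2 by rewrite !mulr_ge0 ?Lpow_ge0.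
have eC : e <= (1 + cB * (cB * K) * Lpow T 2) * e by rewrite ler_peMl // lerDl.
(* [g1] is an end of the cell of s and [g2] an end of the cell of t. As V vanishes at both, Chen's
   relation gives R^h_{s,t} = R^h_{g2,t} + sum_k (X_{g1,t} star h)(k) R^k_{s,g1}, where each
   remainder stays inside one cell. *)
have between i j h s t (g1 g2 : nat) : (i <= n)%N -> (j <= n)%N -> (forest_size h < N)%N ->
    in_cell n i s -> in_cell n j t -> (g1 <= n.+1)%N -> (g2 <= n.+1)%N ->
    in_cell n i (grid T n g1) -> in_cell n j (grid T n g2) ->
    dist s (grid T n g1) <= dist s t -> dist (grid T n g1) t <= dist s t ->
    dist (grid T n g2) t <= dist s t ->
    `|remainder X V h s t| <= (1 + cB * (cB * K) * Lpow T 2) * e * dist s t `^ bw (forest_size h).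
  move=> ni nj hN is_ jt g1n g2n ig1 jg2 d1 d2 d3; set g := grid T n g1 in d1 d2 ig1 *.
  have E1 : mcoeff h (V t) = remainder X V h (grid T n g2) t.
    by rewrite /remainder V0 // pairing0 subr0.
  have E2 : remainder X V h s t = remainder X V h (grid T n g2) t +
      \sum_(k <- F) star (X g t) (fdelta R h) k * remainder X V k s g.
    rewrite -(pairing_rem halpha X (star (X g t) (fdelta R h)) s g tV) -E1 /remainder.
    by rewrite V0 // pairing0 sub0r -(chen X s g t) starA.
  rewrite {}E2 -[_ * e * _]mulrA mulrDl mul1r; apply: le_trans (ler_normD _ _) _.
  have /andP[w0 w1] := bweight_bounds halpha halpha_inv hb (forest_size h).
  apply: lerD.
    apply: le_trans (hV j h _ t nj hN jg2 jt) _.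
    by rewrite ler_wpM2l // le_powR.
  rewrite -[leRHS](_ : cB * (cB * K * Lpow T 2 * (e * dist s t `^ bw (forest_size h))) = _); last ring.
  apply: (sum_F_le halpha) => [|k kN]; first by rewrite !mulr_ge0 ?powR_ge0.
  have [kh|hk] := ltnP (forest_size k) (forest_size h).
    by rewrite star_delta0 // mul0r normr0 !mulr_ge0 ?powR_ge0.
  have hs := star_bound halpha h g t K0 hX kN.
  have hr := hV i k s g ni kN is_ ig1.
  rewrite normrM; apply: le_trans (ler_pM (normr_ge0 _) (normr_ge0 _) hs hr) _.
  have /andP[v0 v1] := bweight_bounds halpha halpha_inv hb (forest_size k).
  have q0 := sizeB_ge0 halpha h k; have q1 := sizeB_le1 halpha halpha_inv h kN.
  have e1 : dist g t `^ sizeB alpha h k <= dist s t `^ sizeB alpha h k by exact: le_powR.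
  have e2 : dist s g `^ bw (forest_size k) <= dist s t `^ bw (forest_size k) by exact: le_powR.
  have e3 : dist s t `^ sizeB alpha h k * dist s t `^ bw (forest_size k) <=
      Lpow T 2 * dist s t `^ bw (forest_size h).
    rewrite -powRDge0 //; apply: dist_weaken => //; last lra.
    rewrite /bweight /sizeB; have /andP[_ ba] := hb.
    apply: (@le_trans _ _ ((forest_size k - forest_size h)%N%:R * beta +
        (N - forest_size k)%N%:R * beta)); last by rewrite lerD2r ler_wpM2l.
    rewrite -mulrDl -natrD ler_wpM2r ?(ltW beta0) // ler_nat.
    by rewrite addnC addnBA // subnK // ltnW.
  apply: (@le_trans _ _ (cB * (K * dist s t `^ sizeB alpha h k) * (e * dist s t `^ bw (forest_size k)))).
    by apply: ler_pM; rewrite ?mulr_ge0 ?powR_ge0 //; do ?[apply: ler_wpM2l => //].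
  rewrite (_ : _ * _ = cB * K * e * (dist s t `^ sizeB alpha h k * dist s t `^ bw (forest_size k))); last ring.
  rewrite (_ : cB * K * Lpow T 2 * _ = cB * K * e * (Lpow T 2 * dist s t `^ bw (forest_size h))); last ring.
  by apply: ler_wpM2l => //; rewrite !mulr_ge0.
apply/pboundP; split=> [h hN|h s t hN].
  by rewrite -(grid0 T n) V0 // mcoeff0 normr0; exact: le_trans eC.
have [i ni is_] := grid_cell n s; have [j nj jt] := grid_cell n t.
have [s1 s2] := andP is_; have [t1 t2] := andP jt.
have [ij|ji|ij] := ltngtP i j.
- have g12 := grid_le ij (leqW nj).
  have st : tv s <= tv t by exact: le_trans s2 (le_trans g12 t1).
  apply: (between i j h s t i.+1 j) => //; rewrite /in_cell ?lexx ?andbT ?grid_le // ?(leqW _) //.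
  + by rewrite !ger0_norm ?subr_ge0 //; move: (le_trans g12 t1); lra.
  + have h2 := le_trans g12 t1; rewrite !ger0_norm ?subr_ge0 //; lra.
  + have h2 := le_trans s2 g12; rewrite !ger0_norm ?subr_ge0 //; lra.
- have g12 := grid_le ji (leqW ni).
  have st : tv t <= tv s by exact: le_trans t2 (le_trans g12 s1).
  apply: (between i j h s t i j.+1) => //; rewrite /in_cell ?lexx ?andbT ?grid_le // ?(leqW _) //.
  + have h2 := le_trans t2 g12; rewrite !ler0_norm ?subr_le0 //; lra.
  + have h2 := le_trans t2 g12; rewrite !ler0_norm ?subr_le0 //; lra.
  + have h2 := le_trans g12 s1; rewrite !ler0_norm ?subr_le0 //; lra.
rewrite -ij in jt; apply: le_trans (hV i h s t ni hN is_ jt) _.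
by rewrite ler_wpM2r ?powR_ge0.
Qed.

Lemma section_dense X Z e : controlled X Z -> 0 < e ->
  exists f : forest A -> time -> R, exists G,
  [/\ forall h, (forest_size h < N)%N -> little_hoelder kappa (f h),
      is_Gamma P X f G & pclose bw X X Z G e].
Proof.
move=> /(controlledP halpha)[tZ [M hM]] e0.
have [K K1 hX] := xbound_exists X; have K0 : 0 <= K by exact: le_trans ler01 K1.
have M0 := pclose_ge0 halpha hM; have b0 := cB_ge0 A alpha.
have k01 : 0 < kappa < 1.
  by case/andP: hkappa => k0 ->; rewrite andbT; apply: le_lt_trans k0; rewrite mulr_ge0 // ltW.
pose D := M + cellC alpha P K ^+ N * M.
have D0 : 0 <= D by rewrite addr_ge0 // mulr_ge0 // exprn_ge0 // (le_trans ler01 (cellC_ge1 halpha hP K0)).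
pose Q := (1 + cB * (cB * K) * Lpow T 2) * D.
have Q0 : 0 <= Q by rewrite mulr_ge0 // addr_ge0 // !mulr_ge0 ?Lpow_ge0.
have ab0 : 0 < alpha - beta by rewrite subr_gt0; case/andP: hbeta.
have [d d0 hd] := small_powR ab0 Q0 e0.
pose d' := Num.min d 1; have d'0 : 0 < d' by rewrite lt_min d0 ltr01.
pose n := Num.truncn (T%:num / d').
pose delta : R := T%:num / n.+1%:R.
have delta0 : 0 < delta by rewrite divr_gt0.
have deltad : delta <= d'.
  rewrite /delta ler_pdivrMr // mulrC -ler_pdivrMr //; exact/ltW/truncnS_gt.
(* On the grid f^h = Z^h - J, so G^h = J + f^h equals Z^h there, separately for each h. *)
pose op (h : forest A) (J : time -> R) : time -> R := interp n (fun t => mcoeff h (Z t) - J t).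
have hop h J : hoelder_path kappa (op h J).
  by apply: (little_hoelder_bound _ (little_hoelder_interp _ _ k01)); case/andP: k01 => -> /ltW.
have [f [G [gG fE]]] := gamma_exists halpha halpha_inv hP hkappa X hop.
have [tG _] := (is_GammaP hP _ _ _).1 gG.
exists f, G; split=> // [h hN|]; first by rewrite fE //; exact: little_hoelder_interp.
have GZ i : (i <= n.+1)%N -> Z (grid T n i) = G (grid T n i).
  move=> ni; apply/malgP => h; have [hN|hN] := ltnP (forest_size h) N; last by rewrite tZ // tG.
  have := congr1 (fun F => F (grid T n i)) (fE h hN); rewrite /op interp_grid // => E.
  apply/eqP; rewrite -subr_eq0; apply/eqP.
  by apply: (addIr (f h (grid T n i))); rewrite add0r [RHS]E; ring.
have hZ h s t : (forest_size h < N)%N ->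
    `|remainder X Z h s t| <= M * dist s t `^ qexp alpha h.
  by have [_ h2] := (pboundP _ _ _ _).1 hM; exact: h2.
have affine i h s t : (i <= n)%N -> (forest_size h < N)%N -> in_cell n i s -> in_cell n i t ->
    f h t - f h s = (f h (grid T n i.+1) - f h (grid T n i)) * ((tv t - tv s) / delta).
  move=> ni hN hs ht; rewrite fE // /op (interp_cell _ ni hs) (interp_cell _ ni ht).
  rewrite !interp_grid ?(leqW ni) // /delta; ring.
apply: (pbound_sub _ _ _ _ _).1; apply: (@pclose_le _ _ _ _ _ _ _ _ _ ((1 + cB * (cB * K) * Lpow T 2) * (D * d `^ (alpha - beta)))).
  by rewrite mulrA ltW.
apply: (grid_global (n := n) K0 hX).
- by move=> t h hN; rewrite mcoeffB tZ // tG // subrr.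
- by rewrite mulr_ge0 ?powR_ge0.
- by move=> i ni; rewrite GZ // subrr.
move=> i h s t ni hN hs ht.
have hc := cell_diff halpha halpha_inv hP delta0 (gridS T ni) K0 M0 hX gG (GZ i (leqW ni)) (GZ i.+1 ni) hZ
  (fun h s t hN hs ht => affine i h s t ni hN hs ht) hN hs ht.
apply: le_trans hc _.
rewrite -/D -mulrA ler_wpM2l //.
have dd : dist s t <= delta.
  move: hs ht => /andP[a1 a2] /andP[a3 a4]; have := gridS T ni; rewrite -/delta => ds.
  by rewrite ler_norml; apply/andP; split; lra.
have m1 : 1 <= (N - forest_size h)%N%:R :> R by rewrite ler1n subn_gt0.
(* Since |h| < N the first factor is at least 1; with distances at most 1 the gain is at least the
   power alpha - beta of the mesh. This is where beta < alpha is used strictly. *)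
have -> : qexp alpha h = (N - forest_size h)%N%:R * (alpha - beta) + bw (forest_size h).
  by rewrite /qexp /bweight; ring.
have mab : alpha - beta <= (N - forest_size h)%N%:R * (alpha - beta) by rewrite ler_peMl // ltW.
have bw0 : 0 <= bw (forest_size h) by case/andP: (bweight_bounds halpha halpha_inv hb (forest_size h)).
rewrite (powRDge0 (normr_ge0 _) (le_trans (ltW ab0) mab) bw0).
rewrite ler_wpM2r ?powR_ge0 //.
have [dd' d1] : dist s t <= d /\ dist s t <= 1.
  by have := le_trans dd deltad; rewrite le_min => /andP.
apply: (@le_trans _ _ (dist s t `^ (alpha - beta))); last by rewrite le_powR // ltW.
have ex0 : 0 <= (N - forest_size h)%N%:R * (alpha - beta) - (alpha - beta) by rewrite subr_ge0.
have -> : (N - forest_size h)%N%:R * (alpha - beta) =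
  ((N - forest_size h)%N%:R * (alpha - beta) - (alpha - beta)) + (alpha - beta) by ring.
rewrite (powRDge0 (normr_ge0 _) ex0 (ltW ab0)) ler_piMl ?powR_ge0 //.
by apply: le_trans (le_powR ex0 _ d1) _; rewrite ?powR1.
Qed.

End Density.

(** * Lacunary series that are not integrable against each other *)

Section TrigSums.
Variable R : realType.
Implicit Types (x y phi : R) (i j k n m M : nat).

Lemma trig_2pi k : cos (pi *+ 2 * k%:R) = 1 :> R /\ sin (pi *+ 2 * k%:R) = 0 :> R.
Proof.
elim: k => [|k [IHc IHs]]; first by rewrite mulr0 cos0 sin0.
have -> : k.+1%:R = k%:R + 1 :> R by rewrite -addn1 natrD.
by rewrite mulrDr mulr1 cosD2pi sinD2pi.
Qed.

(** After multiplication by 2 sin(phi / 2) both sums telescope, and the angle K phi closes up. *)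
Lemma trig_sum0 K phi : sin (phi / 2) != 0 -> cos (K%:R * phi) = 1 -> sin (K%:R * phi) = 0 ->
  \sum_(0 <= i < K) cos (i%:R * phi) = 0 /\ \sum_(0 <= i < K) sin (i%:R * phi) = 0.
Proof.
move=> s0 cK sK.
have step i : i.+1%:R * phi - phi / 2 = i%:R * phi + phi / 2.
  have -> : i.+1%:R = i%:R + 1 :> R by rewrite -addn1 natrD.
  by field.
split; apply: (mulfI s0); apply: (mulfI (lt0r_neq0 (ltr0n R 2))); rewrite !mulr0 !mulr_sumr.
  rewrite (eq_bigr (fun i => sin (i.+1%:R * phi - phi / 2) - sin (i%:R * phi - phi / 2))).
    rewrite (telescope_sumr (fun i => sin (i%:R * phi - phi / 2))) //.
    by rewrite mul0r sub0r sinN sinB cK sK; ring.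
  by move=> i _; rewrite step sinD sinB; ring.
rewrite (eq_bigr (fun i => - cos (i.+1%:R * phi - phi / 2) - - cos (i%:R * phi - phi / 2))).
  rewrite (telescope_sumr (fun i => - cos (i%:R * phi - phi / 2))) //.
  by rewrite mul0r sub0r cosN cosB cK sK; ring.
by move=> i _; rewrite step cosD cosB; ring.
Qed.

(** The right side increases with k, because sin 2y = 2 sin y cos y <= 2 sin y, and it is 2 for k =
    0. *)
Lemma sin_pi_pow k : 2 <= 2 ^+ k.+1 * sin (pi / 2 ^+ k.+1) :> R.
Proof.
elim: k => [|k IH]; first by rewrite expr1 sin_pihalf mulr1.
have p0 := pi_gt0 R; have e0 : 0 < 2 ^+ k.+2 :> R by rewrite exprn_gt0.
set y : R := pi / 2 ^+ k.+2; have y0 : 0 < y by rewrite divr_gt0.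
have y1 : y <= pi.
  by rewrite ler_pdivrMr // ler_peMr ?(ltW p0) // exprn_ege1 // ler1n.
have E : pi / 2 ^+ k.+1 = y *+ 2.
  by rewrite /y [2 ^+ k.+2]exprS mulr2n; field; rewrite gt_eqF ?exprn_gt0.
have s0 : 0 <= sin y by rewrite sin_ge0_pi // ltW.
have cs : cos y * sin y <= sin y by rewrite ler_piMl // cos_le1.
apply: le_trans IH _; rewrite E sin_mulr2n mulr2n.
rewrite [leRHS](_ : _ = 2 ^+ k.+1 * (sin y + sin y)); last by rewrite [2 ^+ k.+2]exprS; ring.
by rewrite ler_wpM2l ?exprn_ge0 // lerD.
Qed.

Lemma pow2D n : 2 ^+ n + 2 ^+ n = 2 ^+ n.+1 :> R.
Proof. by rewrite exprS; ring. Qed.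

Variable M : nat.
Let K := (2 ^ M)%N.
(** The phase gained by the n-th frequency in one step of the partition into 2^M intervals. *)
Definition dyad n : R := pi *+ 2 * 2 ^+ n / 2 ^+ M.

Let K0 : 0 < 2 ^+ M :> R. Proof. by rewrite exprn_gt0. Qed.
Let KE : K%:R = 2 ^+ M :> R. Proof. by rewrite natrX. Qed.

Lemma dyad_period n : cos (K%:R * dyad n) = 1 /\ sin (K%:R * dyad n) = 0.
Proof.
have -> : K%:R * dyad n = pi *+ 2 * (2 ^ n)%N%:R.
  by rewrite KE /dyad natrX mulrC divfK // gt_eqF.
exact: trig_2pi.
Qed.

Let sin_half_neq0 (c : R) : 0 < c -> c < 2 ^+ M -> sin ((pi *+ 2 * c / 2 ^+ M) / 2) != 0.
Proof.
move=> c0 cM; apply: lt0r_neq0; apply: sin_gt0_pi; have p0 := pi_gt0 R.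
have -> : pi *+ 2 * c / 2 ^+ M / 2 = pi * (c / 2 ^+ M).
  by rewrite mulr2n; field; rewrite gt_eqF.
rewrite mulr_gt0 ?divr_gt0 //= -[ltRHS]mulr1 ltr_pM2l //.
by rewrite ltr_pdivrMr // mul1r.
Qed.

(** Discrete orthogonality: the sums and differences of two distinct frequencies below 2^M are not
    multiples of 2^M, so their exponential sums over a period vanish. *)
Lemma dyad_sums n m : (n < M)%N -> (m < M)%N ->
  [/\ \sum_(0 <= i < K) cos (i%:R * dyad n) * sin (i%:R * dyad m) = 0,
      n != m -> \sum_(0 <= i < K) cos (i%:R * dyad n) * cos (i%:R * dyad m) = 0
    & n = m -> (n.+1 < M)%N -> \sum_(0 <= i < K) cos (i%:R * dyad n) * cos (i%:R * dyad m) = 2 ^+ M / 2].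
Proof.
move=> nM mM; have [cn sn] := dyad_period n; have [cm sm] := dyad_period m.
have p0 k : 0 < 2 ^+ k :> R by rewrite exprn_gt0.
have mono i j : (i <= j)%N -> 2 ^+ i <= 2 ^+ j :> R by move=> ij; rewrite ler_eXn2l // ltr1n.
have lt k : (k < M)%N -> 2 * 2 ^+ k <= 2 ^+ M :> R by move=> kM; rewrite -exprS mono.
have cD : cos (K%:R * (dyad n + dyad m)) = 1 by rewrite mulrDr cosD cn cm sn sm; ring.
have sD : sin (K%:R * (dyad n + dyad m)) = 0 by rewrite mulrDr sinD cn cm sn sm; ring.
have cB : cos (K%:R * (dyad n - dyad m)) = 1 by rewrite mulrBr cosB cn cm sn sm; ring.
have sB : sin (K%:R * (dyad n - dyad m)) = 0 by rewrite mulrBr sinB cn cm sn sm; ring.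
have DE : dyad n + dyad m = pi *+ 2 * (2 ^+ n + 2 ^+ m) / 2 ^+ M by rewrite /dyad; ring.
have BE : dyad n - dyad m = pi *+ 2 * (2 ^+ n - 2 ^+ m) / 2 ^+ M by rewrite /dyad; ring.
have plus : 2 ^+ n + 2 ^+ m < 2 ^+ M :> R ->
   \sum_(0 <= i < K) cos (i%:R * (dyad n + dyad m)) = 0 /\
   \sum_(0 <= i < K) sin (i%:R * (dyad n + dyad m)) = 0.
  move=> h; apply: trig_sum0 => //; rewrite DE.
  exact: (@sin_half_neq0 (2 ^+ n + 2 ^+ m) (addr_gt0 (p0 n) (p0 m)) h).
have minus : n != m ->
   \sum_(0 <= i < K) cos (i%:R * (dyad n - dyad m)) = 0 /\
   \sum_(0 <= i < K) sin (i%:R * (dyad n - dyad m)) = 0.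
  move=> nm; apply: trig_sum0 => //; rewrite BE.
  have := lt _ nM; have := lt _ mM; have := p0 n; have := p0 m => h1 h2 h3 h4.
  move: nm; rewrite neq_ltn => /orP[nm|nm].
    rewrite -[2 ^+ n - 2 ^+ m]opprB mulrN !mulNr sinN oppr_eq0; apply: sin_half_neq0; last lra.
    by rewrite subr_gt0 ltr_eXn2l // ltr1n.
  apply: sin_half_neq0; last lra.
  by rewrite subr_gt0 ltr_eXn2l // ltr1n.
have cc i : cos (i%:R * dyad n) * cos (i%:R * dyad m) =
    2^-1 * (cos (i%:R * (dyad n - dyad m)) + cos (i%:R * (dyad n + dyad m))).
  by rewrite [i%:R * (_ - _)]mulrBr [i%:R * (_ + dyad m)]mulrDr cosB cosD; field.
have cs i : cos (i%:R * dyad n) * sin (i%:R * dyad m) =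
    2^-1 * (sin (i%:R * (dyad n + dyad m)) - sin (i%:R * (dyad n - dyad m))).
  by rewrite [i%:R * (_ - _)]mulrBr [i%:R * (_ + dyad m)]mulrDr sinB sinD; field.
have pnm : n != m -> 2 ^+ n + 2 ^+ m < 2 ^+ M :> R.
  move=> nm; have := lt _ nM; have := lt _ mM => h1 h2.
  move: nm; rewrite neq_ltn => /orP[nm|nm].
    have : 2 ^+ n < 2 ^+ m :> R by rewrite ltr_eXn2l // ltr1n.
    lra.
  have : 2 ^+ m < 2 ^+ n :> R by rewrite ltr_eXn2l // ltr1n.
  lra.
split.
- have [nm|nm] := eqVneq n m.
    rewrite (eq_bigr (fun i => 2^-1 * sin (i%:R * (dyad n + dyad m)))); last first.
      by move=> i _; rewrite cs nm subrr mulr0 sin0 subr0.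
    rewrite -mulr_sumr; have [nM'|] := ltnP n.+1 M.
      rewrite (plus _).2 ?mulr0 // -nm pow2D ltr_eXn2l //.
      by rewrite ltr1n.
    (* For n = M - 1 the doubled frequency is 2^M itself and [trig_sum0] does not apply; but then
       each sine vanishes. *)
    move=> Mn; have e : n.+1 = M by apply/eqP; rewrite eqn_leq nM.
    rewrite big1 ?mulr0 // => i _; rewrite -nm.
    have -> : i%:R * (dyad n + dyad n) = pi *+ 2 * i%:R.
      rewrite /dyad -e exprS; field; exact: lt0r_neq0.
    by case: (trig_2pi i).
  rewrite (eq_bigr _ (fun i _ => cs i)) -mulr_sumr sumrB.
  by rewrite (plus (pnm nm)).2 (minus nm).2 subrr mulr0.
- move=> nm; rewrite (eq_bigr _ (fun i _ => cc i)) -mulr_sumr big_split /=.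
  by rewrite (plus (pnm nm)).1 (minus nm).1 addr0 mulr0.
move=> nm nM'; rewrite (eq_bigr (fun i => 2^-1 * (1 + cos (i%:R * (dyad n + dyad m))))).
  rewrite -mulr_sumr big_split /= (plus _).1.
    by rewrite sumr_const_nat subn0 KE addr0 mulrC.
  by rewrite -nm pow2D ltr_eXn2l // ltr1n.
by move=> i _; rewrite cc nm subrr mulr0 cos0.
Qed.

(** The left-point Riemann sum of the n-th cosine against the m-th sine along the dyadic
    partition. *)
Definition dyad_pair n m : R := \sum_(0 <= i < K)
  cos (i%:R * dyad n) * (sin (i.+1%:R * dyad m) - sin (i%:R * dyad m)).

Lemma dyad_pairE n m : dyad_pair n m =
  (cos (dyad m) - 1) * (\sum_(0 <= i < K) cos (i%:R * dyad n) * sin (i%:R * dyad m)) +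
  sin (dyad m) * (\sum_(0 <= i < K) cos (i%:R * dyad n) * cos (i%:R * dyad m)).
Proof.
rewrite !mulr_sumr -big_split; apply: eq_bigr => i _ /=.
have -> : i.+1%:R = i%:R + 1 :> R by rewrite -addn1 natrD.
by rewrite mulrDl mul1r sinD; ring.
Qed.

Lemma dyad_pair_neq n m : (n < M)%N -> (m < M)%N -> n != m -> dyad_pair n m = 0.
Proof.
by move=> nM mM nm; have [h1 h2 _] := dyad_sums nM mM; rewrite dyad_pairE h1 h2 // !mulr0 addr0.
Qed.

Lemma dyad_pair_last n : n.+1 = M -> dyad_pair n n = 0.
Proof.
move=> nM; have nM' : (n < M)%N by rewrite -nM.
have [h1 _ _] := dyad_sums nM' nM'; rewrite dyad_pairE h1 mulr0 add0r.
have -> : dyad n = pi by rewrite /dyad -nM exprS; field; exact: lt0r_neq0 (exprn_gt0 _ _).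
by rewrite sinpi mul0r.
Qed.

Lemma dyad_pair_ge n : (n.+1 < M)%N -> 2 ^+ n.+1 <= dyad_pair n n.
Proof.
move=> nM; have nM' := ltnW nM; have [h1 _ h2] := dyad_sums nM' nM'.
rewrite dyad_pairE h1 mulr0 add0r h2 //.
have [k kM] : exists k, M = (n + k.+2)%N.
  by exists (M - n.+2)%N; rewrite -addSnnS -addSnnS subnKC.
have -> : dyad n = pi / 2 ^+ k.+1.
  rewrite /dyad kM exprD !exprS; field.
  by rewrite !gt_eqF ?exprn_gt0.
rewrite kM exprD exprS.
have -> : 2 ^+ n * 2 ^+ k.+2 / 2 = 2 ^+ n * 2 ^+ k.+1 :> R by rewrite [2 ^+ k.+2]exprS; field.
rewrite mulrC [leRHS]mulrC -mulrA ler_wpM2l ?exprn_ge0 //; exact: sin_pi_pow.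
Qed.

End TrigSums.

(** * Hoelder regularity of lacunary series *)

Section Lacunary.
Variables (R : realType) (T : {posnum R}) (q ph : R).
Hypothesis hq : 0 < q < 1.
Local Notation time := (time T).
Implicit Types (s t : time) (n k l i : nat).

Let q0 : 0 < q. Proof. by case/andP: hq. Qed.
Let q1 : q < 1. Proof. by case/andP: hq. Qed.

Lemma sin_lipschitz (x y : R) : `|sin y - sin x| <= `|y - x|.
Proof.
wlog xy : x y / x <= y => [hw|].
  have [xy|/ltW yx] := leP x y; first exact: hw.
  by rewrite distrC [leRHS]distrC; exact: hw.
have [|c _ ->] := @MVT_segment R sin cos x y xy (fun z _ => is_derive_sin z).
  by apply: continuous_subspaceT => z; exact: continuous_sin.
by rewrite normrM ler_piMl // cos_max.
Qed.

Definition lac_ratio : R := 2 `^ (- q).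
(** It tends to 0, which places the series in the little Hoelder space, while its square 1/(n+1) is
    not summable. *)
Definition lac_coef n : R := (Num.sqrt n.+1%:R)^-1.
Let r := lac_ratio.
Let c := lac_coef.

Lemma lac_ratio_gt0 : 0 < r. Proof. exact: powR_gt0. Qed.

Let lt_pow2 (a b : R) : a < b -> 2 `^ a < 2 `^ b.
Proof. by move=> ab; rewrite /powR pnatr_eq0 /= ltr_expR ltr_pM2r // ln_gt0 // ltr1n. Qed.

Lemma lac_ratio_lt1 : r < 1.
Proof. by rewrite /r /lac_ratio -[ltRHS](powRr0 2) lt_pow2 // oppr_lt0. Qed.

Lemma lac_ratio_pow : r * 2 `^ q = 1.
Proof. by rewrite /r /lac_ratio powRN mulVf // gt_eqF // powR_gt0. Qed.

Lemma lac_ratio2 : 1 < r * 2.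
Proof.
rewrite -[ltRHS]mulr1 -{1}lac_ratio_pow mulr1 ltr_pM2l ?lac_ratio_gt0 //.
by rewrite -[ltRHS]powRr1 // lt_pow2.
Qed.

Let r0 := lac_ratio_gt0.
Let r1 := lac_ratio_lt1.
Let r2 := lac_ratio_pow.
Let rho1 := lac_ratio2.

Lemma lac_coef_ge0 n : 0 <= c n. Proof. by rewrite invr_ge0 sqrtr_ge0. Qed.

Lemma lac_coef_mono n k : (k <= n)%N -> c n <= c k.
Proof.
move=> kn; rewrite lef_pV2 ?posrE ?sqrtr_gt0 ?ltr0n //.
by rewrite ler_sqrt ?ler_nat.
Qed.

Lemma lac_coef_small (e : R) : 0 < e -> exists k, c k < e.
Proof.
move=> e0; exists (Num.truncn (e ^- 2)).
rewrite /c /lac_coef invf_plt ?posrE ?sqrtr_gt0 ?ltr0n //.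
have h : e ^- 2 < (Num.truncn (e ^- 2)).+1%:R by exact: truncnS_gt.
rewrite -[ltLHS]ger0_norm ?invr_ge0 ?(ltW e0) // -sqrtr_sqr exprVn.
by rewrite ltr_sqrt // ltr0n.
Qed.

Lemma geom_sum_le k l : \sum_(k <= n < l) r ^+ n <= (1 - r)^-1.
Proof.
have d0 : 0 < 1 - r by rewrite subr_gt0.
suff h m : \sum_(0 <= n < m) r ^+ n <= (1 - r)^-1.
  have [kl|lk] := leqP k l; last by rewrite big_geq ?invr_ge0 ?(ltW d0) // ltnW.
  apply: le_trans (h l); rewrite [leRHS](@big_cat_nat _ _ _ k) //= lerDr.
  by apply: sumr_ge0 => n _; rewrite exprn_ge0 // ltW.
elim: m => [|m IH]; first by rewrite big_geq // invr_ge0 ltW.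
rewrite big_nat_recl // expr0; under eq_bigr => n _ do rewrite exprS.
rewrite -mulr_sumr.
apply: (@le_trans _ _ (1 + r * (1 - r)^-1)); first by rewrite lerD2l ler_wpM2l // ltW.
by rewrite le_eqVlt; apply/orP; left; apply/eqP; field; rewrite gt_eqF.
Qed.

Variable L : R.
Hypothesis L0 : 0 <= L.

Let Kc : R := L / (r * 2 - 1).
Definition lac_const : R := 2 * (1 - r)^-1 + 2 * Kc.

Let Kc0 : 0 <= Kc. Proof. by rewrite divr_ge0 // subr_ge0 ltW. Qed.

Lemma lac_const_ge0 : 0 <= lac_const.
Proof. by rewrite addr_ge0 // mulr_ge0 // invr_ge0 subr_ge0 ltW. Qed.

(** Induction on the number of terms replaces a splitting near 2^n = 1/d: removing the first term
    doubles [d], and r 2^q = 1 leaves the main term unchanged. The correction [- Kc * d] absorbs the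
    first term L d, as Kc (2 r - 1) = L. *)
Lemma lacunary_sum l (d : R) : 0 <= d <= 2 ->
  \sum_(0 <= n < l) r ^+ n * Num.min 2 (L * 2 ^+ n * d) <= lac_const * d `^ q - Kc * d.
Proof.
elim: l d => [|l IH] d /andP[d0 d2].
  rewrite big_geq // subr_ge0 /lac_const mulrDl.
  have h : Kc * d <= 2 * Kc * d `^ q.
    rewrite (_ : 2 * Kc * _ = Kc * (2 * d `^ q)); last ring.
    apply: ler_wpM2l => //; have e1 : 0 <= 1 - q by rewrite subr_ge0 ltW.
    have {1}-> : d = d `^ (1 - q) * d `^ q by rewrite -powRDge0 ?(ltW q0) // subrK powRr1.
    rewrite ler_wpM2r ?powR_ge0 //; apply: le_trans (le_powR e1 d0 d2) _.
    by rewrite -[leRHS]powRr1 // ler_powR ?ler1n // lerBlDr lerDl ltW.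
  by apply: le_trans h _; rewrite lerDr mulr_ge0 ?powR_ge0 // mulr_ge0 // invr_ge0 subr_ge0 ltW.
(* For d >= 1 doubling would leave the range, but there the geometric series is already bounded by a
   multiple of d^q. *)
have [d1|d1] := leP 1 d.
  apply: (@le_trans _ _ (2 * (1 - r)^-1)).
    apply: le_trans (ler_wpM2l _ (geom_sum_le 0 l.+1)) => //.
    rewrite mulr_sumr; apply: ler_sum => n _; rewrite mulrC ler_wpM2r ?exprn_ge0 ?(ltW r0) //.
    by rewrite ge_min lexx.
  have dq : 1 <= d `^ q by apply: powR_ge1 => //; exact: ltW.
  have h1 : lac_const <= lac_const * d `^ q by rewrite ler_peMr // lac_const_ge0.
  have h2 : Kc * d <= 2 * Kc by rewrite mulrC ler_wpM2r.
  by move: h1 h2; rewrite {1}/lac_const; lra.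
rewrite big_nat_recl // expr0 mul1r expr0 mulr1.
under eq_bigr => n _ do rewrite exprS -mulrA.
rewrite -mulr_sumr.
have -> : \sum_(0 <= n < l) r ^+ n * Num.min 2 (L * 2 ^+ n.+1 * d) =
   \sum_(0 <= n < l) r ^+ n * Num.min 2 (L * 2 ^+ n * (2 * d)).
  by apply: eq_bigr => n _; congr (_ * Num.min _ _); rewrite exprS; ring.
have d2' : 0 <= 2 * d <= 2 by rewrite mulr_ge0 //= -[leRHS]mulr1 ler_wpM2l // ltW.
have {IH}IH := ler_wpM2l (ltW r0) (IH (2 * d) d2').
have m1 : Num.min 2 (L * d) <= L * d by rewrite ge_min lexx orbT.
apply: le_trans (lerD m1 IH) _.
rewrite powRM // [X in _ + X](_ : _ = lac_const * (r * 2 `^ q) * d `^ q - (r * 2) * Kc * d); last ring.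
rewrite r2 mulr1 addrCA lerD2l -subr_ge0.
rewrite (_ : _ - _ = (Kc * (r * 2 - 1) - L) * d); last ring.
by rewrite /Kc divfK ?subrr ?mul0r // subr_eq0 gt_eqF.
Qed.

End Lacunary.

Section LacunaryPath.
Variables (R : realType) (T : {posnum R}) (q ph : R).
Hypothesis hq : 0 < q < 1.
Local Notation time := (time T).
Local Notation tv := (@time_val R T).
Local Notation dist s t := `|tv t - tv s|.
Implicit Types (s t : time) (n k l i : nat).
Local Notation r := (lac_ratio q).
Local Notation c := (@lac_coef R).

Let q0 : 0 < q. Proof. by case/andP: hq. Qed.
Let r0 : 0 < r. Proof. exact: powR_gt0. Qed.

(** The phase [ph] makes the sine series (0) and the cosine series (pi / 2) instances of one
    construction. *)
Definition lterm n (t : time) : R :=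
  c n * r ^+ n * sin (pi *+ 2 * 2 ^+ n / T%:num * tv t + ph).

Definition lsum k t : R := \sum_(0 <= n < k) lterm n t.

Definition lac t : R := limn (fun k => lsum k t).

Let p2 : 0 <= pi *+ 2 :> R. Proof. by rewrite mulrn_wge0 // ltW // pi_gt0. Qed.

Lemma lterm_diff n s t : `|lterm n t - lterm n s| <=
  c n * (r ^+ n * Num.min 2 (pi *+ 2 * 2 ^+ n * (dist s t / T%:num))).
Proof.
rewrite /lterm -mulrBr normrM ger0_norm; last first.
  by rewrite mulr_ge0 ?lac_coef_ge0 // exprn_ge0 // ltW.
rewrite mulrA ler_wpM2l //; first by rewrite mulr_ge0 ?lac_coef_ge0 // exprn_ge0 // ltW.
rewrite le_min; apply/andP; split.
  by apply: le_trans (ler_normB _ _) _; apply: lerD; exact: sin_max.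
apply: le_trans (sin_lipschitz _ _) _.
rewrite (_ : _ - _ = (pi *+ 2 * 2 ^+ n / T%:num) * (tv t - tv s)); last ring.
rewrite normrM ger0_norm; last by rewrite divr_ge0 // mulr_ge0 // exprn_ge0.
by rewrite [leRHS](_ : _ = pi *+ 2 * 2 ^+ n / T%:num * dist s t) //; ring.
Qed.

Lemma lsum_split k l t : (k <= l)%N -> lsum l t - lsum k t = \sum_(k <= n < l) lterm n t.
Proof. by move=> kl; rewrite /lsum (@big_cat_nat _ _ _ k 0 l) //= addrC addrK. Qed.

Lemma lsum_sup k l t : (k <= l)%N -> `|lsum l t - lsum k t| <= c k * (1 - r)^-1.
Proof.
move=> kl; rewrite lsum_split //; apply: le_trans (ler_norm_sum _ _ _) _.
apply: le_trans (ler_wpM2l (lac_coef_ge0 _ k) (geom_sum_le hq k l)).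
rewrite mulr_sumr; apply: ler_sum_nat => n /andP[kn _].
rewrite normrM normrM (ger0_norm (lac_coef_ge0 _ n)) ger0_norm ?exprn_ge0 ?(ltW r0) //.
rewrite -[leRHS]mulr1; apply: ler_pM => //; rewrite ?mulr_ge0 ?lac_coef_ge0 ?exprn_ge0 ?(ltW r0) //.
  by rewrite ler_wpM2r ?exprn_ge0 ?(ltW r0) // lac_coef_mono.
exact: sin_max.
Qed.

Definition lacC : R := lac_const q (pi *+ 2) * (T%:num^-1) `^ q.

Lemma lacC_ge0 : 0 <= lacC. Proof. by rewrite mulr_ge0 ?powR_ge0 // lac_const_ge0. Qed.

Lemma lsum_hoelder k l s t : (k <= l)%N ->
  `|(lsum l t - lsum k t) - (lsum l s - lsum k s)| <= c k * (lacC * dist s t `^ q).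
Proof.
move=> kl; rewrite !lsum_split // -sumrB; apply: le_trans (ler_norm_sum _ _ _) _.
set d := dist s t / T%:num.
have d0 : 0 <= d by rewrite divr_ge0.
have d1 : d <= 1 by rewrite ler_pdivrMr // mul1r dist_leT.
have m0 n : 0 <= r ^+ n * Num.min 2 (pi *+ 2 * 2 ^+ n * d).
  by rewrite mulr_ge0 ?exprn_ge0 ?(ltW r0) // le_min ler0n /= !mulr_ge0 // exprn_ge0.
apply: (@le_trans _ _ (c k * \sum_(k <= n < l) r ^+ n * Num.min 2 (pi *+ 2 * 2 ^+ n * d))).
  rewrite mulr_sumr; apply: ler_sum_nat => n /andP[kn _].
  by apply: le_trans (lterm_diff n s t) _; rewrite ler_wpM2r // lac_coef_mono.
rewrite ler_wpM2l ?lac_coef_ge0 //.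
apply: (@le_trans _ _ (\sum_(0 <= n < l) r ^+ n * Num.min 2 (pi *+ 2 * 2 ^+ n * d))).
  by rewrite [leRHS](@big_cat_nat _ _ _ k) //= lerDr sumr_ge0.
have d2 : 0 <= d <= 2 by rewrite d0; lra.
apply: le_trans (lacunary_sum hq p2 l d2) _.
have -> : lacC * dist s t `^ q = lac_const q (pi *+ 2) * d `^ q.
  by rewrite /lacC -mulrA -powRM ?invr_ge0 // [_^-1 * _]mulrC.
rewrite lerBlDr lerDl mulr_ge0 //.
by rewrite divr_ge0 // subr_ge0 ltW // lac_ratio2.
Qed.

Lemma lac_cvg t : (fun k => lsum k t) @ \oo --> lac t.
Proof.
suff : cvgn (series (fun n => lterm n t)) by [].
apply: normed_cvg.
have rn : `|r| < 1 by rewrite gtr0_norm // lac_ratio_lt1.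
apply: (series_le_cvg _ _ _ (is_cvg_geometric_series (a := 1) rn)) => n /=.
- exact: normr_ge0.
- by rewrite mul1r exprn_ge0 // ltW.
rewrite mul1r normrM normrM (ger0_norm (lac_coef_ge0 _ n)) ger0_norm ?exprn_ge0 ?(ltW r0) //.
rewrite -[leRHS]mulr1; apply: ler_pM; rewrite ?mulr_ge0 ?lac_coef_ge0 ?exprn_ge0 ?(ltW r0) ?sin_max //.
rewrite ler_piMl ?exprn_ge0 ?(ltW r0) // -[leRHS](_ : c 0 = 1).
  exact: lac_coef_mono.
by rewrite /lac_coef sqrtr1 invr1.
Qed.

Lemma lac_near t (e : R) : 0 < e -> exists k0, forall k, (k0 <= k)%N -> `|lac t - lsum k t| < e.
Proof.
move=> e0; have /cvgrPdist_lt /(_ e e0) [k0 _ h] := @lac_cvg t.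
by exists k0 => k hk; exact: h.
Qed.

Lemma lac_limit s t k (x y : R) (M : R) :
  (forall l, (k <= l)%N -> `|(lsum l t - x) - (lsum l s - y)| <= M) ->
  `|(lac t - x) - (lac s - y)| <= M.
Proof.
move=> h; apply/ler_addgt0Pr => e e0; have e2 : 0 < e / 2 by rewrite divr_gt0.
have [k1 h1] := lac_near t e2; have [k2 h2] := lac_near s e2.
pose l := maxn k (maxn k1 k2).
have := h l (leq_maxl _ _); have := h1 l; have := h2 l.
rewrite !leq_max !leqnn !orbT => /(_ isT) a1 /(_ isT) a2 a3.
rewrite (_ : _ - _ = ((lsum l t - x) - (lsum l s - y)) + ((lac t - lsum l t) - (lac s - lsum l s))); last ring.
apply: le_trans (ler_normD _ _) _; apply: lerD => //; apply: le_trans (ler_normB _ _) _.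
by rewrite [e]splitr; apply: lerD; exact: ltW.
Qed.

Lemma lac_sup k t : `|lac t - lsum k t| <= c k * (1 - r)^-1.
Proof.
apply/ler_addgt0Pr => e e0; have [k1 h1] := lac_near t e0.
have := h1 (maxn k k1) (leq_maxr _ _); have := lsum_sup t (leq_maxl k k1) => a1 a2.
rewrite -(subrKA (lsum (maxn k k1) t)); apply: le_trans (ler_normD _ _) _.
by rewrite addrC; apply: lerD => //; exact: ltW.
Qed.

Lemma lac_approx (e : R) : 0 < e -> exists k, happrox q lac (lsum k) e.
Proof.
move=> e0; pose C := (1 - r)^-1 + lacC.
have C0 : 0 < C.
  by rewrite ltr_pwDl ?lacC_ge0 // invr_gt0 subr_gt0 lac_ratio_lt1.
have [k hk] := @lac_coef_small R _ (divr_gt0 e0 C0); exists k.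
have ck := lac_coef_ge0 R k.
have ke : c k * C <= e by rewrite -ler_pdivlMr // ltW.
split=> [t|s t].
  apply: le_trans (lac_sup k t) _; apply: le_trans ke; rewrite ler_wpM2l // lerDl.
  exact: lacC_ge0.
apply: (@lac_limit s t k) => l kl; apply: le_trans (lsum_hoelder s t kl) _.
rewrite mulrA ler_wpM2r ?powR_ge0 //; apply: le_trans ke; rewrite ler_wpM2l // lerDr.
by rewrite invr_ge0 subr_ge0 ltW // lac_ratio_lt1.
Qed.

Lemma smooth_sin (w0 c0 : R) : smooth (fun t : time => sin (w0 * tv t + c0)).
Proof.
pose D n (x : R) := w0 ^+ n * sin (w0 * x + c0 + n%:R * (pi / 2)).
rewrite (_ : (fun t => _) = D 0%N \o tv); last first.
  by apply/funext => t; rewrite /D /= expr0 mul1r mul0r addr0.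
apply: smooth_R => n x.
have d1 : is_derive x (1 : R) (fun y : R => w0 * y + (c0 + n%:R * (pi / 2))) (w0 * 1 + 0).
  exact: (@is_deriveD _ _ _ (fun y : R => w0 * y) (cst (c0 + n%:R * (pi / 2)))).
have d2 : is_derive x (1 : R) (fun y : R => sin (w0 * y + (c0 + n%:R * (pi / 2)))) _ :=
  is_derive1_comp (is_derive_sin _) d1.
have d3 := is_deriveZ (w0 ^+ n) d2.
rewrite (_ : D n = w0 ^+ n *: (fun y : R => sin (w0 * y + (c0 + n%:R * (pi / 2))))); last first.
  by apply/funext => y; rewrite /D -addrA.
refine (is_derive_eq d3 _).
have -> : D n.+1 x = w0 ^+ n.+1 * cos (w0 * x + (c0 + n%:R * (pi / 2))).
  rewrite /D -sinDpihalf; congr (_ * sin _).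
  have -> : n.+1%:R = n%:R + 1 :> R by rewrite -addn1 natrD.
  ring.
by rewrite /GRing.scale /= mulr1 addr0 exprS; ring.
Qed.

Lemma smooth_lsum k : smooth (lsum k).
Proof.
elim: k => [|k IH].
  rewrite (_ : lsum 0 = fun=> 0); first exact: smooth_cst.
  by apply/funext => t; rewrite /lsum big_geq.
rewrite (_ : lsum k.+1 = fun t => (c k * r ^+ k) *
   sin (pi *+ 2 * 2 ^+ k / T%:num * tv t + ph) + lsum k t); last first.
  by apply/funext => t; rewrite /lsum big_nat_recr //= addrC.
by apply: smooth_lin => //; exact: smooth_sin.
Qed.

Lemma little_hoelder_lac : little_hoelder q lac.
Proof.
apply/little_hoelderP => e e0; have [k hk] := lac_approx e0.
by exists (lsum k) => //; exact: smooth_lsum.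
Qed.

(* At dyadic times of level M the terms beyond the M-th complete full periods. *)
Lemma lac_dyadic (M i : nat) t : tv t = T%:num * (i%:R / 2 ^+ M) ->
  lac t - lsum M t = lac (time0 T) - lsum M (time0 T).
Proof.
move=> tE; apply/eqP; rewrite -subr_eq0 -normr_le0.
apply: (@lac_limit (time0 T) t M) => l Ml; rewrite !lsum_split // -sumrB big1_seq ?normr0 // => n.
rewrite mem_index_iota => /= /andP[Mn _]; apply/eqP; rewrite subr_eq0; apply/eqP.
rewrite /lterm; congr (_ * _); rewrite tE mulr0 add0r.
have -> : pi *+ 2 * 2 ^+ n / T%:num * (T%:num * (i%:R / 2 ^+ M)) =
    pi *+ 2 * (2 ^ (n - M) * i)%N%:R.
  have -> : 2 ^+ n = 2 ^+ (n - M) * 2 ^+ M :> R by rewrite -exprD subnK.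
  rewrite natrM natrX; field.
  by rewrite !gt_eqF ?exprn_gt0.
by have [h1 h2] := trig_2pi R (2 ^ (n - M) * i); rewrite sinD h1 h2 mul0r add0r mul1r.
Qed.

End LacunaryPath.

(** * The geometric rough path over a scalar path *)

Section TreeFactorial.
Variables (R : realType) (A : finType).
Implicit Types (h k : forest A) (t u : ptree A).

(* The reciprocal of the tree factorial. *)
Fixpoint tree_weight t : R :=
  let: PNode _ s := t in
  foldr *%R 1 (map tree_weight s) / (sumn (map (@ptree_size A) s)).+1%:R.

Definition forest_weight h : R := \prod_(t <- h) tree_weight t.

Lemma foldr_prod (l : seq R) : foldr *%R 1 l = \prod_(x <- l) x.
Proof. by elim: l => [|x l IH]; rewrite ?big_nil // big_cons -IH. Qed.

Lemma tree_weight_nf t : tree_weight (tree_nf t) = tree_weight t.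
Proof.
elim/ptree_ind_in: t => a s IH /=; rewrite !foldr_prod -/(forest_nf s); congr (_ / _).
  rewrite !big_map (perm_big _ (perm_forest_nf s)) big_map.
  elim: s IH => [|t s IHs] /=; first by rewrite !big_nil.
  by move=> [e /IHs IHs']; rewrite !big_cons e IHs'.
by rewrite -/(forest_size (mkforest s)) forest_size_mk.
Qed.

Lemma forest_weight_mk (s : seq (ptree A)) : forest_weight (mkforest s) = \prod_(t <- s) tree_weight t.
Proof.
rewrite /forest_weight /= (perm_big _ (perm_forest_nf s)) big_map.
by apply: eq_bigr => t _; exact: tree_weight_nf.
Qed.

Lemma forest_weight1 : forest_weight (fempty A) = 1.
Proof. by rewrite forest_weight_mk big_nil. Qed.

Lemma forest_weightM h k : forest_weight (fmul h k) = forest_weight h * forest_weight k.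
Proof. by rewrite forest_weight_mk big_cat. Qed.

Lemma forest_weight_graft a h :
  forest_weight (fgraft a h) = forest_weight h / (forest_size h).+1%:R.
Proof. by rewrite forest_weight_mk big_seq1 /= foldr_prod big_map. Qed.

Lemma forest_weight01 h : 0 <= forest_weight h <= 1.
Proof.
elim/forest_ind: h => [|a h /andP[h0 h1]|h k /andP[h0 h1] /andP[k0 k1]].
- by rewrite forest_weight1 ler01 lexx.
- rewrite forest_weight_graft divr_ge0 //= ler_pdivrMr ?ltr0n // mul1r.
  by apply: le_trans h1 _; rewrite ler1n.
by rewrite forest_weightM mulr_ge0 //= -[leRHS]mulr1; apply: ler_pM.
Qed.

Lemma deriv_inj (p q : {poly R}) : p^`() = q^`() -> p.[0] = q.[0] -> p = q.
Proof.
move=> d0 e; apply/polyP => -[|i]; first by rewrite -!horner_coef0.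
have := congr1 (fun p : {poly R} => p`_i) d0; rewrite !coef_deriv => /eqP.
by rewrite -subr_eq0 -mulrnBl mulrn_eq0 /= subr_eq0 => /eqP.
Qed.

(* The binomial formula along the coproduct: both sides of the grafting step have
   the same derivative and the same value at 0. *)
Lemma weight_binomial_poly (y : R) h :
  \sum_(c <- coprod h) (y ^+ forest_size c.1 * forest_weight c.1 * forest_weight c.2) *:
    'X^(forest_size c.2) = forest_weight h *: (y%:P + 'X) ^+ forest_size h.
Proof.
pose O (b c : forest A) : {poly R} := (y ^+ forest_size b * forest_weight b * forest_weight c) *: 'X^(forest_size c).
elim/forest_ind: h => [|a h IH|h k IHh IHk].
- rewrite (coprod_sum1 O) /O !forest_size1 forest_weight1 !expr0 !mul1r //.
- rewrite (coprod_sum_graft O) /O; apply: deriv_inj.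
    rewrite derivD derivZ derivXn forest_size1 /= mulr0n scaler0 addr0.
    rewrite derivZ deriv_exp derivD derivC derivX add0r mul1r forest_size_graft /=.
    rewrite forest_weight_graft -[_ ^+ _ *+ _]scaler_nat scalerA divfK ?pnatr_eq0 // -IH.
    rewrite (linear_sum (@deriv R)); apply: eq_bigr => c _ /=.
    rewrite derivZ forest_size_graft derivXn /= -['X^_ *+ _]scaler_nat scalerA forest_weight_graft.
    by congr (_ *: _); rewrite -!mulrA mulVf ?pnatr_eq0 // mulr1.
  rewrite hornerD horner_sum big1 => [|c _]; last first.
    by rewrite hornerZ forest_size_graft hornerXn expr0n /= mulr0.
  rewrite !hornerZ forest_size1 hornerXn expr0 forest_weight1 horner_exp hornerD hornerC hornerX addr0 add0r.
  ring.
rewrite (coprod_sum_mul O) forest_weightM forest_size_mul exprD.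
rewrite -scalerA scalerAr scalerAl -IHh -IHk mulr_suml; apply: eq_bigr => c _.
rewrite mulr_sumr; apply: eq_bigr => d _; rewrite /O !forest_weightM !forest_size_mul.
rewrite -[RHS]scalerAl -[X in _ = _ *: X]scalerAr [RHS]scalerA !exprD; congr (_ *: _); ring.
Qed.

Lemma weight_binomial (y z : R) h :
  \sum_(c <- coprod h) y ^+ forest_size c.1 * forest_weight c.1 *
     (z ^+ forest_size c.2 * forest_weight c.2) = (y + z) ^+ forest_size h * forest_weight h.
Proof.
have := congr1 (fun p => p.[z]) (weight_binomial_poly y h).
rewrite horner_sum hornerZ horner_exp hornerD hornerC hornerX [RHS]mulrC => <-.
by apply: eq_bigr => c _; rewrite hornerZ hornerXn; ring.
Qed.

End TreeFactorial.

(** * Divergence of the dyadic Riemann sums *)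

Section NotIntegrable.
Variables (R : realType) (T : {posnum R}) (alpha gamma : R).
Hypothesis halpha : 0 < alpha < 1.
Hypothesis hgamma : 0 < gamma < 1.
Hypothesis hsum : gamma + alpha <= 1.
Local Notation time := (time T).
Local Notation tv := (@time_val R T).
Implicit Types (s t : time) (n k l i M : nat).
Local Notation c := (@lac_coef R).

Lemma psum_map (Xi : time -> time -> R) (p : nat -> time) m n :
  partition_sum Xi (p m) [seq p i | i <- iota m.+1 n] = \sum_(m <= i < m + n) Xi (p i) (p i.+1).
Proof.
elim: n m => [|n IH] m /=; first by rewrite psum_nil addn0 big_geq.
by rewrite psum_cons IH addSnnS [RHS]big_ltn // addnS ltnS leq_addr.
Qed.

Lemma harmonic_unbounded (B : R) : exists n, B < \sum_(0 <= i < n) i.+1%:R^-1.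
Proof.
apply: contrapT => h; apply: (@dvg_harmonic R).
apply: nondecreasing_is_cvgn.
  apply/nondecreasing_seqP => n; rewrite /series /= big_nat_recr //= lerDl.
  by rewrite invr_ge0.
exists B => _ [n _ <-]; rewrite /series /= leNgt; apply/negP => hn; apply: h; exists n.
exact: hn.
Qed.

Definition rough_cos : time -> R := lac gamma (pi / 2).
Definition rough_sin : time -> R := lac alpha 0.

Let Tend : time := mktime T T%:num.
Let TendE : tv Tend = T%:num. Proof. by apply: mktimeE; rewrite lexx andbT. Qed.

Section Level.
Variable M : nat.
Let K := (2 ^ M)%N.
Let K0 : 0 < 2 ^+ M :> R. Proof. by rewrite exprn_gt0. Qed.
Let p i : time := mktime T (tv (time0 T) + (tv Tend - tv (time0 T)) * i%:R / K%:R).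

Let pE i : (i <= K)%N -> tv (p i) = T%:num * (i%:R / 2 ^+ M).
Proof.
move=> iK; have -> : T%:num * (i%:R / 2 ^+ M) = tv (time0 T) + (tv Tend - tv (time0 T)) * i%:R / K%:R.
  by rewrite TendE natrX add0r subr0 mulrA.
apply: mktimeE; rewrite TendE add0r subr0 natrX -mulrA; have q0 : 0 <= i%:R / 2 ^+ M :> R by rewrite divr_ge0 // ltW.
rewrite mulr_ge0 //=.
by rewrite ler_piMr // ler_pdivrMr // mul1r -natrX ler_nat.
Qed.

Let p_start : p 0 = time0 T.
Proof. by apply: time_val_inj; rewrite pE // mul0r mulr0. Qed.

Let p_end : p K = Tend.
Proof. by apply: time_val_inj; rewrite pE // TendE natrX divff ?mulr1 // gt_eqF. Qed.

Lemma lterm_cos n i : (i <= K)%N -> lterm gamma (pi / 2) n (p i) =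
  c n * lac_ratio gamma ^+ n * cos (i%:R * dyad R M n).
Proof.
move=> iK; rewrite /lterm pE // -sinDpihalf; congr (_ * sin (_ + _)).
by rewrite /dyad; field; rewrite !gt_eqF.
Qed.

Lemma lterm_sin n i : (i <= K)%N -> lterm alpha 0 n (p i) =
  c n * lac_ratio alpha ^+ n * sin (i%:R * dyad R M n).
Proof.
move=> iK; rewrite /lterm pE // addr0; congr (_ * sin _).
by rewrite /dyad; field; rewrite !gt_eqF.
Qed.

Lemma rough_sin_end : lsum alpha 0 M (p K) = lsum alpha 0 M (p 0).
Proof.
have h1 : rough_sin Tend - lsum alpha 0 0 Tend = rough_sin (time0 T) - lsum alpha 0 0 (time0 T).
  by apply: (@lac_dyadic _ _ _ _ halpha 0 1); rewrite TendE expr0 divr1 mulr1.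
have h2 : rough_sin Tend - lsum alpha 0 M Tend = rough_sin (time0 T) - lsum alpha 0 M (time0 T).
  by apply: (@lac_dyadic _ _ _ _ halpha M K); rewrite TendE natrX divff ?mulr1 // gt_eqF.
rewrite p_end p_start; move: h1 h2; rewrite /lsum big_geq // big_geq // !subr0 => ->.
by move=> /addrI /oppr_inj.
Qed.

(** At dyadic points the terms of frequency at least 2^M are constant. They cancel in the increments
    of the sine series and add a constant to the cosine series; the latter contributes nothing,
    since the sine series is periodic. Orthogonality leaves the diagonal. *)
Lemma dyadic_sumE : partition_sum (fun u v => rough_cos u * (rough_sin v - rough_sin u))
    (time0 T) (unif_part (time0 T) Tend K) =
  \sum_(0 <= n < M) c n ^+ 2 * (lac_ratio gamma * lac_ratio alpha) ^+ n * dyad_pair R M n n.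
Proof.
rewrite /unif_part -{1}p_start -/p psum_map add0n.
pose kap := rough_cos (time0 T) - lsum gamma (pi / 2) M (time0 T).
have fE i : (i <= K)%N -> rough_cos (p i) = lsum gamma (pi / 2) M (p i) + kap.
  move=> iK; have := lac_dyadic (pi / 2) hgamma (pE iK); rewrite -/rough_cos -/kap => <-.
  by rewrite subrKC.
have xE i : (i < K)%N -> rough_sin (p i.+1) - rough_sin (p i) =
    lsum alpha 0 M (p i.+1) - lsum alpha 0 M (p i).
  move=> iK; have := lac_dyadic 0 halpha (pE iK); have := lac_dyadic 0 halpha (pE (ltnW iK)).
  by rewrite -/rough_sin => h1 h2; lra.
rewrite (eq_big_nat _ _ (F2 := fun i => lsum gamma (pi / 2) M (p i) *
   (lsum alpha 0 M (p i.+1) - lsum alpha 0 M (p i)) +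
   kap * (lsum alpha 0 M (p i.+1) - lsum alpha 0 M (p i)))); last first.
  by move=> i /andP[_ iK]; rewrite (fE _ (ltnW iK)) (xE _ iK) mulrDl.
rewrite big_split /= -mulr_sumr telescope_sumr // rough_sin_end subrr mulr0 addr0.
pose a n : R := c n * lac_ratio gamma ^+ n; pose b n : R := c n * lac_ratio alpha ^+ n.
transitivity (\sum_(0 <= n < M) \sum_(0 <= m < M) a n * b m * dyad_pair R M n m).
  transitivity (\sum_(0 <= i < K) \sum_(0 <= n < M) \sum_(0 <= m < M) a n * b m *
     (cos (i%:R * dyad R M n) * (sin (i.+1%:R * dyad R M m) - sin (i%:R * dyad R M m)))).
    apply: eq_big_nat => i /andP[_ iK]; rewrite /lsum mulr_suml; apply: eq_bigr => n _.
    rewrite -sumrB mulr_sumr; apply: eq_bigr => m _.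
    rewrite (lterm_cos _ (ltnW iK)) (lterm_sin _ iK) (lterm_sin _ (ltnW iK)) /a /b; ring.
  rewrite exchange_big; apply: eq_bigr => n _; rewrite exchange_big; apply: eq_bigr => m _.
  by rewrite /dyad_pair mulr_sumr.
apply: eq_big_nat => n /andP[_ nM].
rewrite (bigD1_seq n) ?mem_index_iota ?iota_uniq //= big_seq_cond big1 ?addr0.
  by rewrite /a /b exprMn expr2; ring.
move=> m /andP[]; rewrite mem_index_iota => /andP[_ mM] mn.
by rewrite dyad_pair_neq ?mulr0 // eq_sym.
Qed.

(** The assumption gamma + alpha <= 1 enters here: the amplitudes decay no faster than the diagonal
    terms [dyad_pair] grow. *)
Let ratio : 1 <= lac_ratio gamma * lac_ratio alpha * 2.
Proof.
rewrite /lac_ratio -powRD; last by rewrite pnatr_eq0 implybT.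
rewrite -[X in _ * X]powRr1 // -powRD; last by rewrite pnatr_eq0 implybT.
rewrite -[leLHS](powRr0 2); apply: ler_powR; rewrite ?ler1n //. by rewrite -opprD addrC subr_ge0.
Qed.

Lemma dyadic_sum_ge : \sum_(0 <= n < M.-1) n.+1%:R^-1 <=
  partition_sum (fun u v => rough_cos u * (rough_sin v - rough_sin u))
    (time0 T) (unif_part (time0 T) Tend K).
Proof.
rewrite dyadic_sumE; case EM : M => [|m]; first by rewrite !big_geq.
(* The highest frequency, n = M - 1, contributes 0: its sine vanishes at all points of the
   partition. Hence the sum stops at [M.-1]. *)
rewrite [leRHS]big_nat_recr //= dyad_pair_last // mulr0 addr0.
apply: ler_sum_nat => n /andP[_ nm].
have r0 : 0 <= (lac_ratio gamma * lac_ratio alpha) ^+ n.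
  by rewrite exprn_ge0 // mulr_ge0 // powR_ge0.
have nM : (n.+1 < m.+1)%N by [].
have c2 : c n ^+ 2 = n.+1%:R^-1 by rewrite /lac_coef exprVn sqr_sqrtr.
rewrite c2 -[leLHS]mulr1 -mulrA ler_wpM2l ?invr_ge0 //.
apply: (@le_trans _ _ ((lac_ratio gamma * lac_ratio alpha) ^+ n * 2 ^+ n.+1)).
  apply: (@le_trans _ _ ((lac_ratio gamma * lac_ratio alpha * 2) ^+ n)).
    by rewrite exprn_ege1.
  by rewrite exprMn ler_wpM2l // ler_eXn2l // ltr1n.
by rewrite ler_wpM2l // dyad_pair_ge.
Qed.

End Level.

Lemma not_integrable I :
  ~ has_integral (fun u v => rough_cos u * (rough_sin v - rough_sin u)) (time0 T) Tend I.
Proof.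
have T0 : tv (time0 T) < tv Tend by rewrite TendE; change (0 < T%:num).
move=> /(has_integralP _ _ (ltW T0)) /(_ 1 ltr01)[d d0 hd].
have [n hn] := harmonic_unbounded (I + 1).
(* Large enough for the mesh T / 2^M to be below [d] and for [M.-1] to be at least [n]. *)
pose M := (maxn n (Num.truncn (T%:num / d))).+1.
have KM : ((2 ^ M).-1.+1 = 2 ^ M)%N by rewrite prednK // expn_gt0.
have [|pl ml] := @unif_partP _ _ _ _ (2 ^ M).-1 d T0.
  rewrite KM TendE subr0 ltr_pdivrMr ?ltr0n ?expn_gt0 // mulrC -ltr_pdivrMr //.
  apply: lt_le_trans (truncnS_gt _) _; rewrite ler_nat.
  apply: (@leq_trans M); last by apply: ltnW; exact: ltn_expl.
  by rewrite ltnS leq_maxr.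
rewrite KM in pl ml; have := hd _ pl ml.
rewrite ltNge => /negP; apply; apply: le_trans (ler_norm _); rewrite lerBrDr addrC.
apply: le_trans (dyadic_sum_ge M); apply: le_trans (ltW hn) _.
rewrite [leRHS](@big_cat_nat _ _ _ n) //=; last by rewrite leq_maxl.
by rewrite lerDl sumr_ge0.
Qed.

End NotIntegrable.

(** * The lift of a scalar path, its geometricity, and scalar controlled paths *)

Section PathLift.
Variables (R : realType) (A : finType) (T : {posnum R}) (alpha : R).
Hypothesis halpha : 0 < alpha < 1.
Hypothesis halpha_inv : forall n : nat, (0 < n)%N -> alpha <> n%:R^-1.
Local Notation time := (time T).
Local Notation tv := (@time_val R T).
Local Notation dist s t := `|tv t - tv s|.
Local Notation one := (fempty A).
Local Notation N := (level alpha).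
Local Notation H := (forest_alg R A).
Local Notation w := (@forest_weight R A).
Implicit Types (x y : time -> R) (s t u : time) (h k : forest A) (f g : time -> R).
Local Opaque pairing forest_vec fempty.

Let alpha0 : 0 < alpha. Proof. by case/andP: halpha. Qed.

Definition path_lift x s t h : R := (x t - x s) ^+ forest_size h * w h.

Definition alpha_hoelder x C := 0 <= C /\ forall s t, `|x t - x s| <= C * dist s t `^ alpha.

Lemma exp_hoelder (d C D : R) n : 0 <= d -> 0 <= C -> `|D| <= C * d `^ alpha ->
  `|D| ^+ n <= C ^+ n * d `^ (n%:R * alpha).
Proof.
move=> d0 C0 hD; have -> : d `^ (n%:R * alpha) = (d `^ alpha) ^+ n.
  by rewrite mulrC powRrM powR_mulrn ?powR_ge0.
by rewrite -exprMn lerXn2r // nnegrE mulr_ge0 ?powR_ge0.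
Qed.

Lemma path_lift_rough x C : alpha_hoelder x C -> is_rough_path alpha (path_lift x).
Proof.
move=> [C0 hx]; split=> [s t|s u t h|h].
- split=> [|h k]; first by rewrite /path_lift forest_size1 forest_weight1 expr0 mulr1.
  by rewrite /path_lift forest_size_mul forest_weightM exprD; ring.
- rewrite /star /path_lift weight_binomial; congr (_ ^+ _ * _); ring.
apply: le_lt_trans (ltry (C ^+ forest_size h)); apply: hoelder_geP => s t _.
have /andP[w0 w1] := forest_weight01 R h.
rewrite /path_lift normrM normrX (ger0_norm w0) mulrC.
rewrite [alpha * _]mulrC; apply: le_trans (exp_hoelder _ (normr_ge0 _) C0 (hx s t)).
by rewrite ler_piMl // exprn_ge0.
Qed.

Definition path_rough x C (hx : alpha_hoelder x C) : rough_path A T alpha :=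
  RoughPath (path_lift_rough hx).

(** The quadratic error makes the germ of the canonical lift of a Lipschitz path agree with the
    increments of [path_lift] up to |v - u|^2, so that [has_integral_of_bound] applies with exponent
    2. *)
Lemma pow_taylor (L : R) n : 0 <= L -> exists2 C, 0 <= C & forall a b : R, `|a| <= L -> `|b| <= L ->
  `|b ^+ n.+1 - a ^+ n.+1 - n.+1%:R * a ^+ n * (b - a)| <= C * `|b - a| ^+ 2.
Proof.
move=> L0; elim: n => [|n [C C0 hC]].
  exists 0 => // a b _ _; rewrite (_ : _ - _ = 0) ?normr0 ?mul0r //; ring.
exists (L * C + n.+1%:R * L ^+ n); first by rewrite addr_ge0 ?mulr_ge0 // exprn_ge0.
move=> a b ha hb.
have -> : b ^+ n.+2 - a ^+ n.+2 - n.+2%:R * a ^+ n.+1 * (b - a) =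
    b * (b ^+ n.+1 - a ^+ n.+1 - n.+1%:R * a ^+ n * (b - a)) + n.+1%:R * a ^+ n * (b - a) ^+ 2.
  have -> : n.+2%:R = n.+1%:R + 1 :> R by rewrite -addn1 natrD.
  by rewrite !exprS; ring.
apply: le_trans (ler_normD _ _) _; rewrite mulrDl; apply: lerD.
  by rewrite normrM -[leRHS]mulrA; apply: ler_pM => //; exact: hC.
have -> : `|n.+1%:R * a ^+ n * (b - a) ^+ 2| = n.+1%:R * `|a| ^+ n * `|b - a| ^+ 2.
  by rewrite normrM (normrM n.+1%:R) !normrX ger0_norm.
apply: ler_wpM2r; first exact: exprn_ge0.
by apply: ler_wpM2l => //; rewrite lerXn2r // nnegrE.
Qed.

Lemma path_canonical x C (hx : alpha_hoelder x C) M : 0 <= M ->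
  (forall s t, `|x t - x s| <= M * dist s t) -> canonical_lift (fun=> x) (path_rough hx).
Proof.
move=> M0 hM a h s t Xi.
pose J v := path_lift x s v (fgraft a h).
have JE v : J v = (x v - x s) ^+ (forest_size h).+1 * (w h / (forest_size h).+1%:R).
  by rewrite /J /path_lift forest_size_graft forest_weight_graft.
have J0 : J s = 0 by rewrite JE subrr expr0n mul0r.
pose L := M * T%:num; have L0 : 0 <= L by exact: mulr_ge0.
have xL u : `|x u - x s| <= L.
  by apply: le_trans (hM s u) _; rewrite ler_wpM2l // dist_leT.
have [C' C'0 hC'] := pow_taylor (forest_size h) L0.
have /andP[w0 w1] := forest_weight01 R h.
pose W := w h / (forest_size h).+1%:R; have W0 : 0 <= W by rewrite divr_ge0.
have germ u v : `|J v - J u - Xi u v| <= W * C' * M ^+ 2 * `|tv v - tv u| `^ 2.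
  have -> : J v - J u - Xi u v = W * ((x v - x s) ^+ (forest_size h).+1 - (x u - x s) ^+ (forest_size h).+1
      - (forest_size h).+1%:R * (x u - x s) ^+ forest_size h * ((x v - x s) - (x u - x s))).
    rewrite !JE /Xi /= /path_lift -/W.
    have -> : w h = W * (forest_size h).+1%:R by rewrite /W divfK // pnatr_eq0.
    by ring.
  rewrite normrM (ger0_norm W0) (_ : W * C' * M ^+ 2 * _ = W * (C' * (M ^+ 2 * `|tv v - tv u| `^ 2))); last ring.
  apply: ler_wpM2l => //; apply: le_trans (hC' _ _ (xL u) (xL v)) _; apply: ler_wpM2l => //.
  rewrite (_ : x v - x s - _ = x v - x u); last ring.
  rewrite powR_mulrn // -exprMn lerXn2r // nnegrE ?mulr_ge0 //; exact: hM.
have K0 : 0 <= W * C' * M ^+ 2 by rewrite !mulr_ge0 // exprn_ge0.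
have two : (1 : R) < 2 by rewrite ltr1n.
have hint u v : tv u <= tv v -> has_integral Xi u v (J v - J u).
  move=> uv; apply: (has_integral_of_bound two K0 uv) => a' b' _ ab' _.
  by have := germ a' b'; rewrite (ger0_norm (_ : 0 <= tv b' - tv a')) // subr_ge0.
split=> st; first by have := hint s t st; rewrite J0 subr0.
by have := hint t s st; rewrite J0 sub0r.
Qed.

Lemma exp_close (d C e D E : R) n : 0 <= d -> 1 <= C -> 0 <= e -> `|D| <= C * d `^ alpha ->
  `|E| <= C * d `^ alpha -> `|D - E| <= e * d `^ alpha ->
  `|D ^+ n - E ^+ n| <= n%:R * C ^+ n * e * d `^ (n%:R * alpha).
Proof.
move=> d0 C1 e0 hD hE hDE; have C0 : 0 <= C by exact: le_trans C1.
elim: n => [|n IH]; first by rewrite subrr normr0 !mul0r.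
rewrite (_ : _ - _ = D * (D ^+ n - E ^+ n) + (D - E) * E ^+ n); last by rewrite !exprS; ring.
have p0 : 0 <= d `^ alpha by exact: powR_ge0.
have pS : d `^ (n.+1%:R * alpha) = d `^ alpha * d `^ (n%:R * alpha).
  have -> : n.+1%:R = 1 + n%:R :> R by rewrite -(natrD _ 1).
  by rewrite mulrDl mul1r powRDge0 // ?mulr_ge0 // ltW.
apply: le_trans (ler_normD _ _) _; rewrite !normrM normrX.
have h1 : `|D| * `|D ^+ n - E ^+ n| <= (C * d `^ alpha) * (n%:R * C ^+ n * e * d `^ (n%:R * alpha)).
  by apply: ler_pM.
have h2 : `|D - E| * `|E| ^+ n <= (e * d `^ alpha) * (C ^+ n * d `^ (n%:R * alpha)).
  by apply: ler_pM => //; exact: exp_hoelder.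
apply: le_trans (lerD h1 h2) _; rewrite pS.
have -> : n.+1%:R = n%:R + 1 :> R by rewrite -addn1 natrD.
rewrite exprS.
have h3 : C ^+ n <= C * C ^+ n by rewrite ler_peMl // exprn_ge0.
have Q0 : 0 <= e * (d `^ alpha * d `^ (n%:R * alpha)) by rewrite !mulr_ge0 ?powR_ge0.
have := ler_wpM2r Q0 h3.
set P := d `^ alpha in pS *; set Q := d `^ (n%:R * alpha).
rewrite -subr_ge0 => h4; rewrite -subr_ge0; apply: le_trans h4 _.
by rewrite le_eqVlt; apply/orP; left; apply/eqP; ring.
Qed.

Lemma path_geometric x C (hx : alpha_hoelder x C) : little_hoelder alpha x ->
  geometric_rough_path (path_rough hx).
Proof.
move=> /little_hoelderP hl B /nbhs_ballP[e /= e0 hB]; case: (hx) => C0 hC.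
(* [D] bounds the Hoelder constants of x and of its approximation y, and is at least 1 as
   [exp_close] requires. *)
pose D := C + 1 + 1; have D1 : 1 <= D by rewrite /D lerDr addr_ge0.
have Q0 : 0 < N%:R * D ^+ N + 1 by rewrite ltr_wpDl // mulr_ge0 // exprn_ge0 // (le_trans ler01).
(* The last factor 1/2 turns the weak estimates into the strict inequality that defines the ball. *)
pose eta := Num.min 1 (e / (N%:R * D ^+ N + 1) / 2).
have eta0 : 0 < eta by rewrite lt_min ltr01 !divr_gt0.
have [y sy [_ hy]] := hl eta eta0.
have hyC s t : `|y t - y s| <= D * dist s t `^ alpha.
  rewrite (_ : y t - y s = (x t - x s) - ((x t - y t) - (x s - y s))); last ring.
  have -> : D = C + (1 + 1) by rewrite /D addrA.
  apply: le_trans (ler_normB _ _) _; rewrite mulrDl; apply: lerD => //.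
  apply: le_trans (hy s t) _; rewrite ler_wpM2r ?powR_ge0 //.
  have : eta <= 1 by rewrite ge_min lexx.
  by move=> h; apply: le_trans h _; rewrite lerDl.
have hY : alpha_hoelder y D by split=> //; exact: le_trans ler01 D1.
exists (path_rough hY); split.
  have [M M0 hM] := smooth_lipschitz sy.
  by exists (fun=> y) => //; exact: (path_canonical hY M0 hM).
apply: hB; apply: (@le_lt_trans _ _ (e / 2)%:E); last first.
  by rewrite lte_fin ltr_pdivrMr // ltr_pMr // ltr1n.
have e20 : 0 <= e / 2 by rewrite divr_ge0 // ltW.
rewrite /rough_dist big_seq_cond; apply: bigmax_le => // h /andP[hN h1].
rewrite mem_forests_upto in hN; apply: hoelder_geP => s t _ /=.
rewrite /path_lift -mulrBl normrM; have /andP[w0 w1] := forest_weight01 R h.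
rewrite (ger0_norm w0); apply: (@le_trans _ _ (`|(x t - x s) ^+ forest_size h - (y t - y s) ^+ forest_size h| * 1)).
  by rewrite ler_wpM2l.
have hxD : `|x t - x s| <= D * dist s t `^ alpha.
  by apply: le_trans (hC s t) _; rewrite ler_wpM2r ?powR_ge0 // (_ : D = C + (1 + 1)) ?lerDl // /D addrA.
have hxy : `|(x t - x s) - (y t - y s)| <= eta * dist s t `^ alpha.
  by rewrite (_ : _ - _ = (x t - y t) - (x s - y s)) //; ring.
rewrite mulr1; apply: le_trans (exp_close _ (normr_ge0 _) D1 (ltW eta0) hxD (hyC s t) hxy) _.
rewrite ler_wpM2r ?powR_ge0 //.
have h2 : (forest_size h)%:R * D ^+ forest_size h <= N%:R * D ^+ N + 1.
  apply: (@le_trans _ _ (N%:R * D ^+ N)); last by rewrite lerDl.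
  have D0 : 0 <= D by exact: le_trans ler01 D1.
  apply: ler_pM; [exact: ler0n|exact: exprn_ge0|by rewrite ler_nat|].
  by rewrite ler_weXn2l.
apply: (@le_trans _ _ ((N%:R * D ^+ N + 1) * eta)); first by rewrite ler_wpM2r // ltW.
apply: (@le_trans _ _ ((N%:R * D ^+ N + 1) * (e / (N%:R * D ^+ N + 1) / 2))).
  by rewrite ler_wpM2l ?(ltW Q0) // ge_min lexx orbT.
by rewrite le_eqVlt; apply/orP; left; apply/eqP; field; rewrite gt_eqF.
Qed.

(** Its only nonzero remainder is the increment of [f] at the empty forest, so its norms are Hoelder
    norms of f with exponent N times alpha or beta. *)
Definition scalar_path f (t : time) : H := f t *: forest_vec R one.

Lemma mcoeff_scalar f h t : mcoeff h (scalar_path f t) = f t * (one == h)%:R.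
Proof. by rewrite -pairing_delta pairingZ pairing_vec. Qed.

Lemma scalar_truncated f : truncated alpha (scalar_path f).
Proof.
move=> t h hN; rewrite mcoeff_scalar; case: eqP => [e|_]; last by rewrite mulr0.
by move: hN; rewrite -e forest_size1 leqNgt (level_gt0 halpha).
Qed.

Lemma scalar_remainder (X : rough_path A T alpha) f h s t :
  remainder X (scalar_path f) h s t = (f t - f s) * (one == h)%:R.
Proof.
rewrite /remainder mcoeff_scalar pairingZ pairing_vec star_one X1 mul1r /fdelta.
by rewrite mulrBl.
Qed.

Section Closure.
Variable beta : R.
Hypothesis hbeta : 0 < beta < alpha.

Lemma scalar_pclose (X : rough_path A T alpha) b f g e : 0 < b <= alpha ->
  (forall t, `|f t - g t| <= e) ->
  (forall s t, `|(f t - g t) - (f s - g s)| <= e * dist s t `^ (N%:R * b)) ->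
  pclose (bweight alpha b) X X (scalar_path f) (scalar_path g) e.
Proof.
move=> hb h1 h2; have e0 : 0 <= e by apply: le_trans (h1 (time0 T)).
split=> [h hN|h s t hN].
  rewrite !mcoeff_scalar -mulrBl; case: eqP => _; first by rewrite mulr1.
  by rewrite mulr0 normr0.
rewrite !scalar_remainder -mulrBl; case: eqP => [<-|_]; last first.
  by rewrite mulr0 normr0 mulr_ge0 ?powR_ge0.
rewrite mulr1 forest_size1 /bweight subn0.
by rewrite (_ : _ - _ - _ = (f t - g t) - (f s - g s)) //; ring.
Qed.

Lemma scalar_closure (X : rough_path A T alpha) f : little_hoelder (N%:R * beta) f ->
  controlled_closure beta X (scalar_path f).
Proof.
have hb : 0 < beta <= alpha by case/andP: hbeta => -> /ltW.
move=> /little_hoelderP hf; apply/(closureP halpha X _ hb); split; first exact: scalar_truncated.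
move=> e e0; have [g sg [h1 h2]] := hf e e0; exists (scalar_path g); last exact: scalar_pclose.
apply/(controlledP halpha); split; first exact: scalar_truncated.
have [M M0 hM] := smooth_lipschitz sg.
have aa : 0 < alpha <= alpha by rewrite alpha0 lexx.
exists (`|g (time0 T)| + M * Lpow T 1); apply/pboundP.
have Q0 : 0 <= M * Lpow T 1 by rewrite mulr_ge0 ?Lpow_ge0.
split=> [h hN|h s t hN].
  rewrite mcoeff_scalar normrM; apply: (@le_trans _ _ `|g (time0 T)|); last by rewrite lerDl.
  by rewrite ler_piMr //; case: eqP => _; rewrite ?normr1 ?normr0 // ler01.
rewrite scalar_remainder; case: eqP => [<-|_]; last first.
  by rewrite mulr0 normr0 mulr_ge0 ?powR_ge0 // addr_ge0.
rewrite mulr1 forest_size1; apply: le_trans (hM s t) _.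
have /andP[b0 b1] := bweight_bounds halpha halpha_inv aa 0.
have := @dist_weaken _ _ s t 1 _ 1 b0 b1 (lexx _); rewrite powRr1 // => h3.
apply: le_trans (ler_wpM2l M0 h3) _; rewrite mulrA ler_wpM2r ?powR_ge0 //.
by rewrite lerDr.
Qed.

End Closure.
End PathLift.

Section Counterexample.
Variables (R : realType) (A : finType) (a : A) (T : {posnum R}) (alpha beta : R).
Hypothesis halpha : 0 < alpha < 1.
Hypothesis halpha_inv : forall n : nat, (0 < n)%N -> alpha <> n%:R^-1.
Hypothesis hbeta : 0 < beta < alpha.
Local Notation N := (level alpha).

Lemma integral_threshold : N%:R * beta + alpha <= 1 ->
  exists2 X : rough_path A T alpha, geometric_rough_path X &
  exists2 Z, controlled_closure beta X Z & forall W, ~ is_rough_integral a X Z W.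
Proof.
move=> hth; have /andP[b0 ba] := hbeta; have /andP[a0 a1] := halpha.
have N1 : 1 <= N%:R :> R by rewrite ler1n (level_gt0 halpha).
have hg : 0 < N%:R * beta < 1.
  rewrite mulr_gt0 ?(lt_le_trans ltr01 N1) //=; lra.
have hl : little_hoelder alpha (@rough_sin R T alpha) by exact: little_hoelder_lac.
have a01 : 0 < alpha <= 1 by rewrite a0 ltW.
have [C C0 hC] := little_hoelder_bound a01 hl.
have hx : alpha_hoelder alpha (@rough_sin R T alpha) C by [].
exists (path_rough A hx); first exact: path_geometric.
exists (scalar_path A (@rough_cos R T (N%:R * beta))).
  by apply: scalar_closure => //; exact: little_hoelder_lac.
move=> W [hI _ _]; apply: (not_integrable halpha hg hth (T := T)).
have := hI (mktime T T%:num); congr (has_integral _ _ _ _).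
(* Only the empty forest occurs in the path, so the germ is the Riemann-Stieltjes germ f_u (x_v -
   x_u). *)
apply/funext => u; apply/funext => v; rewrite (graft_germE a halpha) //; last exact: scalar_truncated.
rewrite pairingZ pairing_vec /graft_op /= /path_lift forest_size_graft forest_size1 expr1.
by rewrite forest_weight_graft forest_size1 forest_weight1 divr1 mulr1.
Qed.

End Counterexample.

(** * The integration map *)

Section TubeTopology.
Variables (R : realType) (A : finType) (T : {posnum R}) (alpha beta eps : R).
Variables (P : set (forest_alg R A)) (B : set (rough_path A T alpha)).
Local Notation E := (bundle beta eps P B).

Lemma tube_nbhs (W : set E) (Y : E) : tubes W -> W Y -> nbhs Y W.
Proof.
move=> tW WY; apply: open_nbhs_nbhs; split=> //; exists [set W]; last first.
  by rewrite predeqE => Z; split=> [[_ ->]|] //; exists W.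
move=> _ ->; exists [fset W]%fset.
  by move=> V; rewrite inE inE => /eqP ->.
rewrite predeqE => Z; split=> [h|WZ V /= hV]; first by apply: h => /=; rewrite inE.
by move: hV => /fset1P ->.
Qed.

(** The tubes are declared as a subbase; it is enough to treat one tube at a time, since finite
    intersections of neighbourhoods are neighbourhoods. *)
Lemma continuous_tubes (I : E -> E) :
  (forall (W : set E) Y, tubes W -> W (I Y) -> exists V : set E,
     [/\ tubes V, V Y & V `<=` I @^-1` W]) -> continuous I.
Proof.
move=> hI Y O; rewrite (@nbhsE E) /=; move=> [_ [[C sC <-] [D CD DY] sUO]].
change (nbhs Y (I @^-1` O)); apply: (@filterS _ (nbhs Y) _ (I @^-1` D)).
  by move=> Z DZ; apply: sUO; exists D.
have /sC [F sF IF] := CD; rewrite -IF in DY *.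
rewrite [X in nbhs Y X](_ : _ = \bigcap_(W in [set` F]) (I @^-1` W)); last by rewrite preimage_bigcap.
apply: filter_bigI => W FW; have tW : tubes W by have := sF _ FW; rewrite inE.
have [V [tV VY sV]] := hI W Y tW (DY W FW).
by apply: filterS sV _; exact: tube_nbhs.
Qed.

End TubeTopology.

(** * Existence, linearity and continuity of the integration map *)

Section IntegralMap.
Variables (R : realType) (A : finType) (a : A) (T : {posnum R}) (alpha beta eps : R).
Variables (P : set (forest_alg R A)) (B : set (rough_path A T alpha)).
Hypothesis halpha : 0 < alpha < 1.
Hypothesis halpha_inv : forall n : nat, (0 < n)%N -> alpha <> n%:R^-1.
Hypothesis hbeta : 0 < beta < alpha.
Hypothesis heps : 0 < eps < 1 - (level alpha)%:R * alpha.
Hypothesis hP : primitive_basis P.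
Local Notation time := (time T).
Local Notation tv := (@time_val R T).
Local Notation N := (level alpha).
Local Notation F := (forests_upto A N.-1).
Local Notation E := (bundle beta eps P B).
Local Notation bw := (bweight alpha beta).
Implicit Types (X : rough_path A T alpha) (f g : forest A -> time -> R) (Z W : time -> forest_alg R A).
Local Opaque pairing forest_vec fempty.

Let kappa := 1 - eps.
Let hkappa : N%:R * alpha < kappa < 1.
Proof. by case/andP: heps => e0 e1; rewrite /kappa; apply/andP; split; lra. Qed.
Let hb : 0 < beta <= alpha. Proof. by case/andP: hbeta => -> /ltW. Qed.

Lemma rough_integral_lin (c : R) X Z Z1 Z2 W W1 W2 :
  (forall t, Z t = c *: Z1 t + Z2 t) -> is_rough_integral a X Z W ->
  is_rough_integral a X Z1 W1 -> is_rough_integral a X Z2 W2 ->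
  forall t, W t = c *: W1 t + W2 t.
Proof.
move=> hZ [h1 h2 h3] [k1 k2 k3] [l1 l2 l3] t; apply/malgP => g.
rewrite mcoeffD mcoeffZ; have t0 : tv (time0 T) <= tv t := time_ge0 t.
have [->|/eqP g1] := eqVneq g (fempty A).
  apply: (has_integral_unique t0 (h1 t)).
  have := @has_integral_lin _ _ c _ _ _ _ _ _ t0 (k1 t) (l1 t).
  congr (has_integral _ _ _ _); apply/funext => u; apply/funext => v.
  rewrite mulr_sumr -big_split; apply: eq_bigr => h _ /=.
  by rewrite hZ mcoeffD mcoeffZ mulrDl mulrA.
have [[h [hN ->]]|ne] := pselect (exists h, (forest_size h + 2 <= N)%N /\ g = fgraft a h).
  by rewrite h2 // k2 // l2 // hZ mcoeffD mcoeffZ.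
have hne h : (forest_size h + 2 <= N)%N -> g <> fgraft a h by move=> hN e; apply: ne; exists h.
by rewrite h3 // k3 // l3 // mulr0 addr0.
Qed.

Lemma section_approx X Z e : controlled_closure beta X Z -> 0 < e ->
  exists2 g, section_data alpha eps g & pclose bw X X Z (Gamma P X g) e.
Proof.
move=> /(closureP halpha X Z hb)[tZ hZ] e0; have e20 : 0 < e / 2 by rewrite divr_gt0.
have [Z' cZ' hZ'] := hZ _ e20.
have [g [G [gl gG hG]]] := section_dense halpha halpha_inv hbeta hP hkappa cZ' e20.
exists g => //; rewrite (GammaE halpha halpha_inv hP hkappa _ gG); last first.
  exact: (section_data_hoelder halpha hkappa erefl gl).
by rewrite [e]splitr; exact: pclose_trans hZ' hG.
Qed.

Hypothesis hth : 1 < theta alpha beta.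

(** The slack delta - nu of I Y0 in its tube, divided by the factor [Q] lost between [pclose] and
    the norm, is [s]. One quarter of it each goes to the distance from Y0 to the section g, to the
    radius [eta] of the new tube, and to the change of base point; the last quarter keeps the
    inequality strict. *)
Lemma integral_tube (I : E -> E) f (U : set (rough_path A T alpha)) delta (Y0 : E) :
  integration_map a I -> section_data alpha eps f -> open U -> tube f U delta (I Y0) ->
  exists g U' eta, [/\ section_data alpha eps g, open U', 0 < eta,
     tube g U' eta Y0 & forall Y : E, tube g U' eta Y -> tube f U delta (I Y)].
Proof.
move=> hI sf oU [UX0 hf].
have data (h : forest A -> time -> R) (sh : section_data alpha eps h) : hoelder_data alpha kappa h.
  exact: (section_data_hoelder halpha hkappa erefl sh).
have [p0 i0] := hI Y0; rewrite p0 in UX0 hf.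
have cZ := bundle_pathP Y0.
set X0 := bundle_proj Y0 in p0 i0 UX0 hf cZ *; set Z := bundle_path Y0 in i0 cZ *.
set W := bundle_path (I Y0) in i0 hf.
have [tZ _] := (closureP halpha X0 Z hb).1 cZ.
have [M M0 hM] := closure_bound halpha halpha_inv hb cZ.
have [K K1 hK] := xbound_exists X0.
have K0 : 0 <= K + 1 by rewrite addr_ge0 // (le_trans ler01).
have nu0 := controlled_norm_ge0 X0 beta (fun t => W t - Gamma P X0 f t).
case Enu : (controlled_norm _ _ _) nu0 hf => [nu| |] // nu0; rewrite lte_fin => nud.
pose Q : R := 2 * (size F)%:R + 1; have Q1 : 1 <= Q by rewrite lerDr mulr_ge0.
have Q0 : 0 < Q by exact: lt_le_trans Q1.
pose s := (delta - nu) / Q; have s0 : 0 < s by rewrite divr_gt0 // subr_gt0.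
pose ic := Num.max (int_const A T alpha beta (K + 1)) 1.
have ic1 : 1 <= ic by rewrite le_max lexx orbT.
have ic0 : 0 < ic by exact: lt_le_trans ic1.
pose eta := s / (ic * 4); have eta0 : 0 < eta by rewrite divr_gt0 // mulr_gt0.
(* The accuracy eta / Q, and not eta, is what puts Y0 itself into the new tube after the passage to
   the norm. *)
have [g sg hg] := section_approx cZ (divr_gt0 eta0 Q0).
have [Cg Cg0 hCg] := Gamma_continuous halpha halpha_inv hP hkappa hb X0 (data g sg).
have [Cf Cf0 hCf] := Gamma_continuous halpha halpha_inv hP hkappa hb X0 (data f sf).
pose D := ic * (Cg + M) + Cf + 1.
have D0 : 0 < D by rewrite ltr_wpDl // addr_ge0 // mulr_ge0 ?addr_ge0 // ltW.
pose e := Num.min 1 (s / 4 / D).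
have s4D : 0 < s / 4 / D by rewrite divr_gt0 // divr_gt0.
have e0 : 0 < e by rewrite /e lt_min ltr01.
have e1 : 0 <= e <= 1 by apply/andP; split; [exact: ltW|rewrite /e ge_min lexx].
pose U' := U `&` (ball X0 e)°.
exists g, U', eta; split=> //.
- by apply: openI => //; exact: open_interior.
- split; first by split=> //; apply: nbhs_singleton; apply: nbhs_interior; exact: nbhsx_ballx.
  apply: le_lt_trans (pclose_controlled_norm_sub halpha hg) _; rewrite lte_fin.
  rewrite mulrA ltr_pdivrMr // mulrC ltr_pM2l // /Q ltrDl //.
move=> Y [[UX bX] hY]; have [p1 i1] := hI Y; split; rewrite p1 //.
set X := bundle_proj Y in p1 i1 UX bX hY *; set Z' := bundle_path Y in i1 hY.
set W' := bundle_path (I Y) in i1 *.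
have {}bX : rough_ball X0 e X by exact: interior_subset bX.
have cX := xclose_ball bX; have cX' := xclose_ball (rough_ball_sym bX).
have kX : xbound X (K + 1).
  move=> h u v hN; apply: le_trans (xbound_close (ltW e0) hK cX u v hN) _.
  by rewrite ler_wpM2r ?powR_ge0 // lerD2l; case/andP: e1.
have kX0 : xbound X0 (K + 1).
  by move=> h u v hN; apply: le_trans (hK h u v hN) _; rewrite ler_wpM2r ?powR_ge0 // lerDl.
have tZ' : truncated alpha Z' by case: (bundle_pathP Y).
have h1 := controlled_norm_pclose halpha hY.
have h2 := hCg X e e1 cX; have h3 := hCf X e e1 cX.
have close := pclose_sym (pclose_trans (pclose_trans hg h2) (pclose_sym h1)).
set e2 := _ + _ + _ in close.
(* Adding M e to the distance meets the condition on the rough paths in [pair_data]. *)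
have Me : M * e <= e2 + M * e.
  by rewrite lerDr; exact: (pclose_ge0 halpha close).
have hd : pair_data bw (K + 1) X X0 Z' Z (e2 + M * e) e M.
  split; split=> //; first exact: ltW.
  by apply: pclose_le close; rewrite lerDl mulr_ge0 // ltW.
have hW := integral_estimate halpha halpha_inv hb hth hd i1 i0.
(* The deviation of I Y from the section f over X is compared with that of I Y0 over X0, whose norm
   is [nu]. *)
have hB := pcloseB hW (pclose_sym h3).
apply: le_lt_trans (pclose_controlled_norm halpha hB) _; rewrite Enu -EFinD lte_fin.
rewrite -ltrBrDl; apply: le_lt_trans (_ : Q * (ic * (e2 + M * e) + Cf * e) < _).
  have e2M : 0 <= e2 + M * e by apply: le_trans Me; rewrite mulr_ge0 // ltW.
  have r0 : 0 <= ic * (e2 + M * e) + Cf * e by rewrite addr_ge0 // mulr_ge0 // ltW.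
  apply: (@le_trans _ _ ((2 * (size F)%:R) * (ic * (e2 + M * e) + Cf * e))).
    by apply: ler_wpM2l; rewrite ?mulr_ge0 // lerD2r ler_wpM2r // le_max lexx.
  by rewrite ler_wpM2r // lerDl.
rewrite mulrC -ltr_pdivlMr // -/s /e2.
have etaQ : eta / Q <= eta by rewrite ler_pdivrMr // ler_peMr // ltW.
have icE : ic * eta = s / 4 by rewrite /eta; field; rewrite gt_eqF.
have h5 : ic * (eta / Q) <= s / 4 by rewrite -icE ler_wpM2l // ltW.
have h6 : (ic * (Cg + M) + Cf) * e <= s / 4.
  apply: (@le_trans _ _ (D * e)); first by rewrite ler_wpM2r ?(ltW e0) // lerDl.
  by rewrite mulrC -ler_pdivlMr // /e ge_min lexx orbT.
rewrite (_ : _ + _ = ic * (eta / Q) + ic * eta + (ic * (Cg + M) + Cf) * e); last ring.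
rewrite icE; lra.
Qed.

Lemma integral_continuous (I : E -> E) : integration_map a I -> continuous I.
Proof.
move=> hI; apply: continuous_tubes => W Y [f [U [delta [sf oU d0 ->]]]] hW.
have [g [U' [eta [sg oU' eta0 tY sub]]]] := integral_tube hI sf oU hW.
exists (tube g U' eta); split; [by exists g, U', eta|exact: tY|by move=> Z; exact: sub].
Qed.

Lemma integration_map_exists : exists I : E -> E, integration_map a I.
Proof.
have ex (Y : E) : exists Y' : E, bundle_proj Y' = bundle_proj Y /\
    is_rough_integral a (bundle_proj Y) (bundle_path Y) (bundle_path Y').
  have [W cW hW] := integral_closure a halpha halpha_inv hb hth (bundle_pathP Y).
  by exists (BundlePoint (bundle_projP Y) cW).
have [I hI] := choice ex.
by exists I => Y; exact: hI.
Qed.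

End IntegralMap.

(* The integral of an element of D^{alpha, beta}_X exists for every X only if
   N beta + alpha > 1; this is also sufficient for I to map E to E. The second
   part concerns every I : E -> E given by the integral, for all beta < alpha. *)
Theorem proposition4p19 (R : realType) (A : finType) (a : A) (T : {posnum R})
    (alpha beta eps : R) (P : set (forest_alg R A)) (B : set (rough_path A T alpha))
    (halpha : 0 < alpha < 1)
    (halpha_inv : forall n : nat, (0 < n)%N -> alpha <> n%:R^-1)
    (hbeta : 0 < beta < alpha)
    (heps : 0 < eps < 1 - (level alpha)%:R * alpha)
    (hP : primitive_basis P)
    (hB : B = setT \/ B = @geometric_rough_path R A T alpha) :
  (1 < (level alpha)%:R * beta + alpha ->
     exists I : bundle beta eps P B -> bundle beta eps P B,
       integration_map a I) /\
  (forall I : bundle beta eps P B -> bundle beta eps P B,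
     integration_map a I ->
     [/\ continuous I,
         fibrewise_linear I
       & forall Y : bundle beta eps P B, bundle_proj (I Y) = bundle_proj Y]).
Proof.
split=> [hth|I hI]; first exact: integration_map_exists.
have hth : 1 < theta alpha beta.
  (* Existence of I on the whole of E forces the threshold: the path without an integral lies over a
     geometric rough path, hence in E for either choice of [B]. *)
  rewrite ltNge; apply/negP => hth.
  have [X gX [Z cZ nZ]] := @integral_threshold R A a T _ _ halpha halpha_inv hbeta hth.
  have BX : B X by case: hB => ->.
  by have [_ /nZ] := hI (BundlePoint BX cZ : bundle beta eps P B).
split; first exact: integral_continuous hI.
  move=> c Y1 Y2 Y e1 e2 hY; have [_ i] := hI Y.
  have [_ i1] := hI Y1; have [_ i2] := hI Y2; rewrite e1 in i1; rewrite e2 in i2.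
  exact: rough_integral_lin hY i i1 i2.
by move=> Y; case: (hI Y).
Qed.
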